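(* Let $\Omega\subset\mathbb{R}^N$, $N\ge 2$, be a bounded domain with Lipschitz boundary $\partial\Omega$. Let $p,q\colon\overline\Omega\to\mathbb{R}$ be log-Hölder continuous on $\overline\Omega$ with $1<p(x)\le q(x)<N$ for all $x\in\overline\Omega$. Let $0\le a\in L^\infty(\Omega)$ and $0\le b\in C^{0,\alpha}(\overline\Omega)$ for some $\alpha\in(0,1]$, with $a(x)+b(x)\ge d>0$ for a.a. $x\in\Omega$, and let $1\le\delta\le e$, $\eta\ge0$, $\delta+\eta>1$. Assume $$\sup_{(x,t)\in\Omega\times[1,\infty)}t^{q(x)-p(x)-\alpha}\log(\delta+\eta t)<+\infty .$$ Let $\mathcal{A}\colon\Omega\times\mathbb{R}\times\mathbb{R}^N\to\mathbb{R}^N$ and $\mathcal{B}\colon\Omega\times\mathbb{R}\times\mathbb{R}^N\to\mathbb{R}$ be Carathéodory functions such that for a.a. $x\in\Omega$ and all $(t,\xi)\in\mathbb{R}\times\mathbb{R}^N$, (i) $|\mathcal{A}(x,t,\xi)|\le a_1(|t|)\big(\mathbf{s}(x,|\xi|)+1\big)$; (ii) $\mathcal{A}(x,t,\xi)\cdot\xi\ge a_2(|t|)\,\mathcal{S}(x,|\xi|)-a_3$; (iii) $|\mathcal{B}(x,t,\xi)|\le b_1(|t|)\big(\mathcal{S}(x,|\xi|)+b_2\big)$, where $a_3,b_2$ are positive constants, $a_1,b_1\colon[0,\infty)\to(0,\infty)$ are nondecreasing continuous functions and $a_2\colon[0,\infty)\to(0,\infty)$ is a nonincreasing continuous function. Let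 $u\in W^{1,\mathcal{S}}(\Omega)$ be any bounded weak solution of $-\operatorname{div}\mathcal{A}(x,u,\nabla u)=\mathcal{B}(x,u,\nabla u)$ in $\Omega$ with $u\in C^{0,\beta_0}(\partial\Omega)$ for some $\beta_0\in(0,1]$. Then $u$ belongs to $C^{0,\beta}(\overline\Omega)$ for some $\beta\in(0,\beta_0]$.
   Context: A function $f\colon\overline\Omega\to\mathbb{R}$ is log-Hölder continuous on $\overline\Omega$ if there is $C_{\log}(f)>0$ with $-|f(x)-f(y)|\log|x-y|\le C_{\log}(f)$ for all $x,y\in\overline\Omega$ with $0<|x-y|\le\frac12$. For $x\in\Omega$, $t\ge0$: $\mathcal{S}(x,t):=a(x)t^{p(x)}+b(x)t^{q(x)}\log(\delta+\eta t)$ and $\mathbf{s}(x,t):=\partial_t\mathcal{S}(x,t)=p(x)a(x)t^{p(x)-1}+q(x)b(x)t^{q(x)-1}\log(\delta+\eta t)+\frac{\eta b(x)t^{q(x)}}{\delta+\eta t}$. $L^{\mathcal{S}}(\Omega)$ is the set of measurable $u\colon\Omega\to\mathbb{R}$ with $\int_\Omega\mathcal{S}(x,\lambda|u|)\,dx<\infty$ for some $\lambda>0$; $W^{1,\mathcal{S}}(\Omega)$ is the set of weakly differentiable $u\in L^{\mathcal{S}}(\Omega)$ with $|\nabla u|\in L^{\mathcal{S}}(\Omega)$. $W_0^{1,1}(\Omega)$ is the usual Sobolev space of $W^{1,1}$ functions with zero boundary values (closure in $W^{1,1}(\Omega)$ of the $C^1(\overline\Omega)$ functions with compact support in $\Omega$).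 $u\in W^{1,\mathcal{S}}(\Omega)$ is a weak solution if $\int_\Omega\mathcal{A}(x,u,\nabla u)\cdot\nabla\varphi\,dx=\int_\Omega\mathcal{B}(x,u,\nabla u)\varphi\,dx$ for every $\varphi\in W^{1,\mathcal{S}}(\Omega)\cap W_0^{1,1}(\Omega)$. Boundary values of $u$ on $\partial\Omega$ are understood in the sense of traces. Membership of $u$ in $C^{0,\beta}(\overline\Omega)$ means that $u$ has a representative that is Hölder continuous with exponent $\beta$ on $\overline\Omega$. *)

(* Defs.v *)
From HB Require Import structures.
From mathcomp Require Import all_boot all_order all_algebra.
From mathcomp Require Import all_classical all_reals all_analysis.

Set Implicit Arguments.
Unset Strict Implicit.
Unset Printing Implicit Defensive.
Import Order.TTheory GRing.Theory Num.Theory.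
Import numFieldNormedType.Exports.

Local Open Scope classical_set_scope.
Local Open Scope ring_scope.

(** The library norm of ['rV[R]_N] is the sup norm (it induces the same
    topology); [enorm] is the Euclidean one. *)
Definition dotv (R : realType) (N : nat) (v w : 'rV[R]_N) : R :=
  (v *m w^T) ord0 ord0.

Definition enorm (R : realType) (N : nat) (v : 'rV[R]_N) : R :=
  Num.sqrt (dotv v v).

Definition boundary (T : topologicalType) (A : set T) : set T :=
  closure A `\` A°.

(** Lebesgue and Hausdorff measures on R^N come from Caratheodory's
    construction: [mu_ext w] is the outer measure
    [A |-> inf {\sum_k w (F k) | A `<=` \bigcup_k F k}].  The library takes the
    [F k] in a given semiring of sets; [all_sets T] is a copy of [T] in which
    that semiring consists of all subsets, the sets that may not be used being
    given weight [+oo]. *)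
Definition all_sets (T : Type) : Type := T.

HB.instance Definition _ (T : pointedType) := Pointed.on (all_sets T).
HB.instance Definition _ (T : pointedType) :=
  @isMeasurable.Build default_measure_display (all_sets T)
    (@discrete_measurable T) (@discrete_measurable0 T)
    (@discrete_measurableC T) (@discrete_measurableU T).

(** Infimum of the volumes of the boxes [a_1, b_1] x ... x [a_N, b_N]
    containing [A] ([+oo] if [A] is unbounded). *)
Definition box_weight (R : realType) (N : nat)
    (A : set (all_sets 'rV[R]_N)) : \bar R :=
  if A == set0 then 0%E else
  ereal_inf [set (\prod_(i < N) (ab.2 ord0 i - ab.1 ord0 i))%:E |
    ab in [set ab : 'rV[R]_N * 'rV[R]_N |
      (forall i, ab.1 ord0 i <= ab.2 ord0 i) /\
      (forall x, A x -> forall i, ab.1 ord0 i <= x ord0 i <= ab.2 ord0 i)]].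

Definition lebesgue_outer (R : realType) (N : nat) (A : set 'rV[R]_N) : \bar R :=
  mu_ext (@box_weight R N) A.

(** [(diam A)^s] if [diam A <= r], and [+oo] otherwise.  The usual dimensional
    normalizing constant is omitted: it is a fixed positive factor. *)
Definition diam_weight (R : realType) (N s : nat) (r : R)
    (A : set (all_sets 'rV[R]_N)) : \bar R :=
  if A == set0 then 0%E else
  ereal_inf [set (d ^+ s)%:E | d in [set d : R | [/\ 0 <= d, d <= r &
    forall x y : 'rV[R]_N, A x -> A y -> enorm (x - y) <= d]]].

Definition hausdorff_outer (R : realType) (N s : nat) (A : set 'rV[R]_N) : \bar R :=
  ereal_sup [set mu_ext (@diam_weight R N s r) A | r in [set r : R | 0 < r]].

Section outer_measures.
Variables (R : realType) (N : nat).

Let box_weight0 : @box_weight R N set0 = 0%E.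
Proof. by rewrite /box_weight eqxx. Qed.

Let box_weight_ge0 A : (0 <= @box_weight R N A)%E.
Proof.
rewrite /box_weight; case: ifP => // _; apply: le_ereal_inf_tmp => _ [ab [h _] <-].
by rewrite lee_fin prodr_ge0 // => i _; rewrite subr_ge0.
Qed.

HB.instance Definition _ := isOuterMeasure.Build R 'rV[R]_N (@lebesgue_outer R N)
  (mu_ext0 box_weight0 box_weight_ge0) (mu_ext_ge0 box_weight_ge0)
  (le_mu_ext (@box_weight R N))
  (mu_ext_sigma_subadditive box_weight_ge0).

Variable s : nat.

Let diam_weight0 r : @diam_weight R N s r set0 = 0%E.
Proof. by rewrite /diam_weight eqxx. Qed.

Let diam_weight_ge0 r A : (0 <= @diam_weight R N s r A)%E.
Proof.
rewrite /diam_weight; case: ifP => // _; apply: le_ereal_inf_tmp => _ [d [h _ _] <-].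
by rewrite lee_fin exprn_ge0.
Qed.

Let hausdorff_ub A r : 0 < r ->
  (mu_ext (@diam_weight R N s r) A <= @hausdorff_outer R N s A)%E.
Proof. by move=> r0; apply: ereal_sup_ubound; exists r. Qed.

Let hausdorff_ge0 A : (0 <= @hausdorff_outer R N s A)%E.
Proof.
apply: le_trans (hausdorff_ub A ltr01).
exact: (mu_ext_ge0 (diam_weight_ge0 1)).
Qed.

Let hausdorff0 : @hausdorff_outer R N s set0 = 0%E.
Proof.
apply/eqP; rewrite eq_le hausdorff_ge0 andbT.
apply: ge_ereal_sup => _ [r r0 <-].
by rewrite (mu_ext0 (diam_weight0 r) (diam_weight_ge0 r)).
Qed.

Let le_hausdorff : {homo @hausdorff_outer R N s : A B / A `<=` B >-> (A <= B)%E}.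
Proof.
move=> A B AB; apply: ge_ereal_sup => _ [r r0 <-].
exact: le_trans (le_mu_ext (@diam_weight R N s r) AB) (hausdorff_ub B r0).
Qed.

Let hausdorff_sub : sigma_subadditive (@hausdorff_outer R N s).
Proof.
move=> F; apply: ge_ereal_sup => _ [r r0 <-].
apply: (le_trans (mu_ext_sigma_subadditive (diam_weight_ge0 r) F)).
apply: lee_nneseries => k *; last exact: hausdorff_ub.
exact: (mu_ext_ge0 (diam_weight_ge0 r)).
Qed.

HB.instance Definition _ := isOuterMeasure.Build R 'rV[R]_N
  (@hausdorff_outer R N s) hausdorff0 hausdorff_ge0 le_hausdorff hausdorff_sub.

End outer_measures.

(** The measurable sets are all Lebesgue-measurable sets, not only the Borel
    ones. *)
Definition lebesgue_rV (R : realType) (N : nat) :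
    {measure set (caratheodory_type (@lebesgue_outer R N)) -> \bar R} :=
  let mu : {outer_measure set 'rV[R]_N -> \bar R} := @lebesgue_outer R N in
  (mu : set (caratheodory_type mu) -> \bar R).

Definition hausdorff_rV (R : realType) (N s : nat) :
    {measure set (caratheodory_type (@hausdorff_outer R N s)) -> \bar R} :=
  let mu : {outer_measure set 'rV[R]_N -> \bar R} := @hausdorff_outer R N s in
  (mu : set (caratheodory_type mu) -> \bar R).

Definition lmeasurable_fun (R : realType) (N : nat) (D : set 'rV[R]_N)
    (f : 'rV[R]_N -> R) : Prop :=
  measurable_fun (D : set (caratheodory_type (@lebesgue_outer R N))) f.

Definition lintegrable (R : realType) (N : nat) (D : set 'rV[R]_N)
    (f : 'rV[R]_N -> R) : Prop :=
  (lebesgue_rV R N).-integrable D (EFin \o f).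

Definition ae_in (R : realType) (N : nat) (D : set 'rV[R]_N)
    (P : 'rV[R]_N -> Prop) : Prop :=
  {ae lebesgue_rV R N, forall x, D x -> P x}.

Definition bounded_domain (R : realType) (N : nat) (Om : set 'rV[R]_N) : Prop :=
  [/\ Om !=set0, open Om, connected Om & bounded_set Om].

(** Near each boundary point, and up to a rigid motion [x |-> x *m Q], [Om] is
    the region above the graph of a Lipschitz function of the remaining
    [N - 1] coordinates ([col' i] drops the [i]-th coordinate). *)
Definition lipschitz_boundary (R : realType) (N : nat) (Om : set 'rV[R]_N) : Prop :=
  forall x0, boundary Om x0 ->
  exists (Q : 'M[R]_N) (i : 'I_N) (gam : 'rV[R]_N.-1 -> R) (L r : R),
    [/\ Q *m Q^T = 1%:M, 0 < r,
        forall y z, `|gam y - gam z| <= L * enorm (y - z) &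
        forall x, enorm (x - x0) < r ->
          (Om x <-> gam (col' i (x *m Q)) < (x *m Q) ord0 i)].

Definition log_hoelder (R : realType) (N : nat) (D : set 'rV[R]_N)
    (f : 'rV[R]_N -> R) : Prop :=
  exists2 C : R, 0 < C & forall x y, D x -> D y ->
    0 < enorm (x - y) <= 2^-1 -> - `|f x - f y| * ln (enorm (x - y)) <= C.

(** [C^{0,be}(D)] for a compact set [D]: boundedness is then automatic. *)
Definition hoelder_on (R : realType) (N : nat) (be : R) (D : set 'rV[R]_N)
    (f : 'rV[R]_N -> R) : Prop :=
  exists C : R, forall x y, D x -> D y ->
    `|f x - f y| <= C * enorm (x - y) `^ be.

Definition Linfty (R : realType) (N : nat) (D : set 'rV[R]_N)
    (f : 'rV[R]_N -> R) : Prop :=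
  lmeasurable_fun D f /\ exists M : R, ae_in D (fun x => `|f x| <= M).

Definition evec (R : realType) (N : nat) (i : 'I_N) : 'rV[R]_N :=
  delta_mx ord0 i.

Definition partial (R : realType) (N : nat) (i : 'I_N) (f : 'rV[R]_N -> R)
    (x : 'rV[R]_N) : R := 'D_(evec R i) f x.

Definition grad (R : realType) (N : nat) (f : 'rV[R]_N -> R) (x : 'rV[R]_N) :
    'rV[R]_N := \row_i partial i f x.

Definition C1 (R : realType) (N : nat) (f : 'rV[R]_N -> R) : Prop :=
  continuous f /\ forall i : 'I_N,
    (forall x, derivable f x (evec R i)) /\ continuous (partial i f).

Definition smooth (R : realType) (N : nat) (f : 'rV[R]_N -> R) : Prop :=
  forall s : seq 'I_N, C1 (foldr (@partial R N) f s).

Definition supported_in (R : realType) (N : nat) (Om : set 'rV[R]_N)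
    (f : 'rV[R]_N -> R) : Prop :=
  let K := closure [set x | f x != 0] in compact K /\ K `<=` Om.

Definition loc_integrable (R : realType) (N : nat) (Om : set 'rV[R]_N)
    (f : 'rV[R]_N -> R) : Prop :=
  forall K, compact K -> K `<=` Om -> lintegrable K f.

Definition weak_grad (R : realType) (N : nat) (Om : set 'rV[R]_N)
    (u : 'rV[R]_N -> R) (Du : 'rV[R]_N -> 'rV[R]_N) : Prop :=
  [/\ loc_integrable Om u,
      forall i, loc_integrable Om (fun x => Du x ord0 i) &
      forall (phi : 'rV[R]_N -> R) (i : 'I_N),
        smooth phi -> supported_in Om phi ->
        (\int[lebesgue_rV R N]_(x in Om) (u x * partial i phi x)%:E =
         - \int[lebesgue_rV R N]_(x in Om) (Du x ord0 i * phi x)%:E)%E].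

Definition W11 (R : realType) (N : nat) (Om : set 'rV[R]_N)
    (u : 'rV[R]_N -> R) (Du : 'rV[R]_N -> 'rV[R]_N) : Prop :=
  [/\ weak_grad Om u Du, lintegrable Om u &
      forall i, lintegrable Om (fun x => Du x ord0 i)].

(** The [W^{1,1}(Om)]-norm of [u - psi], for [psi] of class [C^1]. *)
Definition W11_dist (R : realType) (N : nat) (Om : set 'rV[R]_N)
    (u : 'rV[R]_N -> R) (Du : 'rV[R]_N -> 'rV[R]_N) (psi : 'rV[R]_N -> R) : \bar R :=
  (\int[lebesgue_rV R N]_(x in Om)
     (`|u x - psi x| + enorm (Du x - grad psi x))%:E)%E.

(** A [C^1] function on the closure of [Om] with compact support in [Om] is the
    restriction of its extension by zero, which is [C^1] on R^N. *)
Definition W011 (R : realType) (N : nat) (Om : set 'rV[R]_N)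
    (u : 'rV[R]_N -> R) : Prop :=
  exists2 Du, W11 Om u Du & forall eps : R, 0 < eps ->
    exists psi, [/\ C1 psi, supported_in Om psi &
                    (W11_dist Om u Du psi < eps%:E)%E].

(** The trace of [u \in W^{1,1}(Om)] on the boundary is [g], that is: [u] is the
    limit in [W^{1,1}(Om)] of functions [psi_n] that are [C^1] up to the boundary
    and whose restrictions converge to [g] in [L^1(boundary Om)] with respect to
    the surface measure.  This is the extension by continuity of the
    restriction map [psi |-> psi|_(boundary Om)]. *)
Definition has_trace (R : realType) (N : nat) (Om : set 'rV[R]_N)
    (u g : 'rV[R]_N -> R) : Prop :=
  exists2 Du, W11 Om u Du & forall eps : R, 0 < eps ->
    exists psi, [/\ C1 psi, (W11_dist Om u Du psi < eps%:E)%E &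
      (\int[hausdorff_rV R N N.-1]_(x in boundary Om) `|psi x - g x|%:E
         < eps%:E)%E].

Definition Slog (R : realType) (N : nat) (p q a b : 'rV[R]_N -> R) (dl et : R)
    (x : 'rV[R]_N) (t : R) : R :=
  a x * t `^ p x + b x * t `^ q x * ln (dl + et * t).

(** The derivative of [Slog] with respect to [t]. *)
Definition slog (R : realType) (N : nat) (p q a b : 'rV[R]_N -> R) (dl et : R)
    (x : 'rV[R]_N) (t : R) : R :=
  p x * a x * t `^ (p x - 1)
  + q x * b x * t `^ (q x - 1) * ln (dl + et * t)
  + et * b x * t `^ q x / (dl + et * t).

Definition LS (R : realType) (N : nat) (S : 'rV[R]_N -> R -> R)
    (Om : set 'rV[R]_N) (u : 'rV[R]_N -> R) : Prop :=
  lmeasurable_fun Om u /\ exists2 lam : R, 0 < lam &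
    (\int[lebesgue_rV R N]_(x in Om) (S x (lam * `|u x|))%:E < +oo)%E.

Definition W1S (R : realType) (N : nat) (S : 'rV[R]_N -> R -> R)
    (Om : set 'rV[R]_N) (u : 'rV[R]_N -> R) : Prop :=
  LS S Om u /\ exists2 Du, weak_grad Om u Du & LS S Om (fun x => enorm (Du x)).

Definition caratheodory_fun (R : realType) (N : nat) (Om : set 'rV[R]_N)
    (f : 'rV[R]_N -> R -> 'rV[R]_N -> R) : Prop :=
  (forall t xi, lmeasurable_fun Om (fun x => f x t xi)) /\
  ae_in Om (fun x => continuous (fun z : R * 'rV[R]_N => f x z.1 z.2)).

(** The weak gradients are unique up to null sets, so quantifying universally
    over them is harmless.  The identity is one in the extended reals; when
    [u] is bounded and [A] satisfies the growth condition on [|A x t xi|], the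
    left-hand side is absolutely convergent, so the identity includes the
    finiteness of the right-hand side. *)
Definition weak_solution (R : realType) (N : nat) (S : 'rV[R]_N -> R -> R)
    (Om : set 'rV[R]_N) (A : 'rV[R]_N -> R -> 'rV[R]_N -> 'rV[R]_N)
    (B : 'rV[R]_N -> R -> 'rV[R]_N -> R) (u : 'rV[R]_N -> R) : Prop :=
  W1S S Om u /\
  forall (Du : 'rV[R]_N -> 'rV[R]_N) (phi : 'rV[R]_N -> R)
         (Dphi : 'rV[R]_N -> 'rV[R]_N),
    weak_grad Om u Du -> W1S S Om phi -> W011 Om phi -> weak_grad Om phi Dphi ->
    (\int[lebesgue_rV R N]_(x in Om) (dotv (A x (u x) (Du x)) (Dphi x))%:E =
     \int[lebesgue_rV R N]_(x in Om) (B x (u x) (Du x) * phi x)%:E)%E.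

(* Main.v *)
From HB Require Import structures.
Require Import Defs.
From mathcomp Require Import all_boot all_order all_algebra.
From mathcomp Require Import all_classical all_reals all_analysis.
From mathcomp Require Import measurable_realfun ring lra zify.
Import Order.TTheory GRing.Theory Num.Theory.
Import numFieldNormedType.Exports.
Set Implicit Arguments.
Unset Strict Implicit.
Unset Printing Implicit Defensive.
Local Open Scope classical_set_scope.
Local Open Scope ring_scope.

(** De Giorgi's method.  Testing with [zeta^(N+1)] times a truncation of
    [(u - k)_+^2] at a small height [w] (so that the right-hand side of natural
    growth is absorbed) gives a Caccioppoli inequality in which the modular
    [S(x, |Du|)] is compared with [S(x, w/r)].  For [1 <= w/r <= const/r] the
    log-Hoelder continuity of the exponents, the Hoelder continuity of [b] and
    the growth restriction on [t^(q - p - alpha) log(delta + eta t)] make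
    [S(x, w/r)] comparable to one number on a cube of size [r].  Together with
    the superlinear growth of [S] this bounds the [L^1]-norm of [Du] between two
    levels, and the Poincare inequality on cubes then yields the shrinking of
    superlevel sets and a reduction of the oscillation: in the interior by the
    usual alternative, and at the boundary because the complement of a Lipschitz
    domain has positive density and the levels lie above the trace.

    The trace enters only through the [C^1] approximations in its definition:
    truncations of [u] above the trace are limits in [W^{1,1}] of [C^1] functions
    that are small in [L^1] of the boundary, and by the lower regularity of the
    surface measure these can be cut off near the boundary.  This provides both
    admissibility of the test functions and the Poincare inequality for
    extensions by zero. *)

(** The integrand is not homogeneous and its exponents vary, so no estimate is scale invariant.
    Comparison with a single number holds only at heights [t] with [1 <= t] and [t * r <= kap]. As
    [t] is [w / r], an oscillation [w] below the radius escapes the method: hence the radius enters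
    the one-sided estimates as an additive error, and the final contraction factor keeps a margin
    that absorbs it. The square in the test function leaves one spare factor [(u - k)_+] in the term
    with the right-hand side, and this factor is small with [w]. The price is a weight [(u - k)_+]
    in the Caccioppoli inequality, so that gradients are estimated only above [k + th * w]. The gain
    of integrability that a Sobolev embedding would give in the last iteration is obtained from
    Poincare inequalities on ever finer grids, where a small superlevel set has small density in
    every cell. Everything thus rests on one inequality in [L^1]. *)

(** * Lebesgue outer measure of boxes *)

Definition box (R : realType) (N : nat) (a b : 'rV[R]_N) : set 'rV[R]_N :=
  [set x | forall i, a ord0 i <= x ord0 i <= b ord0 i].

Definition vol (R : realType) (N : nat) (a b : 'rV[R]_N) : R :=
  \prod_(i < N) (b ord0 i - a ord0 i).

Lemma vol_ge0 (R : realType) (N : nat) (a b : 'rV[R]_N) :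
  (forall i, a ord0 i <= b ord0 i) -> 0 <= vol a b.
Proof. by move=> h; apply: prodr_ge0 => i _; rewrite subr_ge0. Qed.

Lemma box_weight_le (R : realType) (N : nat) (A : set 'rV[R]_N) (a b : 'rV[R]_N) :
  (forall i, a ord0 i <= b ord0 i) -> A `<=` box a b ->
  (box_weight A <= (vol a b)%:E)%E.
Proof.
move=> ab AB; rewrite /box_weight; case: ifPn => [_|An].
  by rewrite lee_fin vol_ge0.
by apply: ereal_inf_lbound; exists (a, b).
Qed.

Lemma box_weight_lt (R : realType) (N : nat) (A : set 'rV[R]_N) (e : R) :
  A !=set0 -> 0 < e -> (box_weight A < +oo)%E ->
  exists a b : 'rV[R]_N, [/\ (forall i, a ord0 i <= b ord0 i), A `<=` box a b &
    ((vol a b)%:E < box_weight A + e%:E)%E].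
Proof.
move=> An e0; rewrite /box_weight; case: ifPn => [/eqP A0|_].
  by move: An; rewrite A0 => -[].
set S := [set _ | _ in _] => h.
have S0 : (0 <= ereal_inf S)%E.
  by apply: le_ereal_inf_tmp => _ [ab [ab1 _] <-]; rewrite lee_fin vol_ge0.
have Sf : ereal_inf S \is a fin_num by rewrite ge0_fin_numE.
have [_ [ab [ab1 ab2] <-] ht] := lb_ereal_inf_adherent e0 Sf.
by exists ab.1, ab.2; split.
Qed.

Lemma box_weight_ge0 (R : realType) (N : nat) (A : set 'rV[R]_N) :
  (0 <= box_weight A)%E.
Proof.
rewrite /box_weight; case: ifP => // _; apply: le_ereal_inf_tmp => _ [ab [h _] <-].
by rewrite lee_fin vol_ge0.
Qed.

Lemma lebesgue_outer_le (R : realType) (N : nat) (A : set 'rV[R]_N)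
    (F : nat -> set 'rV[R]_N) :
  A `<=` \bigcup_k F k ->
  (lebesgue_outer A <= \sum_(0 <= k <oo) box_weight (F k))%E.
Proof. by move=> AF; apply: ereal_inf_lbound; exists F; [split|]. Qed.

(* Slicing in the last coordinate and integrating in that coordinate against
   the one-dimensional Lebesgue measure. *)
Lemma box_cover_vol (R : realType) (n : nat) (a b : nat -> R) (P : nat -> bool)
    (A B : nat -> nat -> R) :
  (forall i, a i <= b i) -> (forall k i, A k i <= B k i) ->
  (forall x : nat -> R, (forall i, (i < n)%N -> a i <= x i <= b i) ->
     exists2 k, P k & forall i, (i < n)%N -> A k i <= x i <= B k i) ->
  ((\prod_(i < n) (b i - a i))%:E <=
    \sum_(0 <= k <oo) ((P k)%:R * \prod_(i < n) (B k i - A k i))%:E)%E.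
Proof.
move=> ab AB.
have pr0 m k : 0 <= \prod_(i < m) (B k i - A k i).
  by apply: prodr_ge0 => i _; rewrite subr_ge0.
elim: n P => [|n IH] P h.
  (* With no coordinate left, the claim is that at least one [k] satisfies [P k]. *)
  have [k Pk _] := h a (fun i => ltac:(done)).
  rewrite !big_ord0.
  apply: le_trans (nneseries_lim_ge k.+1 _); last first.
    by move=> i _ _; rewrite big_ord0 mulr1 lee_fin.
  rewrite big_nat_recr//= big_ord0 Pk mulr1 -[X in (X <= _)%E]add0e leeD2r//.
  by apply: sume_ge0 => i _; rewrite big_ord0 mulr1 lee_fin.
pose Q k := `[A k n, B k n]%classic : set R.
(* The induction hypothesis on the slice at height [t], which is covered by the boxes whose last
   side contains [t]; this selection is recorded in the predicate. *)
have key t : t \in `[a n, b n]%classic ->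
  ((\prod_(i < n) (b i - a i))%:E <=
    \sum_(0 <= k <oo) ((P k)%:R * \prod_(i < n) (B k i - A k i) * \1_(Q k) t)%:E)%E.
  rewrite inE/= in_itv/= => tab.
  have := IH (fun k => P k && (t \in Q k)).
  have H : forall x : nat -> R, (forall i, (i < n)%N -> a i <= x i <= b i) ->
     exists2 k, P k && (t \in Q k) & forall i, (i < n)%N -> A k i <= x i <= B k i.
    move=> x xab.
    have [|k Pk hk] := h (fun i => if (i == n)%N then t else x i).
      move=> i; rewrite ltnS leq_eqVlt; case: eqP => [->|]//= _; exact: xab.
    exists k.
      by rewrite Pk/= inE/Q/= in_itv/=; have := hk n (ltnSn _); rewrite eqxx.
    move=> i ni; have := hk i (ltnW ni); by rewrite ifF// ltn_eqF.
  move/(_ H) => /le_trans; apply.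
  apply: lee_nneseries => k *.
    by rewrite lee_fin mulr_ge0.
  rewrite lee_fin indicE.
  by case: (P k); case: (_ \in _); rewrite /= ?(mul1r, mul0r, mulr1, mulr0).
have t0 k t : 0 <= (P k)%:R * \prod_(i < n) (B k i - A k i) * \1_(Q k) t.
  by apply: mulr_ge0; [exact: mulr_ge0|rewrite indicE].
have mab : measurable (`[a n, b n]%classic : set R) by exact: measurable_itv.
have -> : (\prod_(i < n.+1) (b i - a i))%:E =
    (\int[lebesgue_measure]_(t in `[a n, b n]) (\prod_(i < n) (b i - a i))%:E)%E.
  rewrite integral_cst//= lebesgue_measure_itv/= lte_fin.
  rewrite big_ord_recr/=.
  case: ltP => [//|ba].
  by rewrite (_ : b n = a n) ?subrr ?mulr0 ?mule0//; apply/eqP; rewrite eq_le ba ab.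
have mQ k : measurable (Q k) by exact: measurable_itv.
apply: (@le_trans _ _ (\int[lebesgue_measure]_(t in `[a n, b n])
   \sum_(0 <= k <oo) ((P k)%:R * \prod_(i < n) (B k i - A k i) * \1_(Q k) t)%:E)%E).
  apply: ge0_le_integral => //.
  - by move=> t _; rewrite lee_fin prodr_ge0// => i _; rewrite subr_ge0.
  - apply: ge0_emeasurable_sum => k *; last first.
      by apply/measurable_EFinP; apply: measurable_funM => //; exact: (measurable_funS measurableT (@subsetT _ _) (measurable_indic (mQ k))).
    by rewrite lee_fin; exact: t0.
  - by move=> t tt; apply: key; rewrite inE.
rewrite integral_nneseries//=; last 2 first.
- move=> k; apply/measurable_EFinP; apply: measurable_funM => //; exact: (measurable_funS measurableT (@subsetT _ _) (measurable_indic (mQ k))).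
- by move=> k t _; rewrite lee_fin; exact: t0.
apply: lee_nneseries => k _.
  by move=> _; apply: integral_ge0 => t _; rewrite lee_fin; exact: t0.
under eq_integral do rewrite EFinM.
rewrite ge0_integralZl//; last 2 first.
- by apply/measurable_EFinP; apply: measurable_indic; exact: mQ.
- by rewrite lee_fin; apply: mulr_ge0 => //; exact: pr0.
rewrite [X in (_ <= X%:E)%E](_ : _ = (P k)%:R * \prod_(i < n) (B k i - A k i) * (B k n - A k n)); last first.
  by rewrite big_ord_recr/= mulrA.
rewrite [X in (_ <= X)%E]EFinM integral_indic//; last exact: mQ.
apply: lee_wpmul2l; first by rewrite lee_fin; apply: mulr_ge0 => //; exact: pr0.
apply: (@le_trans _ _ (lebesgue_measure (Q k))).
  by apply: le_measure; rewrite ?inE; [apply: measurableI; [exact: mQ|exact: mab]|exact: mQ|exact: subIsetl].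
rewrite lebesgue_measure_itv/= lte_fin.
by case: ltP => // h1; rewrite lee_fin subr_ge0.
Qed.

(** For the lower bound each set of a cover is replaced by a box, at the cost of [e / 2 ^ (k+1)],
    and [box_cover_vol] applies. Empty sets receive a dummy box that the predicate [P] switches off;
    a set of infinite weight makes the bound trivial. *)
Lemma lebesgue_outer_box (R : realType) (N : nat) (a b : 'rV[R]_N) :
  (forall i, a ord0 i <= b ord0 i) ->
  lebesgue_outer (box a b) = (vol a b)%:E.
Proof.
move=> ab; apply/eqP; rewrite eq_le; apply/andP; split.
  pose F (k : nat) : set 'rV[R]_N := if k is 0%N then box a b else set0.
  apply: le_trans (lebesgue_outer_le (F := F) _) _.
    by move=> x xb; exists 0%N.
  rewrite (nneseries_split 0 1); last by move=> k _; exact: box_weight_ge0.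
  rewrite big_nat1 eseries0 ?adde0; first exact: box_weight_le.
  by move=> [|k]//= _ _; rewrite /F /box_weight eqxx.
apply: le_ereal_inf_tmp => _ [F [_ abF] <-].
apply/lee_addgt0Pr => e e0.
have [oo|oo] := pselect (exists k, box_weight (F k) = +oo%E).
  rewrite (@eseries_pinfty _ _ xpredT (projT1 (cid oo))) ?leey//.
    by move=> k _; have := @box_weight_ge0 _ _ (F k); case: box_weight.
  exact: (projT2 (cid oo)).
have h k : exists cd : 'rV[R]_N * 'rV[R]_N, [/\ (forall i, cd.1 ord0 i <= cd.2 ord0 i),
     (F k) `<=` box cd.1 cd.2 &
     ((F k !=set0) -> ((vol cd.1 cd.2)%:E <= box_weight (F k) + (e / 2 ^+ k.+1)%:E)%E)].
  have [Fk|Fk] := pselect (F k !=set0); last first.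
    exists (0, 0); split => // x xF; exfalso; apply: Fk; by exists x.
  have [||c [d [cd Fcd H]]] := @box_weight_lt _ _ (F k) (e / 2 ^+ k.+1) Fk.
  - by rewrite divr_gt0// exprn_gt0.
  - by rewrite ltey; apply/eqP => hk; apply: oo; exists k.
  by exists (c, d); split => // _; exact: ltW.
have [cd hcd] := choice h.
have Fn k : reflect (F k !=set0) `[< F k !=set0 >] by exact: asboolP.
(* Vectors become sequences, the format of [box_cover_vol]; indices beyond [N] get the value [z]. *)
pose ext (v : 'rV[R]_N) (z : R) i := if insub i is Some j then v ord0 j else z.
have extE v z (i : 'I_N) : ext v z i = v ord0 i.
  by rewrite /ext valK.
have := @box_cover_vol R N (ext a 0) (ext b 0) (fun k => `[< F k !=set0 >])
  (fun k => ext (cd k).1 0) (fun k => ext (cd k).2 0).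
have -> : \prod_(i < N) (ext b 0 i - ext a 0 i) = vol a b.
  by apply: eq_bigr => i _; rewrite !extE.
move=> H; apply: (le_trans (H _ _ _)) => {H}.
- by move=> i; rewrite /ext; case: insubP => //= j _ _.
- move=> k i; rewrite /ext; case: insubP => //= j _ _.
  by case: (hcd k).
- move=> x xab.
  have [|k _ Fk] := abF (\row_i x i).
    by move=> i; rewrite mxE; have := xab i (ltn_ord i); rewrite !extE.
  exists k; first by apply/Fn; exists (\row_i x i).
  case: (hcd k) => _ /(_ _ Fk) Fk2 _ i iN.
  have := Fk2 (Ordinal iN); rewrite mxE.
  by rewrite -(extE (cd k).1 0) -(extE (cd k).2 0).
rewrite -[e in X in (_ <= X)%E](@mul1r _ e) .
apply: (@le_trans _ _ (\sum_(0 <= k <oo) (box_weight (F k) + (e / 2 ^+ k.+1)%:E))%E).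
  apply: lee_nneseries => k *.
    rewrite lee_fin mulr_ge0// prodr_ge0// => i _; rewrite !extE subr_ge0.
    by case: (hcd k).
  have -> : \prod_(i < N) (ext (cd k).2 0 i - ext (cd k).1 0 i) = vol (cd k).1 (cd k).2.
    by apply: eq_bigr => i _; rewrite !extE.
  case: Fn => Fk; last first.
    by rewrite mul0r adde_ge0 ?box_weight_ge0// lee_fin divr_ge0// ltW.
  by rewrite mul1r; case: (hcd k) => _ _; apply.
rewrite nneseriesD; last 2 first.
- by move=> k _ _; exact: box_weight_ge0.
- by move=> k _ _; rewrite lee_fin divr_ge0// ltW.
rewrite leeD2l// mul1r.
have := epsilon_trick0 xpredT (ltW e0).
by under eq_eseriesr do rewrite natrX.
Qed.

(** If both pieces of [A] are nonempty, [c] lies between the [i]-th ends of any box around [A], and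
    the hyperplane cuts this box into two boxes with the same total volume. Applied to each member
    of a cover, this makes half-spaces Caratheodory measurable. *)
Lemma box_weight_split (R : realType) (N : nat) (A : set 'rV[R]_N) (i : 'I_N) (c : R) :
  (box_weight (A `&` [set x : 'rV[R]_N | (x ord0 i <= c)%R]) +
   box_weight (A `&` ~` [set x : 'rV[R]_N | (x ord0 i <= c)%R]) <= box_weight A)%E.
Proof.
have mono (B C : set 'rV[R]_N) : B `<=` C -> (box_weight B <= box_weight C)%E.
  move=> BC; rewrite [X in (_ <= X)%E]/box_weight; case: ifPn => [/eqP C0|_].
    have -> : B = set0 by apply/seteqP; split => // x /BC; rewrite C0.
    by rewrite /box_weight eqxx.
  apply: le_ereal_inf_tmp => _ [ab [ab1 ab2] <-].
  by apply: box_weight_le => // x /BC; exact: ab2.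
have w0 : @box_weight R N set0 = 0%E by rewrite /box_weight eqxx.
have [/eqP A1|A1] := boolP (A `&` [set x | x ord0 i <= c] == set0).
  by rewrite A1 w0 add0e; apply: mono; exact: subIsetl.
have [/eqP A2|A2] := boolP (A `&` ~` [set x | x ord0 i <= c] == set0).
  by rewrite A2 w0 adde0; apply: mono; exact: subIsetl.
rewrite [X in (_ <= X)%E]/box_weight; case: ifPn => [/eqP A0|An].
  by move: A1; rewrite A0 set0I eqxx.
apply: le_ereal_inf_tmp => _ [[a b] /= [ab1 ab2] <-].
have ac : a ord0 i <= c.
  by move/set0P : A1 => [x [/ab2/(_ i)/andP[h _]]]; exact: le_trans.
have cb : c <= b ord0 i.
  move/set0P : A2 => [x [/ab2/(_ i)/andP[_ h]]] /= /negP; rewrite -ltNge => /ltW h2.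
  exact: le_trans h.
pose b' := \row_j (if j == i then c else b ord0 j).
pose a' := \row_j (if j == i then c else a ord0 j).
have -> : (\prod_(j < N) (b ord0 j - a ord0 j))%:E = ((vol a b')%:E + (vol a' b)%:E)%E.
  rewrite -EFinD /vol; congr EFin.
  rewrite (bigD1 i)//= [X in _ = X + _](bigD1 i)//= [X in _ = _ + X](bigD1 i)//=.
  rewrite !mxE eqxx.
  have -> : \prod_(j < N | j != i) (b' ord0 j - a ord0 j) =
            \prod_(j < N | j != i) (b ord0 j - a ord0 j).
    by apply: eq_bigr => j /negPf ji; rewrite mxE ji.
  have -> : \prod_(j < N | j != i) (b ord0 j - a' ord0 j) =
            \prod_(j < N | j != i) (b ord0 j - a ord0 j).
    by apply: eq_bigr => j /negPf ji; rewrite mxE ji.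
  by ring.
apply: leeD; apply: box_weight_le.
- by move=> j; rewrite mxE; case: eqP => // ->.
- move=> x [/ab2 h /= xc] j; rewrite mxE; have := h j.
  by case: eqP => [->|//] /andP[-> _].
- by move=> j; rewrite mxE; case: eqP => // ->.
- move=> x [/ab2 h /= /negP]; rewrite -ltNge => xc j; rewrite mxE; have := h j.
  by case: eqP => [->|//] /andP[_ ->]; rewrite ltW.
Qed.

Lemma lebesgue_outer_half (R : realType) (N : nat) (i : 'I_N) (c : R) :
  (@lebesgue_outer R N).-caratheodory [set x : 'rV[R]_N | x ord0 i <= c].
Proof.
apply: le_caratheodory_measurable => X.
apply: le_ereal_inf_tmp => _ [F [_ XF] <-].
set H := [set x | _].
apply: (@le_trans _ _ (\sum_(0 <= k <oo) (box_weight (F k `&` H)) +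
   \sum_(0 <= k <oo) (box_weight (F k `&` ~` H)))%E).
  apply: leeD; apply: lebesgue_outer_le => x [/XF [k _ Fx] Hx]; by exists k.
rewrite -nneseriesD; last 2 first.
- by move=> *; exact: box_weight_ge0.
- by move=> *; exact: box_weight_ge0.
apply: lee_nneseries => k *; last exact: box_weight_split.
by rewrite adde_ge0// box_weight_ge0.
Qed.

(** * Measurable sets and boxes *)

Section cara.
Context (R : realType) (N : nat) (mu : {outer_measure set 'rV[R]_N -> \bar R}).
Hypothesis half : forall i c, mu.-caratheodory [set x : 'rV[R]_N | x ord0 i <= c].
Let T := caratheodory_type mu.

Lemma cara_coord (i : 'I_N) : measurable_fun [set: T] (fun x : T => (x : 'rV[R]_N) ord0 i).
Proof.
apply: (measurability _ (@RGenOInfty.measurableE R)) => // _ [_ [c ->] <-].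
rewrite setTI; have -> : (fun x : T => (x : 'rV[R]_N) ord0 i) @^-1` `]c, +oo[ =
  ~` [set x : T | (x : 'rV[R]_N) ord0 i <= c].
  apply/seteqP; split => x /=; rewrite in_itv/= andbT ltNge => /negP//.
by apply: measurableC; exact: half.
Qed.

(** An open set is the union of the cubes [K c k] with rational centre that it contains; [unpickle]
    enumerates the pairs [(c, k)]. The outer measure enters only through the half-spaces, so the
    lemma serves Lebesgue and Hausdorff measure alike. *)
Lemma cara_open (U : set 'rV[R]_N) : open U -> measurable (U : set T).
Proof.
move=> oU.
pose K (c : 'rV[rat]_N) (k : nat) : set T :=
  \bigcap_(i in [set: 'I_N]) ((fun x : T => (x : 'rV[R]_N) ord0 i) @^-1`
    `]ratr (c ord0 i) - k.+1%:R^-1, ratr (c ord0 i) + k.+1%:R^-1[).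
have mK c k : measurable (K c k).
  apply: fin_bigcap_measurable => // i _.
  by rewrite -[X in measurable X]setTI; apply: cara_coord.
pose G (n : nat) : set T := if unpickle n is Some (c, k) then
  (if `[< K c k `<=` U >] then K c k else set0) else set0.
have -> : (U : set T) = \bigcup_n G n.
  apply/seteqP; split => [x Ux|x [n _]]; last first.
    by rewrite /G; case: unpickle => [[c k]|//]; case: asboolP => // h /h.
  have /nbhs_ballP[e /= e0 xe] : nbhs (x : 'rV[R]_N) U by exact: open_nbhs_nbhs.
  have [k ke] : exists k : nat, k.+1%:R^-1 < e / 2.
    exists (Num.truncn (e / 2)^-1); rewrite invf_plt ?posrE ?divr_gt0//.
    by rewrite truncnS_gt// invr_ge0 divr_ge0// ltW.
  have [c hc] : exists c : 'rV[rat]_N, forall i,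
      `|ratr (c ord0 i) - (x : 'rV[R]_N) ord0 i| < k.+1%:R^-1.
    have h i : exists q : rat, `|ratr q - (x : 'rV[R]_N) ord0 i| < k.+1%:R^-1.
      have [|q] := @rat_in_itvoo R ((x : 'rV[R]_N) ord0 i - k.+1%:R^-1)
         ((x : 'rV[R]_N) ord0 i + k.+1%:R^-1).
        by rewrite ltrBlDr -addrA ltrDl addr_gt0// invr_gt0.
      rewrite in_itv/= => hq; exists q; rewrite ltr_distl.
      by [].
    have [f hf] := choice h.
    by exists (\row_i f i) => i; rewrite mxE.
  exists (pickle (c, k)) => //; rewrite /G pickleK.
  have hK : K c k `<=` U.
    move=> y Ky; apply: xe; rewrite /= mx_norm_ball /ball_/=.
    rewrite (le_lt_trans (y := e / 2 + e/2 - (e/2 - k.+1%:R^-1)))//; last first.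
      by rewrite -splitr ltrBlDr ltrDl subr_gt0.
    have -> : e / 2 + e / 2 - (e / 2 - k.+1%:R^-1) = e / 2 + k.+1%:R^-1 by ring.
    rewrite [leLHS]/Num.norm/= mx_normrE.
    apply: bigmax_le => [|[a j] _ /=].
      by rewrite addr_ge0// ?divr_ge0// ltW.
    rewrite !mxE; have := Ky j I; rewrite /= in_itv/= => h1.
    have h2 := hc j.
    rewrite (ord1 a).
    rewrite -ltr_distlC in h1.
    rewrite -(subrKA (ratr (c ord0 j))).
    apply: (le_trans (ler_normD _ _)); apply: lerD; last exact: ltW.
    by rewrite distrC; apply: ltW; apply: (lt_trans h2).
  rewrite asboolT// => i _ /=; rewrite in_itv/=.
  have := hc i; rewrite -ltr_distlC distrC.
  by rewrite distrC.
apply: bigcupT_measurable => n; rewrite /G.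
by case: unpickle => [[c k]|//]; case: ifP.
Qed.

Lemma cara_closed (U : set 'rV[R]_N) : closed U -> measurable (U : set T).
Proof.
move=> cU; rewrite -[U]setCK; apply: measurableC.
by apply: cara_open; exact: closed_openC.
Qed.

Lemma cara_rel_open (D : set 'rV[R]_N) (f : 'rV[R]_N -> R) :
  measurable (D : set T) ->
  (forall c, exists2 V, open V & D `&` [set x | c < f x] = D `&` V) ->
  measurable_fun (D : set T) f.
Proof.
move=> mD h.
apply: (measurability _ (@RGenOInfty.measurableE R)) => // _ [_ [c ->] <-].
have [V oV DV] := h c.
have -> : (D : set T) `&` f @^-1` `]c, +oo[ = (D : set T) `&` V.
  by rewrite -DV; apply/seteqP; split => x /= [? ]; rewrite in_itv/= andbT.
by apply: measurableI => //; exact: cara_open.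
Qed.

Lemma cara_continuous_in (D : set 'rV[R]_N) (f : 'rV[R]_N -> R) :
  measurable (D : set T) -> {within D, continuous f} ->
  measurable_fun (D : set T) f.
Proof.
move=> mD cf; apply: cara_rel_open => // c.
have : open (f @^-1` `]c, +oo[ : set (subspace D)).
  by move/continuousP : cf; apply; exact: interval_open.
move=> /open_subspaceP[U oU hU]; exists U => //; rewrite setIC.
rewrite (setIC _ U) hU; apply/seteqP; split => x /= []; rewrite ?in_itv/= ?andbT//.
Qed.

Lemma cara_continuous (D : set 'rV[R]_N) (f : 'rV[R]_N -> R) :
  measurable (D : set T) -> continuous f ->
  measurable_fun (D : set T) f.
Proof.
move=> mD /continuousP cf; apply: cara_rel_open => // c.
exists (f @^-1` `]c, +oo[); first by apply: cf; exact: interval_open.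
by apply/seteqP; split => x /= [?]; rewrite in_itv/= andbT.
Qed.

End cara.

(** * Translation invariance of Lebesgue measure *)

Section translation.
Context (R : realType) (N : nat).

Definition trset (t : 'rV[R]_N) (A : set 'rV[R]_N) : set 'rV[R]_N :=
  [set x | A (x - t)].

Lemma trsetK (t : 'rV[R]_N) (A : set 'rV[R]_N) : trset t (trset (- t) A) = A.
Proof. by apply/seteqP; split => x; rewrite /trset/= opprK subrK. Qed.

Lemma trsetKV (t : 'rV[R]_N) (A : set 'rV[R]_N) : trset (- t) (trset t A) = A.
Proof. by apply/seteqP; split => x; rewrite /trset/= opprK addrK. Qed.

Lemma box_weight_shift_le (t : 'rV[R]_N) (A : set 'rV[R]_N) :
  (box_weight (trset t A) <= box_weight A)%E.
Proof.
rewrite [X in (_ <= X)%E]/box_weight; case: ifPn => [/eqP ->|An].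
  have -> : trset t set0 = set0 by apply/seteqP; split.
  by rewrite /box_weight eqxx.
apply: le_ereal_inf_tmp => _ [[a b] /= [ab1 ab2] <-].
have -> : \prod_(i < N) (b ord0 i - a ord0 i) = vol (a + t) (b + t).
  by apply: eq_bigr => i _; rewrite !mxE opprD addrACA subrr addr0.
apply: box_weight_le.
  by move=> i; rewrite !mxE lerD2r.
move=> x /ab2 h i; have := h i; rewrite !mxE.
by rewrite lerBrDr lerBlDr.
Qed.

Lemma lebesgue_outer_shift_le (t : 'rV[R]_N) (A : set 'rV[R]_N) :
  (lebesgue_outer (trset t A) <= lebesgue_outer A)%E.
Proof.
apply: le_ereal_inf_tmp => _ [F [_ AF] <-].
apply: le_trans (lebesgue_outer_le (F := fun k => trset t (F k)) _) _.
  by move=> x /AF[k _ Fk]; exists k.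
apply: lee_nneseries => k *; [exact: box_weight_ge0|exact: box_weight_shift_le].
Qed.

Lemma lebesgue_outer_shift (t : 'rV[R]_N) (A : set 'rV[R]_N) :
  lebesgue_outer (trset t A) = lebesgue_outer A.
Proof.
apply/eqP; rewrite eq_le lebesgue_outer_shift_le/=.
by rewrite -{1}(trsetK (- t) A) opprK lebesgue_outer_shift_le.
Qed.

End translation.

Notation leb_space R N := (caratheodory_type (@lebesgue_outer R N)).

Section leb.
Context (R : realType) (N : nat).
Notation T := (leb_space R N).
Notation mu := (lebesgue_rV R N).

Lemma lebE (A : set T) : mu A = lebesgue_outer A.
Proof. by []. Qed.

Lemma leb_open (U : set 'rV[R]_N) : open U -> measurable (U : set T).
Proof. by apply: cara_open; exact: lebesgue_outer_half. Qed.

Lemma leb_closed (U : set 'rV[R]_N) : closed U -> measurable (U : set T).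
Proof. by apply: cara_closed; exact: lebesgue_outer_half. Qed.

Lemma leb_coord (i : 'I_N) : measurable_fun [set: T] (fun x : T => (x : 'rV[R]_N) ord0 i).
Proof. by apply: cara_coord; exact: lebesgue_outer_half. Qed.

Lemma leb_continuous (D : set T) (f : 'rV[R]_N -> R) :
  measurable D -> continuous f -> measurable_fun D f.
Proof. by apply: cara_continuous; exact: lebesgue_outer_half. Qed.

Lemma leb_continuous_in (D : set T) (f : 'rV[R]_N -> R) :
  measurable D -> {within (D : set 'rV[R]_N), continuous f} -> measurable_fun D f.
Proof. by apply: cara_continuous_in; exact: lebesgue_outer_half. Qed.

(** The Caratheodory condition for a translate of [Y], tested on [X], is the one for [Y] tested on a
    translate of [X]. *)
Lemma leb_translation (t : 'rV[R]_N) :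
  measurable_fun [set: T] (fun x : T => (x : 'rV[R]_N) + t : T).
Proof.
move=> _ Y mY; rewrite setTI.
have -> : (fun x : T => (x : 'rV[R]_N) + t : T) @^-1` Y = trset (- t) (Y : set 'rV[R]_N).
  by apply/seteqP; split => x; rewrite /trset/= opprK.
have key (Z : set 'rV[R]_N) : lebesgue_outer Z =
    (lebesgue_outer (Z `&` Y) + lebesgue_outer (Z `&` ~` Y))%E by exact: mY.
move=> X; change (lebesgue_outer X = lebesgue_outer (X `&` trset (- t) Y) +
  lebesgue_outer (X `&` ~` trset (- t) Y))%E.
rewrite -(lebesgue_outer_shift t X) key; congr (_ + _)%E.
  rewrite -[RHS](lebesgue_outer_shift t); congr (lebesgue_outer _).
  by apply/seteqP; split => x; rewrite /trset/= opprK subrK.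
rewrite -[RHS](lebesgue_outer_shift t); congr (lebesgue_outer _).
by apply/seteqP; split => x; rewrite /trset/= opprK subrK.
Qed.

Lemma leb_pushforward (t : 'rV[R]_N) (A : set T) :
  pushforward mu (fun x : T => (x : 'rV[R]_N) + t : T) A = mu A.
Proof.
rewrite /pushforward !lebE -[RHS](lebesgue_outer_shift (- t)); congr (lebesgue_outer _).
by apply/seteqP; split => x; rewrite /trset/= opprK.
Qed.

Lemma measurable_shift (t : 'rV[R]_N) (A : set T) :
  measurable A -> measurable (trset t (A : set 'rV[R]_N) : set T).
Proof.
move=> mA; have := leb_translation (- t) measurableT mA.
by rewrite setTI.
Qed.

Lemma ge0_integral_shift (t : 'rV[R]_N) (A : set T) (f : T -> \bar R) :
  measurable A -> measurable_fun A f -> (forall x, A x -> 0 <= f x)%E ->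
  (\int[mu]_(x in A) f x =
   \int[mu]_(x in (trset (- t) (A : set 'rV[R]_N) : set T)) f ((x : 'rV[R]_N) + t)%R)%E.
Proof.
move=> mA mf f0.
have mt := leb_translation t.
rewrite (@eq_measure_integral _ _ _ A (pushforward mu (fun x : T => (x : 'rV[R]_N) + t : T))); last first.
  by move=> B _ _; rewrite -[LHS](leb_pushforward t).
rewrite ge0_integral_pushforward//; last by move=> x; rewrite inE; exact: f0.
have -> : (fun x : T => (x : 'rV[R]_N) + t : T) @^-1` A = trset (- t) (A : set 'rV[R]_N).
  by apply/seteqP; split => x; rewrite /trset/= opprK.
by [].
Qed.

End leb.

(** * Hausdorff outer measure as a metric outer measure *)

Section diam.
Context (R : realType) (N s : nat).
Notation H := (@hausdorff_outer R N s).
Implicit Types (A B : set 'rV[R]_N) (r : R).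

Lemma diam_weight_ge0 r A : (0 <= diam_weight s r A)%E.
Proof.
rewrite /diam_weight; case: ifP => // _; apply: le_ereal_inf_tmp => _ [d [h _ _] <-].
by rewrite lee_fin exprn_ge0.
Qed.

Lemma diam_weight_le r A d : 0 <= d <= r ->
  (forall x y, A x -> A y -> enorm (x - y) <= d) ->
  (diam_weight s r A <= (d ^+ s)%:E)%E.
Proof.
move=> /andP[d0 dr] Ad; rewrite /diam_weight; case: ifPn => [_|An].
  by rewrite lee_fin exprn_ge0.
by apply: ereal_inf_lbound; exists d.
Qed.

Lemma diam_weight0 r : diam_weight s r (set0 : set 'rV[R]_N) = 0%E.
Proof. by rewrite /diam_weight eqxx. Qed.

Lemma le_diam_weight r A B : A `<=` B -> (diam_weight s r A <= diam_weight s r B)%E.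
Proof.
move=> AB; rewrite [X in (_ <= X)%E]/diam_weight; case: ifPn => [/eqP B0|_].
  have -> : A = set0 by apply/seteqP; split => // x /AB; rewrite B0.
  by rewrite diam_weight0.
apply: le_ereal_inf_tmp => _ [d [d0 dr hd] <-].
by apply: diam_weight_le => [|x y /AB Bx /AB By]; [rewrite d0|exact: hd].
Qed.

Lemma diam_weight_antimono r r' A : r' <= r ->
  (diam_weight s r A <= diam_weight s r' A)%E.
Proof.
move=> rr; rewrite [X in (_ <= X)%E]/diam_weight; case: ifPn => [/eqP ->|_].
  by rewrite diam_weight0.
apply: le_ereal_inf_tmp => _ [d [d0 dr hd] <-].
by apply: diam_weight_le => //; rewrite d0 (le_trans dr).
Qed.

Let hr r A := mu_ext (@diam_weight R N s r) A.

Lemma mu_ext_diam_le r A (F : nat -> set 'rV[R]_N) :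
  A `<=` \bigcup_k F k ->
  (mu_ext (@diam_weight R N s r) A <= \sum_(0 <= k <oo) diam_weight s r (F k))%E.
Proof. by move=> AF; apply: ereal_inf_lbound; exists F; [split|]. Qed.

Lemma hausdorff_ub r A : 0 < r -> (mu_ext (@diam_weight R N s r) A <= H A)%E.
Proof. by move=> r0; apply: ereal_sup_ubound; exists r. Qed.

(** If [A] meets both sets, its diameter exceeds [r]; the infimum defining its weight is then over
    the empty set, hence [+oo]. *)
Lemma diam_weight_sep r A B1 B2 : 
  (forall x y, B1 x -> B2 y -> r < enorm (x - y)) ->
  (diam_weight s r (A `&` B1) + diam_weight s r (A `&` B2) <= diam_weight s r A)%E.
Proof.
move=> h.
have [/eqP A1|A1] := boolP (A `&` B1 == set0).
  by rewrite A1 diam_weight0 add0e; apply: le_diam_weight; exact: subIsetl.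
have [/eqP A2|A2] := boolP (A `&` B2 == set0).
  by rewrite A2 diam_weight0 adde0; apply: le_diam_weight; exact: subIsetl.
rewrite [X in (_ <= X)%E]/diam_weight; case: ifPn => [/eqP A0|_].
  by move: A1; rewrite A0 set0I eqxx.
apply: le_ereal_inf_tmp => _ [d [d0 dr hd] <-]; exfalso.
move/set0P : A1 => [x [Ax Bx]]; move/set0P : A2 => [y [Ay By]].
have := h _ _ Bx By; rewrite ltNge => /negP; apply.
exact: le_trans (hd _ _ Ax Ay) dr.
Qed.

(** A cover of mesh [r < d] splits into the part that meets [B1] and the part that meets [B2]. The
    remaining work is the passage to the supremum over the mesh. *)
Lemma hausdorff_sep A B1 B2 d : 0 < d ->
  (forall x y, B1 x -> B2 y -> d <= enorm (x - y)) ->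
  (H (A `&` B1) + H (A `&` B2) <= H A)%E.
Proof.
move=> d0 h.
have hmono r r' B : 0 < r' -> r' <= r -> (hr r B <= hr r' B)%E.
  move=> r0 rr; apply: le_ereal_inf_tmp => _ [F [_ FB] <-].
  apply: (le_trans (mu_ext_diam_le r FB)); apply: lee_nneseries => k *.
    exact: diam_weight_ge0.
  exact: diam_weight_antimono.
have key r : 0 < r -> r < d -> (hr r (A `&` B1) + hr r (A `&` B2) <= H A)%E.
  move=> r0 rd; apply: le_trans (hausdorff_ub A r0).
  apply: le_ereal_inf_tmp => _ [F [_ FA] <-].
  apply: (@le_trans _ _ (\sum_(0 <= k <oo) (diam_weight s r (F k `&` B1)) +
     \sum_(0 <= k <oo) (diam_weight s r (F k `&` B2)))%E).
    apply: leeD; apply: mu_ext_diam_le => x [/FA [k _ Fx] Hx]; by exists k.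
  rewrite -nneseriesD; last 2 first.
  - by move=> *; exact: diam_weight_ge0.
  - by move=> *; exact: diam_weight_ge0.
  apply: lee_nneseries => k *; first by rewrite adde_ge0// diam_weight_ge0.
  apply: diam_weight_sep => x y B1x B2y; exact: lt_le_trans rd (h _ _ B1x B2y).
have hr_ge0 r B : (0 <= hr r B)%E.
  apply: le_ereal_inf_tmp => _ [F [_ FB] <-]; apply: nneseries_ge0 => *; exact: diam_weight_ge0.
have H_ge0 B : (0 <= H B)%E.
  by apply: le_trans (hausdorff_ub B ltr01); exact: hr_ge0.
have [HA|HA] := eqVneq (H A) +oo%E; first by rewrite HA leey.
have finH B : B `<=` A -> H B \is a fin_num.
  move=> BA; rewrite ge0_fin_numE//; apply: (@le_lt_trans _ _ (H A)).
    exact: le_outer_measure.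
  by rewrite ltey.
have fin1 := finH _ (@subIsetl _ A B1); have fin2 := finH _ (@subIsetl _ A B2).
apply/lee_addgt0Pr => e e0.
have e20 : 0 < e / 2 by rewrite divr_gt0.
have [_ [r1 r10 <-] hr1] := ub_ereal_sup_adherent e20 fin1.
have [_ [r2 r20 <-] hr2] := ub_ereal_sup_adherent e20 fin2.
(* The premeasures increase as the mesh decreases, so one [r] below [r1], [r2] and [d] serves both
   pieces. *)
pose r := Num.min (Num.min r1 r2) (d / 2).
have r0 : 0 < r by rewrite !lt_min r10 r20 divr_gt0.
have rd : r < d by rewrite /r gt_min ltr_pdivrMr// mulr_natr mulr2n ltrDl d0 orbT.
have := key r r0 rd => k1.
apply: (@le_trans _ _ ((hr r (A `&` B1) + (e/2)%:E) + (hr r (A `&` B2) + (e/2)%:E))%E).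
  apply: leeD.
    rewrite -leeBlDr//; apply: (le_trans (ltW hr1)); apply: hmono => //.
    by rewrite !ge_min lexx.
  rewrite -leeBlDr//; apply: (le_trans (ltW hr2)); apply: hmono => //.
  by rewrite !ge_min lexx orbT.
by rewrite addeACA -EFinD -splitr; exact: leeD2r.
Qed.

End diam.

(** * The Euclidean norm *)

Section enorm.
Context (R : realType) (N : nat).
Implicit Types x y : 'rV[R]_N.

Lemma dotvE x y : dotv x y = \sum_i x ord0 i * y ord0 i.
Proof. by rewrite /dotv mxE; apply: eq_bigr => i _; rewrite mxE. Qed.

Lemma dotvC x y : dotv x y = dotv y x.
Proof. by rewrite !dotvE; apply: eq_bigr => i _; rewrite mulrC. Qed.

Lemma dotvDl x y z : dotv (x + y) z = dotv x z + dotv y z.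
Proof. by rewrite /dotv mulmxDl mxE. Qed.

Lemma dotvZl (c : R) x y : dotv (c *: x) y = c * dotv x y.
Proof. by rewrite /dotv -scalemxAl mxE. Qed.

Lemma dotvDr x y z : dotv x (y + z) = dotv x y + dotv x z.
Proof. by rewrite dotvC dotvDl !(dotvC _ x). Qed.

Lemma dotvZr (c : R) x y : dotv x (c *: y) = c * dotv x y.
Proof. by rewrite dotvC dotvZl dotvC. Qed.

Lemma dotv_ge0 x : 0 <= dotv x x.
Proof. by rewrite dotvE; apply: sumr_ge0 => i _; rewrite -expr2 sqr_ge0. Qed.

Lemma enorm_ge0 x : 0 <= enorm x.
Proof. exact: sqrtr_ge0. Qed.

Lemma enorm_sqr x : enorm x ^+ 2 = dotv x x.
Proof. by rewrite sqr_sqrtr// dotv_ge0. Qed.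

Lemma enorm_coord x i : `|x ord0 i| <= enorm x.
Proof.
rewrite -sqrtr_sqr ler_wsqrtr// dotvE (bigD1 i)//= expr2 lerDl.
by apply: sumr_ge0 => j _; rewrite -expr2 sqr_ge0.
Qed.

Lemma enormZ (c : R) x : enorm (c *: x) = `|c| * enorm x.
Proof.
by rewrite /enorm dotvZl dotvZr mulrA -expr2 sqrtrM ?sqr_ge0// sqrtr_sqr.
Qed.

Lemma enormN x : enorm (- x) = enorm x.
Proof. by rewrite -scaleN1r enormZ normrN1 mul1r. Qed.

Lemma enorm0 : enorm (0 : 'rV[R]_N) = 0.
Proof. by rewrite -(scale0r 0) enormZ normr0 mul0r. Qed.

Lemma enorm_eq0 x : enorm x = 0 -> x = 0.
Proof.
move=> x0; apply/rowP => i; rewrite mxE; apply/eqP.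
by rewrite -normr_le0 -x0; exact: enorm_coord.
Qed.

Lemma cauchy_schwarz x y : dotv x y <= enorm x * enorm y.
Proof.
have [x0|x0] := eqVneq (enorm x) 0.
  by rewrite (enorm_eq0 x0) -(scale0r 0) dotvZl enormZ normr0 !mul0r.
have [y0|y0] := eqVneq (enorm y) 0.
  by rewrite (enorm_eq0 y0) -(scale0r 0) dotvZr enormZ normr0 !mul0r mulr0.
have xp : 0 < enorm x by rewrite lt_neqAle eq_sym x0 enorm_ge0.
have yp : 0 < enorm y by rewrite lt_neqAle eq_sym y0 enorm_ge0.
have := dotv_ge0 ((enorm y) *: x + (- enorm x) *: y).
rewrite dotvDl !dotvDr !dotvZl !dotvZr -!enorm_sqr (dotvC y x).
set a := enorm x in xp *; set b := enorm y in yp *; set c := dotv _ _.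
have -> : b * (b * a ^+ 2) + b * (- a * c) + (- a * (b * c) + - a * (- a * b ^+ 2)) =
   (a * b) * (2 * (a * b - c)) by ring.
by rewrite pmulr_rge0 ?mulr_gt0// pmulr_rge0// subr_ge0.
Qed.

Lemma cauchy_schwarz_norm x y : `|dotv x y| <= enorm x * enorm y.
Proof.
rewrite ler_norml cauchy_schwarz andbT lerNl.
by rewrite -(enormN x) -mulN1r -dotvZl scaleN1r cauchy_schwarz.
Qed.

Lemma enormD x y : enorm (x + y) <= enorm x + enorm y.
Proof.
rewrite -(ler_pXn2r (_ : (0 < 2)%N)) ?nnegrE ?addr_ge0 ?enorm_ge0//.
rewrite enorm_sqr dotvDl !dotvDr -!enorm_sqr (dotvC y x).
by have := cauchy_schwarz x y; nra.
Qed.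

Lemma enorm_sum (I : Type) (r : seq I) (F : I -> 'rV[R]_N) :
  enorm (\sum_(i <- r) F i) <= \sum_(i <- r) enorm (F i).
Proof.
elim/big_ind2: _ => [|x1 x2 y1 y2 h1 h2|//]; first by rewrite enorm0.
exact: le_trans (enormD _ _) (lerD h1 h2).
Qed.

Lemma enorm_le_sum x : enorm x <= \sum_i `|x ord0 i|.
Proof.
rewrite {1}(row_sum_delta x); apply: (le_trans (enorm_sum _ _)).
apply: ler_sum => i _; rewrite enormZ ler_piMr//.
rewrite /enorm dotvE (bigD1 i)//= big1 ?addr0 ?mxE ?eqxx ?mulr1 ?sqrtr1//.
by move=> j /negPf ji; rewrite !mxE eqxx ji mulr0.
Qed.

Lemma sup_norm_coord x i : `|x ord0 i| <= `|x|.
Proof.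
rewrite [leRHS]/Num.norm/= mx_normrE.
by apply: (le_bigmax _ (fun ij => `|x ij.1 ij.2|) (ord0, i)).
Qed.

Lemma sup_norm_le x c : 0 <= c -> (forall i, `|x ord0 i| <= c) -> `|x| <= c.
Proof.
move=> c0 h; rewrite [leLHS]/Num.norm/= mx_normrE.
by apply: bigmax_le => // -[a j] _ /=; rewrite (ord1 a).
Qed.

Lemma sup_norm_lt x c : 0 < c -> (forall i, `|x ord0 i| < c) -> `|x| < c.
Proof.
move=> c0 h; rewrite [ltLHS]/Num.norm/= mx_normrE.
by apply: bigmax_lt => // -[a j] _ /=; rewrite (ord1 a).
Qed.

Lemma sup_le_enorm x : `|x| <= enorm x.
Proof. by apply: sup_norm_le => [|i]; [exact: enorm_ge0|exact: enorm_coord]. Qed.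

Lemma enorm_le_sup x : enorm x <= N%:R * `|x|.
Proof.
apply: (le_trans (enorm_le_sum x)).
apply: (@le_trans _ _ (\sum_(i < N) `|x|)).
  by apply: ler_sum => i _; exact: sup_norm_coord.
by rewrite sumr_const card_ord -[leLHS]mulr_natl.
Qed.

Lemma enorm_orth (Q : 'M[R]_N) x : Q *m Q^T = 1%:M -> enorm (x *m Q) = enorm x.
Proof.
move=> QQ; rewrite /enorm /dotv trmx_mul.
by rewrite mulmxA -(mulmxA x) QQ mulmx1.
Qed.

End enorm.

(** * Half-spaces are measurable for the Hausdorff measure *)

Section haus.
Context (R : realType) (N s : nat).
Notation H := (@hausdorff_outer R N s).

(** Caratheodory's argument for metric outer measures. The complement of the half-space is exhausted
    by the sets [B n], at distance [t n] from it; what is missed is a tail of the layers [L m],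
    where [c + t m.+2 < x_i <= c + t m.+1]. Layers whose indices differ by two are a positive
    distance apart, so the measures of the even layers, and of the odd ones, sum to at most [H A];
    hence the tails tend to zero. *)
Lemma hausdorff_outer_half (i : 'I_N) (c : R) :
  H.-caratheodory [set x : 'rV[R]_N | x ord0 i <= c].
Proof.
apply: le_caratheodory_measurable => A; set P : set 'rV[R]_N := [set _ | _].
change (H (A `&` P) + H (A `&` ~` P) <= H A)%E.
have [HA|HA] := eqVneq (H A) +oo%E; first by rewrite HA leey.
pose t (m : nat) : R := m.+1%:R^-1.
have tlt m n : (m < n)%N -> t n < t m.
  by move=> mn; rewrite ltf_pV2 ?posrE// ltr_nat.
pose B m := [set x : 'rV[R]_N | c + t m < x ord0 i].
pose C m := [set x : 'rV[R]_N | x ord0 i <= c + t m].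
pose L m := A `&` (B m.+2 `&` C m.+1).
have sep (b1 b2 : R) (X Y : set 'rV[R]_N) : b2 < b1 ->
    (forall x, X x -> b1 <= x ord0 i) -> (forall x, Y x -> x ord0 i <= b2) ->
    forall x y, X x -> Y y -> b1 - b2 <= enorm (x - y).
  move=> b12 hX hY x y /hX h1 /hY h2.
  apply: le_trans (enorm_coord _ i); rewrite !mxE.
  by apply: le_trans (ler_norm _); exact: lerB.
have H0 X : (0 <= H X)%E by exact: outer_measure_ge0.
have evn e J : (\sum_(j < J) H (L (2 * j + e)%N) <= H (A `&` B (2 * J + e)%N))%E.
  elim: J => [|J IH]; first by rewrite big_ord0.
  rewrite big_ord_recr/=.
  have d0 : 0 < c + t (2 * J + e)%N - (c + t (2 * J + e).+1).
    by rewrite subr_gt0 ltrD2l tlt.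
  have := @hausdorff_sep R N s (A `&` B (2 * J.+1 + e)%N) (B (2 * J + e)%N) (C (2 * J + e).+1) _ d0.
  have -> : (2 * J.+1 + e = (2 * J + e).+2)%N by lia.
  move=> K; apply: le_trans (K _); last first.
    move=> x y; apply: sep => //; first by rewrite ltrD2l tlt.
    by move=> z /ltW.
  apply: leeD; last by rewrite /L setIA.
  apply: (le_trans IH); apply: le_outer_measure => x [Ax Bx]; split => //; split => //.
  by rewrite /B/=; apply: lt_trans Bx; rewrite ltrD2l tlt// ltnW.
have S n : (\sum_(0 <= m < n) H (L m) <= H A + H A)%E.
  have e2 J : (\sum_(0 <= m < (2 * J)%N) H (L m) =
     \sum_(j < J) H (L (2 * j + 0)%N) + \sum_(j < J) H (L (2 * j + 1)%N))%E.
    elim: J => [|J IH]; first by rewrite muln0 big_geq// !big_ord0 adde0.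
    have -> : (2 * J.+1 = (2 * J).+2)%N by lia.
    rewrite big_nat_recr//= big_nat_recr//= IH !big_ord_recr/=.
    by rewrite addn0 addn1 -!addeA; congr (_ + _)%E; rewrite [RHS]addeCA.
  apply: (@le_trans _ _ (\sum_(0 <= m < (2 * n)%N) H (L m))%E).
    by apply: lee_sum_nneg_natr => //; lia.
  rewrite e2; apply: leeD; apply: (le_trans (evn _ n)); apply: le_outer_measure; exact: subIsetl.
have tot : (\sum_(0 <= m <oo) H (L m) <= H A + H A)%E.
  by apply: lime_le; [exact: is_cvg_nneseries|exact: nearW].
have totfin : (\sum_(0 <= m <oo) H (L m) < +oo)%E.
  by apply: (le_lt_trans tot); rewrite lte_add_pinfty// ltey.
have tail := nneseries_tail_cvg totfin (fun k _ => H0 (L k)).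
apply/lee_addgt0Pr => e e0.
have [n hn] : exists n, (\sum_(n <= k <oo) H (L k) < e%:E)%E.
  have : \forall n \near \oo, (\sum_(n <= k <oo) H (L k) < e%:E)%E.
    exact: (tail _ (@nbhs_open_ereal_lt R 0 (fun=> e) e0)).
  by move=> [n _ hn]; exists n; apply: (hn n); exact: leqnn.
have sub : A `&` ~` P `<=` (A `&` B n.+1) `|` \bigcup_(k in ~` `I_n) L k.
  move=> x [Ax /negP]; rewrite -ltNge => cx.
  have [Bx|Bx] := boolP (c + t n.+1 < x ord0 i); first by left.
  right; rewrite -leNgt in Bx.
  have ex : exists m, c + t m.+2 < x ord0 i.
    exists (Num.truncn (x ord0 i - c)^-1); rewrite -ltrBrDl /t invf_plt ?posrE ?subr_gt0//.
    by apply: (lt_le_trans (truncnS_gt _)); rewrite ler_nat ltnW// !ltnS ltnW.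
  have hm := ex_minnP ex; case: hm => m hm mmin.
  have nm : (n <= m)%N.
    rewrite leqNgt; apply/negP => mn.
    have := lt_le_trans hm Bx; rewrite ltrD2l ltNge.
    by rewrite lef_pV2 ?posrE// ler_nat !ltnS mn.
  exists m; first by rewrite /= ltnNge nm.
  split => //; split => //; rewrite /C/= leNgt; apply/negP => h.
  case: m hm mmin nm h => [|m] hm mmin nm h.
    by move: nm; rewrite leqn0 => /eqP n0; move: Bx; rewrite n0 leNgt h.
  by have := mmin m h; rewrite ltnn.
have hsub : (H (A `&` ~` P) <= H (A `&` B n.+1) + \sum_(n <= k <oo) H (L k))%E.
  apply: (le_trans (le_outer_measure H _ _ sub)).
  apply: (le_trans (outer_measureU2 H _ _)); apply: leeD => //.
  exact: outer_measure_sigma_subadditive_tail.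
apply: (le_trans (leeD (lexx (H (A `&` P))) hsub)).
rewrite addeA; apply: leeD; last exact: ltW.
have d0 : 0 < c + t n.+1 - c by rewrite addrAC subrr add0r invr_gt0.
have := @hausdorff_sep R N s A (B n.+1) P _ d0.
rewrite addeC; apply; move=> x y; apply: sep => //.
  by rewrite ltrDl invr_gt0.
by move=> z /ltW.
Qed.

End haus.

(** * Functions of class C^1 *)

Section lines.
Context (R : realType) (N : nat).
Implicit Types (f g : 'rV[R]_N -> R) (x v : 'rV[R]_N) (t : R).

(** Restricted to a line, a directional derivative is an ordinary one; the chain rule and the mean
    value theorem below rest on this. *)
Lemma is_derive_lineP f x v b :
  is_derive x v f b <-> is_derive (0 : R) (1 : R) (fun h : R => f (h *: v + x)) b.
Proof.
have E : (fun h : R => h^-1 *: (((fun h : R => f (h *: v + x)) \o shift (0 : R)) (h *: 1) -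
     (fun h : R => f (h *: v + x)) 0)) =
   (fun h : R => h^-1 *: ((f \o shift x) (h *: v) - f x)).
  by apply/funext => h /=; rewrite addr0 scale0r add0r /GRing.scale/= mulr1.
split=> -[h1 h2]; split.
- by rewrite /derivable E.
- by rewrite -h2 /derive E.
- by move: h1; rewrite /derivable E.
- by rewrite -h2 /derive E.
Qed.

Lemma is_derive_line f x v t b : is_derive (t *: v + x) v f b ->
  is_derive t (1 : R) (fun h : R => f (h *: v + x)) b.
Proof.
move=> /is_derive_lineP h.
have -> : (fun h : R => f (h *: v + x)) =
    (fun h : R => f (h *: v + (t *: v + x))) \o (fun h => h - t).
  by apply/funext => s /=; rewrite addrA -scalerDl subrK.
rewrite -[b]mulr1; apply: is_derive1_comp.
  by rewrite subrr.
by have := is_deriveB (is_derive_id t (1 : R)) (is_derive_cst t t (1 : R)); rewrite subr0.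
Qed.

Lemma is_derive_comp_line (g : R -> R) f x v a b :
  is_derive (f x) 1 g a -> is_derive x v f b -> is_derive x v (g \o f) (a * b).
Proof.
move=> ga /is_derive_lineP fb; apply/is_derive_lineP.
apply: (is_derive1_comp (f := g) (g := fun h => f (h *: v + x))) => //.
by rewrite scale0r add0r.
Qed.

End lines.

Section C1.
Context (R : realType) (N : nat).
Implicit Types (f g : 'rV[R]_N -> R) (x : 'rV[R]_N) (t : R) (i : 'I_N).

Lemma C1_is_derive f : C1 f -> forall i x, is_derive x (evec R i) f (partial i f x).
Proof. by move=> [_ h] i x; split => //; case: (h i). Qed.

Lemma C1_cont f : C1 f -> continuous f. Proof. by case. Qed.

Lemma C1_partial_cont f i : C1 f -> continuous (partial i f).
Proof. by move=> [_ h]; case: (h i). Qed.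

Lemma C1_intro f (df : 'I_N -> 'rV[R]_N -> R) : continuous f ->
  (forall i x, is_derive x (evec R i) f (df i x)) -> (forall i, continuous (df i)) ->
  C1 f /\ forall i, partial i f = df i.
Proof.
move=> cf h cdf.
have E i : partial i f = df i by apply/funext => x; apply: derive_val.
by split => //; split => // i; split; [move=> x; case: (h i x)|rewrite E].
Qed.

Lemma C1_cst_subproof (c : R) : C1 (fun _ : 'rV[R]_N => c) /\
  forall i, partial i (fun _ : 'rV[R]_N => c) = (fun=> 0).
Proof.
by apply: C1_intro => [x|i x]; exact: cst_continuous.
Qed.

Lemma C1_cst (c : R) : C1 (fun _ : 'rV[R]_N => c).
Proof. by case: (C1_cst_subproof c). Qed.

Lemma partial_cst (c : R) i x : partial i (fun _ : 'rV[R]_N => c) x = 0.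
Proof. by case: (C1_cst_subproof c) => _ ->. Qed.

Lemma C1M_subproof f g : C1 f -> C1 g -> C1 (fun x => f x * g x) /\
  forall i, partial i (fun x => f x * g x) = (fun x => f x * partial i g x + g x * partial i f x).
Proof.
move=> Cf Cg; apply: C1_intro => [x|i x|i x].
- by apply: continuousM; [exact: (C1_cont Cf)|exact: (C1_cont Cg)].
- exact: is_deriveM (C1_is_derive Cf i x) (C1_is_derive Cg i x).
- apply: (@continuousD _ _ _ (fun x => f x * partial i g x) (fun x => g x * partial i f x)).
    by apply: continuousM; [exact: (C1_cont Cf)|exact: (C1_partial_cont Cg)].
  by apply: continuousM; [exact: (C1_cont Cg)|exact: (C1_partial_cont Cf)].
Qed.

Lemma C1M f g : C1 f -> C1 g -> C1 (fun x => f x * g x).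
Proof. by move=> Cf Cg; case: (C1M_subproof Cf Cg). Qed.

Lemma partialM f g i x : C1 f -> C1 g ->
  partial i (fun x => f x * g x) x = f x * partial i g x + g x * partial i f x.
Proof. by move=> Cf Cg; case: (C1M_subproof Cf Cg) => _ ->. Qed.

Lemma C1D_subproof f g : C1 f -> C1 g -> C1 (fun x => f x + g x) /\
  forall i, partial i (fun x => f x + g x) = (fun x => partial i f x + partial i g x).
Proof.
move=> Cf Cg; apply: C1_intro => [x|i x|i x].
- by apply: continuousD; [exact: (C1_cont Cf)|exact: (C1_cont Cg)].
- exact: is_deriveD (C1_is_derive Cf i x) (C1_is_derive Cg i x).
- by apply: continuousD; [exact: (C1_partial_cont Cf)|exact: (C1_partial_cont Cg)].
Qed.

Lemma C1D f g : C1 f -> C1 g -> C1 (fun x => f x + g x).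
Proof. by move=> Cf Cg; case: (C1D_subproof Cf Cg). Qed.

Lemma partialD f g i x : C1 f -> C1 g ->
  partial i (fun x => f x + g x) x = partial i f x + partial i g x.
Proof. by move=> Cf Cg; case: (C1D_subproof Cf Cg) => _ ->. Qed.

Lemma C1_comp_subproof (G dG : R -> R) f : C1 f ->
  (forall s, is_derive s (1 : R) G (dG s)) -> continuous dG ->
  C1 (G \o f) /\ forall i, partial i (G \o f) = (fun x => dG (f x) * partial i f x).
Proof.
move=> Cf hG cG; apply: C1_intro => [x|i x|i x].
- apply: continuous_comp; first exact: C1_cont.
  by apply: differentiable_continuous; apply/derivable1_diffP; case: (hG (f x)).
- exact: is_derive_comp_line (hG (f x)) (C1_is_derive Cf i x).
- apply: continuousM; last exact: (C1_partial_cont Cf).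
  by apply: continuous_comp; [exact: (C1_cont Cf)|exact: cG].
Qed.

Lemma C1_comp (G dG : R -> R) f : C1 f ->
  (forall s, is_derive s (1 : R) G (dG s)) -> continuous dG -> C1 (fun x => G (f x)).
Proof. by move=> Cf hG cG; case: (C1_comp_subproof Cf hG cG). Qed.

Lemma partial_comp (G dG : R -> R) f i x : C1 f ->
  (forall s, is_derive s (1 : R) G (dG s)) -> continuous dG ->
  partial i (fun x => G (f x)) x = dG (f x) * partial i f x.
Proof. by move=> Cf hG cG; case: (C1_comp_subproof Cf hG cG) => _ /(_ i) /(congr1 (fun F => F x)). Qed.

Lemma C1_coord (j : 'I_N) : C1 (fun x => x ord0 j) /\
  forall i, partial i (fun x => x ord0 j) = (fun=> (i == j)%:R).
Proof.
apply: C1_intro => [|i x|i x]; [exact: coord_continuous| |exact: cst_continuous].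
apply/is_derive_lineP.
have -> : (fun h : R => (h *: evec R i + x) ord0 j) = (fun h => h * (i == j)%:R + x ord0 j).
  by apply/funext => h; rewrite !mxE eqxx/= eq_sym.
apply: is_derive_eq; rewrite scaler0 add0r addr0 /GRing.scale/= mulr1//.
Qed.

Lemma C1_sum_subproof (I : Type) (r : seq I) (F : I -> 'rV[R]_N -> R) : (forall k, C1 (F k)) ->
  C1 (fun x => \sum_(k <- r) F k x) /\
  forall i x, partial i (fun x => \sum_(k <- r) F k x) x = \sum_(k <- r) partial i (F k) x.
Proof.
move=> CF; elim: r => [|k r [IH1 IH2]].
  have -> : (fun x => \sum_(k <- [::]) F k x) = fun=> 0.
    by apply/funext => x; rewrite big_nil.
  by split; [exact: C1_cst|move=> i x; rewrite partial_cst big_nil].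
have -> : (fun x => \sum_(k <- k :: r) F k x) = (fun x => F k x + \sum_(k <- r) F k x).
  by apply/funext => x; rewrite big_cons.
by split; [exact: C1D|move=> i x; rewrite partialD// IH2 big_cons].
Qed.

Lemma C1_sum (I : Type) (r : seq I) (F : I -> 'rV[R]_N -> R) : (forall k, C1 (F k)) ->
  C1 (fun x => \sum_(k <- r) F k x).
Proof. by move=> /(C1_sum_subproof r)[]. Qed.

Lemma partial_sum (I : Type) (r : seq I) (F : I -> 'rV[R]_N -> R) i x : (forall k, C1 (F k)) ->
  partial i (fun x => \sum_(k <- r) F k x) x = \sum_(k <- r) partial i (F k) x.
Proof. by move=> /(C1_sum_subproof r)[]. Qed.

Lemma C1_mvt f i x t : C1 f -> exists2 c : R, `|c| <= `|t| &
  f (t *: evec R i + x) - f x = t * partial i f (c *: evec R i + x).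
Proof.
move=> Cf; pose phi h := f (h *: evec R i + x).
have d h : is_derive h (1 : R) phi (partial i f (h *: evec R i + x)).
  by apply: is_derive_line; exact: C1_is_derive.
have cphi (A : set R) : {within A, continuous phi}.
  apply: continuous_subspaceT => h; apply: differentiable_continuous.
  by apply/derivable1_diffP; case: (d h).
have E : f x = phi 0 by rewrite /phi scale0r add0r.
rewrite E -/(phi t); case: (leP 0 t) => t0.
  have [c] := MVT_segment t0 (fun h _ => d h) (cphi _).
  rewrite in_itv/= => /andP[c0 ct] ->; exists c; last by rewrite subr0 mulrC.
  by rewrite !ger0_norm.
have [c] := MVT_segment (ltW t0) (fun h _ => d h) (cphi _).
rewrite in_itv/= => /andP[ct c0] h; exists c; last first.
  by rewrite -opprB h sub0r mulrN opprK mulrC.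
by rewrite !ler0_norm ?(ltW t0)// lerN2.
Qed.

Lemma supp_out f x : ~ closure [set x | f x != 0] x -> \forall y \near x, f y = 0.
Proof.
move=> xs.
have oc : open (~` closure [set x | f x != 0]).
  by apply: closed_openC; exact: closed_closure.
have : nbhs x (~` closure [set x | f x != 0]) by exact: open_nbhs_nbhs.
apply: filterS => y ys; apply: contrapT => /eqP fy; apply: ys.
exact: subset_closure.
Qed.

Lemma supp_out0 f x : ~ closure [set x | f x != 0] x -> f x = 0.
Proof. by move=> /supp_out/nbhs_singleton. Qed.

Lemma supp_partial_out f i x : ~ closure [set x | f x != 0] x -> partial i f x = 0.
Proof.
move=> /supp_out xs; rewrite -(partial_cst 0 i x) /partial.
by apply: near_eq_derive.
Qed.

Lemma unif_cont f (K : set 'rV[R]_N) : continuous f -> compact K ->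
  (forall x, ~ K x -> f x = 0) ->
  forall e, 0 < e -> exists2 dl, 0 < dl & forall x y, `|x - y| < dl -> `|f x - f y| < e.
Proof.
move=> cf cK f0 e e0.
have h : \forall dl \near (0 : R)^'+, K `<=` (fun x => forall y, `|x - y| < dl -> `|f x - f y| < e).
  move/compact_near_coveringP : (cK); apply => x Kx.
  have /cvgrPdist_lt/(_ (e / 2))/(_ _)/nbhs_ballP[|eta /= eta0 he] := cf x.
    by rewrite divr_gt0.
  exists (ball x (eta / 2), [set dl | 0 < dl < eta / 2]) => /=.
    split; first by apply: nbhsx_ballx; rewrite divr_gt0.
    have : 0 < eta / 2 by rewrite divr_gt0.
    move=> h; near=> dl; rewrite /=; apply/andP; split; near: dl.
      exact: nbhs_right_gt.
    exact: nbhs_right_lt.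
  move=> [x' dl] /= [xx' /andP[dl0 dl1]] y xy.
  rewrite mx_norm_ball /ball_/= in xx'.
  have h1 : `|f x - f x'| < e / 2.
    apply: he; rewrite mx_norm_ball /ball_/=; apply: (lt_le_trans xx').
    by rewrite ler_pdivrMr// mulr_natr mulr2n lerDl ltW.
  have h2 : `|f x - f y| < e / 2.
    apply: he; rewrite mx_norm_ball /ball_/= -(subrKA x').
    apply: (le_lt_trans (ler_normD _ _)); rewrite [ltRHS]splitr.
    by apply: ltrD => //; exact: lt_trans dl1.
  rewrite -(subrKA (f x)); apply: (le_lt_trans (ler_normD _ _)).
  by rewrite [ltRHS]splitr; apply: ltrD => //; rewrite distrC.
have [dl dl0 hdl] : exists2 dl, 0 < dl & K `<=` (fun x => forall y, `|x - y| < dl -> `|f x - f y| < e).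
  near (0 : R)^'+ => dl; exists dl; first by near: dl; exact: nbhs_right_gt.
  by near: dl.
exists dl => // x y xy.
have [Kx|Kx] := pselect (K x); first exact: hdl.
have [Ky|Ky] := pselect (K y); first by rewrite distrC; apply: hdl => //; rewrite distrC.
by rewrite !f0// subrr normr0.
Unshelve. all: by end_near. Qed.

Lemma supp_bounded f (K : set 'rV[R]_N) : continuous f -> compact K ->
  (forall x, ~ K x -> f x = 0) -> exists2 M, 0 <= M & forall x, `|f x| <= M.
Proof.
move=> cf cK f0.
have : compact (f @` K) by apply: continuous_compact => //; exact: continuous_subspaceT.
move=> /compact_bounded[M [Mr hM]].
exists (`|M| + 1); first by rewrite addr_ge0.
move=> x; have [Kx|Kx] := pselect (K x); last by rewrite f0// normr0 addr_ge0.
by apply: (hM (`|M| + 1)); [rewrite (le_lt_trans (ler_norm _))// ltrDl|exists x].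
Qed.

(** By the mean value theorem the remainder is [t] times a variation of the partial derivative over
    a distance at most [|t|], which is small uniformly in [x] because the support is compact. *)
Lemma diff_quot_unif f i : C1 f -> compact (closure [set x | f x != 0]) ->
  forall e, 0 < e -> exists2 dl, 0 < dl & forall x t, `|t| < dl ->
   `|f (t *: evec R i + x) - f x - t * partial i f x| <= e * `|t|.
Proof.
move=> Cf cK e e0.
have [dl dl0 h] := unif_cont (@C1_partial_cont _ i Cf) cK (fun x => @supp_partial_out f i x) e0.
exists dl => // x t tdl.
have [c ct ->] := C1_mvt i x t Cf.
rewrite -mulrBr normrM mulrC ler_wpM2r// ltW// h// addrK.
rewrite mx_normZ; apply: (le_lt_trans _ tdl); apply: (le_trans _ ct).
rewrite ler_piMr//; apply: sup_norm_le => // j.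
by rewrite mxE eqxx/=; case: eqP => _; rewrite ?normr1 ?normr0.
Qed.

End C1.

(** * Truncations and steps of class C^1 in one variable *)

Section truncation.
Context (R : realType).
Implicit Types (k w s : R).

(** Settles the points where a definition changes branch: those of [posp ^ 2], and later the origin
    for [flat]. *)
Lemma is_derive_quadratic (f : R -> R) (s l C : R) :
  (forall h, `|f (s + h) - f s - h * l| <= C * h ^+ 2) -> is_derive s (1 : R) f l.
Proof.
move=> H.
have C0 : 0 <= C by have := H 1; rewrite expr1n mulr1; exact: le_trans.
have cv : h^-1 *: ((f \o shift s) (h *: (1 : R)) - f s) @[h --> 0^'] --> l.
  apply/cvgrPdist_lt => e e0.
  have d0 : 0 < e / (C + 1) by rewrite divr_gt0// ltr_pwDr.
  near=> h.
  have h0 : h != 0 by near: h; exact: nbhs_dnbhs_neq.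
  have hd : `|h| < e / (C + 1) by near: h; exact: dnbhs0_lt.
  have hp : 0 < `|h| by rewrite normr_gt0.
  rewrite /= /GRing.scale/= mulr1 (addrC h s).
  have -> : l - h^-1 * (f (s + h) - f s) = - (h^-1 * (f (s + h) - f s - h * l)) by field.
  rewrite normrN normrM normfV -(ltr_pM2l hp) mulVKf ?gt_eqF//.
  apply: (le_lt_trans (H h)); idtac.
  have -> : h ^+ 2 = `|h| * `|h| by rewrite -normrM -expr2 ger0_norm ?sqr_ge0.
  rewrite mulrCA ltr_pM2l//; move: hd; rewrite ltr_pdivlMr ?ltr_pwDr//.
  by apply: le_lt_trans; rewrite mulrC ler_wpM2l// lerDl.
split; first by apply/cvg_ex; exists l.
by apply: cvg_lim.
Unshelve. all: by end_near. Qed.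

Lemma lip_continuous (f : R -> R) (C : R) :
  (forall s s', `|f s - f s'| <= C * `|s - s'|) -> continuous f.
Proof.
move=> H s; apply/cvgrPdist_lt => e e0.
have C0 : 0 <= C by have := H 1 0; rewrite subr0 normr1 mulr1; exact: le_trans.
have C1 : 0 < C + 1 by rewrite ltr_pwDr.
apply/nbhs_ballP; exists (e / (C + 1)) => /=; first by rewrite divr_gt0.
move=> t; rewrite /ball/= ltr_pdivlMr// => st; apply: (le_lt_trans (H _ _)).
by apply: le_lt_trans st; rewrite mulrC ler_wpM2l// lerDl.
Qed.

Definition posp s := Num.max s 0.

Lemma posp_ge0 s : 0 <= posp s. Proof. by rewrite le_max lexx orbT. Qed.
Lemma posp_ge s : s <= posp s. Proof. by rewrite le_max lexx. Qed.
Lemma posp_pos s : 0 <= s -> posp s = s. Proof. by move=> h; apply/max_idPl. Qed.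
Lemma posp_neg s : s <= 0 -> posp s = 0. Proof. by move=> h; apply/max_idPr. Qed.

Lemma posp_case s : (0 <= s /\ posp s = s) \/ (s <= 0 /\ posp s = 0).
Proof.
case: (leP 0 s) => h; first by left; rewrite posp_pos.
by right; rewrite posp_neg ?ltW.
Qed.

Lemma posp_lip s s' : `|posp s - posp s'| <= `|s - s'|.
Proof.
case: (posp_case s) => -[h ->]; case: (posp_case s') => -[h' ->] //.
- by rewrite subr0 ger0_norm// (le_trans _ (ler_norm _))//; lra.
- by rewrite sub0r normrN ger0_norm// distrC (le_trans _ (ler_norm _))//; lra.
- by rewrite subrr normr0.
Qed.

Lemma is_derive_posp2 s : is_derive s (1 : R) (fun s => posp s ^+ 2) (2 * posp s).
Proof.
apply: (@is_derive_quadratic _ _ _ 1) => h; rewrite mul1r ler_norml.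
case: (posp_case (s + h)) => -[h1 ->]; case: (posp_case s) => -[h2 ->]; apply/andP; split; nra.
Qed.

(* [C^1]; zero below [k], equal to [(s - k)^2] up to [k + w], affine above. *)
Definition trc k w s := posp (s - k) ^+ 2 - posp (s - k - w) ^+ 2.
Definition dtrc k w s := 2 * (posp (s - k) - posp (s - k - w)).

Lemma is_derive_trc k w s : is_derive s (1 : R) (trc k w) (dtrc k w s).
Proof.
rewrite /dtrc mulrBr; apply: is_deriveB.
  have -> : (fun s => posp (s - k) ^+ 2) = (fun s => posp s ^+ 2) \o (fun s => s - k) by [].
  rewrite -[X in is_derive _ _ _ X]mulr1; apply: is_derive1_comp; first exact: is_derive_posp2.
  by have := is_deriveB (is_derive_id s (1 : R)) (is_derive_cst k s (1 : R)); rewrite subr0.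
have -> : (fun s => posp (s - k - w) ^+ 2) = (fun s => posp s ^+ 2) \o (fun s => s - k - w) by [].
rewrite -[X in is_derive _ _ _ X]mulr1; apply: is_derive1_comp; first exact: is_derive_posp2.
have := is_deriveB (is_derive_id s (1 : R)) (is_derive_cst (k + w) s (1 : R)); rewrite subr0.
have -> : id - cst (k + w) = (fun s0 : R => s0 - k - w).
  by apply/funext => z; rewrite /= opprD addrA.
by [].
Qed.

Lemma posp_continuous : continuous posp.
Proof. by apply: (@lip_continuous _ 1) => s s'; rewrite mul1r posp_lip. Qed.

Lemma dtrc_lip k w s s' : `|dtrc k w s - dtrc k w s'| <= 4 * `|s - s'|.
Proof.
have h1 := posp_lip (s - k) (s' - k); have h2 := posp_lip (s - k - w) (s' - k - w).
have e1 : s - k - (s' - k) = s - s' by ring.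
have e2 : s - k - w - (s' - k - w) = s - s' by ring.
rewrite e1 in h1; rewrite e2 in h2.
rewrite /dtrc -mulrBr normrM (ger0_norm (ler0n _ _)).
have -> : posp (s - k) - posp (s - k - w) - (posp (s' - k) - posp (s' - k - w)) =
  (posp (s - k) - posp (s' - k)) - (posp (s - k - w) - posp (s' - k - w)) by ring.
have := ler_normB (posp (s - k) - posp (s' - k)) (posp (s - k - w) - posp (s' - k - w)).
lra.
Qed.

Lemma dtrc_continuous k w : continuous (dtrc k w).
Proof. exact: (lip_continuous (dtrc_lip k w)). Qed.

Lemma dtrc_ge0 k w s : 0 <= w -> 0 <= dtrc k w s.
Proof.
rewrite /dtrc => w0.
case: (posp_case (s - k)) => -[h1 ->]; case: (posp_case (s - k - w)) => -[h2 ->]; nra.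
Qed.

Lemma dtrc_le k w s : 0 <= w -> dtrc k w s <= 2 * w.
Proof.
rewrite /dtrc => w0.
case: (posp_case (s - k)) => -[h1 ->]; case: (posp_case (s - k - w)) => -[h2 ->]; nra.
Qed.

Lemma dtrc_norm k w s : 0 <= w -> `|dtrc k w s| <= 2 * w.
Proof. by move=> w0; rewrite ger0_norm ?dtrc_ge0 ?dtrc_le. Qed.

Lemma trc_lip k w s s' : 0 <= w -> `|trc k w s - trc k w s'| <= 2 * w * `|s - s'|.
Proof.
wlog ss : s s' / s' <= s.
  move=> H w0; case: (leP s' s) => [h|/ltW h]; first exact: H.
  by rewrite distrC (distrC s); exact: H.
move=> w0; rewrite (ger0_norm (_ : 0 <= s - s')) ?subr_ge0// ler_norml /trc.
case: (posp_case (s - k)) => -[h1 ->]; case: (posp_case (s - k - w)) => -[h2 ->];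
case: (posp_case (s' - k)) => -[h3 ->]; case: (posp_case (s' - k - w)) => -[h4 ->];
apply/andP; split; nra.
Qed.

Lemma trc_below k w s : 0 <= w -> s <= k -> trc k w s = 0.
Proof. by move=> w0 sk; rewrite /trc !posp_neg ?expr0n ?subrr//; lra. Qed.

Lemma dtrc_below k w s : 0 <= w -> s <= k -> dtrc k w s = 0.
Proof. by move=> w0 sk; rewrite /dtrc !posp_neg ?subrr ?mulr0//; lra. Qed.

Lemma trc_mid k w s : k <= s <= k + w -> trc k w s = (s - k) ^+ 2.
Proof. by move=> h; rewrite /trc posp_pos ?posp_neg ?expr0n ?subr0//; lra. Qed.

Lemma dtrc_mid k w s : k <= s <= k + w -> dtrc k w s = 2 * (s - k).
Proof. by move=> h; rewrite /dtrc posp_pos ?posp_neg ?subr0//; lra. Qed.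

Lemma trc_above k w s : 0 <= w -> k + w <= s -> trc k w s = 2 * w * (s - k) - w ^+ 2.
Proof. by move=> w0 h; rewrite /trc !posp_pos ?subr0//; [ring|lra|lra]. Qed.

Lemma dtrc_above k w s : 0 <= w -> k + w <= s -> dtrc k w s = 2 * w.
Proof. by move=> w0 h; rewrite /dtrc !posp_pos ?subr0//; [ring|lra|lra]. Qed.

(* A [C^1] step from [0] (below [k]) to [1] (above [k + 2w]). *)
Definition stp k w s := (2 * w ^+ 2)^-1 * (trc k w s - trc (k + w) w s).
Definition dstp k w s := (2 * w ^+ 2)^-1 * (dtrc k w s - dtrc (k + w) w s).

Lemma is_derive_stp k w s : is_derive s (1 : R) (stp k w) (dstp k w s).
Proof.
have -> : stp k w = (2 * w ^+ 2)^-1 \*: (trc k w - trc (k + w) w) by [].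
by apply: is_deriveZ; apply: is_deriveB; exact: is_derive_trc.
Qed.

Lemma dstp_continuous k w : continuous (dstp k w).
Proof.
move=> s; apply: (@continuousM _ _ (fun=> (2 * w ^+ 2)^-1) (dtrc k w - dtrc (k + w) w)).
  exact: cst_continuous.
by apply: continuousB; exact: dtrc_continuous.
Qed.

Lemma stp_below k w s : 0 <= w -> s <= k -> stp k w s = 0.
Proof. by move=> w0 sk; rewrite /stp !trc_below ?subrr ?mulr0//; lra. Qed.

Lemma stp_above k w s : 0 < w -> k + 2 * w <= s -> stp k w s = 1.
Proof.
move=> w0 h; rewrite /stp !trc_above ?(ltW w0)//; [|lra|lra].
by field; rewrite gt_eqF.
Qed.

(** The derivative is a tent on [[k, k + 2 w]] of height [w^-1], hence of area [1]. *)
Lemma dstp_bound k w s : 0 < w -> 0 <= dstp k w s <= w^-1.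
Proof.
move=> w0; rewrite /dstp /dtrc.
have -> : s - (k + w) = s - k - w by ring.
have -> : w^-1 = (2 * w ^+ 2)^-1 * (2 * w) by field; rewrite gt_eqF.
have p0 : 0 < (2 * w ^+ 2)^-1 by rewrite invr_gt0 mulr_gt0// exprn_gt0.
rewrite ler_pM2l// pmulr_rge0//.
case: (posp_case (s - k)) => -[h1 ->]; case: (posp_case (s - k - w)) => -[h2 ->];
case: (posp_case (s - k - w - w)) => -[h3 ->]; apply/andP; split; lra.
Qed.

Lemma stp_bound k w s : 0 < w -> 0 <= stp k w s <= 1.
Proof.
move=> w0; rewrite /stp /trc.
have -> : s - (k + w) = s - k - w by ring.
have E1 : (1 : R) = (2 * w ^+ 2)^-1 * (2 * w ^+ 2) by field; rewrite gt_eqF.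
have p0 : 0 < (2 * w ^+ 2)^-1 by rewrite invr_gt0 mulr_gt0// exprn_gt0.
rewrite pmulr_rge0// [X in _ && (_ <= X)]E1 ler_pM2l//.
case: (posp_case (s - k)) => -[h1 ->]; case: (posp_case (s - k - w)) => -[h2 ->];
case: (posp_case (s - k - w - w)) => -[h3 ->]; apply/andP; split; nra.
Qed.

End truncation.

(** * Cutoff functions on cubes *)

Section cutoff.
Context (R : realType) (N : nat).
Implicit Types (f : 'rV[R]_N -> R) (x : 'rV[R]_N) (i : 'I_N).

Lemma C1_prod_bound (I : Type) (r : seq I) (F : I -> 'rV[R]_N -> R) :
  (forall k, C1 (F k)) -> (forall k x, 0 <= F k x <= 1) ->
  [/\ C1 (fun x => \prod_(k <- r) F k x),
      forall x, 0 <= \prod_(k <- r) F k x <= 1 &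
      forall i x, `|partial i (fun x => \prod_(k <- r) F k x) x| <=
        \sum_(k <- r) `|partial i (F k) x|].
Proof.
move=> CF F01; elim: r => [|k r [IH1 IH2 IH3]].
  have -> : (fun x => \prod_(k <- [::]) F k x) = fun=> 1.
    by apply/funext => x; rewrite big_nil.
  split=> [|x|i x]; [exact: C1_cst|by rewrite big_nil lexx ler01|].
  by rewrite partial_cst normr0 big_nil.
have -> : (fun x => \prod_(k <- k :: r) F k x) = (fun x => F k x * \prod_(k <- r) F k x).
  by apply/funext => x; rewrite big_cons.
have h x : 0 <= F k x * \prod_(k <- r) F k x <= 1.
  have /andP[a1 a2] := F01 k x; have /andP[b1 b2] := IH2 x.
  by rewrite mulr_ge0//= mulr_ile1.
split=> [|x|i x]; [exact: C1M|by rewrite big_cons h|].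
rewrite partialM// big_cons addrC; apply: (le_trans (ler_normD _ _)).
have /andP[a1 a2] := F01 k x; have /andP[b1 b2] := IH2 x.
rewrite !normrM; apply: lerD.
  by rewrite ler_piMl// ger0_norm.
by apply: le_trans (IH3 i x); rewrite ler_piMl// ger0_norm.
Qed.

(** A plateau in one variable: for [r >= 0] it is [1] on [[-r, r]] and [0] beyond [r + 2 w] in
    absolute value. *)
Definition bump (r w s : R) := (1 - stp r w s) * (1 - stp r w (- s)).
Definition dbump (r w s : R) :=
  (1 - stp r w s) * dstp r w (- s) - (1 - stp r w (- s)) * dstp r w s.

Lemma is_derive_bump (r w s : R) : is_derive s (1 : R) (bump r w) (dbump r w s).
Proof.
have h1 : is_derive s (1 : R) (fun s => 1 - stp r w s) (0 - dstp r w s).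
  exact: (is_deriveB (is_derive_cst _ _ _) (is_derive_stp r w s)).
have h2 : is_derive s (1 : R) (fun s => 1 - stp r w (- s)) (0 - dstp r w (- s) * (-1)).
  have hN : is_derive s (1 : R) -%R (-1 : R) := is_deriveN (is_derive_id s (1 : R)).
  exact: (is_deriveB (is_derive_cst _ _ _)
    (is_derive1_comp (f := stp r w) (g := -%R) (is_derive_stp r w (- s)) hN)).
have := is_deriveM h1 h2.
have -> : (1 - stp r w s) *: (0 - dstp r w (- s) * -1) + (1 - stp r w (- s)) *: (0 - dstp r w s) =
  dbump r w s by rewrite /dbump /GRing.scale/=; ring.
by [].
Qed.

Lemma dbump_continuous (r w : R) : continuous (dbump r w).
Proof.
have cs : continuous (stp r w).
  by move=> s; apply: differentiable_continuous; apply/derivable1_diffP; case: (is_derive_stp r w s).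
have cN (g : R -> R) : continuous g -> continuous (fun s => g (- s)).
  by move=> cg s; apply: continuous_comp; [exact: opp_continuous|exact: cg].
have c1 (g : R -> R) : continuous g -> continuous (fun s => 1 - g s).
  by move=> cg s; apply: continuousB; [exact: cst_continuous|exact: cg].
move=> s; apply: (@continuousB _ _ _ (fun s => (1 - stp r w s) * dstp r w (- s))
  (fun s => (1 - stp r w (- s)) * dstp r w s)).
  by apply: continuousM; [exact: c1|exact: cN (@dstp_continuous _ _ _) _].
by apply: continuousM; [exact: c1 (cN _ cs) _|exact: dstp_continuous].
Qed.

Lemma dbump_bound (r w s : R) : 0 < w -> `|dbump r w s| <= 2 / w.
Proof.
move=> w0; have /andP[a1 a2] := dstp_bound r s w0; have /andP[b1 b2] := dstp_bound r (- s) w0.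
have /andP[c1 c2] := stp_bound r s w0; have /andP[d1 d2] := stp_bound r (- s) w0.
rewrite /dbump; apply: (le_trans (ler_normB _ _)).
have -> : 2 / w = 1 * w^-1 + 1 * w^-1 by ring.
have n1 : `|1 - stp r w s| <= 1 by rewrite ger0_norm; lra.
have n2 : `|1 - stp r w (- s)| <= 1 by rewrite ger0_norm; lra.
have n3 : `|dstp r w s| <= w^-1 by rewrite ger0_norm.
have n4 : `|dstp r w (- s)| <= w^-1 by rewrite ger0_norm.
rewrite !mul1r (normrM (1 - stp r w s)) (normrM (1 - stp r w (- s))); apply: lerD.
  exact: le_trans (ler_piMl (normr_ge0 _) n1) n4.
exact: le_trans (ler_piMl (normr_ge0 _) n2) n3.
Qed.

(** A product of plateaus over the coordinates, adapted to the sup norm. Only the [i]-th factor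
    depends on the [i]-th coordinate, so the slope is the one-dimensional [2 / w], where
    [2 w = rho - r] is the length of the descent. *)
Lemma cutoff_exists (x0 : 'rV[R]_N) (r rho : R) : 0 <= r < rho ->
  exists zeta : 'rV[R]_N -> R,
  [/\ C1 zeta, forall x, 0 <= zeta x <= 1, forall x, `|x - x0| <= r -> zeta x = 1,
      forall x, zeta x != 0 -> `|x - x0| < rho &
      forall i x, `|partial i zeta x| <= 4 / (rho - r)].
Proof.
move=> /andP[r0 rr]; set w := (rho - r) / 2.
have w0 : 0 < w by rewrite divr_gt0// subr_gt0.
have rho0 : 0 < rho by exact: le_lt_trans rr.
have b01 s : 0 <= bump r w s <= 1.
  have /andP[c1 c2] := stp_bound r s w0; have /andP[d1 d2] := stp_bound r (- s) w0.
  by rewrite /bump mulr_ge0 ?mulr_ile1//; lra.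
pose F j x := bump r w (x ord0 j - x0 ord0 j).
have Cc j : C1 (fun x => x ord0 j - x0 ord0 j).
  apply: C1D; [by case: (C1_coord R j)|exact: C1_cst].
have CF j : C1 (F j).
  by apply: C1_comp (Cc j) (@is_derive_bump r w) (@dbump_continuous r w).
have F01 k x : 0 <= F k x <= 1 by exact: b01.
have [h1 h2 h3] := C1_prod_bound (index_enum 'I_N) CF F01.
exists (fun x => \prod_j F j x); split => //.
- move=> x xr; apply: big1 => j _; rewrite /F /bump.
  have xj : `|x ord0 j - x0 ord0 j| <= r.
    by apply: le_trans xr; have := sup_norm_coord (x - x0) j; rewrite !mxE.
  move: xj; rewrite ler_norml => /andP[x1 x2].
  by rewrite !stp_below ?subr0 ?mulr1 ?(ltW w0)//; lra.
- move=> x /prodf_neq0 hx; apply: sup_norm_lt => // j.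
  rewrite !mxE ltNge; apply/negP => hj.
  have := hx j isT; rewrite /F /bump; apply/negP; rewrite negbK.
  have : rho <= x ord0 j - x0 ord0 j \/ rho <= - (x ord0 j - x0 ord0 j).
    by move: hj; rewrite ler_normr => /orP.
  have E2 : r + 2 * w = rho by rewrite /w; field.
  move=> [|] hh; first by rewrite (@stp_above _ r w _ w0 _) ?E2// subrr mul0r.
  by rewrite (@stp_above _ r w (- _) w0 _) ?E2// subrr mulr0.
- move=> i x; apply: (le_trans (h3 i x)); rewrite (bigD1 i)//= big1 ?addr0.
    rewrite (partial_comp i x (Cc i) (@is_derive_bump r w) (@dbump_continuous r w)).
    rewrite partialD; [|by case: (C1_coord R i)|exact: C1_cst].
    case: (C1_coord R i) => _ ->; rewrite eqxx partial_cst addr0 mulr1.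
    apply: (le_trans (dbump_bound _ _ w0)); rewrite /w.
    rewrite invf_div mulrA; lra.
  move=> j ji.
  rewrite (partial_comp i x (Cc j) (@is_derive_bump r w) (@dbump_continuous r w)).
  rewrite partialD; [|by case: (C1_coord R j)|exact: C1_cst].
  case: (C1_coord R j) => _ ->; rewrite eq_sym (negPf ji) partial_cst addr0 mulr0 normr0//.
Qed.

Lemma compact_supp_ball f (x0 : 'rV[R]_N) (r : R) :
  (forall x, f x != 0 -> `|x - x0| <= r) -> compact (closure [set x | f x != 0]).
Proof.
move=> h.
apply: (@subclosed_compact _ _ (closed_ball_ Num.norm x0 r)).
- exact: closed_closure.
- apply: bounded_closed_compact; last exact: closed_closed_ball_.
  exists (`|x0| + r); split; first by rewrite num_real.
  move=> M hM x /=; rewrite /closed_ball_/= => xr; apply: ltW; apply: le_lt_trans hM.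
  have -> : x = x0 - (x0 - x) by rewrite opprB addrCA subrr addr0.
  by apply: (le_trans (ler_normB _ _)); rewrite lerD2l.
- rewrite [X in _ `<=` X](closure_id _).1; last exact: closed_closed_ball_.
  by apply: closure_subset => x /= /h; rewrite /closed_ball_/= distrC.
Qed.

End cutoff.

(** * Poincare inequality on cubes *)

Section hbox.
Context (R : realType) (N : nat).
Notation T := (leb_space R N).
Notation mu := (lebesgue_rV R N).
Implicit Types (a l x : 'rV[R]_N) (i : 'I_N).

(** Half-open, so that bisections and grids are exact partitions. *)
Definition hbox a l : set 'rV[R]_N :=
  [set x | forall i, a ord0 i <= x ord0 i < a ord0 i + l ord0 i].

Lemma measurable_hbox a l : measurable (hbox a l : set T).
Proof.
have -> : hbox a l = \bigcap_(i in [set: 'I_N]) ((fun x : T => (x : 'rV[R]_N) ord0 i) @^-1`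
    `[a ord0 i, a ord0 i + l ord0 i[).
  apply/seteqP; split => x h; first by move=> i _ /=; rewrite in_itv/= h.
  by move=> i; have := h i I; rewrite /= in_itv.
apply: fin_bigcap_measurable => // i _.
by rewrite -[X in measurable X]setTI; apply: leb_coord.
Qed.

Lemma measurable_box a b : measurable (box a b : set T).
Proof.
have -> : box a b = \bigcap_(i in [set: 'I_N]) ((fun x : T => (x : 'rV[R]_N) ord0 i) @^-1`
    `[a ord0 i, b ord0 i]).
  apply/seteqP; split => x h; first by move=> i _ /=; rewrite in_itv/= h.
  by move=> i; have := h i I; rewrite /= in_itv.
apply: fin_bigcap_measurable => // i _.
by rewrite -[X in measurable X]setTI; apply: leb_coord.
Qed.

Lemma leb_le (A B : set T) : A `<=` B -> (mu A <= mu B)%E.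
Proof. by move=> AB; rewrite !lebE; apply: le_outer_measure. Qed.

Lemma leb_hbox a l : (forall i, 0 <= l ord0 i) ->
  mu (hbox a l) = (\prod_i l ord0 i)%:E.
Proof.
move=> l0; apply/eqP; rewrite eq_le; apply/andP; split.
  have -> : (\prod_i l ord0 i)%:E = mu (box a (a + l)).
    rewrite lebE lebesgue_outer_box; last by move=> i; rewrite mxE lerDl.
    by congr EFin; apply: eq_bigr => i _; rewrite mxE addrAC subrr add0r.
  by apply: leb_le => x h i; have /andP[-> /ltW] := h i; rewrite mxE.
have [/existsP[i /eqP li]|/existsPn lp] := boolP [exists i, l ord0 i == 0].
  by rewrite (bigD1 i)//= li mul0r; exact: (measure_ge0 mu).
have lpos i : 0 < l ord0 i by rewrite lt_neqAle eq_sym lp l0.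
apply/lee_addgt0Pr => e e0; set P := \prod_i l ord0 i.
have P0 : 0 < P by apply: prodr_gt0.
pose c := Num.min 2^-1 (e / (P * (N%:R + 1))).
have N1 : 0 < N%:R + 1 :> R by rewrite ltr_wpDl.
have c0 : 0 < c by rewrite lt_min invr_gt0 ltr0n/= divr_gt0// mulr_gt0.
have c1 : c <= 2^-1 by rewrite ge_min lexx.
have cP : c * P * N%:R <= e.
  have : c <= e / (P * (N%:R + 1)) by rewrite ge_min lexx orbT.
  rewrite ler_pdivlMr ?mulr_gt0// mulrA => h; apply: le_trans h.
  by rewrite ler_wpM2l ?lerDl// mulr_ge0 ?ltW.
have : (mu (box a (a + (1 - c) *: l)) <= mu (hbox a l))%E.
  apply: leb_le => x h i; have := h i; rewrite !mxE => /andP[-> h2] /=.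
  apply: (le_lt_trans h2); rewrite ltrD2l gtr_pMl//; lra.
rewrite [mu (box _ _)]lebE lebesgue_outer_box; last first.
  by move=> i; rewrite !mxE lerDl mulr_ge0//; lra.
have -> : vol a (a + (1 - c) *: l) = (1 - c) ^+ N * P.
  rewrite /vol -[in (1 - c) ^+ _](card_ord N) -prodr_const -big_split/=.
  by apply: eq_bigr => i _; rewrite !mxE addrAC subrr add0r.
move=> h; apply: (@le_trans _ _ (((1 - c) ^+ N * P)%:E + e%:E)%E); last exact: leeD2r.
rewrite -EFinD lee_fin.
have bern n : 1 - c * n%:R <= (1 - c) ^+ n.
  elim: n => [|n IH]; first by rewrite mulr0 subr0 expr0.
  rewrite exprS; have : (1 - c) * (1 - c * n%:R) <= (1 - c) * (1 - c) ^+ n.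
    by rewrite ler_wpM2l//; lra.
  apply: le_trans; rewrite -natr1.
  have : 0 <= n%:R :> R by []. nra.
have : (1 - c * N%:R) * P <= (1 - c) ^+ N * P by rewrite ler_wpM2r// ltW.
have -> : (1 - c * N%:R) * P = P - c * P * N%:R by ring.
lra.
Qed.

Lemma leb_hbox_fin a l : (mu (hbox a l) < +oo)%E.
Proof.
apply: (@le_lt_trans _ _ (mu (hbox a (map_mx (fun s => `|s|) l)))).
  apply: leb_le => x h i; have /andP[-> h2] := h i; rewrite mxE.
  by apply: (lt_le_trans h2); rewrite lerD2l ler_norm.
by rewrite leb_hbox ?ltry// => i; rewrite mxE.
Qed.

Lemma leb_bounded_fin (A : set T) (M : R) :
  (forall x : 'rV[R]_N, (A : set 'rV[R]_N) x -> `|x| <= M) -> (mu A < +oo)%E.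
Proof.
move=> AM.
apply: (@le_lt_trans _ _ (mu (hbox (const_mx (- `|M|)) (const_mx (2 * `|M| + 1))))).
  apply: leb_le => x /AM xM i; rewrite !mxE.
  have := le_trans (sup_norm_coord x i) xM; rewrite ler_norml => /andP[h1 h2].
  have := ler_norm M; have := ler_norm (- M); rewrite normrN.
  by move=> h3 h4; apply/andP; split; lra.
exact: leb_hbox_fin.
Qed.

Lemma trset_hbox (t a l : 'rV[R]_N) : trset t (hbox a l) = hbox (t + a) l.
Proof.
apply/seteqP; split => x h i; have := h i; rewrite !mxE => /andP[h1 h2]; apply/andP; split; lra.
Qed.

(** [r] is half the side: up to boundary points this is the sup-norm ball of radius [r]. *)
Definition cube (x : 'rV[R]_N) (r : R) : set 'rV[R]_N :=
  hbox (x - const_mx r) (const_mx (2 * r)).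

Lemma cubeP (x : 'rV[R]_N) (r : R) y :
  cube x r y <-> forall i, x ord0 i - r <= y ord0 i < x ord0 i + r.
Proof.
split=> h i; have := h i; rewrite !mxE => /andP[h1 h2]; apply/andP; split; lra.
Qed.

Lemma cube_le (x : 'rV[R]_N) (r : R) y : 0 <= r -> cube x r y -> `|y - x| <= r.
Proof.
move=> r0 /cubeP h; apply: sup_norm_le => // i; rewrite !mxE.
by have /andP[h1 h2] := h i; rewrite ler_norml; apply/andP; split; lra.
Qed.

Lemma cube_lt (x : 'rV[R]_N) (r : R) y : `|y - x| < r -> cube x r y.
Proof.
move=> h; apply/cubeP => i.
have := le_lt_trans (sup_norm_coord (y - x) i) h; rewrite !mxE ltr_norml => /andP[h1 h2].
by apply/andP; split; lra.
Qed.

Lemma leb_cube x r : 0 <= r -> mu (cube x r) = ((2 * r) ^+ N)%:E.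
Proof.
move=> r0; rewrite leb_hbox; last by move=> i; rewrite mxE mulr_ge0.
congr EFin; transitivity (\prod_(i < N) (2 * r)).
  by apply: eq_bigr => i _; rewrite mxE.
by rewrite prodr_const card_ord.
Qed.

Lemma measurable_cube x r : measurable (cube x r : set T).
Proof. exact: measurable_hbox. Qed.

Lemma leb_cube_fin x r : (mu (cube x r) < +oo)%E.
Proof. exact: leb_hbox_fin. Qed.

Lemma leb_ball_pos x r : 0 < r -> (0 < mu (ball x r : set 'rV[R]_N))%E.
Proof.
move=> r0; apply: (@lt_le_trans _ _ (mu (cube x (r / 2)))).
  by rewrite leb_cube ?divr_ge0 ?ltW// lte_fin exprn_gt0// mulr_gt0// divr_gt0.
apply: leb_le => y /cube_le h; rewrite mx_norm_ball /ball_/= distrC.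
by apply: (le_lt_trans (h _)); rewrite ?divr_ge0 ?ltW// ltr_pdivrMr// ltr_pMr// ltr1n.
Qed.

End hbox.

(** * Translations, difference quotients and the Poincare inequality *)

Section translation_estimates.
Context (R : realType) (N : nat).
Notation T := (leb_space R N).
Notation mu := (lebesgue_rV R N).
Implicit Types (f g : 'rV[R]_N -> R) (x v : 'rV[R]_N) (i : 'I_N).

Lemma integrable_bounded_cont (D : set T) (g : 'rV[R]_N -> R) (M : R) :
  measurable D -> (mu D < +oo)%E -> continuous g -> (forall x, `|g x| <= M) ->
  mu.-integrable D (EFin \o g).
Proof.
move=> mD fD cg gM; apply: measurable_bounded_integrable => //.
  exact: leb_continuous.
exists M; split; first exact: num_real.
by move=> K MK x _ /=; apply: le_trans (gM x) (ltW MK).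
Qed.

Lemma ge0_Rintegral_shift v (A : set T) (g : 'rV[R]_N -> R) :
  measurable A -> continuous g -> (forall x, 0 <= g x) ->
  \int[mu]_(x in A) g (x + v) = \int[mu]_(x in (trset v (A : set 'rV[R]_N) : set T)) g x.
Proof.
move=> mA cg g0; rewrite /Rintegral; congr fine; apply/esym.
rewrite (ge0_integral_shift v); last 3 first.
- exact: measurable_shift.
- by apply/measurable_EFinP; apply: leb_continuous => //; exact: measurable_shift.
- by move=> x _; rewrite lee_fin.
by congr (integral _ _ _); rewrite trsetKV.
Qed.

(** Adding the bound [M] makes the integrand nonnegative. *)
Lemma Rintegral_shift v (A : set T) (g : 'rV[R]_N -> R) (M : R) :
  measurable A -> (mu A < +oo)%E -> continuous g -> (forall x, `|g x| <= M) ->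
  \int[mu]_(x in A) g (x + v) = \int[mu]_(x in (trset v (A : set 'rV[R]_N) : set T)) g x.
Proof.
move=> mA fA cg gM.
have mB : measurable (trset v (A : set 'rV[R]_N) : set T) by exact: measurable_shift.
have eB : mu (trset v (A : set 'rV[R]_N) : set T) = mu A.
  by rewrite !lebE lebesgue_outer_shift.
have cgv : continuous (fun x : 'rV[R]_N => g (x + v)).
  move=> x; apply: continuous_comp; last exact: cg.
  by apply: (@continuousD _ _ _ id (fun=> v)); [exact: cvg_id|exact: cst_continuous].
have cM h : continuous h -> continuous (fun x : 'rV[R]_N => h x + M).
  by move=> ch x; apply: (@continuousD _ _ _ h (fun=> M)); [exact: ch|exact: cst_continuous].
have := @ge0_Rintegral_shift v A (fun x => g x + M) mA (cM _ cg).
have -> : (forall x, 0 <= g x + M) = True.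
  by apply/propext; split => // _ x; have := gM x; rewrite ler_norml => /andP[]; lra.
move=> /(_ I).
have ic (D : set T) (h : 'rV[R]_N -> R) : measurable D -> (mu D < +oo)%E -> continuous h ->
   (forall x, `|h x| <= M) -> \int[mu]_(x in D) (h x + M) = \int[mu]_(x in D) h x + M * fine (mu D).
  move=> mD fD ch hM; rewrite RintegralD//.
  - by rewrite Rintegral_cst.
  - exact: (integrable_bounded_cont mD fD ch hM).
  - apply: (integrable_bounded_cont (M := `|M|) mD fD) => //; exact: cst_continuous.
rewrite ic//; rewrite ic ?eB//.
by move=> /addIr.
Qed.

End translation_estimates.

Section integrable_real.
Context d (T : measurableType d) (R : realType) (mu : {measure set T -> \bar R}).
Context (D : set T) (mD : measurable D).
Implicit Types f g : T -> R.

Lemma integD f g : mu.-integrable D (EFin \o f) -> mu.-integrable D (EFin \o g) ->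
  mu.-integrable D (EFin \o (fun x => f x + g x)).
Proof. by move=> hf hg; have := integrableD mD hf hg; apply: eq_integrable. Qed.

Lemma integN f : mu.-integrable D (EFin \o f) -> mu.-integrable D (EFin \o (fun x => - f x)).
Proof. by move=> hf; have := integrableN hf; apply: eq_integrable. Qed.

Lemma integB f g : mu.-integrable D (EFin \o f) -> mu.-integrable D (EFin \o g) ->
  mu.-integrable D (EFin \o (fun x => f x - g x)).
Proof. by move=> hf hg; apply: integD => //; exact: integN. Qed.

Lemma integZ (k : R) f : mu.-integrable D (EFin \o f) ->
  mu.-integrable D (EFin \o (fun x => k * f x)).
Proof. by move=> hf; have := integrableZl mD k hf; apply: eq_integrable. Qed.

Lemma integ_norm f : mu.-integrable D (EFin \o f) ->
  mu.-integrable D (EFin \o (fun x => `|f x|)).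
Proof. exact: integrable_norm. Qed.

End integrable_real.

Section cb.
Context (R : realType) (N : nat).
Notation T := (leb_space R N).
Notation mu := (lebesgue_rV R N).
Implicit Types (f g : 'rV[R]_N -> R) (x v a l : 'rV[R]_N) (i : 'I_N).

(** A class closed under all the operations below and integrable on sets of finite measure, by which
    integrability conditions are discharged. *)
Definition cb g := continuous g /\ exists M, forall x, `|g x| <= M.

Lemma cb_int (D : set T) g : measurable D -> (mu D < +oo)%E -> cb g ->
  mu.-integrable D (EFin \o g).
Proof. by move=> mD fD [cg [M gM]]; exact: integrable_bounded_cont gM. Qed.

Lemma cb_cst c : cb (fun=> c).
Proof. by split; [exact: cst_continuous|exists `|c|]. Qed.

Lemma cbD f g : cb f -> cb g -> cb (fun x => f x + g x).
Proof.
move=> [cf [M fM]] [cg [K gK]]; split.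
  by move=> x; apply: (@continuousD _ _ _ f g); [exact: cf|exact: cg].
by exists (M + K) => x; apply: (le_trans (ler_normD _ _)); exact: lerD.
Qed.

Lemma cbN f : cb f -> cb (fun x => - f x).
Proof.
move=> [cf [M fM]]; split; first by move=> x; apply: continuousN; exact: cf.
by exists M => x; rewrite normrN.
Qed.

Lemma cbB f g : cb f -> cb g -> cb (fun x => f x - g x).
Proof. by move=> cf cg; apply: cbD => //; exact: cbN. Qed.

Lemma cbM f g : cb f -> cb g -> cb (fun x => f x * g x).
Proof.
move=> [cf [M fM]] [cg [K gK]]; split.
  by move=> x; apply: (@continuousM _ _ f g); [exact: cf|exact: cg].
by exists (M * K) => x; rewrite normrM; apply: ler_pM.
Qed.

Lemma cb_norm f : cb f -> cb (fun x => `|f x|).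
Proof.
move=> [cf [M fM]]; split; last by exists M => x; rewrite normr_id.
by move=> x; apply: (@continuous_comp _ _ _ f Num.norm); [exact: cf|exact: norm_continuous].
Qed.

Lemma cb_shift f v : cb f -> cb (fun x => f (x + v)).
Proof.
move=> [cf [M fM]]; split; last by exists M => x.
move=> x; apply: (@continuous_comp _ _ _ (fun x => x + v) f); last exact: cf.
by apply: (@continuousD _ _ _ id (fun=> v)); [exact: cvg_id|exact: cst_continuous].
Qed.

Lemma C1c_cb f : C1 f -> compact (closure [set x | f x != 0]) -> cb f.
Proof.
move=> Cf cK; split; first exact: C1_cont.
have [M _ fM] := supp_bounded (C1_cont Cf) cK (@supp_out0 _ _ f).
by exists M.
Qed.

Lemma C1c_cb_partial f i : C1 f -> compact (closure [set x | f x != 0]) -> cb (partial i f).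
Proof.
move=> Cf cK; split; first exact: C1_partial_cont.
have [M _ fM] := supp_bounded (@C1_partial_cont _ _ f i Cf) cK (@supp_partial_out _ _ f i).
by exists M.
Qed.

Lemma cb_Rint_shift f v (A : set T) : measurable A -> (mu A < +oo)%E -> cb f ->
  \int[mu]_(x in A) f (x + v) = \int[mu]_(x in (trset v (A : set 'rV[R]_N) : set T)) f x.
Proof. by move=> mA fA [cf [M fM]]; exact: Rintegral_shift fM. Qed.

Lemma cb_Rint_le f g (A : set T) : measurable A -> (mu A < +oo)%E -> cb f -> cb g ->
  (forall x : 'rV[R]_N, (A : set 'rV[R]_N) x -> f x <= g x) ->
  \int[mu]_(x in A) f x <= \int[mu]_(x in A) g x.
Proof. by move=> mA fA cf cg fg; apply: le_Rintegral => //; exact: cb_int. Qed.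

Lemma Rint_subset g (A B : set T) : measurable A -> measurable B -> 
  mu.-integrable B (EFin \o g) -> A `<=` B -> (forall x, 0 <= g x) ->
  \int[mu]_(x in A) g x <= \int[mu]_(x in B) g x.
Proof.
move=> mA mB ig AB g0; rewrite /Rintegral; apply: fine_le.
- by apply: integrable_fin_num => //; exact: integrableS ig.
- exact: integrable_fin_num.
- apply: (@ge0_subset_integral _ _ _ mu A B mA mB _ _ _ AB); last by move=> x _; rewrite lee_fin; exact: g0.
  exact: measurable_int ig.
Qed.

(** The segment is cut into [m + 1] steps, each so short that the first-order expansion holds with
    uniform error [eps]. Each step costs the integral of the partial derivative over a translate of
    [A] that stays inside [C]. This replaces integration along the segments. *)
Lemma translation_bound f i (A C : set T) (t : R) :
  C1 f -> compact (closure [set x | f x != 0]) -> 0 <= t ->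
  measurable A -> measurable C -> (mu C < +oo)%E ->
  (forall (x : 'rV[R]_N) s, (A : set 'rV[R]_N) x -> 0 <= s <= t ->
      (C : set 'rV[R]_N) (x + s *: evec R i)) ->
  \int[mu]_(x in A) `|f (x + t *: evec R i) - f x| <=
    t * \int[mu]_(x in C) `|partial i f x|.
Proof.
move=> Cf cK t0 mA mC fC AC.
have AsubC : A `<=` C.
  by move=> x Ax; have := AC x 0 Ax; rewrite lexx t0 scale0r addr0; exact.
have fA : (mu A < +oo)%E by apply: le_lt_trans (leb_le AsubC) fC.
have cf := C1c_cb Cf cK; have cd := @C1c_cb_partial f i Cf cK.
set P := \int[mu]_(x in C) _; set V := fine (mu A).
have V0 : 0 <= V by exact: fine_ge0.
apply/ler_addgt0Pr => e e0.
have d0 : 0 < t * V + 1 by rewrite ltr_wpDl// mulr_ge0.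
have [dl dl0 hdl] := diff_quot_unif i Cf cK (divr_gt0 e0 d0).
set eps := e / _ in hdl.
have eps0 : 0 < eps by rewrite divr_gt0.
have [m tm] : exists m : nat, t / m.+1%:R < dl.
  exists (Num.truncn (t / dl)); rewrite ltr_pdivrMr// mulrC -ltr_pdivrMr//.
  exact: truncnS_gt.
set tau := t / m.+1%:R in tm.
have tau0 : 0 <= tau by rewrite divr_ge0.
have tauE : t = m.+1%:R * tau by rewrite /tau mulrCA divff ?mulr1// pnatr_eq0.
have key j : (j <= m.+1)%N ->
   \int[mu]_(x in A) `|f (x + (j%:R * tau) *: evec R i) - f x| <= j%:R * (tau * (P + eps * V)).
  elim: j => [|j IH] jm.
    rewrite !mul0r scale0r (_ : \int[mu]_(x in A) _ = 0)//.
    transitivity (\int[mu]_(x in A) (0 : R)); last by rewrite Rintegral_cst// mul0r.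
    by apply: eq_Rintegral => x _; rewrite addr0 subrr normr0.
  have jt : 0 <= j%:R * tau <= t.
    by rewrite mulr_ge0//= tauE ler_wpM2r// ler_nat ltnW.
  pose v := (j%:R * tau) *: evec R i.
  apply: (@le_trans _ _ (\int[mu]_(x in A) (`|f (x + v) - f x| +
      (tau * `|partial i f (x + v)| + tau * eps)))).
    apply: cb_Rint_le => //.
    - by apply: cb_norm; apply: cbB => //; exact: cb_shift.
    - apply: cbD; first by apply: cb_norm; apply: cbB => //; exact: cb_shift.
      apply: cbD; last exact: cb_cst.
      by apply: cbM; [exact: cb_cst|apply: (@cb_shift (fun x => `|partial i f x|)); exact: cb_norm].
    move=> x Ax.
    have -> : x + (j.+1%:R * tau) *: evec R i = tau *: evec R i + (x + v).
      by rewrite /v -[j.+1%:R]natr1 mulrDl mul1r scalerDl [RHS]addrC addrA.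
    have := hdl (x + v) tau; rewrite ger0_norm// => /(_ tm) h.
    have -> : f (tau *: evec R i + (x + v)) - f x =
       (f (x + v) - f x) + ((f (tau *: evec R i + (x + v)) - f (x + v) - tau * partial i f (x + v))
       + tau * partial i f (x + v)) by ring.
    apply: (le_trans (ler_normD _ _)); apply: lerD => //.
    apply: (le_trans (ler_normD _ _)); rewrite addrC normrM (ger0_norm tau0).
    by apply: lerD => //; rewrite [leRHS]mulrC.
  have i1 : mu.-integrable A (EFin \o (fun x : T => `|f ((x : 'rV[R]_N) + v) - f x|)).
    by apply: cb_int => //; apply: cb_norm; apply: cbB => //; exact: cb_shift.
  have i2 : mu.-integrable A (EFin \o (fun x : T => `|partial i f ((x : 'rV[R]_N) + v)|)).
    by apply: cb_int => //; apply: (@cb_shift (fun x => `|partial i f x|)); exact: cb_norm.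
  have i3 : mu.-integrable A (EFin \o (fun x : T => tau * `|partial i f ((x : 'rV[R]_N) + v)|)).
    apply: cb_int => //; apply: cbM; first exact: cb_cst.
    by apply: (@cb_shift (fun x => `|partial i f x|)); exact: cb_norm.
  have i4 : mu.-integrable A (EFin \o (fun x : T => tau * eps)).
    by apply: cb_int => //; exact: cb_cst.
  have i5 : mu.-integrable A (EFin \o (fun x : T => tau * `|partial i f ((x : 'rV[R]_N) + v)| + tau * eps)).
    apply: cb_int => //; apply: cbD; last exact: cb_cst.
    apply: cbM; first exact: cb_cst.
    by apply: (@cb_shift (fun x => `|partial i f x|)); exact: cb_norm.
  rewrite RintegralD// RintegralD// RintegralZl// Rintegral_cst// -natr1 mulrDl mul1r.
  apply: lerD; first exact: IH (ltnW jm).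
  have IP : \int[mu]_(x in A) `|partial i f ((x : 'rV[R]_N) + v)| <= P.
    rewrite (@cb_Rint_shift (fun x => `|partial i f x|) v A)//; last exact: cb_norm.
    apply: Rint_subset => //.
    - exact: measurable_shift.
    - by apply: cb_int => //; exact: cb_norm.
    - move=> x; rewrite /trset/= => Ax; rewrite -(subrK v x); exact: AC.
  rewrite -/V; move: IP; generalize (\int[mu]_(x in A) `|partial i f ((x : 'rV[R]_N) + v)|) => I IP.
  have -> : tau * I + tau * eps * V = tau * (I + eps * V) by ring.
  by apply: ler_wpM2l; [exact: tau0|rewrite lerD2r; exact: IP].
have := key m.+1 (leqnn _); rewrite -tauE mulrA -tauE => /le_trans; apply.
rewrite mulrDr lerD2l mulrA mulrAC /eps mulrA ler_pdivrMr// mulrC ler_wpM2l ?(ltW e0)//.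
by rewrite lerDl.
Qed.

Lemma ge0_integral_shiftT v (f : T -> \bar R) : measurable_fun [set: T] f ->
  (forall x, 0 <= f x)%E ->
  (\int[mu]_x f ((x : 'rV[R]_N) + v)%R = \int[mu]_x f x)%E.
Proof.
by move=> mf f0; rewrite [RHS](ge0_integral_shift v measurableT mf).
Qed.

Lemma int_shift (g : 'rV[R]_N -> R) v : continuous g ->
  (\int[mu]_x (g ((x : 'rV[R]_N) + v)%R)%:E = \int[mu]_x (g x)%:E)%E.
Proof.
move=> cg; rewrite integralE [RHS]integralE.
have mg : measurable_fun [set: T] (EFin \o g).
  by apply/measurable_EFinP; exact: leb_continuous.
have hp : (\int[mu]_x ((fun x0 : T => (g ((x0 : 'rV[R]_N) + v)%R)%:E)^\+ x) =
    \int[mu]_x ((fun x0 : T => (g x0)%:E)^\+ x))%E.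
  rewrite -[RHS](ge0_integral_shiftT v (measurable_funepos mg) (fun x => funepos_ge0 _ x)).
  by apply: eq_integral => x _; rewrite !funeposE.
have hn : (\int[mu]_x ((fun x0 : T => (g ((x0 : 'rV[R]_N) + v)%R)%:E)^\- x) =
    \int[mu]_x ((fun x0 : T => (g x0)%:E)^\- x))%E.
  rewrite -[RHS](ge0_integral_shiftT v (measurable_funeneg mg) (fun x => funeneg_ge0 _ x)).
  by apply: eq_integral => x _; rewrite !funenegE.
by rewrite hp hn.
Qed.

Lemma cc_int (K : set 'rV[R]_N) g : cb g -> compact K -> (forall x, ~ K x -> g x = 0) ->
  mu.-integrable [set: T] (EFin \o g).
Proof.
move=> cg cK g0.
have mK : measurable (K : set T).
  by apply: leb_closed; apply: compact_closed => //; exact: norm_hausdorff.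
have fK : (mu K < +oo)%E.
  have [M [_ hM]] := compact_bounded cK.
  apply: (@leb_bounded_fin _ _ _ (`|M| + 1)) => x Kx; apply: hM => //.
  by rewrite (le_lt_trans (ler_norm _))// ltrDl.
have := cb_int mK fK cg.
rewrite integrable_mkcond//; congr integrable; apply/funext => x.
by rewrite patchE; case: ifPn => // /negP; rewrite inE => /g0 /= ->.
Qed.

Lemma hbox_bisect (a l : 'rV[R]_N) i : 0 < l ord0 i ->
  let l' := \row_j (if j == i then l ord0 i / 2 else l ord0 j) in
  let v := (l ord0 i / 2) *: evec R i in
  hbox a l = hbox a l' `|` trset v (hbox a l') /\ hbox a l' `&` trset v (hbox a l') = set0.
Proof.
move=> li l' v.
have lh : 0 < l ord0 i / 2 by rewrite divr_gt0.
have lE : l ord0 i = l ord0 i / 2 + l ord0 i / 2 by rewrite -splitr.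
rewrite /v trset_hbox; split; last first.
  apply/seteqP; split => // x [/(_ i) h1 /(_ i)]; move: h1; rewrite !mxE !eqxx/= mulr1.
  by move=> /andP[h1 h2] /andP[h3 h4]; exfalso; lra.
apply/seteqP; split => x; last first.
  move=> [|] h j; have := h j; rewrite !mxE ?eqxx/=; case: eqP => [->|ji]/=; rewrite ?(mulr1,mulr0,add0r)//;
    move=> /andP[h1 h2]; apply/andP; split; lra.
move=> h; have := h i; rewrite {1}lE => /andP[h1 h2].
case: (ltP (x ord0 i) (a ord0 i + l ord0 i / 2)) => c.
  left => j; rewrite !mxE; case: eqP => [->|ji]; last exact: h.
  by rewrite h1 c.
right => j; rewrite !mxE eqxx/=; case: eqP => [->|ji]/=; rewrite ?(mulr1,mulr0,add0r); last exact: h.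
by apply/andP; split; lra.
Qed.

Definition avg g (D : set T) : R := (fine (mu D))^-1 * \int[mu]_(x in D) g x.

Lemma bisect_arith (A1 A2 I1 I2 V d h k e : R) :
  A1 <= k * I1 + e * V -> A2 <= k * I2 + e * V -> V * d <= h * (I1 + I2) ->
  A1 + V * (d * 2^-1) + (A2 + V * (d * 2^-1)) <= (k + h) * (I1 + I2) + e * (V + V).
Proof. lra. Qed.

(** The two halves are translates of each other, so their means differ by the average of
    [f (x + v) - f x], which [translation_bound] controls. Doubling the box in direction [i]
    therefore adds half of the new side to the constant and leaves the error [e] per unit of volume
    unchanged. *)
Lemma poincare_bisect f (a l : 'rV[R]_N) i (c e : R) :
  C1 f -> compact (closure [set x | f x != 0]) -> (forall j, 0 < l ord0 j) -> 0 <= c ->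
  let l' := \row_j (if j == i then l ord0 i / 2 else l ord0 j) in
  (forall b, \int[mu]_(x in hbox b l') `|f x - avg f (hbox b l')| <=
     c * \int[mu]_(x in hbox b l') (\sum_j `|partial j f x|) + e * fine (mu (hbox b l'))) ->
  \int[mu]_(x in hbox a l) `|f x - avg f (hbox a l)| <=
     (c + l ord0 i / 2) * \int[mu]_(x in hbox a l) (\sum_j `|partial j f x|) +
       e * fine (mu (hbox a l)).
Proof.
move=> Cf cK lp c0 l' H.
set v := (l ord0 i / 2) *: evec R i.
have [CU CI] := hbox_bisect a (lp i); rewrite -/l' -/v in CU CI.
set C := hbox a l; set C1 := hbox a l'; set C2 := trset v C1.
have C2E : C2 = hbox (v + a) l' by rewrite /C2 trset_hbox.
have mC1 : measurable (C1 : set T) by exact: measurable_hbox.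
have mC2 : measurable (C2 : set T) by rewrite C2E; exact: measurable_hbox.
have mC : measurable (C : set T) by exact: measurable_hbox.
have fC1 : (mu C1 < +oo)%E by exact: leb_hbox_fin.
have fC2 : (mu C2 < +oo)%E by rewrite C2E; exact: leb_hbox_fin.
have fC : (mu C < +oo)%E by exact: leb_hbox_fin.
have cf := C1c_cb Cf cK.
have dis : [disjoint C1 & C2] by apply/disj_setPS; rewrite -/C1 CI.
have muC2 : mu C2 = mu C1 by rewrite !lebE lebesgue_outer_shift.
have l'p j : 0 < l' ord0 j by rewrite mxE; case: eqP => // _; rewrite divr_gt0.
set V := fine (mu C1).
have V0 : 0 < V.
  rewrite /V leb_hbox ?fine_lt//=; last by move=> j; exact: ltW.
  by apply: prodr_gt0 => j _.
have muC : fine (mu C) = V + V.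
  rewrite /C CU measureU//.
  by rewrite fineD ?ge0_fin_numE//; congr (_ + fine _); exact: muC2.
have spl g : cb g -> \int[mu]_(x in C) g x = \int[mu]_(x in C1) g x + \int[mu]_(x in C2) g x.
  move=> cg; rewrite /C CU Rintegral_setU//.
  by rewrite -CU; exact: cb_int.
set m := avg f C; set m1 := avg f C1; set m2 := avg f C2.
have mE : m = (m1 + m2) / 2.
  rewrite /m /m1 /m2 /avg muC2 -/V muC (spl _ cf); field.
  by rewrite !gt_eqF// addr_gt0.
have dm : V * `|m1 - m2| <= l ord0 i / 2 * \int[mu]_(x in C) `|partial i f x|.
  have -> : V * `|m1 - m2| = `|\int[mu]_(x in C1) (f (x + v) - f x)|.
    rewrite RintegralB//; [|by apply: cb_int => //; exact: cb_shift|exact: cb_int].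
    rewrite cb_Rint_shift// -[in LHS](gtr0_norm V0) -normrM /m1 /m2 /avg muC2 -/V.
    rewrite -mulrBr mulrA divff ?gt_eqF// mul1r distrC//.
  apply: (le_trans (le_normr_Rintegral _ _)) => //.
    by apply: cb_int => //; apply: cbB => //; exact: cb_shift.
  apply: translation_bound => //; first by rewrite divr_ge0// ltW.
  move=> x s xC1 /andP[s0 s1] j; have := xC1 j; rewrite !mxE ?eqxx/=.
  case: eqP => [->|ji]/=; rewrite ?(mulr1,mulr0,addr0)//.
  by move=> /andP[h1 h2]; apply/andP; split; lra.
have cbs : cb (fun x => \sum_j `|partial j f x|).
  rewrite (_ : (fun x => _) = \sum_j (fun x => `|partial j f x|)); last first.
    by apply/funext => x; rewrite fct_sumE.
  elim/big_ind: _ => [|g h cg ch|j _]; [exact: cb_cst|exact: cbD|].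
  by apply: cb_norm; exact: C1c_cb_partial.
have part D (k : R) : measurable (D : set T) -> mu D = mu C1 -> 
    \int[mu]_(x in D) `|f x - k| <= \int[mu]_(x in D) `|f x - avg f D| + V * `|avg f D - k|.
  move=> mD eD; have fD : (mu D < +oo)%E by rewrite eD.
  have -> : V * `|avg f D - k| = \int[mu]_(x in D) `|avg f D - k|.
    by rewrite Rintegral_cst// eD mulrC.
  rewrite -RintegralD//; last 2 first.
  - by apply: cb_int => //; apply: cb_norm; apply: cbB => //; exact: cb_cst.
  - by apply: cb_int => //; exact: cb_cst.
  apply: cb_Rint_le => //.
  - by apply: cb_norm; apply: cbB => //; exact: cb_cst.
  - by apply: cbD; [apply: cb_norm; apply: cbB => //; exact: cb_cst|exact: cb_cst].
  - by move=> x _; rewrite -[f x - k](subrKA (avg f D)); exact: ler_normD.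
rewrite spl; last by apply: cb_norm; apply: cbB => //; exact: cb_cst.
apply: (le_trans (lerD (part C1 m mC1 erefl) (part C2 m mC2 muC2))).
rewrite -/m1 -/m2.
have -> : m1 - m = (m1 - m2) / 2 by rewrite mE; field.
have -> : m2 - m = - ((m1 - m2) / 2) by rewrite mE; field.
rewrite normrN normrM (ger0_norm (_ : 0 <= 2^-1))//.
have H1 := H a; have H2 := H (v + a); rewrite -C2E -/m2 muC2 -/V in H2.
rewrite -/C1 -/m1 -/V in H1.
rewrite (spl _ cbs) muC.
have pl : \int[mu]_(x in C) `|partial i f x| <=
  \int[mu]_(x in C1) (\sum_j `|partial j f x|) + \int[mu]_(x in C2) (\sum_j `|partial j f x|).
  rewrite -(spl _ cbs); apply: cb_Rint_le => //.
    by apply: cb_norm; exact: C1c_cb_partial.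
  by move=> x _; rewrite (bigD1 i)//= lerDl sumr_ge0.
have lh : 0 <= l ord0 i / 2 by rewrite divr_ge0// ltW.
exact: bisect_arith H1 H2 (le_trans dm (ler_wpM2l lh pl)).
Qed.

(** The sides are doubled one coordinate at a time: the first [k] sides of [L k] are already
    doubled. *)
Lemma poincare_cube_step f (h c e : R) : (0 < N)%N ->
  C1 f -> compact (closure [set x | f x != 0]) -> 0 < h -> 0 <= c ->
  (forall b, \int[mu]_(x in hbox b (const_mx (h / 2))) `|f x - avg f (hbox b (const_mx (h / 2)))| <=
     c * \int[mu]_(x in hbox b (const_mx (h / 2))) (\sum_j `|partial j f x|) +
     e * fine (mu (hbox b (const_mx (h / 2))))) ->
  forall a, \int[mu]_(x in hbox a (const_mx h)) `|f x - avg f (hbox a (const_mx h))| <=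
     (c + N%:R * (h / 2)) * \int[mu]_(x in hbox a (const_mx h)) (\sum_j `|partial j f x|) +
       e * fine (mu (hbox a (const_mx h))).
Proof.
move=> N0 Cf cK h0 c0 H.
pose L (k : nat) : 'rV[R]_N := \row_j (if (j < k)%N then h else h / 2).
have key k : (k <= N)%N -> forall a, \int[mu]_(x in hbox a (L k)) `|f x - avg f (hbox a (L k))| <=
     (c + k%:R * (h / 2)) * \int[mu]_(x in hbox a (L k)) (\sum_j `|partial j f x|) +
       e * fine (mu (hbox a (L k))).
  elim: k => [_|k IH kN] a.
    rewrite mul0r addr0 (_ : L 0%N = const_mx (h / 2)); first exact: H.
    by apply/rowP => j; rewrite !mxE.
  pose i := Ordinal kN.
  have Li : L k.+1 ord0 i = h by rewrite mxE ltnS leqnn.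
  have := @poincare_bisect f a (L k.+1) i (c + k%:R * (h / 2)) e Cf cK.
  have E : c + k.+1%:R * (h / 2) = c + k%:R * (h / 2) + h / 2 by rewrite -[k.+1%:R]natr1; ring.
  rewrite Li E; apply.
  - by move=> j; rewrite mxE; case: ifP => // _; rewrite divr_gt0.
  - by rewrite addr_ge0// mulr_ge0// divr_ge0// ltW.
  - have -> : \row_j (if j == i then h / 2 else L k.+1 ord0 j) = L k.
      apply/rowP => j; rewrite !mxE ltnS leq_eqVlt.
      by rewrite -(inj_eq val_inj)/=; case: ltngtP.
    exact: IH (ltnW kN).
move=> a; have := key N (leqnn _) a.
by rewrite (_ : L N = const_mx h)//; apply/rowP => j; rewrite !mxE ltn_ord.
Qed.

(** At a scale below the modulus of continuity the inequality holds with constant [0] and error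
    [eps] per unit of volume. Doubling a cube to side [h] takes the constant [N * (h / 2)] to
    [N * h], so the form of the inequality reproduces itself up to the given cube, and the error
    does not accumulate. *)
Lemma poincare_C1 f (a : 'rV[R]_N) (h : R) : (0 < N)%N ->
  C1 f -> compact (closure [set x | f x != 0]) -> 0 < h ->
  \int[mu]_(x in hbox a (const_mx h)) `|f x - avg f (hbox a (const_mx h))| <=
     N%:R * h * \int[mu]_(x in hbox a (const_mx h)) (\sum_j `|partial j f x|).
Proof.
move=> N0 Cf cK h0.
set P := \int[mu]_(x in _) (\sum_j _).
apply/ler_addgt0Pr => e e0; set V := fine (mu (hbox a (const_mx h))).
have V0 : 0 <= V by exact: fine_ge0.
pose eps := e / (V + 1).
have eps0 : 0 < eps by rewrite divr_gt0// ltr_wpDl.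
have [dl dl0 hdl] := unif_cont (C1_cont Cf) cK (@supp_out0 _ _ f) eps0.
have base s : 0 < s -> s < dl -> forall b,
  \int[mu]_(x in hbox b (const_mx s)) `|f x - avg f (hbox b (const_mx s))| <=
     0 * \int[mu]_(x in hbox b (const_mx s)) (\sum_j `|partial j f x|) +
     eps * fine (mu (hbox b (const_mx s))).
  move=> s0 sdl b; rewrite mul0r add0r; set D := hbox _ _.
  have mD : measurable (D : set T) by exact: measurable_hbox.
  have fD : (mu D < +oo)%E by exact: leb_hbox_fin.
  have cf := C1c_cb Cf cK.
  rewrite -(Rintegral_cst mu mD); apply: cb_Rint_le => //.
  - by apply: cb_norm; apply: cbB => //; exact: cb_cst.
  - exact: cb_cst.
  move=> x Dx.
  have VD : 0 < fine (mu D).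
    rewrite leb_hbox; last by move=> j; rewrite mxE ltW.
    by apply: prodr_gt0 => j _; rewrite mxE.
  have -> : f x - avg f D = (fine (mu D))^-1 * \int[mu]_(y in D) (f x - f y).
    rewrite RintegralB//; [|by apply: cb_int => //; exact: cb_cst|exact: cb_int].
    by rewrite Rintegral_cst// /avg mulrBr (mulrC (f x)) mulrA mulVf ?gt_eqF// mul1r.
  rewrite normrM gtr0_norm ?invr_gt0// ler_pdivrMl//.
  apply: (le_trans (le_normr_Rintegral _ _)) => //.
    by apply: cb_int => //; apply: cbB => //; exact: cb_cst.
  rewrite mulrC -(Rintegral_cst mu mD); apply: cb_Rint_le => //.
  - by apply: cb_norm; apply: cbB => //; exact: cb_cst.
  - exact: cb_cst.
  move=> y Dy; apply: ltW; apply: hdl; apply: le_lt_trans sdl.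
  apply: sup_norm_le => [|j]; first exact: ltW.
  have := Dx j; have := Dy j; rewrite !mxE => /andP[h1 h2] /andP[h3 h4].
  by rewrite ler_norml; apply/andP; split; lra.
have [m hm] : exists m : nat, h / 2 ^+ m < dl.
  exists (Num.truncn (h / dl)).+1.
  rewrite ltr_pdivrMr ?exprn_gt0// mulrC -ltr_pdivrMr//.
  apply: lt_trans (truncnS_gt _) _; rewrite -natrX ltr_nat; exact: ltn_expl.
have key k : (k <= m)%N -> forall b, 
  \int[mu]_(x in hbox b (const_mx (h / 2 ^+ (m - k)))) `|f x - avg f (hbox b (const_mx (h / 2 ^+ (m - k))))| <=
     (N%:R * (h / 2 ^+ (m - k))) * \int[mu]_(x in hbox b (const_mx (h / 2 ^+ (m - k)))) (\sum_j `|partial j f x|) +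
     eps * fine (mu (hbox b (const_mx (h / 2 ^+ (m - k))))).
  elim: k => [_|k IH km] b.
    rewrite subn0; have s0 : 0 < h / 2 ^+ m by rewrite divr_gt0// exprn_gt0.
    apply: (le_trans (base _ s0 hm b)); rewrite lerD2r ler_wpM2r//.
      by apply: Rintegral_ge0 => x _; rewrite sumr_ge0.
    by rewrite mulr_ge0// ltW.
  set s := h / 2 ^+ (m - k.+1).
  have s0 : 0 < s by rewrite divr_gt0// exprn_gt0.
  have sE : h / 2 ^+ (m - k) = s / 2.
    by rewrite /s -mulrA -invfM -exprSr -subSn// subSS.
  have := IH (ltnW km); rewrite sE => IH'.
  have c0 : 0 <= N%:R * (s / 2) by rewrite mulr_ge0// divr_ge0// ltW.
  have := @poincare_cube_step f s (N%:R * (s / 2)) eps N0 Cf cK s0 c0 IH' b.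
  by rewrite -mulrDr -splitr.
have := key m (leqnn m) a; rewrite subnn expr0 divr1 -/P -/V => /le_trans; apply.
rewrite lerD2l /eps mulrAC ler_pdivrMr ?ltr_wpDl// ler_wpM2l ?(ltW e0)// lerDl//.
Qed.

(** The integral of [f (x + t e_i) - f x] vanishes by translation invariance. Up to sign, [t] times
    the integral of the partial derivative is thus the integral of a first-order remainder, which is
    [o(t)] uniformly and lives on a fixed cube. *)
Lemma int_partial0 f i : C1 f -> compact (closure [set x | f x != 0]) ->
  (\int[mu]_x (partial i f x)%:E = 0)%E.
Proof.
move=> Cf cK.
have cf := C1c_cb Cf cK; have cd := @C1c_cb_partial f i Cf cK.
set K := closure _ in cK.
have iF : mu.-integrable [set: T] (EFin \o partial i f).
  by apply: (cc_int cd cK); exact: supp_partial_out.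
have [M0 [_ hM0]] := compact_bounded cK.
pose M := `|M0| + 1.
have hM x : K x -> `|x| <= M.
  by move=> Kx; apply: (hM0 M) => //; rewrite /M (le_lt_trans (ler_norm _))// ltrDl.
have M0' : 0 < M by rewrite /M ltr_pwDr.
set J := \int[mu]_x (partial i f x).
suff J0 : J = 0.
  by rewrite -[LHS]fineK ?integrable_fin_num//; congr EFin.
pose B : set 'rV[R]_N := cube 0 (M + 2).
have mB : measurable (B : set T) by exact: measurable_cube.
have fB : (mu B < +oo)%E by exact: leb_cube_fin.
set V := fine (mu B); have V0 : 0 <= V by exact: fine_ge0.
apply/eqP; rewrite -normr_le0; apply/ler_addgt0Pr => e e0; rewrite add0r.
have e1 : 0 < e / (V + 1) by rewrite divr_gt0// ltr_wpDl.
have [dl dl0 hdl] := diff_quot_unif i Cf cK e1.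
pose t := Num.min 1 (dl / 2).
have t0 : 0 < t by rewrite lt_min ltr01 divr_gt0.
have t1 : t <= 1 by rewrite ge_min lexx.
have tdl : t < dl by rewrite gt_min ltr_pdivrMr// ltr_pMr// ltr1n orbT.
pose D x := f (x + t *: evec R i) - f x - t * partial i f x.
have cD : cb D.
  by apply: cbB; [apply: cbB => //; exact: cb_shift|apply: cbM => //; exact: cb_cst].
have ecoord (y : R) : `|y *: evec R i| <= `|y|.
  rewrite mx_normZ ler_piMr//; apply: sup_norm_le => // j.
  by rewrite mxE eqxx/=; case: eqP => _; rewrite ?normr1 ?normr0.
have D0 x : ~ B x -> D x = 0.
  move=> Bx.
  have xM : M + 1 < `|x|.
    rewrite ltNge; apply/negP => h; apply: Bx; apply: cube_lt; rewrite subr0; lra.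
  have nK : ~ K x by move=> /hM; lra.
  have nK' : ~ K (x + t *: evec R i).
    move=> /hM h; have := ler_normD (x + t *: evec R i) (- (t *: evec R i)).
    rewrite addrK normrN; have := ecoord t; rewrite (ger0_norm (ltW t0)); lra.
  by rewrite /D (supp_out0 nK) (supp_out0 nK') (supp_partial_out i nK) mulr0 !subr0.
have iD : mu.-integrable [set: T] (EFin \o D).
  have := cb_int mB fB cD; rewrite integrable_mkcond//; congr integrable; apply/funext => x.
  by rewrite patchE; case: ifPn => // /negP; rewrite inE => /D0 /= ->.
have i1 : mu.-integrable [set: T] (EFin \o (fun x : T => f ((x : 'rV[R]_N) + t *: evec R i))).
  have cK' : compact (closure [set x | f (x + t *: evec R i) != 0]).
    apply: (@compact_supp_ball _ _ _ 0 (M + 1)) => x fx; rewrite subr0.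
    have : K (x + t *: evec R i) by exact: subset_closure.
    move=> /hM h; have := ler_normD (x + t *: evec R i) (- (t *: evec R i)).
    rewrite addrK normrN; have := ecoord t; rewrite (ger0_norm (ltW t0)); lra.
  by apply: (cc_int (cb_shift _ cf) cK') => x; exact: supp_out0.
have i2 : mu.-integrable [set: T] (EFin \o f) by apply: (cc_int cf cK); exact: supp_out0.
have i3 : mu.-integrable [set: T] (EFin \o (fun x => t * partial i f x)).
  by apply: (cc_int (cbM (cb_cst t) cd) cK) => x Kx; rewrite (supp_partial_out i Kx) mulr0.
have i4 : mu.-integrable [set: T] (EFin \o (fun x : T => f ((x : 'rV[R]_N) + t *: evec R i) - f x)).
  exact: integB.
have ID : \int[mu]_x D x = - (t * J).
  rewrite /D RintegralB// RintegralB// RintegralZl//.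
  rewrite {1}/Rintegral int_shift; last exact: C1_cont.
  by rewrite -/(Rintegral mu setT f) subrr add0r.
have : `|t * J| <= t * e.
  rewrite -normrN -ID; apply: (le_trans (le_normr_Rintegral _ _)) => //.
  have -> : \int[mu]_x `|D x| = \int[mu]_(x in B) `|D x|.
    rewrite [RHS]Rintegral_mkcond; apply: eq_Rintegral => x _.
    by rewrite patchE; case: ifPn => // /negP; rewrite inE => /D0 ->; rewrite normr0.
  apply: (@le_trans _ _ (\int[mu]_(x in B) (e / (V + 1) * t))).
    apply: cb_Rint_le => //; [exact: cb_norm|exact: cb_cst|].
    move=> x _; have := hdl x t; rewrite (gtr0_norm t0) => /(_ tdl).
    by rewrite /D [x + _]addrC.
  rewrite Rintegral_cst// mulrAC -/V mulrC ler_pM2l// mulrAC ler_pdivrMr ?ltr_wpDl//.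
  by rewrite ler_pM2l// lerDl.
by rewrite normrM (gtr0_norm t0) ler_pM2l.
Qed.

Lemma compact_measurable (K : set 'rV[R]_N) : compact K -> measurable (K : set T).
Proof.
by move=> cK; apply: leb_closed; apply: compact_closed => //; exact: norm_hausdorff.
Qed.

Lemma compact_leb_fin (K : set 'rV[R]_N) : compact K -> (mu K < +oo)%E.
Proof.
move=> cK; have [M [_ hM]] := compact_bounded cK.
apply: (@leb_bounded_fin _ _ _ (`|M| + 1)) => x Kx; apply: hM => //.
by rewrite (le_lt_trans (ler_norm _))// ltrDl.
Qed.

Lemma int_supported (Om : set 'rV[R]_N) g : (forall x, ~ Om x -> g x = 0) ->
  (\int[mu]_(x in Om) (g x)%:E = \int[mu]_x (g x)%:E)%E.
Proof.
move=> g0; rewrite integral_mkcond; apply: eq_integral => x _.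
by rewrite patchE; case: ifPn => // /negP; rewrite inE => /g0 ->.
Qed.

(** Integration by parts is [int_partial0] for the product. *)
Lemma C1c_weak_grad (Om : set 'rV[R]_N) psi : C1 psi -> supported_in Om psi ->
  weak_grad Om psi (grad psi).
Proof.
move=> Cp [cK KO].
have cp := C1c_cb Cp cK.
have psi0 x : ~ Om x -> psi x = 0.
  by move=> Ox; apply: supp_out0 => /KO.
have dpsi0 i x : ~ Om x -> partial i psi x = 0.
  by move=> Ox; apply: supp_partial_out => /KO.
have loc g : cb g -> loc_integrable Om g.
  by move=> cg L cL _; apply: cb_int => //; [exact: compact_measurable|exact: compact_leb_fin].
split; first exact: loc.
  by move=> i; under eq_fun do rewrite mxE; apply: loc; exact: C1c_cb_partial.
move=> phi i sphi [cL LO].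
have Cphi : C1 phi := sphi [::].
have cphi := C1c_cb Cphi cL.
under [in RHS]eq_integral do rewrite mxE.
rewrite int_supported; last by move=> x /psi0 ->; rewrite mul0r.
rewrite [in RHS]int_supported; last by move=> x /dpsi0 ->; rewrite mul0r.
have i1 : mu.-integrable [set: T] (EFin \o (fun x => psi x * partial i phi x)).
  apply: (@cc_int _ _ _ cK) => [|x /supp_out0 ->]; last by rewrite mul0r.
  by apply: cbM => //; exact: C1c_cb_partial.
have i2 : mu.-integrable [set: T] (EFin \o (fun x => partial i psi x * phi x)).
  apply: (@cc_int _ _ _ cK) => [|x /supp_partial_out ->]; last by rewrite mul0r.
  by apply: cbM => //; exact: C1c_cb_partial.
have cKp : compact (closure [set x | psi x * phi x != 0]).
  apply: (@subclosed_compact _ _ _ _ cK); first exact: closed_closure.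
  by apply: closure_subset => x /=; apply: contra => /eqP ->; rewrite mul0r.
have := int_partial0 i (C1M Cp Cphi) cKp.
under eq_integral do rewrite partialM//.
under eq_integral do rewrite EFinD.
rewrite integralD//=; last first.
  by under eq_fun do rewrite mulrC.
have -> : (\int[mu]_x (phi x * partial i psi x)%:E = \int[mu]_x (partial i psi x * phi x)%:E)%E.
  by apply: eq_integral => x _; rewrite mulrC.
move=> h; rewrite -[RHS]add0e -h addeK//; exact: (integrable_fin_num measurableT i2).
Qed.

End cb.

(** * Integrals and almost everywhere relations *)

Section Rint_ae.
Context d (T : measurableType d) (R : realType) (mu : {measure set T -> \bar R}).
Context (D : set T) (mD : measurable D).
Implicit Types f g : T -> R.

Lemma integ_measurable f : mu.-integrable D (EFin \o f) -> measurable_fun D f.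
Proof. by move=> h; apply/measurable_EFinP; exact: measurable_int h. Qed.

Lemma integ_dom f g : measurable_fun D f -> {ae mu, forall x, D x -> `|f x| <= g x} ->
  mu.-integrable D (EFin \o g) -> mu.-integrable D (EFin \o f).
Proof.
move=> mf fg /integrableP[mg fing]; apply/integrableP; split; first exact/measurable_EFinP.
apply: le_lt_trans fing; apply: ae_ge0_le_integral => //.
- by apply: measurableT_comp => //; exact/measurable_EFinP.
- exact: measurableT_comp.
- apply: filterS fg => x h Dx /=; rewrite lee_fin; apply: le_trans (h Dx) _; exact: ler_norm.
Qed.

Lemma integ_dom_all f g : measurable_fun D f -> (forall x, D x -> `|f x| <= g x) ->
  mu.-integrable D (EFin \o g) -> mu.-integrable D (EFin \o f).
Proof. by move=> mf fg; apply: integ_dom => //; exact: aeW. Qed.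

Lemma Rint_ae_eq f g : measurable_fun D f -> measurable_fun D g ->
  {ae mu, forall x, D x -> f x = g x} ->
  \int[mu]_(x in D) f x = \int[mu]_(x in D) g x.
Proof.
move=> mf mg fg; rewrite /Rintegral; congr fine; apply: ae_eq_integral => //.
- exact/measurable_EFinP.
- exact/measurable_EFinP.
- by apply: filterS fg => x h Dx; rewrite h.
Qed.

Lemma Rint_ae_le f g : mu.-integrable D (EFin \o f) -> mu.-integrable D (EFin \o g) ->
  {ae mu, forall x, D x -> f x <= g x} ->
  \int[mu]_(x in D) f x <= \int[mu]_(x in D) g x.
Proof.
move=> hf hg fg; rewrite -subr_ge0 -RintegralB//.
have hgf := integB mD hg hf.
rewrite (_ : \int[mu]_(x in D) (g x - f x) = \int[mu]_(x in D) `|g x - f x|).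
  by apply: Rintegral_ge0 => x _; exact: normr_ge0.
apply: Rint_ae_eq.
- exact: integ_measurable.
- by apply: integ_measurable; exact: integ_norm.
- by apply: filterS fg => x h Dx; rewrite ger0_norm// subr_ge0; exact: h.
Qed.

Lemma Rint_norm f : mu.-integrable D (EFin \o f) ->
  `|\int[mu]_(x in D) f x| <= \int[mu]_(x in D) `|f x|.
Proof. by move=> hf; exact: le_normr_Rintegral. Qed.

Lemma integ_sum (I : Type) (r : seq I) (F : I -> T -> R) :
  (forall i, mu.-integrable D (EFin \o F i)) ->
  mu.-integrable D (EFin \o (fun x => \sum_(i <- r) F i x)).
Proof.
move=> h; elim: r => [|i r IH].
  have -> : (fun x => \sum_(i <- [::]) F i x) = (fun=> 0).
    by apply/funext => x; rewrite big_nil.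
  exact: integrable0.
have -> : (fun x => \sum_(j <- i :: r) F j x) = (fun x => F i x + \sum_(j <- r) F j x).
  by apply/funext => x; rewrite big_cons.
exact: integD.
Qed.

Lemma Rint_fin_lt f (e : R) : mu.-integrable D (EFin \o f) ->
  (\int[mu]_(x in D) (f x)%:E < e%:E)%E -> \int[mu]_(x in D) f x < e.
Proof.
move=> hf h; rewrite -lte_fin /Rintegral fineK//; exact: integrable_fin_num.
Qed.

Lemma RintE f : mu.-integrable D (EFin \o f) ->
  (\int[mu]_(x in D) (f x)%:E)%E = (\int[mu]_(x in D) f x)%:E.
Proof. by move=> hf; rewrite /Rintegral fineK//; exact: integrable_fin_num. Qed.

(** Dominated convergence. The truncation height [L] plays the part of absolute continuity of the
    integral in what follows. *)
Lemma integ_tail f e : mu.-integrable D (EFin \o f) -> 0 < e ->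
  exists2 L : R, 0 < L & \int[mu]_(x in D) (`|f x| - Num.min `|f x| L) < e.
Proof.
move=> hf e0.
have mf := integ_measurable hf.
have hn := integ_norm hf.
pose g n x := `|f x| - Num.min `|f x| n.+1%:R.
have mg n : measurable_fun D (g n).
  apply: measurable_funB; first exact: measurableT_comp.
  by apply: measurable_minr => //; exact: measurableT_comp.
have gb n x : 0 <= g n x <= `|f x|.
  rewrite /g subr_ge0 ge_min lexx/= lerBlDr lerDl le_min normr_ge0/=; exact: ler0n.
have ig n : mu.-integrable D (EFin \o g n).
  apply: (integ_dom_all (mg n) _ hn) => x _; have /andP[h1 h2] := gb n x.
  by rewrite ger0_norm.
have [] := @dominated_convergence _ _ _ mu D mD (fun n => EFin \o g n) (cst 0%E) (EFin \o (fun x => `|f x|)).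
- by move=> n; apply/measurable_EFinP; exact: mg.
- exact: measurable_cst.
- apply: aeW => x Dx; apply: cvg_near_cst; near=> n; rewrite /= /g.
  rewrite (min_idPl _) ?subrr//; near: n.
  exists (Num.truncn `|f x|) => // n /= hn'; apply: ltW.
  by apply: (lt_le_trans (truncnS_gt _)); rewrite ler_nat ltnS.
- exact: hn.
- by apply: aeW => x n Dx; rewrite /= lee_fin; have /andP[h1 h2] := gb n x; rewrite ger0_norm.
move=> _ _; rewrite integral0_eq//.
move=> /(_ [set x | (x < e%:E)%E] (@nbhs_open_ereal_lt R 0 (fun=> e) e0)) [n _ hn'].
exists n.+1%:R; first by rewrite ltr0n.
apply: Rint_fin_lt; first exact: ig.
exact: (hn' n (leqnn n)).
Unshelve. all: by end_near. Qed.

End Rint_ae.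

(** * Functions with zero boundary values *)

Section sobolev.
Context (R : realType) (N : nat).
Notation T := (leb_space R N).
Notation mu := (lebesgue_rV R N).
Implicit Types (f g : 'rV[R]_N -> R) (Om : set 'rV[R]_N) (V : 'rV[R]_N -> 'rV[R]_N).

Lemma enorm_measurable (D : set T) V :
  (forall i, measurable_fun D (fun x : T => V x ord0 i)) ->
  measurable_fun D (fun x : T => enorm (V x)).
Proof.
move=> h; rewrite /enorm.
apply: (@measurableT_comp _ _ _ _ _ _ (@Num.sqrt R)).
  by apply: continuous_measurable_fun; exact: sqrt_continuous.
under eq_fun do rewrite dotvE.
by apply: measurable_sum => i; apply: measurable_funM; exact: h.
Qed.

Lemma enorm_integrable (D : set T) V : measurable D ->
  (forall i, mu.-integrable D (EFin \o (fun x : T => V x ord0 i))) ->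
  mu.-integrable D (EFin \o (fun x : T => enorm (V x))).
Proof.
move=> mD h.
apply: (@integ_dom_all _ _ _ _ _ mD _ (fun x : T => \sum_i `|V x ord0 i|)).
- by apply: enorm_measurable => i; exact: integ_measurable.
- by move=> x _; rewrite ger0_norm ?enorm_ge0//; exact: enorm_le_sum.
- by apply: integ_sum => // i; exact: integ_norm.
Qed.

(** The integrability half of [W11]; for functions with zero boundary values the weak gradient
    identity is derived from the approximation, in [zero_trace_weak_grad]. *)
Definition W11i Om f V := lintegrable Om f /\ forall i, lintegrable Om (fun x => V x ord0 i).

Lemma grad_coord f i x : grad f x ord0 i = partial i f x.
Proof. by rewrite mxE. Qed.

Lemma C1_measurable (D : set T) f : measurable D -> C1 f -> measurable_fun D f.
Proof. by move=> mD Cf; apply: leb_continuous => //; exact: C1_cont. Qed.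

Lemma C1_grad_measurable (D : set T) f i : measurable D -> C1 f ->
  measurable_fun D (fun x : T => grad f x ord0 i).
Proof.
move=> mD Cf; under eq_fun do rewrite mxE; apply: leb_continuous => //; exact: C1_partial_cont.
Qed.

Lemma W11_distP Om f V psi e : measurable (Om : set T) -> W11i Om f V -> C1 psi ->
  (W11_dist Om f V psi < e%:E)%E ->
  [/\ mu.-integrable Om (EFin \o (fun x => f x - psi x)),
      mu.-integrable Om (EFin \o (fun x => enorm (V x - grad psi x))),
      \int[mu]_(x in Om) `|f x - psi x| < e &
      \int[mu]_(x in Om) enorm (V x - grad psi x) < e].
Proof.
move=> mO [iF iV] Cp h.
have mf : measurable_fun (Om : set T) f by exact: integ_measurable iF.
have m1 : measurable_fun (Om : set T) (fun x : T => f x - psi x).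
  by apply: measurable_funB => //; exact: C1_measurable.
have m2 : measurable_fun (Om : set T) (fun x : T => enorm (V x - grad psi x)).
  apply: enorm_measurable => i; under eq_fun do rewrite 2!mxE.
  apply: measurable_funB; first exact: integ_measurable (iV i).
  by have := @C1_grad_measurable Om psi i mO Cp; under eq_fun do rewrite mxE.
have iS : mu.-integrable Om (EFin \o (fun x => `|f x - psi x| + enorm (V x - grad psi x))).
  apply/integrableP; split.
    apply/measurable_EFinP; apply: measurable_funD; last exact: m2.
    exact: (measurableT_comp (@normr_measurable R setT) m1).
  apply: (@le_lt_trans _ _ (W11_dist Om f V psi)); last first.
    by apply: (lt_le_trans h); exact: leey.
  rewrite /W11_dist le_eqVlt; apply/orP; left; apply/eqP; apply: eq_integral => x _ /=.
  by rewrite ger0_norm// addr_ge0// enorm_ge0.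
have i1 : mu.-integrable Om (EFin \o (fun x => f x - psi x)).
  apply: (integ_dom_all mO m1 _ iS) => x _; by rewrite lerDl enorm_ge0.
have i2 : mu.-integrable Om (EFin \o (fun x => enorm (V x - grad psi x))).
  by apply: (integ_dom_all mO m2 _ iS) => x _; rewrite ger0_norm ?enorm_ge0// lerDr.
have hS := Rint_fin_lt mO iS h.
split => //; apply: le_lt_trans hS; apply: le_Rintegral => //.
- exact: integ_norm.
- by move=> x _; rewrite lerDl enorm_ge0.
- by move=> x _; rewrite lerDr.
Qed.

(* Zero boundary values in the sense of [W^{1,1}_0], for the pair of a function
   and its gradient. *)
Definition zero_trace Om f V := W11i Om f V /\ forall e, 0 < e -> exists psi,
  [/\ C1 psi, supported_in Om psi & (W11_dist Om f V psi < e%:E)%E].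

(** Against a fixed test function both sides of the identity are continuous for the [W^{1,1}]
    distance, and the approximants satisfy it. *)
Lemma zero_trace_weak_grad Om f V : open Om -> zero_trace Om f V -> weak_grad Om f V.
Proof.
move=> oO [[iF iV] hz].
have mO : measurable (Om : set T) by exact: leb_open.
have loc g : lintegrable Om g -> loc_integrable Om g.
  by move=> ig K cK KO; apply: integrableS ig => //; exact: compact_measurable.
split; [exact: loc|by move=> i; apply: loc|].
move=> eta i seta [cK KO].
have Ceta : C1 eta := seta [::].
have [c1 [M1 hM1]] := C1c_cb Ceta cK.
have [c2 [M2 hM2]] := @C1c_cb_partial _ _ eta i Ceta cK.
have mb g (h : 'rV[R]_N -> R) M : continuous h -> (forall x, `|h x| <= M) -> lintegrable Om g ->
    lintegrable Om (fun x => g x * h x).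
  move=> ch hM ig.
  apply: (@integ_dom_all _ _ _ _ _ mO _ (fun x => M * `|g x|)).
  - by apply: measurable_funM; [exact: integ_measurable ig|exact: leb_continuous].
  - by move=> x _; rewrite normrM mulrC ler_wpM2r.
  - by apply: integZ => //; exact: integ_norm.
have iA := mb _ _ _ c2 hM2 iF; have iB := mb _ _ _ c1 hM1 (iV i).
rewrite (RintE mO iA) (RintE mO iB) -EFinN; congr EFin.
set A := \int[mu]_(x in Om) _; set B := \int[mu]_(x in Om) _.
suff AB : A + B = 0 by lra.
apply/eqP; rewrite -normr_le0; apply/ler_addgt0Pr => e e0; rewrite add0r.
have M10 : 0 <= M1 by exact: le_trans (hM1 0).
have M20 : 0 <= M2 by exact: le_trans (hM2 0).
have d0 : 0 < e / (M1 + M2 + 1) by rewrite divr_gt0// ltr_wpDl// addr_ge0.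
have [psi [Cp sp hd]] := hz _ d0.
have [j1 j2 k1 k2] := W11_distP mO (conj iF iV) Cp hd.
have ip : lintegrable Om psi.
  have := integB mO iF j1; apply: eq_integrable => // x _ /=.
  by rewrite opprB addrC subrK.
have mVp : measurable_fun (Om : set T) (fun x : T => V x ord0 i - partial i psi x).
  apply: measurable_funB; first exact: integ_measurable (iV i).
  by have := @C1_grad_measurable Om psi i mO Cp; under eq_fun do rewrite mxE.
have j2i : lintegrable Om (fun x => V x ord0 i - partial i psi x).
  apply: (integ_dom_all mO mVp _ j2) => x _.
  by have := enorm_coord (V x - grad psi x) i; rewrite !mxE.
have idp : lintegrable Om (partial i psi).
  have := integB mO (iV i) j2i; apply: eq_integrable => // x _ /=.
  by rewrite opprB addrC subrK.
have [_ _ /(_ eta i seta (conj cK KO))] := C1c_weak_grad Cp sp.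
have iA' := mb _ _ _ c2 hM2 ip; have iB' := mb _ _ _ c1 hM1 idp.
under [in RHS]eq_integral do rewrite mxE.
rewrite (RintE mO iA') (RintE mO iB') -EFinN => -[E].
have -> : A + B = \int[mu]_(x in Om) ((f x - psi x) * partial i eta x) +
   \int[mu]_(x in Om) ((V x ord0 i - partial i psi x) * eta x).
  rewrite (_ : \int[mu]_(x in Om) ((f x - psi x) * partial i eta x) =
      A - \int[mu]_(x in Om) (psi x * partial i eta x)); last first.
    by rewrite /A -RintegralB//; apply: eq_Rintegral => x _; rewrite mulrBl.
  rewrite (_ : \int[mu]_(x in Om) ((V x ord0 i - partial i psi x) * eta x) =
      B - \int[mu]_(x in Om) (partial i psi x * eta x)); last first.
    by rewrite /B -RintegralB//; apply: eq_Rintegral => x _; rewrite mulrBl.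
  by move: E; lra.
have bnd g h M : continuous h -> (forall x, `|h x| <= M) -> lintegrable Om g ->
    `|\int[mu]_(x in Om) (g x * h x)| <= M * \int[mu]_(x in Om) `|g x|.
  move=> ch hM ig; have igh := mb _ _ _ ch hM ig.
  apply: (le_trans (Rint_norm mO igh)); rewrite -RintegralZl//; last exact: integ_norm.
  apply: le_Rintegral => //; [exact: integ_norm|apply: integZ => //; exact: integ_norm|].
  by move=> x _; rewrite normrM mulrC ler_wpM2r.
apply: (le_trans (ler_normD _ _)).
apply: (le_trans (lerD (bnd _ _ _ c2 hM2 j1) (bnd _ _ _ c1 hM1 j2i))).
have k2' : \int[mu]_(x in Om) `|V x ord0 i - partial i psi x| <= e / (M1 + M2 + 1).
  apply: le_trans (ltW k2); apply: le_Rintegral => //; first exact: integ_norm.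
  by move=> x _; have := enorm_coord (V x - grad psi x) i; rewrite !mxE.
apply: (@le_trans _ _ (M2 * (e / (M1 + M2 + 1)) + M1 * (e / (M1 + M2 + 1)))).
  by apply: lerD; apply: ler_wpM2l => //; exact: ltW.
rewrite -mulrDl mulrA ler_pdivrMr; last by rewrite ltr_wpDl// addr_ge0.
by rewrite mulrC ler_wpM2l ?(ltW e0)// addrC lerDl.
Qed.

Lemma poincare_arith (IW IP J G mz mc e c th h n : R) : 0 < th -> 0 <= mz ->
  0 <= h -> 0 <= n -> 0 <= c -> th * mc <= mz ->
  IW <= IP + e ->  IP <= n * h * J + c * mc ->
  c * mz <= n * h * J + e -> J <= n * (G + e) ->
  th * IW <= n * h * (th + 1) * (n * (G + e)) + (1 + th) * e.
Proof.
move=> th0 mz0 h0 n0 c0 tm h1 h2 h3 h4.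
have a1 : th * IW <= th * IP + th * e by rewrite -mulrDr ler_wpM2l// ltW.
have a2 : th * IP <= th * (n * h * J) + c * (th * mc).
  by have := ler_wpM2l (ltW th0) h2; rewrite mulrDr [th * (c * mc)]mulrCA.
have a3 : c * (th * mc) <= c * mz by rewrite ler_wpM2l.
have a4 : n * h * J <= n * h * (n * (G + e)) by rewrite ler_wpM2l// mulr_ge0.
have a5 : th * (n * h * J) <= th * (n * h * (n * (G + e))) by rewrite ler_wpM2l// ltW.
have -> : n * h * (th + 1) * (n * (G + e)) + (1 + th) * e =
  th * (n * h * (n * (G + e))) + n * h * (n * (G + e)) + e + th * e by ring.
lra.
Qed.

(** The approximants [psi] are [C^1] on the whole space and vanish outside [Om], so [poincare_C1]
    applies to cubes crossing the boundary. Their mean [c] is controlled through [Z], which may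
    reach outside [Om]: there [psi] is zero or close to [f = 0]. *)
Lemma zero_trace_poincare Om f V (a : 'rV[R]_N) (h th : R) (Z : set T) : (0 < N)%N ->
  open Om -> zero_trace Om f V -> 0 < h -> 0 < th ->
  let C := hbox a (const_mx h) in
  measurable Z -> Z `<=` C -> (forall x : 'rV[R]_N, (Z : set 'rV[R]_N) x -> Om x -> f x = 0) ->
  th * fine (mu C) <= fine (mu Z) ->
  th * \int[mu]_(x in C `&` Om) `|f x| <=
    N%:R ^+ 2 * h * (th + 1) * \int[mu]_(x in C `&` Om) enorm (V x).
Proof.
move=> N0 oO [[iF iV] hz] h0 th0 C mZ ZC Zf ZCm.
have mO : measurable (Om : set T) by exact: leb_open.
have mC : measurable (C : set T) by exact: measurable_hbox.
have fC : (mu C < +oo)%E by exact: leb_hbox_fin.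
have fZ : (mu Z < +oo)%E by exact: le_lt_trans (leb_le ZC) fC.
have mCO : measurable (C `&` Om : set T) by exact: measurableI.
have iE : mu.-integrable Om (EFin \o (fun x => enorm (V x))) by exact: enorm_integrable.
have sub g : lintegrable Om g -> mu.-integrable (C `&` Om : set T) (EFin \o g).
  by move=> ig; apply: integrableS ig => //; exact: subIsetr.
set IW := \int[mu]_(x in _) `|f x|; set G := \int[mu]_(x in _) enorm (V x).
have N1 : 0 <= N%:R :> R by exact: ler0n.
pose Q := N%:R * h * (th + 1) * N%:R + (1 + th).
have Q0 : 0 <= Q by rewrite /Q addr_ge0 ?mulr_ge0 ?addr_ge0// ltW.
apply/ler_addgt0Pr => e e0.
have e1 : 0 < e / (Q + 1) by rewrite divr_gt0// ltr_wpDl.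
have [psi [Cp [cK KO] hd]] := hz _ e1.
have [j1 j2 k1 k2] := W11_distP mO (conj iF iV) Cp hd.
have cp := C1c_cb Cp cK.
have P := poincare_C1 a N0 Cp cK h0.
rewrite -/C in P; set c := avg psi C in P; set J := \int[mu]_(x in C) \sum_j _ in P.
have psi0 x : ~ Om x -> psi x = 0 by move=> Ox; apply: supp_out0 => /KO.
have dpsi0 i x : ~ Om x -> partial i psi x = 0.
  by move=> Ox; apply: supp_partial_out => /KO.
have restr g : (forall x, ~ Om x -> g x = 0) ->
    \int[mu]_(x in C) g x = \int[mu]_(x in C `&` Om) g x.
  move=> g0; rewrite Rintegral_mkcondr; apply: eq_Rintegral => x _.
  by rewrite patchE; case: ifPn => // /negP; rewrite inE => /g0.
have cbs : cb (fun x => \sum_j `|partial j psi x|).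
  rewrite (_ : (fun x => _) = \sum_j (fun x => `|partial j psi x|)); last first.
    by apply/funext => x; rewrite fct_sumE.
  elim/big_ind: _ => [|g1 g2 cg ch|j _]; [exact: cb_cst|exact: cbD|].
  by apply: cb_norm; exact: C1c_cb_partial.
have cbc : cb (fun x => psi x - c) by apply: cbB => //; exact: cb_cst.
have J4 : J <= N%:R * (G + e / (Q + 1)).
  rewrite /J restr; last by move=> x Ox; apply: big1 => j _; rewrite dpsi0// normr0.
  have ij2 := sub _ j2; have ie := sub _ iE.
  apply: (@le_trans _ _ (N%:R * \int[mu]_(x in C `&` Om) (enorm (V x) + enorm (V x - grad psi x)))).
    rewrite -RintegralZl//; last exact: integD.
    apply: le_Rintegral => //.
    - apply: integrableS (cb_int mC fC cbs) => //; exact: subIsetl.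
    - by apply: integZ => //; exact: integD.
    move=> x _; apply: (@le_trans _ _ (\sum_(j < N) (enorm (V x) + enorm (V x - grad psi x)))).
      apply: ler_sum => j _; rewrite -grad_coord.
      apply: (le_trans (enorm_coord (grad psi x) j)).
      rewrite -[X in enorm X <= _](subKr (V x) (grad psi x)).
      by apply: (le_trans (enormD _ _)); rewrite enormN.
    by rewrite sumr_const card_ord -[leLHS]mulr_natl.
  rewrite RintegralD// ler_wpM2l// -/G lerD2l; apply: le_trans (ltW k2).
  by apply: Rint_subset => //; move=> x; exact: enorm_ge0.
have IWP : IW <= \int[mu]_(x in C) `|psi x| + e / (Q + 1).
  rewrite restr; last by move=> x /psi0 ->; rewrite normr0.
  have ip : mu.-integrable (C `&` Om : set T) (EFin \o psi).
    by apply: integrableS (cb_int mC fC cp) => //; exact: subIsetl.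
  have ij1 := sub _ j1.
  apply: (@le_trans _ _ (\int[mu]_(x in C `&` Om) (`|psi x| + `|f x - psi x|))).
    apply: le_Rintegral => //.
    - by apply: integ_norm => //; exact: sub.
    - by apply: integD => //; exact: integ_norm.
    - by move=> x _; rewrite -{1}(subrK (psi x) (f x)) addrC; exact: ler_normD.
  rewrite RintegralD//; [|exact: integ_norm|exact: integ_norm].
  rewrite lerD2l; apply: le_trans (ltW k1).
  by apply: Rint_subset => //; exact: integ_norm.
have IPc : \int[mu]_(x in C) `|psi x| <= N%:R * h * J + `|c| * fine (mu C).
  apply: (@le_trans _ _ (\int[mu]_(x in C) (`|psi x - c| + `|c|))).
    apply: cb_Rint_le => //; first exact: cb_norm.
      by apply: cbD; [exact: cb_norm|exact: cb_cst].
    by move=> x _; rewrite -{1}(subrK c (psi x)); exact: ler_normD.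
  rewrite RintegralD//; [|by apply: cb_int => //; exact: cb_norm|by apply: cb_int => //; exact: cb_cst].
  by rewrite Rintegral_cst// lerD2r.
have cZ : `|c| * fine (mu Z) <= N%:R * h * J + e / (Q + 1).
  rewrite -(Rintegral_cst mu mZ).
  apply: (@le_trans _ _ (\int[mu]_(x in Z) (`|psi x - c| + `|psi x|))).
    apply: cb_Rint_le => //; first exact: cb_cst.
      by apply: cbD; exact: cb_norm.
    by move=> x _; have := ler_normB (psi x) (psi x - c); rewrite subKr addrC.
  rewrite RintegralD//; [|by apply: cb_int => //; exact: cb_norm|by apply: cb_int => //; exact: cb_norm].
  apply: lerD.
    apply: le_trans P; apply: Rint_subset => //.
    by apply: cb_int => //; exact: cb_norm.
  apply: le_trans (ltW k1).
  have mZO : measurable (Z `&` Om : set T) by exact: measurableI.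
  rewrite (_ : \int[mu]_(x in Z) `|psi x| = \int[mu]_(x in Z `&` Om) `|f x - psi x|).
    by apply: Rint_subset => //; exact: integ_norm.
  rewrite Rintegral_mkcondr; apply: eq_Rintegral => x; rewrite inE => Zx.
  rewrite patchE; case: ifPn => [|/negP]; rewrite inE => Ox.
    by rewrite Zf// sub0r normrN.
  by rewrite psi0// normr0.
have := @poincare_arith IW _ J G (fine (mu Z)) (fine (mu C)) (e / (Q + 1)) `|c| th h N%:R
  th0 (fine_ge0 (measure_ge0 _ _)) (ltW h0) N1 (normr_ge0 _) ZCm IWP IPc cZ J4.
move=> /le_trans; apply.
have -> : N%:R * h * (th + 1) * (N%:R * (G + e / (Q + 1))) + (1 + th) * (e / (Q + 1)) =
  N%:R ^+ 2 * h * (th + 1) * G + Q * (e / (Q + 1)) by rewrite /Q; ring.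
rewrite lerD2l mulrA ler_pdivrMr ?ltr_wpDl// mulrC ler_wpM2l ?(ltW e0)// lerDl//.
Qed.

End sobolev.

(** * Uniqueness of weak gradients *)

Section flat.
Context (R : realType).

(* [t^-j exp(-1/t)], extended by zero; these functions and their products are
   stable under differentiation up to linear combinations. *)
Definition flat (j : nat) (t : R) : R := if 0 < t then expR (- t^-1) * t^-1 ^+ j else 0.

Lemma flat_ge0 j t : 0 <= flat j t.
Proof. by rewrite /flat; case: ifP => // t0; rewrite mulr_ge0 ?expR_ge0// exprn_ge0// invr_ge0 ltW. Qed.

Lemma flat_le0 j t : t <= 0 -> flat j t = 0.
Proof. by rewrite /flat leNgt; case: ltP. Qed.

(** The [m]-th power of [y / m <= exp (y / m)]. *)
Lemma expR_ge_pow (y : R) (m : nat) : 0 <= y -> y ^+ m <= m%:R ^+ m * expR y.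
Proof.
move=> y0; case: m => [|m]; first by rewrite expr0 mul1r -expR0 ler_expR.
have m0 : 0 < m.+1%:R :> R by rewrite ltr0n.
have h : y <= m.+1%:R * expR (y / m.+1%:R).
  rewrite mulrC -ler_pdivrMr//; apply: le_trans (expR_ge1Dx _); rewrite lerDr//.
have -> : expR y = expR (y / m.+1%:R) ^+ m.+1.
  by rewrite -expRM_natl; congr expR; rewrite mulrC divfK// gt_eqF.
by rewrite -exprMn; apply: lerXn2r => //; rewrite nnegrE ?mulr_ge0 ?expR_ge0// ltW.
Qed.

(** Quadratic decay at the origin, for every [j], is what gives the derivative zero there. *)
Lemma flat_quad j t : flat j t <= j.+2%:R ^+ j.+2 * t ^+ 2.
Proof.
rewrite /flat; case: ltP => t0; last by rewrite mulr_ge0 ?sqr_ge0// exprn_ge0.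
have s0 : 0 < t^-1 by rewrite invr_gt0.
have := expR_ge_pow j.+2 (ltW s0).
move=> h; rewrite expRN [leLHS]mulrC ler_pdivrMr ?expR_gt0//.
have -> : t^-1 ^+ j = t^-1 ^+ j.+2 * t ^+ 2.
  by rewrite -addn2 exprD -mulrA -exprMn mulVf ?expr1n ?mulr1// gt_eqF.
by rewrite [leRHS]mulrAC ler_wpM2r ?sqr_ge0.
Qed.

Lemma flat_le1 t : flat 0 t <= 1.
Proof.
rewrite /flat; case: ltP => // t0; rewrite mulr1 -expR0 ler_expR oppr_le0 invr_ge0 ltW//.
Qed.

Lemma is_derive_flat j t : is_derive t (1 : R) (flat j) (flat j.+2 t - j%:R * flat j.+1 t).
Proof.
have [t0|t0|->] := ltgtP t 0.
- rewrite !flat_le0 ?ltW// mulr0 subr0.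
  apply: (@near_eq_is_derive _ _ _ (fun=> 0)).
  near=> s; rewrite flat_le0//; apply: ltW; near: s; exact: lt_nbhsl.
- apply: (@near_eq_is_derive _ _ _ (fun s : R => expR (- s^-1) * s^-1 ^+ j)).
    near=> s; rewrite /flat ifT//; near: s; exact: lt_nbhsr.
  have tn : t != 0 by rewrite gt_eqF.
  have d1 : is_derive t (1 : R) (fun s : R => s^-1) (- t ^- 2).
    have := @is_deriveV R id t 1 1 tn (is_derive_id t 1).
    by rewrite -[_ *: _]mulrC mul1r.
  have d2 : is_derive t (1 : R) (fun s : R => expR (- s^-1)) (expR (- t^-1) * t ^- 2).
    apply: (@is_derive1_comp _ expR (fun s => - s^-1)).
    by have := is_deriveN d1; rewrite opprK.
  have d3 := is_deriveX j d1.
  have E : (fun s : R => expR (- s^-1) * s^-1 ^+ j) =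
      (fun s => expR (- s^-1)) * (fun s => s^-1) ^+ j.
    by apply/funext => s; rewrite exprfctE.
  rewrite E; apply: is_derive_eq (is_deriveM d2 d3) _; rewrite exprfctE /flat t0 /GRing.scale/= -exprVn.
  move: (expR (- t^-1)) (t^-1) => e s {E d1 d2 d3}.
  case: j => [|j]; first by rewrite !expr0 !mul0r !mulr0 mul1r !subr0 add0r.
  by rewrite /= !exprS; ring.
- rewrite !flat_le0// mulr0 subr0.
  apply: (@is_derive_quadratic _ _ _ _ (j.+2%:R ^+ j.+2)) => h.
  by rewrite add0r [flat j 0]flat_le0// mulr0 !subr0 ger0_norm ?flat_ge0// flat_quad.
Unshelve. all: by end_near. Qed.

Lemma flat_continuous j : continuous (flat j).
Proof.
move=> t; apply: differentiable_continuous; apply/derivable1_diffP.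
by have [] := is_derive_flat j t.
Qed.

End flat.

(** * Smooth approximations of indicators of boxes *)

Section smooth_bump.
Context (R : realType) (N : nat).
Implicit Types (f g : 'rV[R]_N -> R).

(** The algebra generated by the functions [flat j] of affine expressions in one coordinate. It is
    stable under partial derivatives, since [flat j] differentiates into [flat j.+2] and
    [flat j.+1], so smoothness follows by induction on the list of derivatives. *)
Inductive flatalg : ('rV[R]_N -> R) -> Prop :=
| flatalg_cst c : flatalg (fun=> c)
| flatalg_base j i s c : flatalg (fun x => flat j (s * x ord0 i + c))
| flatalg_add f g : flatalg f -> flatalg g -> flatalg (fun x => f x + g x)
| flatalg_mul f g : flatalg f -> flatalg g -> flatalg (fun x => f x * g x).

Lemma flatalg_partial f : flatalg f -> C1 f /\ forall i, flatalg (partial i f).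
Proof.
elim=> [c|j k s c|{}f g ff [Cf pf] fg [Cg pg]|{}f g ff [Cf pf] fg [Cg pg]].
- split=> [|i]; first exact: C1_cst.
  rewrite (_ : partial i _ = fun=> 0); first exact: flatalg_cst.
  by apply/funext => x; rewrite partial_cst.
- have [Ck dk] := @C1_coord R N k.
  have dlin t : is_derive t (1 : R) (fun t => s * t + c) s.
    have h1 := is_deriveD (is_deriveZ s (is_derive_id t (1 : R))) (is_derive_cst c t (1 : R)).
    by apply: is_derive_eq h1 _; rewrite /GRing.scale/= mulr1 addr0.
  have dG t : is_derive t (1 : R) (fun t => flat j (s * t + c))
      ((flat j.+2 (s * t + c) - j%:R * flat j.+1 (s * t + c)) * s).
    exact: (@is_derive1_comp _ (flat j) (fun t => s * t + c) t _ _ (is_derive_flat j _) (dlin t)).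
  have cl : continuous (fun t : R => s * t + c).
    move=> t; apply: (@continuousD _ _ _ (fun t => s * t) (fun=> c)); last exact: cst_continuous.
    apply: (@continuousM _ _ (fun=> s) id); [exact: cst_continuous|exact: cvg_id].
  have cf m : continuous (fun t : R => flat m (s * t + c)).
    by move=> t; apply: (@continuous_comp _ _ _ (fun t => s * t + c)); [exact: cl|exact: flat_continuous].
  have cG : continuous (fun t : R => (flat j.+2 (s * t + c) - j%:R * flat j.+1 (s * t + c)) * s).
    move=> t; apply: (@continuousM _ _ (fun t => flat j.+2 (s * t + c) - j%:R * flat j.+1 (s * t + c)) (fun=> s)); last exact: cst_continuous.
    apply: (@continuousB _ _ _ (fun t => flat j.+2 (s * t + c))); first exact: cf.
    apply: (@continuousM _ _ (fun=> j%:R) (fun t => flat j.+1 (s * t + c))); [exact: cst_continuous|exact: cf].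
  split=> [|i]; first exact: (C1_comp Ck dG cG).
  rewrite (_ : partial i _ = fun x => (flat j.+2 (s * x ord0 k + c) +
     (- j%:R) * flat j.+1 (s * x ord0 k + c)) * (s * (i == k)%:R)).
    apply: flatalg_mul; last exact: flatalg_cst.
    apply: flatalg_add; first exact: flatalg_base.
    by apply: flatalg_mul; [exact: flatalg_cst|exact: flatalg_base].
  apply/funext => x; rewrite (partial_comp i x Ck dG cG) dk; ring.
- split=> [|i]; first exact: C1D.
  rewrite (_ : partial i _ = fun x => partial i f x + partial i g x); first exact: flatalg_add.
  by apply/funext => x; exact: partialD.
- split=> [|i]; first exact: C1M.
  rewrite (_ : partial i _ = fun x => f x * partial i g x + g x * partial i f x).
    by apply: flatalg_add; apply: flatalg_mul.
  by apply/funext => x; exact: partialM.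
Qed.

Lemma flatalg_smooth f : flatalg f -> smooth f.
Proof.
move=> ff s; suff : flatalg (foldr (@partial R N) f s) by case/flatalg_partial.
by elim: s => //= i s /flatalg_partial[_]; exact.
Qed.

Lemma flatalg_prod (I : Type) (r : seq I) (F : I -> 'rV[R]_N -> R) :
  (forall k, flatalg (F k)) -> flatalg (fun x => \prod_(k <- r) F k x).
Proof.
move=> h; elim: r => [|k r IH].
  by under eq_fun do rewrite big_nil; exact: flatalg_cst.
by under eq_fun do rewrite big_cons; exact: flatalg_mul.
Qed.

Lemma box_closed (a b : 'rV[R]_N) : closed (box a b).
Proof.
have -> : box a b = \bigcap_(i in [set: 'I_N])
    ((fun x : 'rV[R]_N => x ord0 i) @^-1` `[a ord0 i, b ord0 i]).
  apply/seteqP; split => x /= h i; last by have := h i I; rewrite /= in_itv.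
  by move=> _; rewrite /= in_itv/=; exact: h.
apply: closed_bigI => i _; apply: closed_comp; last exact: interval_closed.
by move=> x _; exact: coord_continuous.
Qed.

Lemma box_compact (a b : 'rV[R]_N) : compact (box a b).
Proof.
apply: bounded_closed_compact; last exact: box_closed.
exists (`|a| + `|b|); split; first exact: num_real.
move=> M hM x h; apply: (le_trans _ (ltW hM)); apply: sup_norm_le; first by rewrite addr_ge0.
move=> i; have /andP[h1 h2] := h i.
have := sup_norm_coord a i; have := sup_norm_coord b i; rewrite !ler_norml => /andP[_ hb] /andP[ha _].
have := normr_ge0 a; have := normr_ge0 b; move=> *; apply/andP; split; lra.
Qed.

(** The inner affine expressions are positive exactly up to [1 / (n+1)] outside the box, and the
    outer factor [n+1] sends the arguments to infinity on the box. So these functions tend pointwise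
    to the indicator of the closed box. *)
Definition bump_box (a b : 'rV[R]_N) (n : nat) (x : 'rV[R]_N) : R :=
  \prod_(i < N) (flat 0 (n.+1%:R * (n.+1%:R * (x ord0 i - a ord0 i) + 1)) *
    flat 0 (n.+1%:R * (n.+1%:R * (b ord0 i - x ord0 i) + 1))).

Lemma bump_box_flatalg a b n : flatalg (bump_box a b n).
Proof.
apply: flatalg_prod => i; apply: flatalg_mul.
  rewrite (_ : (fun x => _) = fun x => flat 0 (n.+1%:R ^+ 2 * (x : 'rV[R]_N) ord0 i +
    n.+1%:R * (1 - n.+1%:R * a ord0 i))); first exact: flatalg_base.
  by apply/funext => x; congr (flat 0 _); ring.
rewrite (_ : (fun x => _) = fun x => flat 0 (- n.+1%:R ^+ 2 * (x : 'rV[R]_N) ord0 i +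
  n.+1%:R * (1 + n.+1%:R * b ord0 i))); first exact: flatalg_base.
by apply/funext => x; congr (flat 0 _); ring.
Qed.

Lemma bump_box_itv a b n x : 0 <= bump_box a b n x <= 1.
Proof.
rewrite /bump_box; elim/big_rec: _ => [|i y _ /andP[y0 y1]]; first by rewrite ler01 lexx.
rewrite !mulr_ge0 ?flat_ge0//= mulr_ile1 ?mulr_ge0 ?flat_ge0//.
by rewrite mulr_ile1 ?flat_ge0 ?flat_le1.
Qed.

Lemma bump_box_supp a b n x : bump_box a b n x != 0 ->
  box (a - const_mx n.+1%:R^-1) (b + const_mx n.+1%:R^-1) x.
Proof.
have n0 : 0 < n.+1%:R :> R by rewrite ltr0n.
move=> h i; have : flat 0 (n.+1%:R * (n.+1%:R * (x ord0 i - a ord0 i) + 1)) *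
    flat 0 (n.+1%:R * (n.+1%:R * (b ord0 i - x ord0 i) + 1)) != 0.
  by apply: contra h => /eqP h; rewrite /bump_box (bigD1 i)//= h mul0r.
rewrite mulf_eq0 negb_or => /andP[].
have key (y z : R) : flat 0 (n.+1%:R * (n.+1%:R * (y - z) + 1)) != 0 -> z - n.+1%:R^-1 <= y.
  apply: contraR; rewrite -ltNge => hy; rewrite flat_le0// mulr_ge0_le0 ?ltW//.
  have : n.+1%:R * (y - z) < n.+1%:R * (- n.+1%:R^-1).
    by rewrite ltr_pM2l//; move: (n.+1%:R^-1) hy => m; lra.
  by rewrite mulrN mulfV ?gt_eqF//; lra.
move=> /key h1 /key h2; rewrite !mxE; move: (n.+1%:R^-1) h1 h2 => m h1 h2; apply/andP; split; lra.
Qed.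

Lemma flat_cvg1 (y : nat -> R) : (forall n, n.+1%:R <= y n) -> flat 0 (y n) @[n --> \oo] --> (1 : R).
Proof.
move=> hy; apply/cvgrPdist_lt => e e0.
have := @cvg_harmonic R => /cvgrPdist_lt/(_ _ e0)[n0 _ hn]; exists n0 => // n /hn.
have y0 : 0 < y n by apply: lt_le_trans (hy n); rewrite ltr0n.
have yn : (y n)^-1 <= n.+1%:R^-1 by rewrite lef_pV2 ?posrE ?ltr0n.
rewrite /harmonic sub0r normrN ger0_norm ?invr_ge0// => h.
rewrite /= /flat y0 mulr1 ger0_norm; last first.
  by rewrite subr_ge0 -expR0 ler_expR oppr_le0 invr_ge0 ltW.
by have := expR_ge1Dx (- (y n)^-1); have := le_lt_trans yn h; lra.
Qed.

Lemma cvg_prod_fin (I : Type) (r : seq I) (F : I -> nat -> R) (l : I -> R) :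
  (forall i, F i n @[n --> \oo] --> l i) ->
  \prod_(i <- r) F i n @[n --> \oo] --> \prod_(i <- r) l i.
Proof.
move=> h; elim: r => [|i r IH].
  by rewrite big_nil; under eq_cvg do rewrite big_nil; exact: cvg_cst.
by rewrite big_cons; under eq_cvg do rewrite big_cons; exact: cvgM.
Qed.

Lemma bump_box_in a b x : box a b x -> bump_box a b n x @[n --> \oo] --> (1 : R).
Proof.
move=> bx; have -> : (1 : R) = \prod_(i < N) (1 * 1) by rewrite big1// => i _; rewrite mulr1.
apply: cvg_prod_fin => i; have /andP[h1 h2] := bx i.
have n0 n : 0 < n.+1%:R :> R by rewrite ltr0n.
by apply: cvgM; apply: flat_cvg1 => n; rewrite ler_peMr ?(ltW (n0 n))// lerDr mulr_ge0 ?(ltW (n0 n))// subr_ge0.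
Qed.

Lemma bump_box_out a b x : ~ box a b x -> \forall n \near \oo, bump_box a b n x = 0.
Proof.
move=> bx; have [i hi] : exists i, ~ (a ord0 i <= x ord0 i <= b ord0 i).
  by apply: contrapT => h; apply: bx => i; apply: contrapT => hi; apply: h; exists i.
have key c d : d < c -> \forall n \near \oo, flat 0 (n.+1%:R * (n.+1%:R * (d - c) + 1)) = 0 :> R.
  move=> dc; exists (Num.truncn (c - d)^-1) => // n /= hn.
  rewrite flat_le0// mulr_ge0_le0//.
  have h : (c - d)^-1 <= n.+1%:R.
    by apply: ltW; apply: (lt_le_trans (truncnS_gt _)); rewrite ler_nat ltnS.
  have cd : 0 < c - d by rewrite subr_gt0.
  by move: h; rewrite -[_^-1]mul1r ler_pdivrMr//; lra.
have /orP[h|h] : (x ord0 i < a ord0 i) || (b ord0 i < x ord0 i).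
  by rewrite !ltNge -negb_and; apply/negP.
- by apply: filterS (key _ _ h) => n hn; rewrite /bump_box (bigD1 i)//= hn !mul0r.
- by apply: filterS (key _ _ h) => n hn; rewrite /bump_box (bigD1 i)//= hn mulr0 mul0r.
Qed.

End smooth_bump.

(** * Functions with vanishing integral over boxes *)

Section null_on_boxes.
Context (R : realType) (N : nat).
Notation T := (leb_space R N).
Notation mu := (lebesgue_rV R N).
Implicit Types (f : 'rV[R]_N -> R) (a b : 'rV[R]_N).

Lemma ae_inS (D E : set 'rV[R]_N) (P : 'rV[R]_N -> Prop) : D `<=` E -> ae_in E P -> ae_in D P.
Proof. by move=> DE; apply: (@filterS _ (almost_everywhere mu)) => x h /DE. Qed.

Lemma ae_in_imp (D : set 'rV[R]_N) (P Q : 'rV[R]_N -> Prop) :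
  (forall x, D x -> P x -> Q x) -> ae_in D P -> ae_in D Q.
Proof. by move=> PQ; apply: (@filterS _ (almost_everywhere mu)) => x h Dx; apply: PQ => //; exact: h. Qed.

Lemma ae_in_imp2 (D : set 'rV[R]_N) (P P' Q : 'rV[R]_N -> Prop) :
  (forall x, D x -> P x -> P' x -> Q x) -> ae_in D P -> ae_in D P' -> ae_in D Q.
Proof.
move=> PQ; apply: (@filterS2 _ (almost_everywhere mu)) => x h h' Dx; apply: PQ => //; [exact: h|exact: h'].
Qed.

Lemma ae_in_all (D : set 'rV[R]_N) (P : 'rV[R]_N -> Prop) : (forall x, D x -> P x) -> ae_in D P.
Proof. by move=> h; exact: aeW. Qed.

Lemma boxI a b a' b' : box a b `&` box a' b' =
  box (\row_i Num.max (a ord0 i) (a' ord0 i)) (\row_i Num.min (b ord0 i) (b' ord0 i)).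
Proof.
apply/seteqP; split => x.
  move=> [h1 h2] i; have /andP[h3 h4] := h1 i; have /andP[h5 h6] := h2 i.
  by rewrite !mxE ge_max le_min h3 h4 h5 h6.
by move=> h; split => i; have := h i; rewrite !mxE ge_max le_min => /andP[/andP[h1 h2] /andP[h3 h4]]; apply/andP.
Qed.

Lemma outer_box_cover (A : set T) (e : R) : (0 < N)%N -> (mu A < +oo)%E -> 0 < e ->
  exists c d : nat -> 'rV[R]_N,
    A `<=` \bigcup_k box (c k) (d k) /\ (mu (\bigcup_k box (c k) (d k)) <= mu A + e%:E)%E.
Proof.
move=> N0 fA e0.
have e20 : 0 < e / 2 by rewrite divr_gt0.
have fn : lebesgue_outer A \is a fin_num by rewrite ge0_fin_numE// outer_measure_ge0.
have [_ [F [_ AF] <-] ht] := lb_ereal_inf_adherent e20 fn.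
have oo k : (box_weight (F k) < +oo)%E.
  rewrite ltey; apply/eqP => hk; move: ht.
  rewrite (@eseries_pinfty _ _ xpredT k)//; last first.
    by move=> j _; have := @box_weight_ge0 _ _ (F j); case: box_weight.
  by rewrite ltNge leey.
have h k : exists cd : 'rV[R]_N * 'rV[R]_N, [/\ (forall i, cd.1 ord0 i <= cd.2 ord0 i),
     F k `<=` box cd.1 cd.2 &
     ((vol cd.1 cd.2)%:E <= box_weight (F k) + ((e / 2) / 2 ^+ k.+1)%:E)%E].
  have [Fk|Fk] := pselect (F k !=set0); last first.
    exists (0, 0); split => //.
      by move=> x xF; exfalso; apply: Fk; exists x.
    rewrite /vol /= (eq_bigr (fun=> 0)); last by move=> i _; rewrite /= subrr.
    rewrite prodr_const card_ord expr0n gtn_eqF// adde_ge0 ?box_weight_ge0//.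
    by rewrite lee_fin divr_ge0// ltW.
  have [||c [d [cd Fcd H]]] := @box_weight_lt _ _ (F k) ((e / 2) / 2 ^+ k.+1) Fk.
  - by rewrite divr_gt0// exprn_gt0.
  - exact: oo.
  by exists (c, d); split => //; exact: ltW.
have [cd hcd] := choice h.
exists (fun k => (cd k).1), (fun k => (cd k).2); split.
  by move=> x /AF[k _ Fx]; exists k => //; case: (hcd k) => _ + _; exact.
have := @outer_measure_sigma_subadditive R _ (@lebesgue_outer R N) (fun k => box (cd k).1 (cd k).2).
move=> /le_trans; apply.
apply: (@le_trans _ _ (\sum_(0 <= k <oo) (box_weight (F k) + ((e / 2) / 2 ^+ k.+1)%:E))%E).
  apply: lee_nneseries => k *; first exact: outer_measure_ge0.
  by case: (hcd k) => h1 h2 h3; apply: le_trans h3; rewrite -(lebesgue_outer_box h1).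
rewrite nneseriesD; last 2 first.
- by move=> k _ _; exact: box_weight_ge0.
- by move=> k _ _; rewrite lee_fin divr_ge0// ltW.
have h2 : (\sum_(0 <= k <oo) ((e / 2) / 2 ^+ k.+1)%:E <= (e / 2)%:E)%E.
  have := epsilon_trick0 xpredT (ltW e20).
  by under eq_eseriesr do rewrite natrX.
apply: le_trans (leeD (ltW ht) h2) _; rewrite -addeA -EFinD lebE.
by rewrite (_ : e / 2 + e / 2 = e) //; lra.
Qed.

(** Adding one box requires the statement on its intersection with the union, and intersections of
    boxes are boxes: hence the additional [a] and [b], over which the induction is generalized. *)
Lemma box_union_int (Q : set T) f (c d : nat -> 'rV[R]_N) n a b :
  measurable Q -> mu.-integrable Q (EFin \o f) ->
  (forall a b, \int[mu]_(x in Q `&` box a b) f x = 0) ->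
  \int[mu]_(x in (Q `&` box a b) `&` \bigcup_(k < n) box (c k) (d k)) f x = 0.
Proof.
move=> mQ iF h0; elim: n a b => [|n IH] a b.
  by rewrite bigcup_mkord big_ord0 setI0 Rintegral_set0.
have mU m : measurable (\bigcup_(k < m) box (c k) (d k) : set T).
  by apply: bigcup_measurable => k _; exact: measurable_box.
have sub (A : set T) : measurable A -> A `<=` Q -> mu.-integrable A (EFin \o f).
  by move=> mA AQ; exact: integrableS iF.
set X : set T := Q `&` box a b; set F : set T := box (c n) (d n).
set U : set T := \bigcup_(k < n) box (c k) (d k).
have mX : measurable X by apply: measurableI => //; exact: measurable_box.
have mF : measurable F by exact: measurable_box.
have XQ : X `<=` Q by exact: subIsetl.
have -> : X `&` \bigcup_(k < n.+1) box (c k) (d k) = (X `&` F) `|` (X `&` U `\` F).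
  apply/seteqP; split => x.
    move=> [Xx [k /= kn kx]]; have [Fx|Fx] := pselect (F x); first by left.
    right; split => //; split => //; exists k => //=.
    move: kn; rewrite ltnS leq_eqVlt => /orP[/eqP kn|//].
    by exfalso; apply: Fx; rewrite /F -kn.
  move=> [[Xx Fx]|[[Xx [k /= kn kx]] _]]; split => //; first by exists n => /=.
  by exists k => //=; rewrite ltnS ltnW.
have m1 : measurable (X `&` F) by exact: measurableI.
have m2 : measurable (X `&` U) by apply: measurableI => //; exact: mU.
have m3 : measurable (X `&` U `\` F) by exact: measurableD.
rewrite Rintegral_setU//; last 2 first.
- by apply: sub; [exact: measurableU|move=> x [[/XQ]|[[/XQ]]]].
- by apply/disj_setPS => x [[_ Fx] [_]].
have E1 : \int[mu]_(x in X `&` F) f x = 0.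
  by rewrite /X /F -setIA boxI h0.
have E2 : \int[mu]_(x in X `&` F `&` U) f x = 0.
  by rewrite /X /F -[_ `&` _ `&` box (c n) _]setIA boxI; exact: IH.
have E3 : \int[mu]_(x in X `&` U) f x =
    \int[mu]_(x in X `&` F `&` U) f x + \int[mu]_(x in X `&` U `\` F) f x.
  rewrite -Rintegral_setU//.
  - congr (Rintegral _ _ _); apply/seteqP; split => x.
      by move=> [Xx Ux]; have [Fx|Fx] := pselect (F x); [left|right].
    by move=> [[[Xx Fx] Ux]|[[Xx Ux] _]].
  - by apply: measurableI => //; exact: mU.
  - by apply: sub; [apply: measurableU => //; apply: measurableI => //; exact: mU|move=> x [[[/XQ]]|[[/XQ]]]].
  - by apply/disj_setPS => x [[[_ Fx] _] [_]].
by rewrite E1 add0r; move: E3; rewrite E2 add0r => <-; exact: IH.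
Qed.

Lemma Rint_indic_lim (Q D : set T) f (h : nat -> T -> R) : measurable Q -> measurable D ->
  mu.-integrable Q (EFin \o f) -> (forall n, measurable_fun Q (h n)) ->
  (forall n x, `|h n x| <= 1) -> (forall x, h n x @[n --> \oo] --> (\1_D x : R)) ->
  (forall n, \int[mu]_(x in Q) (f x * h n x) = 0) ->
  \int[mu]_(x in Q `&` D) f x = 0.
Proof.
move=> mQ mD iF mh h1 hl h0.
have mf := integ_measurable iF.
have mfh n : measurable_fun Q (fun x => f x * h n x) by exact: measurable_funM.
have -> : \int[mu]_(x in Q `&` D) f x = \int[mu]_(x in Q) (f x * \1_D x).
  rewrite Rintegral_mkcondr; apply: eq_Rintegral => x _.
  by rewrite patchE indicE; case: ifP => _; rewrite ?mulr1 ?mulr0.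
have b n x : `|f x * h n x| <= `|f x| by rewrite normrM ler_piMr.
have H := @dominated_convergence _ _ _ mu Q mQ (fun n => EFin \o (fun x => f x * h n x))
   (EFin \o (fun x => f x * \1_D x)) (EFin \o (fun x => `|f x|))
   (fun n => (measurable_EFinP _ _).2 (mfh n))
   ((measurable_EFinP _ _).2 (measurable_funM mf (@measurable_indic _ _ _ Q D mD))).
have {H} [|//|//|_ _] := H.
- apply: aeW => x Qx; apply: cvg_EFin; first exact: nearW.
  by apply: cvgMr; exact: hl.
- exact: integ_norm.
- by apply: aeW => x n Qx; rewrite /= lee_fin.
have -> : (fun n => (\int[mu]_(x in Q) (EFin \o (fun x => (f x * h n x)%R)) x)%E) = cst 0%E.
  apply/funext => n /=.
  have i1 : mu.-integrable Q (EFin \o (fun x => f x * h n x)).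
    by apply: (integ_dom_all mQ (mfh n) _ (integ_norm iF)) => x _.
  by rewrite [LHS](RintE mQ i1) h0.
move=> H; rewrite /Rintegral.
by have := cvg_unique (@ereal_hausdorff R) H (cvg_cst _); rewrite /= => ->.
Qed.

(** The set where [f > 0] is covered by boxes with excess measure at most [e / L]. The integral over
    the cover vanishes, so the integral over the set is minus the one over the excess, which is at
    most the tail of [|f|] above [L] plus [L] times the excess measure. *)
Lemma null_boxes_le0 a0 b0 f (Q : set T := box a0 b0) : (0 < N)%N ->
  mu.-integrable Q (EFin \o f) ->
  (forall a b, \int[mu]_(x in Q `&` box a b) f x = 0) ->
  ae_in Q (fun x => f x <= 0).
Proof.
move=> N0 iF h0.
have mQ : measurable Q by exact: measurable_box.
have fQ : (mu Q < +oo)%E by apply: compact_leb_fin; exact: box_compact.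
have mf := integ_measurable iF.
pose A : set T := Q `&` [set x | 0 < f x].
have mA : measurable A.
  have := mf mQ `]0, +oo[%classic (measurable_itv _).
  by congr measurable; apply/seteqP; split => x /= [Qx]; rewrite in_itv/= andbT.
have fA : (mu A < +oo)%E by apply: le_lt_trans fQ; apply: leb_le; exact: subIsetl.
have AQ : A `<=` Q by exact: subIsetl.
have iA : mu.-integrable A (EFin \o f) by exact: integrableS iF.
have IA : \int[mu]_(x in A) `|f x| = \int[mu]_(x in A) f x.
  by apply: eq_Rintegral => x; rewrite inE => -[_ /=] /ltW h; rewrite ger0_norm.
have main e : 0 < e -> \int[mu]_(x in A) f x <= e + e.
  move=> e0; have [L L0 hL] := integ_tail mQ iF e0.
  have eL : 0 < e / L by rewrite divr_gt0.
  have [c [d [Acd mcd]]] := outer_box_cover N0 fA eL.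
  set U : set T := \bigcup_k box (c k) (d k) in Acd mcd.
  have mU : measurable U by apply: bigcup_measurable => k _; exact: measurable_box.
  have IU : \int[mu]_(x in Q `&` U) f x = 0.
    have mk k : measurable (\bigcup_(j < k) box (c j) (d j) : set T).
      by apply: bigcup_measurable => j _; exact: measurable_box.
    apply: (@Rint_indic_lim _ _ _ (fun n => \1_(\bigcup_(j < n) box (c j) (d j)))) => //.
    - by move=> n x; rewrite indicE; case: (_ \in _); rewrite ?normr1 ?normr0.
    - move=> x; apply: cvg_near_cst; have [[k _ kx]|nx] := pselect (U x).
        by exists k.+1 => // n /= kn; rewrite !indicE !mem_set//; exists k.
      apply: nearW => n; rewrite /= !indicE !memNset// => -[k _ kx]; apply: nx; by exists k.
    move=> n; transitivity (\int[mu]_(x in Q `&` \bigcup_(j < n) box (c j) (d j)) f x).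
      rewrite Rintegral_mkcondr; apply: eq_Rintegral => x _.
      by rewrite patchE indicE; case: ifP => _; rewrite ?mulr1 ?mulr0.
    rewrite -[X in X `&` _](setIid Q); exact: box_union_int.
  have mD : measurable (Q `&` U `\` A) by apply: measurableD => //; exact: measurableI.
  have DQ : Q `&` U `\` A `<=` Q by move=> x [[]].
  have iD : mu.-integrable (Q `&` U `\` A) (EFin \o f) by exact: integrableS iF.
  have E : \int[mu]_(x in Q `&` U) f x = \int[mu]_(x in A) f x + \int[mu]_(x in Q `&` U `\` A) f x.
    have QU : Q `&` U = A `|` (Q `&` U `\` A).
      apply/seteqP; split => x; last by move=> [Ax|[]//]; split; [exact: AQ|exact: Acd].
      by move=> h; have [Ax|Ax] := pselect (A x); [left|right].
    rewrite {1}QU Rintegral_setU//.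
    - by rewrite -QU; apply: integrableS iF => //; exact: measurableI.
    - by apply/disj_setPS => x [Ax [_]].
  have muD : fine (mu (Q `&` U `\` A)) <= e / L.
    have h : (mu (Q `&` U `\` A) <= (e / L)%:E)%E.
      have AQU : A `<=` Q `&` U by move=> x Ax; split; [exact: AQ|exact: Acd].
      have fQU : (mu (Q `&` U) < +oo)%E by apply: le_lt_trans fQ; apply: leb_le; exact: subIsetl.
      rewrite measureD//; last exact: measurableI.
      rewrite [_ `&` A]setIC (setIidl AQU) leeBlDl; last by rewrite ge0_fin_numE.
      by apply: le_trans mcd; apply: leb_le; exact: subIsetr.
    by rewrite -lee_fin fineK// ge0_fin_numE//; apply: le_lt_trans h _; exact: ltry.
  have hD : - (\int[mu]_(x in Q `&` U `\` A) f x) <= \int[mu]_(x in Q) (`|f x| - Num.min `|f x| L)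
       + L * fine (mu (Q `&` U `\` A)).
    have mt : mu.-integrable Q (EFin \o (fun x => `|f x| - Num.min `|f x| L)).
      apply: integB => //; first exact: integ_norm.
      apply: (integ_dom_all mQ _ _ (integ_norm iF)).
        apply: measurable_minr; first exact: (measurableT_comp (@normr_measurable R setT) mf).
        exact: measurable_cst.
      move=> x _; rewrite ger0_norm; last by rewrite le_min normr_ge0 ltW.
      by rewrite ge_min lexx.
    apply: (@le_trans _ _ (\int[mu]_(x in Q `&` U `\` A) ((`|f x| - Num.min `|f x| L) + L))).
      rewrite -mulN1r -RintegralZl//; apply: le_Rintegral => //.
      - exact: integZ.
      - apply: integD => //; first by apply: integrableS mt.
        apply: cb_int => //; last exact: cb_cst.
        by apply: le_lt_trans fQ; exact: leb_le.
      move=> x _; rewrite mulN1r; have := ler_norm (- f x); rewrite normrN => h.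
      apply: (le_trans h); rewrite -addrA lerDl addrC subr_ge0 ge_min lexx orbT//.
    rewrite RintegralD//; last 2 first.
    - by apply: integrableS mt.
    - apply: cb_int => //; last exact: cb_cst.
      by apply: le_lt_trans fQ; exact: leb_le.
    rewrite Rintegral_cst// lerD2r; apply: Rint_subset => // x.
    by rewrite subr_ge0 ge_min lexx.
  have hL2 : L * fine (mu (Q `&` U `\` A)) <= e by rewrite mulrC -ler_pdivlMr.
  by move: E hL hD hL2; rewrite IU; do 3 move: (Rintegral _ _ _); move=> *; lra.
have I0 : \int[mu]_(x in A) `|f x| = 0.
  apply/eqP; rewrite eq_le Rintegral_ge0// andbT IA; apply/ler_addgt0Pr => e e0.
  have e20 : 0 < e / 2 by rewrite divr_gt0.
  by have := main _ e20; lra.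
have : (\int[mu]_(x in A) `|(EFin \o f) x| = 0)%E.
  have := RintE mA (integ_norm iA).
  by rewrite I0 => E; exact: E.
have me : measurable_fun A (EFin \o f) by apply: measurable_int iA.
move=> /(ae_eq_integral_abs mu mA me); apply: filterS => x h Qx.
rewrite leNgt; apply/negP => fx.
by have := h (conj Qx fx); rewrite /= => -[f0]; rewrite f0 ltxx in fx.
Qed.

Lemma null_boxes a0 b0 f (Q : set T := box a0 b0) : (0 < N)%N ->
  mu.-integrable Q (EFin \o f) ->
  (forall a b, \int[mu]_(x in Q `&` box a b) f x = 0) ->
  ae_in Q (fun x => f x = 0).
Proof.
move=> N0 iF h0.
have mQ : measurable Q by exact: measurable_box.
have h1 := null_boxes_le0 N0 iF h0.
have h2 : ae_in Q (fun x => - f x <= 0).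
  apply: null_boxes_le0 => //; first exact: integN.
  move=> a b; have mQb : measurable (Q `&` box a b) by apply: measurableI => //; exact: measurable_box.
  have iQb : mu.-integrable (Q `&` box a b) (EFin \o f) by apply: integrableS iF => //; exact: subIsetl.
  under eq_Rintegral do rewrite -mulN1r.
  by rewrite RintegralZl// h0 mulr0.
apply: (ae_in_imp2 _ h1 h2) => x Qx h3 h4; apply/eqP; rewrite eq_le h3/=.
by move: h4; rewrite oppr_le0.
Qed.

(** Countably many balls suffice, with rational centres and radii [1 / (n+1)]. *)
Lemma ae_local (Om : set 'rV[R]_N) (P : 'rV[R]_N -> Prop) :
  (forall x, Om x -> exists2 r, 0 < r & ae_in (ball x r) P) -> ae_in Om P.
Proof.
move=> h.
pose B (k : 'rV[rat]_N * nat) : set 'rV[R]_N :=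
  ball (map_mx ratr k.1 : 'rV[R]_N) k.2.+1%:R^-1.
pose Z (n : nat) : set 'rV[R]_N := if (unpickle n : option ('rV[rat]_N * nat)) is Some k then
  if `[< ae_in (B k) P >] then [set x | B k x /\ ~ P x] else set0 else set0.
have nZ n : mu.-negligible (Z n : set T).
  rewrite /Z; case: unpickle => [k|]; last exact: negligible_set0.
  case: ifPn => [/asboolP [S [mS S0 hS]]|_]; last exact: negligible_set0.
  by exists S; split => // x [Bx Px]; apply: hS => /(_ Bx).
have [S [mS S0 hS]] := negligible_bigcup nZ.
exists S; split => // x /= /not_implyP[Ox Px]; apply: hS.
have [r r0 hr] := h x Ox.
pose n := Num.truncn (2 / r).
have n0 : 0 < n.+1%:R^-1 :> R by rewrite invr_gt0 ltr0n.
have nr : n.+1%:R^-1 < r / 2.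
  rewrite -[r / 2]invrK ltf_pV2 ?posrE ?invr_gt0 ?divr_gt0 ?ltr0n//.
  by rewrite invf_div; exact: truncnS_gt.
have [c hc] : exists c : 'rV[rat]_N, forall i, `|x ord0 i - ratr (c ord0 i)| < n.+1%:R^-1.
  have H i : exists q : rat, `|x ord0 i - ratr q| < n.+1%:R^-1.
    have [|q] := @rat_in_itvoo R (x ord0 i - n.+1%:R^-1) (x ord0 i + n.+1%:R^-1).
      by rewrite ltrBlDr -addrA ltrDl addr_gt0.
    rewrite in_itv/= => /andP[h1 h2]; exists q; rewrite ltr_norml.
    by move: (n.+1%:R^-1) h1 h2 => m h1 h2; apply/andP; split; lra.
  have [c hc] := choice H; exists (\row_i c i) => i; rewrite mxE; exact: hc.
have Bx : B (c, n) x.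
  rewrite /B /= -ball_normE /=; apply: sup_norm_lt => // i; rewrite !mxE distrC; exact: hc.
have BS : B (c, n) `<=` ball x r.
  move=> y; rewrite -!ball_normE /= => hy.
  move: Bx; rewrite /B -ball_normE /= => Bx.
  rewrite -(subrK (map_mx ratr c) x) -addrA; apply: (le_lt_trans (ler_normD _ _)).
  move: Bx hy nr; rewrite /B -ball_normE /= distrC; move: (n.+1%:R^-1) `|_| `|_| => m s t; lra.
exists (pickle (c, n)) => //; rewrite /Z pickleK ifT//.
by apply/asboolP; exact: ae_inS BS hr.
Qed.

(** Testing with smooth approximations of indicators shows that the difference of the two gradients
    has integral zero over every small box. *)
Lemma weak_grad_unique (Om : set 'rV[R]_N) f V V' : (0 < N)%N -> open Om ->
  weak_grad Om f V -> weak_grad Om f V' -> ae_in Om (fun x => V x = V' x).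
Proof.
move=> N0 oO [_ iV hV] [_ iV' hV'].
suff H i : ae_in Om (fun x => V x ord0 i - V' x ord0 i = 0).
  have : \forall x \ae mu, forall i, Om x -> V x ord0 i - V' x ord0 i = 0.
    by apply: filter_forall => i; exact: H.
  apply: (@filterS _ (almost_everywhere mu)) => x hx Ox; apply/rowP => i; apply/eqP; rewrite -subr_eq0; apply/eqP; exact: hx.
apply: ae_local => x Ox.
have [r r0 hr] : exists2 r, 0 < r & ball x r `<=` Om.
  have := open_nbhs_nbhs (conj oO Ox); by rewrite -nbhs_ballE => -[r r0 hr]; exists r.
(* The box [Q] of half-side [s], enlarged by [s] in every direction, still lies in the ball of
   radius [r = 4 s]. *)
pose s := r / 4; have s0 : 0 < s by rewrite divr_gt0.
exists s => //; pose a0 := x - const_mx s; pose b0 := x + const_mx s.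
have sub1 : ball x s `<=` box a0 b0.
  move=> y; rewrite -ball_normE/= => /ltW h j; have := le_trans (sup_norm_coord (x - y) j) h.
  by rewrite !mxE ler_norml => /andP[h1 h2]; apply/andP; split; lra.
have sub2 : box (a0 - const_mx s) (b0 + const_mx s) `<=` Om.
  move=> y h; apply: hr; rewrite -ball_normE/=; apply: sup_norm_lt => // j.
  have := h j; rewrite !mxE ltr_norml /s => /andP[h1 h2]; apply/andP; split; lra.
pose Q : set T := box a0 b0; pose K : set T := box (a0 - const_mx s) (b0 + const_mx s).
have QK : Q `<=` K.
  move=> y h j; have := h j; rewrite !mxE => /andP[h1 h2]; apply/andP; split; lra.
have cK : compact (K : set 'rV[R]_N) by exact: box_compact.
have mK : measurable K by exact: measurable_box.
have mQ : measurable Q by exact: measurable_box.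
pose g y := V y ord0 i - V' y ord0 i.
have iK : mu.-integrable K (EFin \o g).
  by apply: integB => //; [exact: (iV i _ cK sub2)|exact: (iV' i _ cK sub2)].
have iQ : mu.-integrable Q (EFin \o g) by exact: integrableS iK.
have mO : measurable (Om : set T) by exact: leb_open.
have test (phi : 'rV[R]_N -> R) : smooth phi -> (forall y, phi y != 0 -> K y) ->
    \int[mu]_(x in K) (g x * phi x) = 0.
  move=> sp pK.
  have cphi : closure [set y | phi y != 0] `<=` K.
    by rewrite [X in _ `<=` X](closure_id K).1; [apply: closure_subset => y /pK|exact: box_closed].
  have cp : continuous phi := C1_cont (sp [::]).
  have cpt : compact (closure [set y | phi y != 0]).
    by apply: subclosed_compact cK cphi; exact: closed_closure.
  have sOm : supported_in Om phi by split => //; exact: subset_trans cphi sub2.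
  have [M M0 hM] := supp_bounded cp cpt (@supp_out0 _ _ phi).
  have ig (W : 'rV[R]_N -> R) : lintegrable K W -> lintegrable K (fun x => W x * phi x).
    move=> iW; apply: (@integ_dom_all _ _ _ _ _ mK _ (fun x => M * `|W x|)).
    - by apply: measurable_funM; [exact: integ_measurable iW|exact: leb_continuous].
    - by move=> y _; rewrite normrM mulrC ler_wpM2r.
    - by apply: integZ => //; exact: integ_norm.
  have E (W : 'rV[R]_N -> 'rV[R]_N) : lintegrable K (fun x => W x ord0 i) ->
      (\int[mu]_(x in Om) (W x ord0 i * phi x)%:E = (\int[mu]_(x in K) (W x ord0 i * phi x))%:E)%E.
    move=> iW; rewrite -(RintE mK (ig _ iW)) (integral_mkcond (Om : set T)) (integral_mkcond K).
    apply: eq_integral => y _; rewrite !patchE.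
    have [Ky|Ky] := pselect (K y); first by rewrite !mem_set//; exact: sub2.
    have -> : phi y = 0 by apply: contrapT => /eqP/pK.
    by rewrite mulr0; case: ifP; case: ifP.
  have /eqP := hV phi i sp sOm; rewrite (hV' phi i sp sOm) (E _ (iV i _ cK sub2)) (E _ (iV' i _ cK sub2)).
  rewrite eqe_opp => /eqP[] EE.
  under eq_Rintegral do rewrite mulrBl.
  rewrite RintegralB ?EE ?subrr//; first exact: (ig _ (iV i _ cK sub2)).
  exact: (ig _ (iV' i _ cK sub2)).
suff : ae_in Q (fun y => g y = 0) by exact: ae_inS sub1.
apply: null_boxes => // a b; rewrite boxI.
set a' := \row_i _; set b' := \row_i _.
have Qab : box a' b' `<=` Q by rewrite /a' /b' -boxI; exact: subIsetl.
have mab : measurable (box a' b' : set T) by exact: measurable_box.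
(* From index [m] on, the bumps are supported within distance [s] of the box, hence in [K]. *)
pose m := Num.truncn s^-1.
have ms n : (m + n).+1%:R^-1 <= s.
  rewrite -[s]invrK lef_pV2 ?posrE ?invr_gt0 ?ltr0n//.
  by apply/ltW/(lt_le_trans (truncnS_gt _)); rewrite ler_nat ltnS leq_addr.
have -> : box a' b' = K `&` box a' b' by rewrite setIidr//; exact: subset_trans QK.
have sb n := flatalg_smooth (bump_box_flatalg a' b' (m + n)).
apply: (@Rint_indic_lim _ _ _ (fun n => bump_box a' b' (m + n))) => //.
- by move=> n; apply: leb_continuous => //; exact: C1_cont (sb n [::]).
- by move=> n y; have /andP[h1 h2] := bump_box_itv a' b' (m + n) y; rewrite ger0_norm.
- move=> y; have [By|By] := pselect (box a' b' y).
    rewrite indicE mem_set//; have := bump_box_in By.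
    rewrite -(cvg_shiftn m) (_ : (fun n => bump_box a' b' (m + n) y) = fun n => bump_box a' b' (n + m) y)//.
    by apply/funext => n; rewrite addnC.
  rewrite indicE memNset//; apply: cvg_near_cst; have := bump_box_out By.
  by move=> [k _ hk]; exists k => // n /= kn; apply: hk; exact: leq_trans (leq_addl _ _).
move=> n; apply: test => // y /bump_box_supp h j.
have := ms n; move: h => /(_ j); rewrite !mxE; move: ((m + n).+1%:R^-1) => t.
have : a0 ord0 j <= Num.max (a0 ord0 j) (a ord0 j) by rewrite le_max lexx.
have : Num.min (b0 ord0 j) (b ord0 j) <= b0 ord0 j by rewrite ge_min lexx.
rewrite !mxE => h1 h2 /andP[h3 h4] h5; apply/andP; split; lra.
Qed.
End null_on_boxes.

(** * Geometry of the boundary *)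

Section projection.
Context (R : realType) (N : nat).
Implicit Types (x y : 'rV[R]_N).

Lemma enorm_col' (i : 'I_N) x : enorm (col' i x) <= enorm x.
Proof.
rewrite /enorm ler_sqrt; last by rewrite dotvE sumr_ge0// => j _; rewrite -expr2 sqr_ge0.
rewrite !dotvE (bigD1_ord i)//= [leRHS]addrC -[leLHS]addr0 lerD//; last by rewrite -expr2 sqr_ge0.
by apply: ler_sum => j _; rewrite !mxE.
Qed.

Lemma box_weight_diam (i : 'I_N) (Q : 'M[R]_N) (F : set 'rV[R]_N) r : Q *m Q^T = 1%:M ->
  (((2 ^+ N.-1)^-1)%:E * box_weight [set col' i (x *m Q) | x in F] <= diam_weight N.-1 r F)%E.
Proof.
move=> QQ; have p0 : 0 < 2 ^+ N.-1 :> R by rewrite exprn_gt0.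
rewrite /diam_weight; case: ifPn => [/eqP ->|/set0P[x0 Fx0]].
  by rewrite image_set0 /box_weight eqxx mule0.
apply: le_ereal_inf_tmp => _ [d [d0 _ hd] <-].
rewrite lee_pdivrMl// -EFinM -exprMn.
pose c := col' i (x0 *m Q).
apply: le_trans (@box_weight_le _ _ _ (c - const_mx d) (c + const_mx d) _ _) _.
- by move=> j; rewrite !mxE lerD2l ge0_cp.
- move=> _ [x Fx <-] j; have := enorm_coord (col' i ((x - x0) *m Q)) j.
  move=> /le_trans/(_ (enorm_col' _ _)); rewrite (enorm_orth _ QQ) => /le_trans/(_ (hd _ _ Fx Fx0)).
  have -> : col' i ((x - x0) *m Q) ord0 j = col' i (x *m Q) ord0 j - c ord0 j.
    by rewrite /c mulmxBl !mxE.
  rewrite [(c - _) _ _]mxE [(c + _) _ _]mxE [(- const_mx d) _ _]mxE !mxE ler_norml => /andP[h1 h2].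
  by apply/andP; split; lra.
rewrite lee_fin /vol (eq_bigr (fun=> 2 * d)); first by rewrite prodr_const card_ord.
by move=> j _; rewrite !mxE; ring.
Qed.

(* A set of diameter [d] projects into a cube of side [2 d]. *)
Lemma hausdorff_proj (i : 'I_N) (Q : 'M[R]_N) (A : set 'rV[R]_N) : Q *m Q^T = 1%:M ->
  (((2 ^+ N.-1)^-1)%:E * lebesgue_outer [set col' i (x *m Q) | x in A] <=
    hausdorff_outer N.-1 A)%E.
Proof.
move=> QQ; apply: le_trans (hausdorff_ub _ _ ltr01).
have p0 : 0 < 2 ^+ N.-1 :> R by rewrite exprn_gt0.
apply: le_ereal_inf_tmp => _ [F [_ AF] <-].
apply: (@le_trans _ _ (\sum_(0 <= k <oo) (((2 ^+ N.-1)^-1)%:E *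
    box_weight [set col' i (x *m Q) | x in F k])%E)%E); last first.
  apply: lee_nneseries => k *; last exact: box_weight_diam.
  by rewrite mule_ge0 ?box_weight_ge0// lee_fin invr_ge0 ltW.
rewrite nneseriesZl; last by move=> *; exact: box_weight_ge0.
apply: lee_wpmul2l; first by rewrite lee_fin invr_ge0 ltW.
apply: lebesgue_outer_le => _ [x Ax <-]; have [k _ Fx] := AF x Ax.
by exists k => //; exists x.
Qed.

End projection.

Section boundary.
Context (R : realType) (N : nat).
Notation mu := (lebesgue_rV R N).
Implicit Types (x y : 'rV[R]_N) (Om : set 'rV[R]_N).

Lemma closed_boundary Om : closed (boundary Om).
Proof.
rewrite /boundary setDE; apply: closedI; first exact: closed_closure.
by apply: open_closedC; exact: open_interior.
Qed.

Lemma compact_boundary Om : bounded_set Om -> compact (boundary Om).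
Proof.
move=> bO; apply: bounded_closed_compact; last exact: closed_boundary.
have [M [Mr hM]] := bO.
exists (M + 1); split; first by rewrite realD// real1.
move=> K hK x [clx _].
have [y [Oy]] := clx _ (nbhsx_ballx x _ (ltac:(exact: (ltr01 : 0 < 1 :> R)))).
rewrite -ball_normE/= => xy.
have My : `|y| <= K - 1 by apply: hM => //; rewrite ltrBrDr.
by rewrite -(subrK y x); apply: (le_trans (ler_normD _ _)); move: xy My; lra.
Qed.

Lemma boundary_notin Om y : open Om -> boundary Om y -> ~ Om y.
Proof. by move=> oO [_] + Oy; apply; exact: open_nbhs_nbhs. Qed.

(* In the graph chart the region above (below) the graph contains a cone with
   vertex at each boundary point, and the graph projects onto a neighbourhood. *)
Section chart.
Variables (Om : set 'rV[R]_N) (x0 : 'rV[R]_N) (Q : 'M[R]_N) (i : 'I_N).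
Variables (gam : 'rV[R]_N.-1 -> R) (L r : R).
Hypotheses (oO : open Om) (QQ : Q *m Q^T = 1%:M) (r0 : 0 < r) (L0 : 0 <= L).
Hypothesis gamL : forall y z : 'rV[R]_N.-1, `|gam y - gam z| <= L * enorm (y - z).
Hypothesis chart : forall x, enorm (x - x0) < r ->
  (Om x <-> gam (col' i (x *m Q)) < (x *m Q) ord0 i).

(** Height over the graph: within the chart it is positive exactly on [Om], and it is Lipschitz with
    constant [1 + L]. *)
Let hgt x := (x *m Q) ord0 i - gam (col' i (x *m Q)).

Let hgtB x y : `|hgt x - hgt y| <= (1 + L) * enorm (x - y).
Proof.
have -> : hgt x - hgt y = ((x - y) *m Q) ord0 i - (gam (col' i (x *m Q)) - gam (col' i (y *m Q))).
  by rewrite /hgt mulmxBl [in RHS]mxE [(- (y *m Q)) _ _]mxE; ring.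
apply: (le_trans (ler_normB _ _)); rewrite mulrDl mul1r lerD//.
  by rewrite -(enorm_orth (x - y) QQ); exact: enorm_coord.
apply: (le_trans (gamL _ _)); rewrite ler_wpM2l// -(enorm_orth (x - y) QQ) mulmxBl.
apply: le_trans (enorm_col' i _); rewrite le_eqVlt; apply/orP; left; apply/eqP; congr enorm.
by apply/rowP => j; rewrite !mxE.
Qed.

Let hgtE x : enorm (x - x0) < r -> Om x <-> 0 < hgt x.
Proof. by move=> /chart ->; rewrite subr_gt0. Qed.

Lemma chart_boundary y : enorm (y - x0) < r -> boundary Om y -> hgt y = 0.
Proof.
move=> yr By; apply/eqP; rewrite eq_le; apply/andP; split.
  by rewrite leNgt; apply/negP => /(hgtE yr); exact: boundary_notin By.
case: By => cly _; rewrite leNgt; apply/negP => h.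
(* Within sup-norm distance [e] of [y] one stays in the chart and the height stays negative, so [Om]
   is not met. The factor [2 * N.+1] passes from the sup norm to the Euclidean one with room to
   spare. *)
pose e := Num.min (- hgt y / (1 + L) / (2 * N.+1%:R)) ((r - enorm (y - x0)) / (2 * N.+1%:R)).
have L1 : 0 < 1 + L by rewrite ltr_pwDl.
have N1 : 0 < 2 * N.+1%:R :> R by rewrite mulr_gt0// ltr0n.
have e0 : 0 < e by rewrite lt_min !divr_gt0 ?oppr_gt0 ?subr_gt0.
have [x [Ox]] := cly _ (nbhsx_ballx y e e0).
rewrite -ball_normE/= => xy.
have d1 : enorm (x - y) * 2 <= e * (2 * N.+1%:R).
  rewrite mulrA mulrAC ler_wpM2r// mulrC; apply: (le_trans (enorm_le_sup _)).
  by rewrite distrC ler_pM ?ler_nat// ltW.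
have d2 : e * (2 * N.+1%:R) <= - hgt y / (1 + L) by rewrite -ler_pdivlMr// ge_min lexx.
have d3 : e * (2 * N.+1%:R) <= r - enorm (y - x0) by rewrite -ler_pdivlMr// ge_min lexx orbT.
have := enorm_ge0 (x - y) => en0.
have xr : enorm (x - x0) < r.
  rewrite -(subrK y x) -addrA; apply: (le_lt_trans (enormD _ _)).
  have h1 := le_trans d1 d3; have : 0 < e * (2 * N.+1%:R) by rewrite mulr_gt0.
  by move: h1 d3 yr; move: (e * _) => t; lra.
have hx := (hgtE xr).1 Ox.
have := hgtB x y; rewrite ler_norml => /andP[_ h2].
have : (1 + L) * (enorm (x - y) * 2) <= - hgt y.
  by rewrite mulrC -ler_pdivlMr//; exact: le_trans d1 d2.
by move: h2; rewrite mulrA; move: ((1 + L) * enorm (x - y)) => t; lra.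
Qed.

Let ei : 'rV[R]_N := evec R i *m Q^T.

Let hgt_vert y t : hgt (y + t *: ei) = hgt y + t.
Proof.
rewrite /hgt mulmxDl -scalemxAl -mulmxA (mulmx1C QQ) mulmx1.
have -> : col' i (y *m Q + t *: evec R i) = col' i (y *m Q).
  by apply/rowP => j; rewrite !mxE eqxx [lift _ _ == _]eq_sym (negPf (neq_lift _ _)) mulr0 addr0.
by rewrite [(y *m Q + _) _ _]mxE [X in _ + X - _]mxE [evec _ _ _ _]mxE !eqxx mulr1; ring.
Qed.

Let enorm_vert t : enorm (t *: ei) = `|t|.
Proof.
have QQ' : Q^T *m Q^T^T = 1%:M by rewrite trmxK; exact: mulmx1C.
rewrite enormZ /ei (enorm_orth _ QQ') /enorm dotvE (bigD1 i)//= big1.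
  by rewrite !mxE !eqxx mulr1 addr0 sqrtr1 mulr1.
by move=> j /negPf ji; rewrite !mxE ji andbF mulr0.
Qed.

(** The vertical shift by [s] produces height exactly [s], and [|s| = (1 + L) * rho] dominates the
    variation of the height over a ball of radius [rho]. *)
Lemma chart_cone y s rho x : boundary Om y -> enorm (y - x0) < r / 2 ->
  `|s| = (1 + L) * rho -> (2 + L) * rho <= r / 2 -> 0 < rho ->
  enorm (x - (y + s *: ei)) < rho ->
  enorm (x - y) < (2 + L) * rho /\ (Om x <-> 0 < s).
Proof.
move=> By yr hs rr rho0 hx.
have xy : enorm (x - y) < (2 + L) * rho.
  have -> : x - y = (x - (y + s *: ei)) + s *: ei by rewrite opprD addrA subrK.
  by apply: (le_lt_trans (enormD _ _)); rewrite enorm_vert hs; move: hx; lra.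
split => //.
have xr : enorm (x - x0) < r.
  rewrite -(subrK y x) -addrA; apply: (le_lt_trans (enormD _ _)); lra.
have yr2 : enorm (y - x0) < r by have := r0; move: yr; lra.
have := hgtB x (y + s *: ei); rewrite hgt_vert (chart_boundary yr2 By) add0r.
have : (1 + L) * enorm (x - (y + s *: ei)) < (1 + L) * rho by rewrite ltr_pM2l// ltr_pwDl.
move=> h1 /le_lt_trans/(_ h1); rewrite -hs ltr_norml => /andP[h2 h3].
rewrite (hgtE xr); move: h2 h3; case: (ger0P s) => s0; split; lra.
Qed.

Lemma chart_graph y (w : 'rV[R]_N.-1) rho : boundary Om y -> enorm (y - x0) < r / 2 ->
  enorm (w - col' i (y *m Q)) < rho -> (1 + L) * rho <= r / 4 ->
  exists2 x, boundary Om x /\ col' i (x *m Q) = w & enorm (x - y) < (1 + L) * rho.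
Proof.
move=> By yr hw rr.
have yr2 : enorm (y - x0) < r by have := r0; move: yr; lra.
pose X : 'rV[R]_N := \row_j (if unlift i j is Some k then w ord0 k else gam w).
have Xi : X ord0 i = gam w by rewrite mxE unlift_none.
have XC : col' i X = w by apply/rowP => k; rewrite !mxE liftK.
pose x := X *m Q^T.
have xQ : x *m Q = X by rewrite /x -mulmxA (mulmx1C QQ) mulmx1.
have hx : hgt x = 0 by rewrite /hgt xQ XC Xi subrr.
have hy := chart_boundary yr2 By.
have xy : enorm (x - y) < (1 + L) * rho.
  have -> : enorm (x - y) = enorm (X - y *m Q) by rewrite -(enorm_orth _ QQ) mulmxBl xQ.
  have H (v : 'rV[R]_N) : enorm v <= `|v ord0 i| + enorm (col' i v).
    rewrite -[leRHS]ger0_norm ?addr_ge0 ?enorm_ge0// -sqrtr_sqr ler_sqrt ?sqr_ge0//.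
    rewrite dotvE (bigD1_ord i)//= sqrrD.
    have -> : enorm (col' i v) ^+ 2 = \sum_(j < N.-1) v ord0 (lift i j) * v ord0 (lift i j).
      by rewrite enorm_sqr dotvE; apply: eq_bigr => j _; rewrite !mxE.
    rewrite -expr2 real_normK ?num_real// addrAC lerDl mulrn_wge0// mulr_ge0// enorm_ge0//.
  apply: (le_lt_trans (H _)).
  have -> : col' i (X - y *m Q) = w - col' i (y *m Q) by apply/rowP => j; rewrite -XC !mxE.
  have -> : (X - y *m Q) ord0 i = gam w - gam (col' i (y *m Q)).
    by rewrite !mxE unlift_none; move: hy; rewrite /hgt !mxE => /eqP; rewrite subr_eq0 => /eqP ->.
  have := gamL w (col' i (y *m Q)); move: hw (enorm_ge0 (w - col' i (y *m Q))).
  move: (enorm (w - _)) (`|_|) => t u h1 h2 h3; have : L * t <= L * rho by rewrite ler_wpM2l// ltW.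
  lra.
have xr : enorm (x - x0) < 3 / 4 * r.
  by rewrite -(subrK y x) -addrA; apply: (le_lt_trans (enormD _ _)); lra.
exists x => //; split => //; last by rewrite xQ.
have xr2 : enorm (x - x0) < r by have := r0; move: xr; lra.
split; last first.
  by move=> /interior_subset/(hgtE xr2); rewrite hx ltxx.
move=> B; rewrite -nbhs_ballE => -[e e0 eB].
(* Moving up from the graph by [t] enters [Om], so the point is in its closure. *)
pose t := Num.min (e / 2) (r / 8).
have t0 : 0 < t by rewrite lt_min !divr_gt0.
have en : enorm (t *: ei) = t by rewrite enorm_vert gtr0_norm.
exists (x + t *: ei); split.
  apply/hgtE; last by rewrite hgt_vert hx add0r.
  rewrite addrAC; apply: (le_lt_trans (enormD _ _)); rewrite en.
  have : t <= r / 8 by rewrite ge_min lexx orbT.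
  by move: t0 xr r0 => /=; lra.
apply: eB; rewrite -ball_normE/= opprD addrA subrr sub0r normrN.
apply: (le_lt_trans (sup_le_enorm _)); rewrite en.
have : t <= e / 2 by rewrite ge_min lexx.
by move: (e0 : 0 < e) => /=; lra.
Qed.

End chart.

(** Each chart gives constants valid near its centre, and compactness of the boundary leaves a
    single [c], which bounds the admissible radii as well as the densities. *)
Lemma boundary_regular Om : (2 <= N)%N -> bounded_domain Om -> lipschitz_boundary Om ->
  exists2 c : R, 0 < c & forall y r, boundary Om y -> 0 < r <= c ->
  [/\ ((c * r ^+ N)%:E <= mu (ball y r `&` Om))%E,
      ((c * r ^+ N)%:E <= mu (ball y r `\` Om))%E &
      ((c * r ^+ N.-1)%:E <= hausdorff_outer N.-1 (boundary Om `&` ball y r))%E].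
Proof.
move=> N2 [_ oO _ bO] lO.
have N0 : 0 < N%:R :> R by rewrite ltr0n; lia.
pose P (c : R) y := boundary Om y -> forall r, 0 < r <= c ->
  [/\ ((c * r ^+ N)%:E <= mu (ball y r `&` Om))%E,
      ((c * r ^+ N)%:E <= mu (ball y r `\` Om))%E &
      ((c * r ^+ N.-1)%:E <= hausdorff_outer N.-1 (boundary Om `&` ball y r))%E].
have : \forall c \near (0 : R)^'+, boundary Om `<=` P c.
  apply: ((compact_near_coveringP _).1 (compact_boundary bO)) => x0 Bx0.
  have [Q [i [gam [L' [r [QQ r0 gL' ch]]]]]] := lO x0 Bx0.
  pose L := `|L'|; have L0 : 0 <= L by exact: normr_ge0.
  have gL (y z : 'rV[R]_N.-1) : `|gam y - gam z| <= L * enorm (y - z).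
    by apply: (le_trans (gL' y z)); rewrite ler_wpM2r ?enorm_ge0// ler_norm.
  have L2 : 0 < 2 + L by rewrite ltr_pwDl.
  pose k := (2 + L)^-1; have k0 : 0 < k by rewrite invr_gt0.
  (* A Euclidean ball of radius [rho = s * k] fits on either side of the boundary within distance
     [s] of [y]. A cube inside it has side [s * (k / (2 N))], and so has, once the factor of
     [hausdorff_proj] is used up, the box covered by the projection of the graph: hence the two
     powers. *)
  pose c0 := Num.min (r / 4) (Num.min ((k / (2 * N%:R)) ^+ N) ((k / (2 * N%:R)) ^+ N.-1)).
  have kN : 0 < k / (2 * N%:R) by rewrite divr_gt0// mulr_gt0.
  have c00 : 0 < c0 by rewrite !lt_min !exprn_gt0// divr_gt0.
  have r2 : 0 < r / 2 / N.+1%:R by rewrite !divr_gt0// ltr0n.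
  exists (ball x0 (r / 2 / N.+1%:R), [set c | 0 < c < c0]).
    split => /=; first exact: nbhsx_ballx.
    near=> c; apply/andP; split; near: c; [exact: nbhs_right_gt|exact: nbhs_right_lt].
  move=> [y c] /= [+ /andP[c1 c2]]; rewrite -ball_normE/= => hy By s /andP[s0 sc].
  have yr : enorm (y - x0) < r / 2.
    apply: (le_lt_trans (enorm_le_sup _)); rewrite distrC.
    apply: (@le_lt_trans _ _ (N.+1%:R * `|x0 - y|)); first by rewrite ler_wpM2r// ler_nat.
    by rewrite mulrC -ltr_pdivlMr// ltr0n.
  have cr : c < r / 4 by apply: (lt_le_trans c2); rewrite ge_min lexx.
  have ck : c < (k / (2 * N%:R)) ^+ N by apply: (lt_le_trans c2); rewrite !ge_min lexx orbT.
  have ck' : c < (k / (2 * N%:R)) ^+ N.-1 by apply: (lt_le_trans c2); rewrite !ge_min lexx !orbT.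
  pose rho := s * k; have rho0 : 0 < rho by rewrite mulr_gt0.
  have rhoE : (2 + L) * rho = s by rewrite /rho mulrCA mulfV ?mulr1// gt_eqF.
  have Lrho : 0 <= (1 + L) * rho by rewrite mulr_ge0 ?addr_ge0// ltW.
  pose ei := evec R i *m Q^T.
  have volA (z : 'rV[R]_N) (A : set 'rV[R]_N) : (forall x, enorm (x - z) < rho -> A x) ->
      ((c * s ^+ N)%:E <= mu (A : set (leb_space R N)))%E.
    move=> zA; have rN : 0 < rho / (4 * N%:R) by rewrite divr_gt0// mulr_gt0.
    apply: (@le_trans _ _ (mu (cube z (rho / (4 * N%:R))))); last first.
      apply: leb_le => x /(cube_le (ltW rN)) h; apply: zA.
      apply: (le_lt_trans (enorm_le_sup _)).
      apply: (@le_lt_trans _ _ (rho / 4)); last by lra.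
      by move: h; rewrite invfM mulrA ler_pdivlMr// mulrC.
    rewrite leb_cube ?(ltW rN)// lee_fin.
    have -> : 2 * (rho / (4 * N%:R)) = s * (k / (2 * N%:R)) by rewrite /rho; field; rewrite !gt_eqF.
    by rewrite exprMn mulrC ler_wpM2l ?exprn_ge0 ?(ltW s0)// ltW.
  have ballE x : enorm (x - y) < s -> ball y s x.
    by move=> h; rewrite -ball_normE/= distrC; exact: le_lt_trans (sup_le_enorm _) h.
  have cone t x : `|t| = (1 + L) * rho -> enorm (x - (y + t *: ei)) < rho ->
      ball y s x /\ (Om x <-> 0 < t).
    move=> ht hx.
    have [|h1 h2] := chart_cone oO QQ r0 L0 gL ch By yr ht _ rho0 hx.
      by rewrite rhoE; lra.
    by split => //; apply: ballE; rewrite -rhoE.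
  split.
  - apply: (volA (y + ((1 + L) * rho) *: ei)) => x hx.
    have [|h1 h2] := cone _ _ _ hx; first by rewrite ger0_norm.
    by split => //; apply/h2; rewrite mulr_gt0// ltr_pwDl.
  - apply: (volA (y + (- ((1 + L) * rho)) *: ei)) => x hx.
    have [|h1 h2] := cone _ _ _ hx; first by rewrite normrN ger0_norm.
    by split => // /h2; rewrite oppr_gt0 ltNge Lrho.
  - have rN : 0 < rho / (2 * N%:R) by rewrite divr_gt0// mulr_gt0.
    pose w0 := col' i (y *m Q); pose h := rho / (2 * N%:R).
    apply: le_trans (hausdorff_proj i _ QQ).
    apply: (@le_trans _ _ (((2 ^+ N.-1)^-1)%:E * lebesgue_outer (box (w0 - const_mx h) (w0 + const_mx h)))%E).
      rewrite lebesgue_outer_box; last by move=> j; rewrite !mxE lerD2l ge0_cp// ltW.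
      rewrite -EFinM lee_fin /vol (eq_bigr (fun=> 2 * h)); last by move=> j _; rewrite !mxE; ring.
      rewrite prodr_const card_ord -exprVn -exprMn mulrA mulVf// mul1r.
      have -> : h = s * (k / (2 * N%:R)) by rewrite /h /rho; field; rewrite gt_eqF.
      by rewrite exprMn mulrC ler_wpM2l ?exprn_ge0 ?(ltW s0)// ltW.
    apply: lee_wpmul2l; first by rewrite lee_fin invr_ge0 exprn_ge0.
    apply: le_outer_measure => w hw.
    have [||x [Bx xw] xy] := chart_graph (w := w) (rho := rho) oO QQ r0 L0 gL ch By yr.
    + apply: (le_lt_trans (enorm_le_sup _)).
      apply: (@le_lt_trans _ _ (N%:R * h)).
        apply: ler_pM => //; first by rewrite ler_nat leq_pred.
        apply: sup_norm_le; first exact: ltW.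
        move=> j; have := hw j.
        rewrite [(w0 - _) _ _]mxE [(w0 + _) _ _]mxE [(- const_mx h) _ _]mxE ![const_mx _ _ _]mxE.
        rewrite -/w0 [(w - w0) _ _]mxE [(- w0) _ _]mxE ler_norml => /andP[h1 h2].
        by apply/andP; split; lra.
      have -> : N%:R * h = rho / 2 by rewrite /h; field; rewrite gt_eqF.
      by lra.
    + have := rhoE; rewrite mulrDl mulrDl mul1r; lra.
    + exists x => //; split => //; apply: ballE; apply: (lt_trans xy).
      by rewrite -rhoE ltr_pM2r//; lra.
move=> /(filterI (nbhs_right_gt (0 : R))); move=> /filter_ex[c [c0 hc]].
by exists c => // y r By hr; exact: hc.
Unshelve. all: by end_near. Qed.

End boundary.

(** * Sums of integrals over disjoint sets *)

Section disjoint_sum.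
Context d (T : measurableType d) (R : realType) (m : {measure set T -> \bar R}).

Lemma sum_disjoint_integral (I : eqType) (Y : seq I) (B : I -> set T) (D : set T) (f : T -> \bar R) :
  measurable D -> (forall y, measurable (B y)) -> measurable_fun D f ->
  (forall x, (0 <= f x)%E) ->
  pairwise (fun y z => `[< B y `&` B z = set0 >]) Y ->
  (\sum_(y <- Y) \int[m]_(x in D `&` B y) f x <= \int[m]_(x in D) f x)%E.
Proof.
move=> + mB + f0; elim: Y D => [|y Y IH] D mD mf /=; first by rewrite big_nil integral_ge0.
move=> /andP[/allP hy hY]; rewrite big_cons.
have m1 : measurable (D `&` B y) by exact: measurableI.
have m2 : measurable (D `\` B y) by exact: measurableD.
have E : D = (D `&` B y) `|` (D `\` B y) by rewrite setUIDK.
rewrite [X in (_ <= X)%E](_ : _ = \int[m]_(x in D `&` B y) f x + \int[m]_(x in D `\` B y) f x)%E.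
  rewrite leeD2l//; apply: le_trans (IH _ m2 _ hY); last by apply: measurable_funS mf => //; exact: subDsetl.
  rewrite big_seq [X in (_ <= X)%E]big_seq; apply: lee_sum => z Yz.
  have /asboolP Bz := hy _ Yz.
  have -> // : D `&` B z = (D `\` B y) `&` B z.
  apply/seteqP; split => x; last by move=> [[]].
  move=> [Dx Bzx]; split => //; split => // Byx.
  by have : (B y `&` B z) x by []; rewrite Bz.
rewrite -ge0_integral_setU//; first by rewrite -E.
- by rewrite -E.
- by apply/disj_setPS => x [[_ h] [_]].
Qed.

Lemma Rint_sum (D : set T) (I : Type) (r : seq I) (F : I -> T -> R) : measurable D ->
  (forall i, m.-integrable D (EFin \o F i)) ->
  \int[m]_(x in D) (\sum_(i <- r) F i x) = \sum_(i <- r) \int[m]_(x in D) F i x.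
Proof.
move=> mD h; elim: r => [|i r IH].
  under eq_Rintegral do rewrite big_nil.
  by rewrite big_nil Rintegral_cst// mul0r.
under eq_Rintegral do rewrite big_cons.
by rewrite big_cons -IH RintegralD//; exact: integ_sum.
Qed.

Lemma integ_indic (D A : set T) (c : R) : measurable D -> measurable A -> (m A < +oo)%E ->
  m.-integrable D (EFin \o (fun x => c * \1_A x)).
Proof.
move=> mD mA fA; apply: integZ => //; apply/integrableP; split.
  by apply/measurable_EFinP; exact: measurable_indic.
rewrite (eq_integral (fun x => (\1_A x)%:E)); last by move=> x _ /=; rewrite ger0_norm.
rewrite integral_indic//; apply: le_lt_trans fA; apply: le_measure; rewrite ?inE//.
exact: measurableI.
Qed.

Lemma Rint_indic_le (D A : set T) (c : R) : measurable D -> measurable A -> (m A < +oo)%E ->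
  0 <= c -> \int[m]_(x in D) (c * \1_A x) <= c * fine (m A).
Proof.
move=> mD mA fA c0; rewrite RintegralZl//; last first.
  have := @integ_indic D A 1 mD mA fA; by under eq_fun do rewrite mul1r.
rewrite ler_wpM2l// /Rintegral integral_indic// fine_le//.
- by rewrite ge0_fin_numE//; apply: le_lt_trans fA; apply: le_measure; rewrite ?inE//; exact: measurableI.
- by rewrite ge0_fin_numE.
- by apply: le_measure; rewrite ?inE//; exact: measurableI.
Qed.

End disjoint_sum.

Section C1_more.
Context (R : realType) (N : nat).
Notation mu := (lebesgue_rV R N).
Implicit Types (f g v : 'rV[R]_N -> R).

Lemma C1_local f : (forall x : 'rV[R]_N, exists2 g, C1 g & \forall y \near x, f y = g y) -> C1 f.
Proof.
move=> h; have [G hG] := choice (fun x => (let: ex_intro2 g a b := h x in ex_intro _ g (conj a b))).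
have pG i x y : (\forall z \near y, f z = G x z) -> partial i f y = partial i (G x) y.
  by move=> e; apply: near_eq_derive.
apply: (proj1 (@C1_intro R N f (fun i x => partial i (G x) x) _ _ _)).
- move=> x; have [CG e] := hG x.
  have Cx : G x y @[y --> x] --> G x x := @C1_cont _ _ _ CG x.
  rewrite /continuous_at (nbhs_singleton e); apply: cvg_trans Cx.
  by apply: (@near_eq_cvg _ _ (nbhs x) _ (G x) f); apply: filterS e => y ->.
- move=> i x; have [CG e] := hG x.
  apply: near_eq_is_derive (C1_is_derive CG i x).
  by apply: filterS e => y ->.
- move=> i x; have [CG e] := hG x.
  have Cx : partial i (G x) y @[y --> x] --> partial i (G x) x := @C1_partial_cont _ _ _ i CG x.
  apply: cvg_trans Cx; apply: (@near_eq_cvg _ _ (nbhs x) _ (partial i (G x)) (fun y => partial i (G y) y)).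
  apply: filterS (nbhs_interior e) => y hy.
  rewrite -(pG i x y hy); have [CGy ey] := hG y; exact: pG.
Qed.

(** The coordinates are changed one at a time, whence the factor [N]. *)
Lemma C1_lip f (M : R) : C1 f -> (forall i x, `|partial i f x| <= M) ->
  forall x y, `|f x - f y| <= N%:R * M * `|x - y|.
Proof.
move=> Cf hM x y.
pose z k : 'rV[R]_N := \row_j (if (j < k)%N then x ord0 j else y ord0 j).
have z0 : z 0%N = y by apply/rowP => j; rewrite mxE.
have zN : z N = x by apply/rowP => j; rewrite mxE ltn_ord.
have -> : f x - f y = \sum_(0 <= k < N) (f (z k.+1) - f (z k)).
  by rewrite telescope_sumr// z0 zN.
rewrite big_mkord; apply: (le_trans (ler_norm_sum _ _ _)).
apply: (@le_trans _ _ (\sum_(k < N) M * `|x - y|)); last first.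
  by rewrite sumr_const card_ord -[leLHS]mulr_natl mulrA.
apply: ler_sum => k _.
have -> : z k.+1 = (x ord0 k - y ord0 k) *: evec R k + z k.
  apply/rowP => j; rewrite !mxE ltnS leq_eqVlt; have [/val_inj ->|jk] := eqVneq (j : nat) k.
    by rewrite !eqxx ltnn mulr1 subrK.
  by rewrite /= (_ : (j == k) = false) ?mulr0 ?add0r//; apply/negbTE.
have [t _ ->] := C1_mvt k (z k) (x ord0 k - y ord0 k) Cf.
rewrite normrM mulrC ler_pM//.
by have := sup_norm_coord (x - y) k; rewrite !mxE.
Qed.

Lemma partial_out f (y x : 'rV[R]_N) rho i : (forall z, f z != 0 -> `|z - y| < rho) ->
  rho < `|x - y| -> partial i f x = 0.
Proof.
move=> h hx; apply: supp_partial_out => cl.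
have e0 : 0 < `|x - y| - rho by rewrite subr_gt0.
have [z [/= fz]] := cl _ (nbhsx_ballx x _ e0); rewrite -ball_normE/= => xz.
have zy := h _ fz.
by have := ler_normD (x - z) (z - y); rewrite subrKA; move: xz zy; lra.
Qed.

Lemma cb_sum (I : Type) (r : seq I) (F : I -> 'rV[R]_N -> R) : (forall k, cb (F k)) ->
  cb (fun x => \sum_(k <- r) F k x).
Proof.
move=> h; elim: r => [|k r IH].
  by under eq_fun do rewrite big_nil; exact: cb_cst.
by under eq_fun do rewrite big_cons; exact: cbD.
Qed.

End C1_more.

(** * Cutting off near the boundary *)

Section boundary_layer.
Context (R : realType) (N : nat).
Notation T := (leb_space R N).
Notation mu := (lebesgue_rV R N).
Notation HH := (hausdorff_rV R N N.-1).
Implicit Types (x y : 'rV[R]_N) (Om : set 'rV[R]_N).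

(** The factor [4] matches [net_cutoff]: its cutoff differs from [1] only within [4 e] of the points
    of a net on the boundary. *)
Definition layer Om (e : R) : set 'rV[R]_N := Om `&` \bigcup_(y in boundary Om) ball y (4 * e).

Lemma layer_open Om e : open Om -> open (layer Om e).
Proof. by move=> oO; apply: openI => //; apply: bigcup_open => y _; exact: ball_open. Qed.

Lemma bounded_leb_fin Om : bounded_set Om -> (mu (Om : set T) < +oo)%E.
Proof.
move=> [M [Mr hM]]; apply: (@leb_bounded_fin _ _ _ (M + 1)) => x Ox.
by apply: hM => //; rewrite ltrDl.
Qed.

(** Continuity from above: the layers decrease to the empty set, because an open set is disjoint
    from its boundary. *)
Lemma layer_small Om (dl : R) : open Om -> bounded_set Om -> 0 < dl ->
  exists2 e0 : R, 0 < e0 & forall e, 0 < e <= e0 -> (mu (layer Om e : set T) < dl%:E)%E.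
Proof.
move=> oO bO dl0.
pose F n : set T := layer Om n.+1%:R^-1.
have mF n : measurable (F n) by apply: leb_open; exact: layer_open.
have mono e e' : e <= e' -> layer Om e `<=` layer Om e'.
  move=> ee x [Ox [y By xy]]; split => //; exists y => //.
  by apply: le_ball xy; rewrite ler_pM2l.
have F0 : (mu (F 0%N) < +oo)%E.
  by apply: le_lt_trans (bounded_leb_fin bO); apply: leb_le; exact: subIsetl.
have nF : nonincreasing_seq F.
  move=> m n mn; rewrite subsetEset; apply: mono.
  by rewrite lef_pV2 ?posrE ?ltr0n// ler_nat.
have capF : \bigcap_n F n = set0.
  apply/seteqP; split => // x h; have [Ox _] := h 0%N I.
  have := open_nbhs_nbhs (conj oO Ox); rewrite -nbhs_ballE => -[r r0 hr].
  have [n hn] : exists n, 4 * n.+1%:R^-1 < r.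
    exists (Num.truncn (4 / r)); rewrite ltr_pdivrMr ?ltr0n// mulrC -ltr_pdivrMr//.
    exact: truncnS_gt.
  have [_ [y By xy]] := h n I.
  apply: (boundary_notin oO By); apply: hr; apply: ball_sym.
  by apply: le_ball xy; exact: ltW.
have := @nonincreasing_cvg_mu _ _ _ mu F F0 mF (bigcapT_measurable mF) nF.
rewrite capF measure0.
move=> /(_ [set x | (x < dl%:E)%E] (@nbhs_open_ereal_lt R 0 (fun=> dl) dl0)) [n _ hn].
exists n.+1%:R^-1; first by rewrite invr_gt0 ltr0n.
move=> e /andP[e0 en]; apply: le_lt_trans (hn n (leqnn n)).
by apply: leb_le; exact: mono.
Qed.

(** Balls of radius [e / 2] about [e]-separated points are disjoint. *)
Lemma net_count Om (c e : R) (Y : seq 'rV[R]_N) (D : set T) :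
  open Om -> (forall y, y \in Y -> ((c * (e / 2) ^+ N)%:E <= mu (ball y (e / 2) `&` Om))%E) ->
  pairwise (fun y z => e <= `|y - z|) Y -> measurable D ->
  (forall y, y \in Y -> ball y (e / 2) `&` Om `<=` D) ->
  (((size Y)%:R * (c * (e / 2) ^+ N))%:E <= mu D)%E.
Proof.
move=> oO hc pY mD hD.
have mB y : measurable (ball y (e / 2) : set T) by apply: leb_open; exact: ball_open.
have := @sum_disjoint_integral _ _ _ mu _ Y (fun y => ball y (e / 2) : set T) D (cst 1%E) mD mB.
rewrite integral_cst// mul1e => /(_ (measurable_cst _) (fun _ => lee01)) H.
apply: le_trans (H _).
  rewrite (eq_bigr (fun y => mu (D `&` ball y (e / 2)))); last first.
    by move=> y _; rewrite integral_cst ?mul1e//; exact: measurableI.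
  rewrite mulr_natl (_ : _ *+ size Y = \sum_(y <- Y) (c * (e / 2) ^+ N)); last first.
    by rewrite big_const_seq count_predT iter_addr addr0.
  rewrite -sumEFin big_seq [X in (_ <= X)%E]big_seq.
  apply: lee_sum => y Yy; apply: le_trans (hc _ Yy) _; apply: leb_le => x [bx Ox].
  by split => //; exact: (hD _ Yy).
apply: sub_pairwise pY => y z hyz; apply/asboolP/seteqP; split => // x [].
rewrite -!ball_normE/= => h1 h2; exfalso; move: hyz; rewrite leNgt => /negP; apply.
rewrite -(subrK x y) -addrA; apply: (le_lt_trans (ler_normD _ _)).
by rewrite [ltRHS]splitr ltrD// distrC.
Qed.

(** A separated family of maximal size is a net; [net_count] bounds the sizes. *)
Lemma net_exists Om (c e : R) : open Om -> bounded_set Om -> 0 < c -> 0 < e ->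
  (forall y, boundary Om y -> ((c * (e / 2) ^+ N)%:E <= mu (ball y (e / 2) `&` Om))%E) ->
  exists Y : seq 'rV[R]_N, [/\ forall y, y \in Y -> boundary Om y,
    pairwise (fun y z => e <= `|y - z|) Y &
    forall z, boundary Om z -> exists2 y, y \in Y & `|z - y| < e].
Proof.
move=> oO bO c0 e0 hc.
pose P n := `[< exists Y : seq 'rV[R]_N, [/\ size Y = n, forall y, y \in Y -> boundary Om y &
    pairwise (fun y z => e <= `|y - z|) Y] >].
have P0 : exists n, P n by exists 0%N; apply/asboolP; exists [::].
have ce0 : 0 < c * (e / 2) ^+ N by rewrite mulr_gt0// exprn_gt0// divr_gt0.
have fO := bounded_leb_fin bO.
have mO : measurable (Om : set T) by exact: leb_open.
have Pb n : P n -> (n <= Num.truncn (fine (mu (Om : set T)) / (c * (e / 2) ^+ N)))%N.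
  move=> /asboolP[Y [<- hY pY]].
  have := @net_count Om c e Y Om oO (fun y h => hc y (hY y h)) pY mO (fun y _ => @subIsetr _ _ _).
  have -> : mu (Om : set T) = (fine (mu (Om : set T)))%:E by rewrite fineK// ge0_fin_numE.
  rewrite lee_fin -ler_pdivlMr//= => h; rewrite leqNgt; apply/negP => hn.
  have := le_lt_trans h (truncnS_gt _); rewrite ltr_nat ltnS => /leq_trans/(_ (leqnn _)).
  by rewrite leqNgt hn.
case: (ex_maxnP P0 Pb) => n /asboolP[Y [sY hY pY]] nmax.
exists Y; split => // z Bz; apply: contrapT => hz.
have : P n.+1.
  apply/asboolP; exists (z :: Y); split => /=; first by rewrite sY.
    by move=> y; rewrite inE => /orP[/eqP ->//|]; exact: hY.
  rewrite pY andbT; apply/allP => y Yy; rewrite leNgt; apply/negP => h; apply: hz; by exists y.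
by move=> /nmax; rewrite ltnn.
Qed.

Lemma C1_dist_measurable (D : set T) (f psi : 'rV[R]_N -> R) : measurable D -> C1 f -> C1 psi ->
  measurable_fun D (fun x : T => (`|f x - psi x| + enorm (grad f x - grad psi x))%:E).
Proof.
move=> mD Cf Cp; apply/measurable_EFinP; apply: measurable_funD.
  apply: (measurableT_comp (@normr_measurable R setT)).
  by apply: measurable_funB; exact: C1_measurable.
apply: enorm_measurable => i.
rewrite (_ : (fun x => _) = (fun x : T => partial i f x - partial i psi x)); last first.
  by apply/funext => x; rewrite !mxE.
by apply: measurable_funB; apply: leb_continuous => //; exact: C1_partial_cont.
Qed.

(** Within [ep] of the boundary the bumps about the net points sum to at least [1], where the step
    [stp 0 (1 / 2)] has already reached [1]; so the cutoff vanishes there exactly. The gradient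
    bound keeps one term per net point, to be paired with the value of a function at that point. *)
Lemma net_cutoff Om (ep : R) (Y : seq 'rV[R]_N) : 0 < ep ->
  (forall z, boundary Om z -> exists2 y, y \in Y & `|z - y| < ep) ->
  exists kp, [/\ C1 kp, forall x, 0 <= kp x <= 1,
    forall x z, boundary Om z -> `|x - z| < ep -> kp x = 0,
    forall x, (forall y, y \in Y -> 4 * ep <= `|x - y|) -> kp x = 1 &
    forall i x, `|partial i kp x| <= \sum_(y <- Y) (8 / ep) * \1_(cube y (4 * ep)) x].
Proof.
move=> ep0 netY; have hr : 0 <= 2 * ep < 3 * ep by lra.
have [bt hbt] := choice (fun y : 'rV[R]_N => cutoff_exists y hr).
have btC y : C1 (bt y) by case: (hbt y).
have bt01 y x : 0 <= bt y x <= 1 by case: (hbt y).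
have bt1 y x : `|x - y| <= 2 * ep -> bt y x = 1 by case: (hbt y) => _ _ h _ _; exact: h.
have btn y x : bt y x != 0 -> `|x - y| < 3 * ep by case: (hbt y) => _ _ _ h _; exact: h.
have btd y i x : `|partial i (bt y) x| <= 4 / ep.
  by case: (hbt y) => _ _ _ _ /(_ i x); rewrite (_ : 3 * ep - 2 * ep = ep)//; ring.
clear hbt.
pose s x := \sum_(y <- Y) bt y x.
have Cs : C1 s by exact: C1_sum.
have h20 : 0 < 1 / 2 :> R by rewrite divr_gt0.
have dG t : is_derive t (1 : R) (fun t => 1 - stp 0 (1 / 2) t) (- dstp 0 (1 / 2) t).
  have := is_deriveB (is_derive_cst (1 : R) t (1 : R)) (is_derive_stp 0 (1 / 2) t).
  by rewrite sub0r.
have cG : continuous (fun t : R => - dstp 0 (1 / 2) t).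
  by move=> t; apply: continuousN; exact: dstp_continuous.
exists (fun x => 1 - stp 0 (1 / 2) (s x)); split.
- exact: (C1_comp Cs dG cG).
- by move=> x; have /andP[k1 k2] := stp_bound 0 (s x) h20; rewrite subr_ge0 k2 lerBlDr lerDl.
- move=> x z Bz xz; rewrite stp_above ?subrr// add0r (_ : 2 * (1 / 2) = 1); last by field.
  have [y Yy yz] := netY _ Bz.
  rewrite /s (big_rem y)//= bt1 ?lerDl ?sumr_ge0// => [u _|]; first by case/andP: (bt01 u x).
  rewrite -(subrK z x) -addrA; apply: (le_trans (ler_normD _ _)).
  by rewrite mulr_natl mulr2n; apply: lerD; exact: ltW.
- move=> x hx; rewrite stp_below ?subr0 ?(ltW h20)// le_eqVlt; apply/orP; left.
  rewrite /s big_seq big1// => y Yy; apply/eqP; apply: contrapT => /negP/btn xy.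
  by have := le_lt_trans (hx y Yy) xy; rewrite ltr_pM2r// ltr_nat.
- move=> i x; rewrite (partial_comp i x Cs dG cG) normrM normrN.
  apply: (@le_trans _ _ (2 * \sum_(y <- Y) `|partial i (bt y) x|)).
    apply: ler_pM => //; last by rewrite partial_sum//; exact: ler_norm_sum.
    have /andP[k1 k2] := dstp_bound 0 (s x) h20; rewrite ger0_norm//.
    by apply: le_trans k2 _; rewrite invf_div divr1.
  rewrite mulr_sumr; apply: ler_sum => y _.
  have [xy|xy] := ltP `|x - y| (4 * ep).
    rewrite indicE mem_set; last exact: cube_lt.
    by rewrite mulr1 (_ : 8 / ep = 2 * (4 / ep)) ?ler_pM2l//; ring.
  rewrite (@partial_out _ _ _ y x (3 * ep)); first by rewrite normr0 mulr0 mulr_ge0 ?divr_ge0 ?indicE// ltW.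
  + exact: btn.
  + by apply: lt_le_trans xy; rewrite ltr_pM2r// ltr_nat.
Qed.

(** Being [C^1] is a local property: off [Om] a point is either outside the closure or on the
    boundary, near which the cutoff vanishes. *)
Lemma zero_extension Om v kp (ep : R) : open Om -> bounded_set Om -> 0 < ep -> C1 v -> C1 kp ->
  (forall x z, boundary Om z -> `|x - z| < ep -> kp x = 0) ->
  exists chi, [/\ C1 chi, supported_in Om chi, forall x, Om x -> chi x = v x * kp x &
    forall i x, Om x -> partial i chi x = v x * partial i kp x + kp x * partial i v x].
Proof.
move=> oO bO ep0 Cv Ck k0.
pose vk x := v x * kp x; have Cvk : C1 vk by exact: C1M.
pose chi x := if `[< Om x >] then vk x else 0.
have chiO x : Om x -> \forall y \near x, chi y = vk y.
  move=> Ox; have := open_nbhs_nbhs (conj oO Ox); apply: filterS => y Oy.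
  by rewrite /chi asboolT.
have chiN x : ~ Om x -> \forall y \near x, chi y = 0.
  move=> Ox; have [clx|ncl] := pselect (closure Om x).
    have Bx : boundary Om x by split => // /interior_subset.
    have := @nbhsx_ballx _ _ x ep ep0; apply: filterS => y; rewrite -ball_normE/= => xy.
    by rewrite /chi; case: ifP => // _; rewrite /vk (k0 _ x) ?mulr0// distrC.
  have oc : open (~` closure Om) by apply: closed_openC; exact: closed_closure.
  have := open_nbhs_nbhs (conj oc ncl); apply: filterS => y ny.
  by rewrite /chi asboolF// => /subset_closure.
exists chi; split.
- apply: C1_local => x; have [Ox|Ox] := pselect (Om x); first by exists vk => //; exact: chiO.
  by exists (fun=> 0); [exact: C1_cst|exact: chiN].
- split.
    have [B [Br hB]] := bO; apply: (@compact_supp_ball _ _ _ 0 (B + 1)) => x hx.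
    rewrite subr0; apply: hB; first by rewrite ltrDl.
    by move: hx; rewrite /chi; case: asboolP => //; rewrite eqxx.
  move=> x cl; apply: contrapT => Ox.
  by have [y [/eqP + h]] := cl _ (chiN _ Ox); exact.
- by move=> x Ox; exact: nbhs_singleton (chiO _ Ox).
- by move=> i x Ox; rewrite -partialM//; apply: near_eq_derive; exact: chiO.
Qed.

(** A lower Riemann sum: on the ball of radius [rho] about [y], [|v|] is at least [|v y| - L * rho],
    and these balls are disjoint and have surface measure at least [c * rho ^ (N-1)]. *)
Lemma net_trace Om (v : 'rV[R]_N -> R) (c rho L I : R) (Y : seq 'rV[R]_N) : 0 <= L -> 0 < rho -> 0 < c ->
  (forall x y : 'rV[R]_N, `|v x - v y| <= L * `|x - y|) -> continuous v ->
  (\int[HH]_(x in boundary Om) `|v x|%:E <= I%:E)%E ->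
  (forall y, y \in Y -> ((c * rho ^+ N.-1)%:E <=
    hausdorff_outer N.-1 (boundary Om `&` ball y rho))%E) ->
  pairwise (fun y z => 2 * rho <= `|y - z|) Y ->
  \sum_(y <- Y) `|v y| * (c * rho ^+ N.-1) <= I + L * rho * ((size Y)%:R * (c * rho ^+ N.-1)).
Proof.
move=> L0 rho0 c0 lip cv hI reg pY.
have mbY : measurable (boundary Om : set (caratheodory_type (@hausdorff_outer R N N.-1))).
  by apply: cara_closed; [exact: hausdorff_outer_half|exact: closed_boundary].
have mB y : measurable (ball y rho : set (caratheodory_type (@hausdorff_outer R N N.-1))).
  by apply: cara_open; [exact: hausdorff_outer_half|exact: ball_open].
have mv : measurable_fun (boundary Om : set (caratheodory_type (@hausdorff_outer R N N.-1)))
    (fun x => `|v x|%:E).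
  apply/measurable_EFinP; apply: cara_continuous => //; first exact: hausdorff_outer_half.
  by move=> x; apply: (@continuous_comp _ _ _ v Num.norm); [exact: cv|exact: norm_continuous].
have posE x : (0 <= `|v x|%:E)%E by rewrite lee_fin.
have := @sum_disjoint_integral _ _ _ HH _ Y (fun y => ball y rho) (boundary Om)
  (fun x => `|v x|%:E) mbY mB mv posE.
move=> H.
suff : \sum_(y <- Y) (`|v y| - L * rho) * (c * rho ^+ N.-1) <= I.
  under eq_bigr do rewrite mulrBl.
  rewrite sumrB big_const_seq count_predT iter_addr addr0 -[X in _ - X]mulr_natl mulrCA.
  by rewrite lerBlDr.
rewrite -lee_fin; apply: le_trans hI; rewrite -sumEFin; apply: le_trans (H _); last first.
  apply: sub_pairwise pY => y z hyz; apply/asboolP/seteqP; split => // x [].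
  rewrite -!ball_normE/= => b1 b2; move: hyz; rewrite leNgt => /negP; apply.
  rewrite -(subrK x y) -addrA; apply: (le_lt_trans (ler_normD _ _)).
  by rewrite mulr_natl mulr2n; apply: ltrD => //; rewrite distrC.
rewrite big_seq [X in (_ <= X)%E]big_seq; apply: lee_sum => y Yy.
have [neg|/ltW pos] := leP (`|v y| - L * rho) 0.
  apply: (@le_trans _ _ 0%E); last by apply: integral_ge0.
  by rewrite lee_fin mulr_le0_ge0// mulr_ge0 ?exprn_ge0// ltW.
have mBy : measurable ((boundary Om `&` ball y rho) : set (caratheodory_type (@hausdorff_outer R N N.-1))).
  by apply: measurableI.
apply: (@le_trans _ _ ((`|v y| - L * rho)%:E * HH (boundary Om `&` ball y rho))%E).
  by rewrite EFinM; apply: lee_wpmul2l; [rewrite lee_fin|exact: reg].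
rewrite -(integral_cst HH mBy); apply: ge0_le_integral.
- exact: mBy.
- by move=> x _; rewrite /= lee_fin.
- exact: measurable_cst.
- by apply: measurable_funS mv => //; exact: subIsetl.
- move=> x [_ bx]; rewrite /= lee_fin lerBlDr -{1}(subrK (v x) (v y)) addrC.
  apply: (le_trans (ler_normD _ _)); rewrite lerD2l; apply: (le_trans (lip _ _)).
  by rewrite ler_wpM2l//; move: bx; rewrite -ball_normE/= => /ltW.
Qed.

Lemma layer_arith (M K c L I e D n W : R) : 0 < K / c -> 0 <= M -> 0 <= L ->
  I < e -> n <= D -> D * (M + 9 * L * (K / c) + 1) < K / c * e -> 0 <= D ->
  W <= I + L * n -> M * D + (K / c * W + K / c * (8 * L) * n) < 2 * (K / c) * e.
Proof.
move=> k0 M0 L0 Ie nD hD D0 hW; move: (K / c) k0 hD => k k0 hD.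
have h1 : k * W <= k * I + k * (L * n) by rewrite -mulrDr ler_wpM2l// ltW.
have h2 : k * I < k * e by rewrite ltr_pM2l.
have h3 : k * (L * n) <= k * (L * D) by rewrite !ler_wpM2l// ltW.
have e1 : k * (8 * L) * n = 8 * (k * (L * n)) by ring.
have e2 : D * (M + 9 * L * k + 1) = M * D + 9 * (k * (L * D)) + D by ring.
rewrite e2 in hD; rewrite e1 -mulrA; lra.
Qed.

(* The gradient of the cutoff has size [1/ep] on a layer of width [ep]; by the
   lower bound on the surface measure, its integral against [v] is controlled by
   the surface integral of [v]. *)
Lemma C1_boundary_approx Om : (2 <= N)%N -> bounded_domain Om -> lipschitz_boundary Om ->
  exists2 C : R, 0 < C & forall v e, C1 v -> compact (closure [set x | v x != 0]) -> 0 < e ->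
    (\int[HH]_(x in boundary Om) `|v x|%:E < e%:E)%E ->
    exists chi, [/\ C1 chi, supported_in Om chi & (W11_dist Om v (grad v) chi < (C * e)%:E)%E].
Proof.
move=> N2 hO lO; have [c c0 reg] := boundary_regular N2 hO lO.
have [_ oO _ bO] := hO.
have N0 : 0 < N%:R :> R by rewrite ltr0n; lia.
have NE : N.-1.+1 = N by lia.
(* A cube of half-side [4 ep = 8 rho] has volume [(16 rho) ^ N], and each net point contributes at
   most [8 N / ep = 4 N / rho] to the gradient; their product is [K * rho ^ (N-1)]. *)
have [K KE] : exists K : R, K = 4 * N%:R * 16 ^+ N by eexists.
have K0 : 0 < K by rewrite KE !mulr_gt0// exprn_gt0.
have Kc0 : 0 < K / c by rewrite divr_gt0.
exists (2 * (K / c)); first by rewrite mulr_gt0.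
move=> v e Cv cv e0 hI.
have mO : measurable (Om : set T) by exact: leb_open.
have cbv : cb (fun x => `|v x| + \sum_i `|partial i v x|).
  apply: cbD; first by apply: cb_norm; exact: C1c_cb.
  by apply: cb_sum => i; apply: cb_norm; exact: C1c_cb_partial.
have [M M0 hM] : exists2 M, 0 <= M & forall x, `|v x| + \sum_i `|partial i v x| <= M.
  have [_ [M hM]] := cbv; exists `|M|; first exact: normr_ge0.
  by move=> x; apply: le_trans (le_trans (hM x) (ler_norm M)); exact: ler_norm.
have hMi i x : `|partial i v x| <= M.
  apply: le_trans (hM x); rewrite (bigD1 i)//= addrCA lerDl addr_ge0// sumr_ge0//.
have lip := C1_lip Cv hMi.
have [L LE] : exists L, L = N%:R * M by eexists.
have L0 : 0 <= L by rewrite LE mulr_ge0// ltW.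
rewrite -LE in lip.
have Q0 : 0 < M + 9 * L * (K / c) + 1 by rewrite ltr_wpDl// addr_ge0// mulr_ge0//; [exact: mulr_ge0|exact: ltW].
(* So small that all the terms proportional to the measure of the layer together stay below
   [K / c * e], as used in [layer_arith]. *)
have dl0 : 0 < K / c * e / (M + 9 * L * (K / c) + 1) by rewrite divr_gt0// mulr_gt0.
have [e1 e10 he1] := layer_small oO bO dl0.
have [ep [ep0 hD epc]] : exists ep : R, [/\ 0 < ep,
    (mu (layer Om ep : set T) < (K / c * e / (M + 9 * L * (K / c) + 1))%:E)%E & ep <= c].
  exists (Num.min e1 c); have h : 0 < Num.min e1 c by rewrite lt_min e10.
  by rewrite h ge_min lexx orbT; split => //; apply: he1; rewrite h/= ge_min lexx.
have [rho epE] : exists rho, ep = 2 * rho by exists (ep / 2); field.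
have rho0 : 0 < rho by lra.
have rhoc : 0 < rho <= c by rewrite rho0/=; lra.
have rhoE : ep / 2 = rho by rewrite epE; field.
have [Y [YB pY netY]] : exists Y : seq 'rV[R]_N, [/\ forall y, y \in Y -> boundary Om y,
    pairwise (fun y z => ep <= `|y - z|) Y &
    forall z, boundary Om z -> exists2 y, y \in Y & `|z - y| < ep].
  apply: (@net_exists Om c ep oO bO c0 ep0) => y By.
  by rewrite rhoE; have [] := reg y rho By rhoc.
have [kp [Ck kp01 kp_in kp_out kpd]] := net_cutoff ep0 netY.
have [chi [Cchi suppchi chiE dchi]] := zero_extension oO bO ep0 Cv Ck kp_in.
exists chi; split => //.
have [muD muDE0] : exists muD : R, muD = fine (mu (layer Om ep : set T)) by eexists.
have mD : measurable (layer Om ep : set T) by apply: leb_open; exact: layer_open.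
have fD : (mu (layer Om ep : set T) < +oo)%E by apply: lt_trans hD _; exact: ltry.
have muDE : mu (layer Om ep : set T) = muD%:E by rewrite muDE0 fineK// ge0_fin_numE.
have muD0 : 0 <= muD by rewrite muDE0 fine_ge0.
have muDlt : muD * (M + 9 * L * (K / c) + 1) < K / c * e by rewrite -ltr_pdivlMr// -lte_fin -muDE.
have cnt : (size Y)%:R * (c * rho ^+ N) <= muD.
  rewrite -lee_fin -muDE -rhoE; apply: (@net_count Om c ep Y _ oO) => //; rewrite ?rhoE.
  - by move=> y /YB By; have [] := reg y rho By rhoc.
  - move=> y /YB By x [bx Ox]; split => //; exists y => //.
    by apply: le_ball bx; rewrite epE mulrA ler_peMl ?(ltW rho0)// -natrM ler1n.
have rhoN : rho ^+ N = rho * rho ^+ N.-1 by rewrite -exprS NE.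
have [I IE0] : exists I : R, I = fine (\int[HH]_(x in boundary Om) `|v x|%:E)%E by eexists.
have IE : (\int[HH]_(x in boundary Om) `|v x|%:E = I%:E)%E.
  rewrite IE0 fineK// ge0_fin_numE; first by apply: lt_trans hI _; exact: ltry.
  by apply: integral_ge0 => x _; rewrite lee_fin.
have Ie : I < e by rewrite -lte_fin -IE.
have sumv : \sum_(y <- Y) `|v y| * (c * rho ^+ N.-1) <= I + L * ((size Y)%:R * (c * rho ^+ N)).
  have -> : L * ((size Y)%:R * (c * rho ^+ N)) = L * rho * ((size Y)%:R * (c * rho ^+ N.-1)).
    by rewrite rhoN; ring.
  apply: (@net_trace Om) => //; first exact: C1_cont; first by rewrite IE.
    by move=> y /YB By; have [] := reg y rho By rhoc.
  by rewrite -epE.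
(* The bound for [|v|] on the cube about [y], by the Lipschitz constant, times the slope of the
   cutoff. *)
pose mm y := (`|v y| + 4 * ep * L) * (8 * N%:R / ep).
have q1 : 0 <= 4 * ep * L by rewrite mulr_ge0 ?mulr_ge0// ltW.
have mm0 y : 0 <= mm y by rewrite mulr_ge0 ?addr_ge0 ?divr_ge0 ?mulr_ge0// ltW.
have mZ y : measurable (cube y (4 * ep) : set T) by exact: measurable_cube.
have fZ y : (mu (cube y (4 * ep) : set T) < +oo)%E by exact: leb_cube_fin.
pose g x := M * \1_(layer Om ep) x + \sum_(y <- Y) mm y * \1_(cube y (4 * ep)) x.
have pt x : Om x -> `|v x - chi x| + enorm (grad v x - grad chi x) <= g x.
  move=> Ox; have /andP[k1 k2] := kp01 x; have k3 : 0 <= 1 - kp x by rewrite subr_ge0.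
  have h1 : `|v x - chi x| = (1 - kp x) * `|v x|.
    by rewrite chiE// -{1}[v x]mulr1 -mulrBr normrM mulrC ger0_norm.
  have h3 : enorm (grad v x - grad chi x) <= (1 - kp x) * (\sum_i `|partial i v x|) +
      \sum_i `|v x| * `|partial i kp x|.
    apply: (le_trans (enorm_le_sum _)); rewrite mulr_sumr -big_split/=; apply: ler_sum => i _.
    rewrite !mxE dchi//.
    have -> : partial i v x - (v x * partial i kp x + kp x * partial i v x) =
      (1 - kp x) * partial i v x - v x * partial i kp x by ring.
    by apply: (le_trans (ler_normB _ _)); rewrite !normrM lerD2r ger0_norm.
  have h4 : \sum_(i < N) `|v x| * `|partial i kp x| <= \sum_(y <- Y) mm y * \1_(cube y (4 * ep)) x.
    apply: (@le_trans _ _ (\sum_(i < N) \sum_(y <- Y) (`|v y| + 4 * ep * L) * (8 / ep) * \1_(cube y (4 * ep)) x)).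
      apply: ler_sum => i _; apply: (@le_trans _ _ (`|v x| * (\sum_(y <- Y) 8 / ep * \1_(cube y (4 * ep)) x))).
        by rewrite ler_wpM2l.
      rewrite mulr_sumr; apply: ler_sum => y _; rewrite indicE.
      case: (boolP (x \in cube y (4 * ep))) => [|_]; last by rewrite !mulr0.
      rewrite inE !mulr1 => hx; rewrite ler_wpM2r ?divr_ge0 ?(ltW ep0)//.
      rewrite -{1}(subrK (v y) (v x)) addrC; apply: (le_trans (ler_normD _ _)); rewrite lerD2l.
      apply: (le_trans (lip _ _)); rewrite mulrC ler_wpM2r//; apply: cube_le => //.
      by rewrite mulr_ge0// ltW.
    rewrite exchange_big/=; apply: ler_sum => y _.
    rewrite sumr_const card_ord -[leLHS]mulr_natl /mm le_eqVlt; apply/orP; left; apply/eqP.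
    by ring.
  have h5 : (1 - kp x) * (`|v x| + \sum_i `|partial i v x|) <= M * \1_(layer Om ep) x.
    have [Dx|Dx] := pselect (layer Om ep x).
      rewrite indicE mem_set// mulr1; apply: le_trans (hM x); rewrite ler_piMl//.
        by rewrite addr_ge0// sumr_ge0.
      by rewrite lerBlDr lerDl.
    rewrite indicE memNset// mulr0 kp_out ?subrr ?mul0r// => y Yy.
    rewrite leNgt; apply/negP => xy; apply: Dx; split => //.
    by exists y; [exact: YB|rewrite -ball_normE/= distrC].
  rewrite h1 /g; apply: le_trans (lerD h5 h4); rewrite mulrDr -addrA lerD2l; exact: h3.
have gint : mu.-integrable (Om : set T) (EFin \o g).
  apply: integD => //; first exact: integ_indic.
  by apply: integ_sum => // y; exact: integ_indic.
have gle : \int[mu]_(x in Om) g x <= M * muD + \sum_(y <- Y) mm y * (8 * ep) ^+ N.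
  rewrite RintegralD//; last 2 first.
  - exact: integ_indic.
  - by apply: integ_sum => // y; exact: integ_indic.
  apply: lerD; first by rewrite muDE0; exact: Rint_indic_le.
  rewrite Rint_sum//; last by move=> y; exact: integ_indic.
  apply: ler_sum => y _; apply: le_trans (Rint_indic_le mO (mZ y) (fZ y) (mm0 y)) _.
  rewrite leb_cube/=; last by rewrite mulr_ge0// ltW.
  by rewrite (_ : 2 * (4 * ep) = 8 * ep)//; ring.
apply: (@le_lt_trans _ _ (\int[mu]_(x in Om) g x)%:E).
  rewrite -RintE// /W11_dist; apply: ge0_le_integral.
  - exact: mO.
  - by move=> x _; rewrite lee_fin addr_ge0// enorm_ge0.
  - exact: C1_dist_measurable.
  - by apply: measurable_int gint.
  - by move=> x Ox; rewrite lee_fin; exact: pt.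
rewrite lte_fin; apply: (le_lt_trans gle).
have -> : \sum_(y <- Y) mm y * (8 * ep) ^+ N =
   K / c * (\sum_(y <- Y) `|v y| * (c * rho ^+ N.-1)) + K / c * (8 * L) * ((size Y)%:R * (c * rho ^+ N)).
  rewrite (eq_bigr (fun y => K / c * (`|v y| * (c * rho ^+ N.-1)) + K / c * (8 * L) * (c * rho ^+ N))).
    rewrite big_split/= -mulr_sumr big_const_seq count_predT iter_addr addr0 -[_ *+ size Y]mulr_natl.
    by congr (_ + _); ring.
  move=> y _; rewrite /mm epE (_ : 8 * (2 * rho) = 16 * rho); last by ring.
  rewrite exprMn rhoN KE; move: (rho ^+ N.-1) (16 ^+ N) => s1 s2.
  by field; rewrite !gt_eqF.
exact: (layer_arith Kc0 M0 L0 Ie cnt muDlt muD0 sumv).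
Qed.

End boundary_layer.

(** * Truncations above the trace have zero boundary values *)

Section zero_trace_truncation.
Context (R : realType) (N : nat).
Notation T := (leb_space R N).
Notation mu := (lebesgue_rV R N).
Notation HH := (hausdorff_rV R N N.-1).
Notation TH := (caratheodory_type (@hausdorff_outer R N N.-1)).
Implicit Types (Om : set 'rV[R]_N) (f g u v : 'rV[R]_N -> R) (V Du : 'rV[R]_N -> 'rV[R]_N).

Lemma W11_dist_le Om f V v (G : 'rV[R]_N -> R) : measurable (Om : set T) -> W11i Om f V ->
  C1 v -> lintegrable Om G ->
  (forall x, Om x -> `|f x - v x| + enorm (V x - grad v x) <= G x) ->
  (W11_dist Om f V v <= (\int[mu]_(x in Om) G x)%:E)%E.
Proof.
move=> mO hW Cv iG hG; rewrite -(RintE mO iG) /W11_dist; apply: ge0_le_integral.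
- exact: mO.
- by move=> x _; rewrite lee_fin addr_ge0// enorm_ge0.
- apply/measurable_EFinP; apply: measurable_funD.
    apply: (measurableT_comp (@normr_measurable R setT)).
    by apply: measurable_funB; [exact: integ_measurable hW.1|exact: C1_measurable].
  apply: enorm_measurable => i.
  rewrite (_ : (fun x => _) = (fun x : T => V x ord0 i - partial i v x)); last first.
    by apply/funext => x; rewrite !mxE.
  apply: measurable_funB; first exact: integ_measurable (hW.2 i).
  by apply: leb_continuous => //; exact: C1_partial_cont.
- exact: measurable_int iG.
- by move=> x Ox; rewrite lee_fin; exact: hG.
Qed.

Lemma W11_dist_triangle Om f V v chi (e e' : R) : measurable (Om : set T) -> W11i Om f V ->
  C1 v -> compact (closure [set x | v x != 0]) -> (mu (Om : set T) < +oo)%E ->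
  C1 chi -> (W11_dist Om f V v < e%:E)%E -> (W11_dist Om v (grad v) chi < e'%:E)%E ->
  (W11_dist Om f V chi < (e + e')%:E)%E.
Proof.
move=> mO hW Cv cv fO Cc h1 h2.
have hv : W11i Om v (grad v).
  split; first by apply: cb_int => //; exact: C1c_cb.
  by move=> i; under eq_fun do rewrite mxE; apply: cb_int => //; exact: C1c_cb_partial.
have [a1 a2 a3 a4] := W11_distP mO hW Cv h1; have [b1 b2 b3 b4] := W11_distP mO hv Cc h2.
have ia := integD mO (integ_norm a1) a2; have ib := integD mO (integ_norm b1) b2.
have hA := Rint_fin_lt mO ia h1; have hB := Rint_fin_lt mO ib h2.
have iab := integD mO ia ib.
apply: (@le_lt_trans _ _ (\int[mu]_(x in Om) ((`|f x - v x| + enorm (V x - grad v x)) +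
    (`|v x - chi x| + enorm (grad v x - grad chi x))))%:E); last first.
  by rewrite lte_fin (RintegralD mO ia ib) ltrD.
apply: (W11_dist_le mO hW Cc iab) => x _; rewrite addrACA; apply: lerD.
  by rewrite -{1}(subrK (v x) (f x)) -addrA; exact: ler_normD.
by rewrite -{1}(subrK (grad v x) (V x)) -addrA; exact: enormD.
Qed.

Lemma zero_trace_of_trace0 Om f V : (2 <= N)%N -> bounded_domain Om -> lipschitz_boundary Om ->
  W11i Om f V ->
  (forall e, 0 < e -> exists v, [/\ C1 v, compact (closure [set x | v x != 0]),
     (W11_dist Om f V v < e%:E)%E & (\int[HH]_(x in boundary Om) `|v x|%:E < e%:E)%E]) ->
  zero_trace Om f V.
Proof.
move=> N2 hO lO hW happ; split => // e e0.
have [C C0 hC] := C1_boundary_approx N2 hO lO.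
have [_ oO _ bO] := hO.
have e10 : 0 < e / (1 + C) by rewrite divr_gt0// addr_gt0.
have [v [Cv cv h1 h2]] := happ _ e10.
have [chi [Cc sc h3]] := hC v _ Cv cv e10 h2.
exists chi; split => //.
have -> : e = e / (1 + C) + C * (e / (1 + C)) by field; rewrite gt_eqF// addr_gt0.
by apply: (W11_dist_triangle _ hW Cv cv _ Cc h1 h3); [exact: leb_open|exact: bounded_leb_fin].
Qed.

(** Here [dd] stands for [|dF u - dF psi|], [d] for [|u - psi|] and [D] for [|Du|]. Below the height
    [L] the Lipschitz bound of [dF] is used, above it its boundedness; this avoids a product of two
    functions that are merely integrable. *)
Lemma trunc_pointwise (A B L d dd D : R) : 0 <= A -> 0 <= B -> 0 <= D -> 0 < L ->
  0 <= dd -> dd <= B * d -> dd <= 2 * A ->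
  dd * D <= B * L * d + 2 * A * (D - Num.min D L).
Proof.
move=> A0 B0 D0 L0 dd0 h1 h2.
have [DL|/ltW LD] := leP D L.
  rewrite subrr mulr0 addr0; apply: (@le_trans _ _ (dd * L)); first by rewrite ler_wpM2l.
  by rewrite mulrAC ler_wpM2r// ltW.
have -> : dd * D = dd * L + dd * (D - L) by ring.
by apply: lerD; [rewrite mulrAC ler_wpM2r// ltW|rewrite ler_wpM2r// subr_ge0].
Qed.

Lemma trunc_arith (c1 c2 c3 e x t y : R) : 0 <= c1 -> 0 <= c2 -> 0 <= c3 -> 0 < e ->
  x <= e / (4 * (c1 + c3 + 1)) -> t <= e / (4 * (c2 + 1)) -> y <= e / (4 * (c1 + c3 + 1)) ->
  c1 * x + c2 * t + c3 * y < e.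
Proof.
move=> h1 h2 h3 e0; set E1 := e / (4 * (c1 + c3 + 1)); set E2 := e / _ => hx ht hy.
have p1 : 0 < 4 * (c1 + c3 + 1) by lra.
have p2 : 0 < 4 * (c2 + 1) by lra.
have q1 : E1 * (4 * (c1 + c3 + 1)) = e by rewrite /E1 divfK// gt_eqF.
have q2 : E2 * (4 * (c2 + 1)) = e by rewrite /E2 divfK// gt_eqF.
have E10 : 0 < E1 by rewrite divr_gt0.
have E20 : 0 < E2 by rewrite divr_gt0.
have a1 : c1 * x <= c1 * E1 by rewrite ler_wpM2l.
have a2 : c2 * t <= c2 * E2 by rewrite ler_wpM2l.
have a3 : c3 * y <= c3 * E1 by rewrite ler_wpM2l.
move: q1 q2; clearbody E1 E2 => q1 q2; nra.
Qed.

(** The approximants are [zeta * F (psi)], with [psi] from the definition of the trace. On the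
    boundary [F (g) = 0] wherever [zeta] does not vanish, so they are bounded by a multiple of
    [|psi - g|], and [zero_trace_of_trace0] applies. The delicate term inside is [dF (u) - dF (psi)]
    times [Du], for which [trunc_pointwise] is made. *)
Lemma zero_trace_comp Om u Du g zeta (F dF : R -> R) (A B k : R) :
  (2 <= N)%N -> bounded_domain Om -> lipschitz_boundary Om ->
  W11i Om u Du ->
  (forall eps : R, 0 < eps -> exists psi, [/\ C1 psi, (W11_dist Om u Du psi < eps%:E)%E &
      (\int[HH]_(x in boundary Om) `|psi x - g x|%:E < eps%:E)%E]) ->
  measurable_fun (boundary Om : set TH) g ->
  C1 zeta -> compact (closure [set x | zeta x != 0]) ->
  0 <= A -> 0 <= B ->
  (forall s, is_derive s (1 : R) F (dF s)) ->
  (forall s s', `|F s - F s'| <= A * `|s - s'|) -> (forall s, `|dF s| <= A) ->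
  (forall s s', `|dF s - dF s'| <= B * `|s - s'|) ->
  (forall s, s <= k -> F s = 0) ->
  (forall y, boundary Om y -> zeta y != 0 -> g y <= k) ->
  zero_trace Om (fun x => zeta x * F (u x))
    (fun x => (zeta x * dF (u x)) *: Du x + F (u x) *: grad zeta x).
Proof.
move=> N2 hO lO [iu iD] happ mg Cz cz A0 B0 dFF lF bF lF' F0 hg.
have [_ oO _ bO] := hO.
have mO : measurable (Om : set T) by exact: leb_open.
have fO := bounded_leb_fin bO.
have cF : continuous F := lip_continuous lF.
have cdF : continuous dF := lip_continuous lF'.
have mu' := integ_measurable iu.
have mFu : measurable_fun (Om : set T) (fun x : T => F (u x)).
  by apply: (measurableT_comp _ mu'); exact: continuous_measurable_fun.
have mdFu : measurable_fun (Om : set T) (fun x : T => dF (u x)).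
  by apply: (measurableT_comp _ mu'); exact: continuous_measurable_fun.
have czt := C1c_cb Cz cz.
have [Z Z0 [hZ hZi]] : exists2 Z : R, 0 <= Z & (forall x, `|zeta x| <= Z) /\
    (forall x, enorm (grad zeta x) <= Z).
  have cbv : cb (fun x => `|zeta x| + \sum_i `|partial i zeta x|).
    apply: cbD; first by apply: cb_norm.
    by apply: cb_sum => i; apply: cb_norm; exact: C1c_cb_partial.
  have [_ [M hM]] := cbv; exists `|M|; first exact: normr_ge0.
  have hM' x := le_trans (ler_norm _) (le_trans (hM x) (ler_norm M)).
  split=> x; apply: le_trans (hM' x); first by rewrite lerDl sumr_ge0.
  apply: (le_trans (enorm_le_sum _)); under eq_bigr do rewrite mxE.
  by rewrite lerDr.
have mz : measurable_fun (Om : set T) zeta by exact: C1_measurable.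
have iE : mu.-integrable (Om : set T) (EFin \o (fun x => enorm (Du x))) by exact: enorm_integrable.
have Fk s : `|F s| <= A * (`|s| + `|k|).
  rewrite -[F s]subr0 -(F0 k (lexx k)); apply: (le_trans (lF _ _)).
  by rewrite ler_wpM2l//; exact: ler_normB.
have ic : mu.-integrable (Om : set T) (EFin \o (fun x => A * (`|u x| + `|k|))).
  by apply: integZ => //; apply: integD => //; [exact: integ_norm|apply: cb_int => //; exact: cb_cst].
have iFu : mu.-integrable (Om : set T) (EFin \o (fun x => F (u x))).
  by apply: (integ_dom_all mO mFu _ ic) => x _; exact: Fk.
have hW : W11i Om (fun x => zeta x * F (u x))
    (fun x => (zeta x * dF (u x)) *: Du x + F (u x) *: grad zeta x).
  split.
    apply: (integ_dom_all mO (measurable_funM mz mFu) _ (integZ mO Z ic)) => x _.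
    by rewrite normrM ler_pM.
  move=> i; rewrite (_ : (fun x => _) = (fun x => (zeta x * dF (u x)) * Du x ord0 i +
      F (u x) * partial i zeta x)); last by apply/funext => x; rewrite !mxE.
  have h1 : lintegrable Om (fun x => (zeta x * dF (u x)) * Du x ord0 i).
    apply: (@integ_dom_all _ _ _ _ _ mO _ (fun x => (Z * A) * `|Du x ord0 i|)).
    - apply: measurable_funM; first exact: measurable_funM.
      exact: integ_measurable (iD i).
    - by move=> x _; rewrite normrM ler_wpM2r// normrM ler_pM.
    - by apply: integZ => //; exact: integ_norm (iD i).
  have h2 : lintegrable Om (fun x => F (u x) * partial i zeta x).
    apply: (@integ_dom_all _ _ _ _ _ mO _ (fun x => Z * `|F (u x)|)).
    - by apply: measurable_funM => //; apply: leb_continuous => //; exact: C1_partial_cont.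
    - move=> x _; rewrite normrM mulrC ler_wpM2r//; apply: le_trans (hZi x).
      by have := enorm_coord (grad zeta x) i; rewrite mxE.
    - by apply: integZ => //; exact: integ_norm iFu.
  exact: (integD mO h1 h2).
apply: zero_trace_of_trace0 => // e e0.
pose K1 := Z * A + Z * B; pose K2 := 2 * (Z * A) + 1.
have e10 : 0 < e / (4 * K2) by rewrite divr_gt0// mulr_gt0// ltr_wpDl// !mulr_ge0.
(* [L] is fixed before [psi], whose accuracy depends on it. *)
have [L L0 hL] := integ_tail mO iE e10.
have q1 : 0 < 4 * (2 * (Z * A) + Z * (B * L) + Z * A + 1) by rewrite mulr_gt0// ltr_wpDl// !addr_ge0 ?mulr_ge0// ltW.
have [psi [Cp hd ht]] := happ _ (divr_gt0 e0 q1).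
set e2 := e / _ in hd ht.
have [j1 j2 k1 k2] := W11_distP mO (conj iu iD) Cp hd.
pose v x := zeta x * F (psi x).
have CF : C1 (fun x => F (psi x)) by exact: C1_comp dFF cdF.
have Cv : C1 v by exact: C1M.
have cv : compact (closure [set x | v x != 0]).
  apply: (subclosed_compact _ cz); first exact: closed_closure.
  by apply: closure_subset => x /=; apply: contra => /eqP h; rewrite /v h mul0r.
have e20 : 0 < e2 by exact: divr_gt0.
have mpg : measurable_fun (boundary Om : set TH) (fun x => `|psi x - g x|%:E).
  apply/measurable_EFinP; apply: (measurableT_comp (@normr_measurable R setT)).
  apply: measurable_funB => //.
  apply: cara_continuous; [exact: hausdorff_outer_half| |exact: C1_cont].
  by apply: cara_closed; [exact: hausdorff_outer_half|exact: closed_boundary].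
have vg i x : partial i v x = zeta x * (dF (psi x) * partial i psi x) + F (psi x) * partial i zeta x.
  by rewrite /v partialM// (partial_comp _ _ Cp dFF cdF).
exists v; split => //.
- pose G x := (2 * (Z * A) + Z * (B * L)) * `|u x - psi x| +
    2 * (Z * A) * (enorm (Du x) - Num.min (enorm (Du x)) L) + Z * A * enorm (Du x - grad psi x).
  have it : mu.-integrable (Om : set T) (EFin \o (fun x => enorm (Du x) - Num.min (enorm (Du x)) L)).
    apply: integB => //; apply: (integ_dom_all mO _ _ iE).
      apply: measurable_minr; [exact: integ_measurable iE|exact: measurable_cst].
    by move=> x _; rewrite ger0_norm ?ge_min ?lexx// le_min enorm_ge0 ltW.
  have g1 := integZ mO (2 * (Z * A) + Z * (B * L)) (integ_norm j1).
  have g2 := integZ mO (2 * (Z * A)) it; have g3 := integZ mO (Z * A) j2.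
  have iG : mu.-integrable (Om : set T) (EFin \o G) by have h := integD mO (integD mO g1 g2) g3; exact: h.
  have pt x : `|zeta x * F (u x) - v x| +
      enorm ((zeta x * dF (u x)) *: Du x + F (u x) *: grad zeta x - grad v x) <= G x.
    have h1 : `|zeta x * F (u x) - v x| <= Z * A * `|u x - psi x|.
      by rewrite -mulrBr normrM -mulrA ler_pM.
    have -> : (zeta x * dF (u x)) *: Du x + F (u x) *: grad zeta x - grad v x =
      (zeta x * (dF (u x) - dF (psi x))) *: Du x + (zeta x * dF (psi x)) *: (Du x - grad psi x) +
      (F (u x) - F (psi x)) *: grad zeta x.
      by apply/rowP => i; rewrite !mxE vg; ring.
    have h2 : enorm ((zeta x * (dF (u x) - dF (psi x))) *: Du x) <=
       Z * (B * L) * `|u x - psi x| + 2 * (Z * A) * (enorm (Du x) - Num.min (enorm (Du x)) L).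
      rewrite enormZ normrM; apply: (@le_trans _ _ (Z * (`|dF (u x) - dF (psi x)| * enorm (Du x)))).
        by rewrite -mulrA ler_wpM2r// mulr_ge0// enorm_ge0.
      have -> : Z * (B * L) * `|u x - psi x| + 2 * (Z * A) * (enorm (Du x) - Num.min (enorm (Du x)) L)
        = Z * (B * L * `|u x - psi x| + 2 * A * (enorm (Du x) - Num.min (enorm (Du x)) L)) by ring.
      rewrite ler_wpM2l//; apply: trunc_pointwise => //; first exact: enorm_ge0.
      by apply: (le_trans (ler_normB _ _)); rewrite mulr_natl mulr2n lerD.
    have h3 : enorm ((zeta x * dF (psi x)) *: (Du x - grad psi x)) <= Z * A * enorm (Du x - grad psi x).
      by rewrite enormZ ler_wpM2r ?enorm_ge0// normrM ler_pM.
    have h4 : enorm ((F (u x) - F (psi x)) *: grad zeta x) <= Z * A * `|u x - psi x|.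
      rewrite enormZ -[leRHS]mulrA mulrC ler_pM//; exact: enorm_ge0.
    have h5 := enormD ((zeta x * (dF (u x) - dF (psi x))) *: Du x + (zeta x * dF (psi x)) *: (Du x - grad psi x))
      ((F (u x) - F (psi x)) *: grad zeta x).
    have h6 := enormD ((zeta x * (dF (u x) - dF (psi x))) *: Du x) ((zeta x * dF (psi x)) *: (Du x - grad psi x)).
    rewrite /G mulrDl; move: h1 h2 h3 h4 h5 h6 => a1 a2 a3 a4 a5 a6.
    have b1 := le_trans a6 (lerD a2 a3); have b2 := le_trans a5 (lerD b1 a4).
    apply: (le_trans (lerD a1 b2)); rewrite le_eqVlt; apply/orP; left; apply/eqP; ring.
  apply: (@le_lt_trans _ _ (\int[mu]_(x in Om) G x)%:E).
    by apply: (W11_dist_le mO hW Cv iG) => x _; exact: pt.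
  rewrite lte_fin /G (RintegralD mO (integD mO g1 g2) g3) (RintegralD mO g1 g2).
  rewrite (RintegralZl _ mO (integ_norm j1)) (RintegralZl _ mO it) (RintegralZl _ mO j2).
  have c1 : 0 <= 2 * (Z * A) + Z * (B * L) by rewrite addr_ge0 ?mulr_ge0// ltW.
  have c2 : 0 <= 2 * (Z * A) by rewrite !mulr_ge0.
  by apply: (trunc_arith c1 c2 (mulr_ge0 Z0 A0) e0 (ltW k1) _ (ltW k2)); under eq_Rintegral do rewrite -[enorm _]ger0_norm ?enorm_ge0//; exact: ltW.
- apply: (@le_lt_trans _ _ (\int[HH]_(x in boundary Om) ((Z * A)%:E * `|psi x - g x|%:E))%E).
    apply: ge0_le_integral.
    - by apply: cara_closed; [exact: hausdorff_outer_half|exact: closed_boundary].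
    - by move=> x _; rewrite lee_fin.
    - apply/measurable_EFinP; apply: (measurableT_comp (@normr_measurable R setT)).
      apply: cara_continuous; [exact: hausdorff_outer_half| |exact: C1_cont].
      by apply: cara_closed; [exact: hausdorff_outer_half|exact: closed_boundary].
    - by apply: measurable_funeM; exact: mpg.
    - move=> x Bx; rewrite -EFinM lee_fin /v.
      have [->|zx] := eqVneq (zeta x) 0; first by rewrite mul0r normr0 !mulr_ge0.
      rewrite normrM -mulrA ler_pM//.
      by have := lF (psi x) (g x); rewrite (F0 (g x)) ?subr0//; exact: hg.
  have mbY : measurable (boundary Om : set TH).
    by apply: cara_closed; [exact: hausdorff_outer_half|exact: closed_boundary].
  rewrite (ge0_integralZl_EFin HH mbY _ mpg (mulr_ge0 Z0 A0))//.
  apply: (@le_lt_trans _ _ ((Z * A)%:E * e2%:E)%E).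
    by apply: lee_wpmul2l; [rewrite lee_fin mulr_ge0|exact: ltW].
  rewrite -EFinM lte_fin /e2 [X in X < _]mulrA ltr_pdivrMr//.
  have c1 : 0 <= Z * (B * L) by rewrite !mulr_ge0// ltW.
  have c2 : 0 <= Z * A by rewrite mulr_ge0.
  by rewrite mulrC ltr_pM2l//; move: (Z * A) (Z * (B * L)) c1 c2 => s t s0 t0; lra.
Qed.

End zero_trace_truncation.

(** * The integrand *)

Section integrand.
Context (R : realType) (N : nat) (P Q al be dl et : R).
Hypotheses (P1 : 1 < P) (PQ : P <= Q) (QN : Q <= N%:R) (al0 : 0 <= al) (be0 : 0 <= be).
Hypotheses (dl1 : 1 <= dl) (et0 : 0 <= et).

Definition lg (dl et t : R) : R := ln (dl + et * t).
(** The integrand at a frozen point: [Slog p q a b dl et x] is convertible to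
    [Sv (p x) (q x) (a x) (b x) dl et], and [slog] to [sv] in the same way. *)
Definition Sv (P Q al be dl et t : R) : R := al * t `^ P + be * t `^ Q * ln (dl + et * t).
Definition sv (P Q al be dl et t : R) : R :=
  P * al * t `^ (P - 1) + Q * be * t `^ (Q - 1) * ln (dl + et * t)
  + et * be * t `^ Q / (dl + et * t).

Local Notation L := (lg dl et).
Local Notation S := (Sv P Q al be dl et).
Local Notation s := (sv P Q al be dl et).

Lemma lg_arg_ge1 t : 0 <= t -> 1 <= dl + et * t.
Proof. by move=> t0; rewrite (le_trans dl1)// lerDl mulr_ge0. Qed.

Lemma lg_ge0 t : 0 <= t -> 0 <= L t.
Proof. by move=> t0; rewrite ln_ge0// lg_arg_ge1. Qed.

Lemma lg_mono t t' : 0 <= t -> t <= t' -> L t <= L t'.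
Proof.
move=> t0 tt; have t0' := le_trans t0 tt.
rewrite /lg ler_ln ?posrE ?(lt_le_trans ltr01)// ?lg_arg_ge1// lerD2l ler_wpM2l//.
Qed.

(** This is [ln y^-1 <= y^-1 - 1] for [y = dl + et * t], combined with [dl >= 1]. *)
Lemma lg_ratio t : 0 <= t -> et * t / (dl + et * t) <= L t.
Proof.
move=> t0; set y := dl + et * t; have y1 : 1 <= y by exact: lg_arg_ge1.
have y0 : 0 < y by apply: lt_le_trans y1.
have : ln y^-1 <= y^-1 - 1.
  by rewrite -{1}(subrKC 1 y^-1); apply: le_ln1Dx; rewrite ltrBrDl subrr invr_gt0.
rewrite lnV ?posrE// /lg -/y => h.
have -> : et * t / y = 1 - dl / y by rewrite /y; field; exact: lt0r_neq0.
have : y^-1 <= dl / y by rewrite ler_peMl// invr_ge0 ltW.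
by move: h; lra.
Qed.

Lemma lg_scale c t : 1 <= c -> 0 <= t -> L (c * t) <= c * L t.
Proof.
move=> c1 t0; have c0 : 0 <= c by exact: le_trans c1.
have y1 := lg_arg_ge1 t0; have y0 : 0 < dl + et * t by apply: lt_le_trans y1.
have y2 := lg_arg_ge1 (mulr_ge0 c0 t0); have y3 : 0 < dl + et * (c * t) by apply: lt_le_trans y2.
have h : L (c * t) - L t <= (c - 1) * (et * t / (dl + et * t)).
  rewrite /lg -ln_div ?posrE//.
  have -> : (dl + et * (c * t)) / (dl + et * t) = 1 + (c - 1) * (et * t / (dl + et * t)).
    by field; rewrite gt_eqF.
  apply: le_ln1Dx; apply: (@lt_le_trans _ _ 0); first by rewrite oppr_lt0.
  by rewrite mulr_ge0 ?subr_ge0// divr_ge0 ?mulr_ge0// ltW.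
have := ler_wpM2l (_ : 0 <= c - 1) (lg_ratio t0); rewrite subr_ge0 => /(_ c1).
by move: h; lra.
Qed.

Let P0 : 0 < P. Proof. exact: lt_trans P1. Qed.
Let Q0 : 0 < Q. Proof. exact: lt_le_trans PQ. Qed.
Let Q1 : 1 < Q. Proof. exact: lt_le_trans PQ. Qed.

Lemma powR_mono (t t' r : R) : 0 <= r -> 0 <= t -> t <= t' -> t `^ r <= t' `^ r.
Proof. by move=> r0 t0 tt; apply: ge0_ler_powR; rewrite ?nnegrE// (le_trans t0). Qed.

Lemma Sv_ge0 t : 0 <= t -> 0 <= S t.
Proof. by move=> t0; rewrite addr_ge0 ?mulr_ge0 ?powR_ge0//; exact: lg_ge0. Qed.

Lemma Sv_mono t t' : 0 <= t -> t <= t' -> S t <= S t'.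
Proof.
move=> t0 tt; apply: lerD; first by rewrite ler_wpM2l// powR_mono// ltW.
rewrite -!mulrA ler_wpM2l// ler_pM ?powR_ge0//; [exact: lg_ge0|by rewrite powR_mono// ltW|exact: lg_mono].
Qed.

(** A nondecreasing majorant of [s] for which [t * s1v t] is exactly [N.+1 * S t]; it carries
    Young's inequality below. *)
Definition s1v (t : R) := N.+1%:R * (al * t `^ (P - 1) + be * t `^ (Q - 1) * L t).

Lemma s1v_mono t t' : 0 <= t -> t <= t' -> s1v t <= s1v t'.
Proof.
move=> t0 tt; rewrite ler_wpM2l//; apply: lerD.
  by rewrite ler_wpM2l// powR_mono// subr_ge0 ltW.
rewrite -!mulrA ler_wpM2l// ler_pM ?powR_ge0//; [exact: lg_ge0| |exact: lg_mono].
by rewrite powR_mono// subr_ge0 ltW.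
Qed.

Lemma s1vM t : 0 <= t -> t * s1v t = N.+1%:R * S t.
Proof.
move=> t0; rewrite /s1v /Sv -(mulr_powRB1 t0 P0) -(mulr_powRB1 t0 Q0) /lg; ring.
Qed.

Lemma s1v_ge0 t : 0 <= t -> 0 <= s1v t.
Proof. by move=> t0; rewrite mulr_ge0// addr_ge0 ?mulr_ge0 ?powR_ge0//; exact: lg_ge0. Qed.

Lemma sv_le t : 0 <= t -> s t <= s1v t.
Proof.
move=> t0; have y1 := lg_arg_ge1 t0; have y0 : 0 < dl + et * t by apply: lt_le_trans y1.
have h3 : et * be * t `^ Q / (dl + et * t) <= be * t `^ (Q - 1) * L t.
  rewrite -(mulr_powRB1 t0 Q0).
  have -> : et * be * (t * t `^ (Q - 1)) / (dl + et * t) = be * t `^ (Q - 1) * (et * t / (dl + et * t)) by ring.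
  by rewrite ler_wpM2l ?mulr_ge0 ?powR_ge0//; exact: lg_ratio.
have a0 : 0 <= al * t `^ (P - 1) by rewrite mulr_ge0 ?powR_ge0.
have b0 : 0 <= be * t `^ (Q - 1) * L t by rewrite !mulr_ge0 ?powR_ge0//; exact: lg_ge0.
have h1 : P * al * t `^ (P - 1) <= N%:R * (al * t `^ (P - 1)).
  by rewrite -mulrA ler_wpM2r//; exact: le_trans QN.
have h2 : Q * be * t `^ (Q - 1) * L t <= N%:R * (be * t `^ (Q - 1) * L t).
  by rewrite (_ : Q * be * _ * _ = Q * (be * t `^ (Q - 1) * L t)) ?ler_wpM2r//; ring.
rewrite /s1v -natr1 mulrDr !mulrDl !mul1r; rewrite /sv -/(L t); lra.
Qed.

Lemma sv_ge0 t : 0 <= t -> 0 <= s t.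
Proof.
move=> t0; have y1 := lg_arg_ge1 t0; have y0 : 0 < dl + et * t by apply: lt_le_trans y1.
rewrite !addr_ge0// ?divr_ge0 ?mulr_ge0 ?powR_ge0//; try exact: ltW.
exact: lg_ge0.
Qed.

(** The powers contribute [c ^ N], as [Q <= N], and the logarithm one more factor [c], by
    [lg_scale]. The resulting exponent [N + 1] reappears in the power of the cutoff and in all
    constants. *)
Lemma Sv_scale c t : 1 <= c -> 0 <= t -> S (c * t) <= c ^+ N.+1 * S t.
Proof.
move=> c1 t0; have c0 : 0 <= c by exact: le_trans c1.
have cN r : 0 < r -> r <= N%:R -> c `^ r <= c ^+ N.
  by move=> r0 rN; rewrite -powR_mulrn// ler_powR.
have cN1 : c ^+ N <= c ^+ N.+1 by rewrite exprSr ler_peMr// exprn_ge0.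
have L0 := lg_ge0 t0.
rewrite /Sv !powRM// mulrDr; apply: lerD.
  rewrite mulrCA ler_wpM2r ?mulr_ge0 ?powR_ge0//.
  by apply: le_trans cN1; apply: cN => //; exact: le_trans QN.
have -> : be * (c `^ Q * t `^ Q) * ln (dl + et * (c * t)) = (c `^ Q) * (be * t `^ Q * L (c * t)).
  by rewrite /lg; ring.
have -> : c ^+ N.+1 * (be * t `^ Q * ln (dl + et * t)) = c ^+ N * (be * t `^ Q * (c * L t)).
  by rewrite exprSr /lg; ring.
apply: ler_pM; rewrite ?powR_ge0//; last by rewrite ler_wpM2l ?mulr_ge0 ?powR_ge0//; exact: lg_scale.
  by rewrite !mulr_ge0 ?powR_ge0//; apply: lg_ge0; exact: mulr_ge0.
exact: cN.
Qed.

(* Young's inequality without the conjugate integrand: compare [D] with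
   [lam * g / z]. *)
Lemma sv_young (z g D lam : R) : (0 < N)%N -> 0 <= z <= 1 -> 0 <= g -> 0 <= D -> 1 <= lam ->
  z ^+ N * (g * s D) <= N.+1%:R / lam * (z ^+ N.+1 * S D) + N.+1%:R * lam ^+ N * S g.
Proof.
move=> N0 /andP[z0 z1] g0 D0 l1; have l0 : 0 < lam by apply: lt_le_trans l1.
have SD := Sv_ge0 D0; have Sg := Sv_ge0 g0.
have r1 : 0 <= N.+1%:R / lam * (z ^+ N.+1 * S D) by rewrite !mulr_ge0 ?exprn_ge0 ?invr_ge0// ltW.
have r2 : 0 <= N.+1%:R * lam ^+ N * S g by rewrite !mulr_ge0// exprn_ge0// ltW.
move: z0; rewrite le_eqVlt => /orP[/eqP <-|z0].
  by rewrite expr0n gtn_eqF// mul0r expr0n/= mul0r mulr0 add0r.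
have zN : 0 <= z ^+ N by rewrite exprn_ge0// ltW.
have [h|h] := leP (lam * g) (z * D).
  apply: (@le_trans _ _ (N.+1%:R / lam * (z ^+ N.+1 * S D))); last by rewrite lerDl.
  have gz : g <= z * D / lam by rewrite ler_pdivlMr// mulrC.
  apply: (@le_trans _ _ (z ^+ N * (z * D / lam * s1v D))).
    by rewrite ler_wpM2l// ler_pM// ?sv_ge0//; exact: sv_le.
  have -> : z ^+ N * (z * D / lam * s1v D) = z ^+ N.+1 / lam * (D * s1v D) by rewrite exprSr; ring.
  by rewrite s1vM// le_eqVlt; apply/orP; left; apply/eqP; ring.
apply: (@le_trans _ _ (N.+1%:R * lam ^+ N * S g)); last by rewrite lerDr.
pose E := lam / z * g.
have c1 : 1 <= lam / z by rewrite ler_pdivlMr// mul1r (le_trans z1).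
have DE : D <= E by rewrite /E mulrAC ler_pdivlMr// mulrC ltW.
have E0 : 0 <= E by exact: le_trans DE.
apply: (@le_trans _ _ (z ^+ N * (g * s1v E))).
  rewrite ler_wpM2l// ler_wpM2l//; apply: le_trans (sv_le D0) _; exact: s1v_mono.
have -> : g * s1v E = z / lam * (E * s1v E) by rewrite /E; field; rewrite !gt_eqF.
rewrite s1vM//; have := Sv_scale c1 g0; rewrite -/E => hE.
apply: (@le_trans _ _ (z ^+ N * (z / lam * (N.+1%:R * ((lam / z) ^+ N.+1 * S g))))).
  by rewrite !ler_wpM2l// divr_ge0// ltW.
rewrite expr_div_n le_eqVlt; apply/orP; left; apply/eqP.
rewrite !exprSr; have : z ^+ N != 0 by rewrite expf_neq0// gt_eqF.
move: (z ^+ N) (lam ^+ N) (S g) => u v w u0; field.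
by rewrite u0 !gt_eqF.
Qed.

(** Superlinear growth: both terms grow at least like the power [pm]. *)
Lemma Sv_lower (T tau pm : R) : 0 < T -> T <= tau -> pm <= P ->
  S T * (tau / T) `^ pm <= S tau.
Proof.
move=> T0 Tt pP; have tT : 1 <= tau / T by rewrite ler_pdivlMr// mul1r.
have tau0 : 0 <= tau by apply: le_trans Tt; exact: ltW.
have tE : tau = T * (tau / T) by rewrite mulrC divfK// gt_eqF.
have q0 : 0 <= tau / T by exact: le_trans tT.
have key r : pm <= r -> T `^ r * (tau / T) `^ pm <= tau `^ r.
  move=> h; have -> : tau `^ r = T `^ r * (tau / T) `^ r by rewrite -powRM ?(ltW T0)// -tE.
  by rewrite ler_wpM2l ?powR_ge0// ler_powR.
rewrite /Sv mulrDl; apply: lerD; first by rewrite -mulrA ler_wpM2l// key.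
have -> : be * T `^ Q * ln (dl + et * T) * (tau / T) `^ pm = be * (T `^ Q * (tau / T) `^ pm * L T).
  by rewrite /lg; ring.
rewrite -[leRHS]mulrA ler_wpM2l// ler_pM ?mulr_ge0 ?powR_ge0//.
- by apply: lg_ge0; exact: ltW.
- by apply: key; exact: le_trans PQ.
- by apply: lg_mono => //; exact: ltW.
Qed.

(** The integrand with [al] replaced by [1]: the merely measurable coefficient [a] disappears and
    only the regular data [p], [q], [b] remain. As [a + b >= d], both integrands are comparable for
    [T >= 1]. *)
Definition S0v (P Q be T : R) := T `^ P + be * T `^ Q * L T.

Lemma Sv_le_S0v T Ma : 0 <= T -> 1 <= Ma -> al <= Ma -> S T <= Ma * S0v P Q be T.
Proof.
move=> T0 M1 aM; rewrite /Sv /S0v mulrDr; apply: lerD; first by rewrite ler_wpM2r ?powR_ge0.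
by rewrite ler_peMl// !mulr_ge0 ?powR_ge0//; exact: lg_ge0.
Qed.

(** The number [l] bounds the logarithm from below for arguments above [1], so a missing part of
    [al * T ^ P] is made up for by the second term, [be] being large where [al] is small. *)
Lemma S0v_le_Sv T d l : 1 <= T -> 0 < d -> 0 < l <= 1 -> l <= L 1 -> d <= al + be ->
  S0v P Q be T <= (1 + (l * d)^-1) * S T.
Proof.
move=> T1 d0 /andP[l0 l1] lL dab; have T0 : 0 <= T by exact: le_trans T1.
have LT : l <= L T by apply: le_trans lL _; exact: lg_mono.
have h1 : l * d * T `^ P <= S T.
  apply: (@le_trans _ _ (l * ((al + be) * T `^ P))).
    by rewrite -mulrA ler_wpM2l ?(ltW l0)// ler_wpM2r ?powR_ge0.
  rewrite mulrDl mulrDr /Sv; apply: lerD.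
    by rewrite ler_piMl ?mulr_ge0 ?powR_ge0.
  rewrite mulrC ler_pM ?mulr_ge0 ?powR_ge0// ?(ltW l0)// ler_wpM2l//; exact: ler_powR.
have ld : 0 < l * d by rewrite mulr_gt0.
rewrite mulrDl mul1r addrC; apply: lerD; first by rewrite mulrC ler_pdivlMr// mulrC.
by rewrite /Sv lerDr mulr_ge0 ?powR_ge0.
Qed.

Lemma S0v_ge T : 1 <= T -> T <= S0v P Q be T.
Proof.
move=> T1; have T0 : 0 <= T by exact: le_trans T1.
apply: (@le_trans _ _ (T `^ P)); first by apply: le1r_powR => //; exact: ltW.
by rewrite lerDl !mulr_ge0 ?powR_ge0//; exact: lg_ge0.
Qed.

(** Changing the exponents costs the factor [E]. The increment [dlt] of the second coefficient is
    paid by the first term: [dlt * T ^ Q' * L] is the product of [dlt * T ^ alpha],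
    [T ^ (Q' - P' - alpha) * L] and [T ^ P'], where [G] and [H] bound the first two factors. *)
Lemma S0v_compare (P' Q' be' T E G H alpha dlt : R) : 1 <= T -> 0 <= dlt -> 0 <= H -> 0 <= G ->
  T `^ `|P - P'| <= E -> T `^ `|Q - Q'| <= E -> be' <= be + dlt -> dlt * T `^ alpha <= G ->
  T `^ (Q' - P' - alpha) * L T <= H ->
  S0v P' Q' be' T <= E * (1 + G * H) * S0v P Q be T.
Proof.
move=> T1 d0 H0 G0 hP hQ hb hd hH; have T0 : 0 < T by apply: lt_le_trans T1.
have LT := lg_ge0 (ltW T0).
have cmp (u v : R) : T `^ `|u - v| <= E -> T `^ v <= E * T `^ u.
  move=> h; apply: (@le_trans _ _ (T `^ `|u - v| * T `^ u)); last by rewrite ler_wpM2r ?powR_ge0.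
  rewrite -powRD; last by apply/implyP => _; rewrite gt_eqF.
  by apply: ler_powR => //; have := ler_norm (v - u); rewrite distrC; lra.
have a1 := cmp _ _ hP; have a2 := cmp _ _ hQ.
have a3 : dlt * T `^ Q' * L T <= G * H * T `^ P'.
  have -> : T `^ Q' = T `^ alpha * (T `^ (Q' - P' - alpha) * T `^ P').
    rewrite -!powRD; [congr (T `^ _); ring|..]; by apply/implyP => _; rewrite gt_eqF.
  have -> : dlt * (T `^ alpha * (T `^ (Q' - P' - alpha) * T `^ P')) * L T =
    (dlt * T `^ alpha) * (T `^ (Q' - P' - alpha) * L T) * T `^ P' by ring.
  by rewrite ler_wpM2r ?powR_ge0// ler_pM ?mulr_ge0 ?powR_ge0.
have a4 : be' * T `^ Q' * L T <= be * T `^ Q' * L T + dlt * T `^ Q' * L T.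
  by rewrite -!mulrDl -!mulrA ler_wpM2r ?mulr_ge0 ?powR_ge0.
have a5 : be * T `^ Q' * L T <= E * (be * T `^ Q * L T).
  have -> : E * (be * T `^ Q * L T) = be * (E * T `^ Q) * L T by ring.
  by rewrite ler_wpM2r// ler_wpM2l.
have E0 : 0 <= E by apply: le_trans hP; exact: powR_ge0.
have a6 : G * H * T `^ P' <= G * H * (E * T `^ P) by rewrite ler_wpM2l ?mulr_ge0.
have a7 : 0 <= E * (G * H) * (be * T `^ Q * L T) by rewrite !mulr_ge0 ?powR_ge0.
have e1 : E * (1 + G * H) * S0v P Q be T = E * T `^ P + G * H * (E * T `^ P) +
  E * (be * T `^ Q * L T) + E * (G * H) * (be * T `^ Q * L T) by rewrite /S0v; ring.
rewrite e1 /S0v; lra.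
Qed.

End integrand.

(** * Consequences of log-Hoelder continuity *)

Section exponents.
Context (R : realType) (N : nat).

Lemma powR_log_bound (T c E : R) : 1 <= T -> c * ln T <= E -> T `^ c <= expR E.
Proof.
move=> T1 h; rewrite /powR gt_eqF; last by apply: lt_le_trans T1.
by rewrite ler_expR.
Qed.

Lemma log_hoelder_powR (D : set 'rV[R]_N) (f : 'rV[R]_N -> R) : (0 < N)%N -> log_hoelder D f ->
  exists2 E : R, 0 < E & exists2 r0 : R, 0 < r0 & forall x y r T, D x -> D y ->
    0 < r <= r0 -> `|x - y| <= 2 * r -> 1 <= T -> T * r <= r0^-1 -> T `^ `|f x - f y| <= E.
Proof.
move=> N0 [C C0 hC]; exists (expR (4 * C)); first exact: expR_gt0.
pose n : R := 2 * N%:R; have n0 : 0 < n by rewrite mulr_gt0// ltr0n.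
have n2 : 2 <= n by rewrite ler_peMr// ler1n.
(* With [n = 2 N] and [r <= n ^ -2], the Euclidean distance is at most [n * r <= r ^ (1/2)], while
   [T <= n ^ 2 / r <= r ^ -2]. So [ln T] is at most four times minus the logarithm of the distance,
   which explains [4 * C]. *)
exists (n ^- 2); first by rewrite invr_gt0 exprn_gt0.
move=> x y r T Dx Dy /andP[r0 rn] xy T1 Tr.
have T0 : 0 < T by apply: lt_le_trans T1.
apply: powR_log_bound => //.
have [->|xyn] := eqVneq x y; first by rewrite subrr normr0 mul0r mulr_ge0// ltW.
set e := enorm (x - y).
have e0 : 0 < e.
  by rewrite /e lt_neqAle enorm_ge0 andbT eq_sym; apply: contra xyn => /eqP/enorm_eq0/eqP; rewrite subr_eq0.
have er : e <= n * r.
  apply: (le_trans (enorm_le_sup _)); rewrite /n [2 * _]mulrC -mulrA ler_wpM2l//.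
have n20 : 0 < n ^+ 2 by rewrite exprn_gt0.
have nr : n * r <= n^-1.
  have : n * r <= n * n ^- 2 by rewrite ler_pM2l.
  by rewrite expr2 invfM mulrA mulfV ?mul1r// gt_eqF.
have nh : n^-1 <= 2^-1 by rewrite lef_pV2 ?posrE.
have := hC x y Dx Dy; rewrite -/e e0 => /(_ (le_trans er (le_trans nr nh))).
have f0 : 0 <= `|f x - f y| by [].
move: `|f x - f y| f0 => f0 f00 h.
have lnr : ln r <= - 2 * ln n.
  have : ln r <= ln (n ^- 2) by rewrite ler_ln ?posrE ?invr_gt0.
  by rewrite lnV ?posrE// lnXn//; lra.
have lne : ln e <= ln r / 2.
  have : ln e <= ln (n * r) by rewrite ler_ln ?posrE// mulr_gt0.
  by rewrite lnM ?posrE//; lra.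
have lnT : ln T <= - 2 * ln r.
  rewrite invrK in Tr; have : ln (T * r) <= ln (n ^+ 2) by rewrite ler_ln// posrE; exact: mulr_gt0.
  by rewrite lnM ?posrE// lnXn//; lra.
have l1 : 4 * - ln e >= ln T by lra.
have : f0 * ln T <= f0 * (4 * - ln e) by rewrite ler_wpM2l.
lra.
Qed.

Lemma log_hoelder_cont (D : set 'rV[R]_N) (f : 'rV[R]_N -> R) :
  log_hoelder D f -> {within D, continuous f}.
Proof.
move=> [C C0 hC]; apply/subspace_continuousP => x Dx.
apply/cvgrPdist_lt => eps eps0.
pose r := Num.min 2^-1 (expR (- (C / eps) - 1)).
have r0 : 0 < r by rewrite lt_min expR_gt0 invr_gt0 ltr0n.
have rN : 0 < r / N.+1%:R by rewrite divr_gt0// ltr0n.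
rewrite /within/=; apply: filterS (nbhsx_ballx x _ rN) => y; rewrite -ball_normE/= => xy Dy.
have [->|xyn] := eqVneq x y; first by rewrite subrr normr0.
have e0 : 0 < enorm (x - y).
  by rewrite lt_neqAle enorm_ge0 andbT eq_sym; apply: contra xyn => /eqP/enorm_eq0/eqP; rewrite subr_eq0.
have er : enorm (x - y) < r.
  apply: (le_lt_trans (enorm_le_sup _)); apply: (@le_lt_trans _ _ (N.+1%:R * `|x - y|)).
    by rewrite ler_wpM2r// ler_nat.
  by rewrite mulrC -ltr_pdivlMr// ltr0n.
have := hC x y Dx Dy; rewrite e0/= => /(_ (ltW (lt_le_trans er _))).
rewrite ge_min lexx => /(_ isT).
have : ln (enorm (x - y)) < - (C / eps) - 1.
  rewrite -[ltRHS]expRK ltr_ln ?posrE ?expR_gt0//; apply: (lt_le_trans er).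
  by rewrite ge_min lexx orbT.
move: (ln _) => l hl h; rewrite ltNge; apply/negP => hf0.
have hf : eps <= `|f x - f y| := hf0.
have : eps * (C / eps + 1) <= `|f x - f y| * - l.
  by rewrite ler_pM ?addr_ge0 ?divr_ge0 ?(ltW eps0) ?(ltW C0)//; lra.
rewrite mulrDr mulr1 mulrCA mulfV ?gt_eqF// mulr1; lra.
Qed.

End exponents.

Section measurable_pow.
Context d (T : measurableType d) (R : realType).

Lemma measurable_powRf (D : set T) (f g : T -> R) : measurable D ->
  measurable_fun D f -> measurable_fun D g -> measurable_fun D (fun x => f x `^ g x).
Proof.
move=> mD mf mg; rewrite /powR.
have mE : measurable_fun D (fun x => f x == 0) by apply: measurable_fun_eqr; [exact: mf|exact: measurable_cst].
have mB : measurable_fun D (fun x => g x == 0) by apply: measurable_fun_eqr; [exact: mg|exact: measurable_cst].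
have m1 : measurable_fun D (fun x => if g x == 0 then 1 else 0 : R).
  by apply: (measurable_fun_if mD mB); exact: measurable_cst.
have m2 : measurable_fun D (fun x => expR (g x * ln (f x))).
  apply: (measurableT_comp (@measurable_expR R)); apply: measurable_funM; first exact: mg.
  exact: (measurableT_comp (@measurable_ln R) mf).
have -> : (fun x => if f x == 0 then (g x == 0)%:R else expR (g x * ln (f x))) =
    (fun x => if f x == 0 then (if g x == 0 then 1 else 0) else expR (g x * ln (f x))).
  by apply/funext => x; case: (f x == 0) => //; case: (g x == 0).
apply: (measurable_fun_if mD mE).
- by apply: (measurable_funS mD _ m1); exact: subIsetl.
- by apply: (measurable_funS mD _ m2); exact: subIsetl.
Qed.

End measurable_pow.

(** * Measurability of compositions *)

Section superposition.
Context (R : realType) (N : nat).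
Notation T := (leb_space R N).
Notation mu := (lebesgue_rV R N).
Implicit Types (Om : set 'rV[R]_N) (u h : 'rV[R]_N -> R) (V : 'rV[R]_N -> 'rV[R]_N).

Lemma null_measurable (A B : set T) : measurable B -> mu B = 0%E -> A `<=` B -> measurable A.
Proof.
by move=> mB B0 AB; apply: measure_is_complete_caratheodory; exists B.
Qed.

Definition rnd (n : nat) (s : R) : R := (Num.floor (n.+1%:R * s))%:~R / n.+1%:R.

Lemma rnd_dist n s : `|rnd n s - s| <= n.+1%:R^-1.
Proof.
have /andP[h1 h2] := floor_itv (n.+1%:R * s).
have n0 : (0 : R) < n.+1%:R by [].
have e : rnd n s - s = n.+1%:R^-1 * ((Num.floor (n.+1%:R * s))%:~R - n.+1%:R * s).
  by rewrite /rnd; field.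
rewrite e normrM gtr0_norm ?invr_gt0// ler_piMr ?invr_ge0//.
by move: h2; rewrite intrD ler_norml; lra.
Qed.

Lemma cvg_inv_dist (W : normedModType R) (y : nat -> W) (l : W) :
  (forall n, `|y n - l| <= n.+1%:R^-1) -> y n @[n --> \oo] --> l.
Proof.
move=> h; apply/cvgrPdist_le => e e0; near=> n; rewrite distrC; apply: le_trans (h n) _.
rewrite ltW//; near: n; exact: near_infty_natSinv_lt (PosNum e0).
Unshelve. all: by end_near. Qed.

(* Round the arguments [u x] and [V x] to the grid of mesh [1/n]. *)
Lemma superposition_measurable Om (f : 'rV[R]_N -> R -> 'rV[R]_N -> R) u V :
  measurable (Om : set T) -> caratheodory_fun Om f ->
  measurable_fun (Om : set T) u ->
  (forall i, measurable_fun (Om : set T) (fun x : T => V x ord0 i)) ->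
  measurable_fun (Om : set T) (fun x : T => f x (u x) (V x)).
Proof.
move=> mO [mf [N0 [mN0 N00 cf]]] mu' mV.
have mD : measurable (Om `\` N0 : set T) by exact: measurableD.
have -> : (Om : set T) = (Om `\` N0) `|` (Om `&` N0) by rewrite setUC setUIDK.
apply/(measurable_funU _ mD (measurableI _ _ mO mN0)).
split; last first.
  (* On the exceptional null set every subset is measurable, by completeness. *)
  move=> mE Y mY; apply: (null_measurable mN0 N00) => x [[_]//].
pose rv n (v : 'rV[R]_N) : 'rV[R]_N := \row_i rnd n (v ord0 i).
apply: (@measurable_fun_cvg _ _ _ _ (fun n (x : T) => f x (rnd n (u x)) (rv n (V x)))); last first.
  move=> x [Ox nx].
  have cx : continuous (fun z : R * 'rV[R]_N => f x z.1 z.2).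
    by apply: contrapT => h; apply: nx; apply: cf => /= /(_ Ox).
  apply: (@cvg_comp _ _ _ (fun n => (rnd n (u x), rv n (V x))) (fun z : R * 'rV[R]_N => f x z.1 z.2)
    \oo (nbhs (u x, V x))); last exact: cx (u x, V x).
  have c1 : rnd n (u x) @[n --> \oo] --> u x by apply: cvg_inv_dist => n; exact: rnd_dist.
  have c2 : rv n (V x) @[n --> \oo] --> V x; last exact: (cvg_pair c1 c2).
  apply: cvg_inv_dist => n; apply: sup_norm_le => [|i]; first by rewrite invr_ge0.
  have -> : (rv n (V x) - V x) ord0 i = rnd n (V x ord0 i) - V x ord0 i by rewrite !mxE.
  exact: rnd_dist.
move=> n; apply: (measurable_funS mO (@subDsetl _ Om N0)).
move=> _ Y mY.
(* The rounded arguments take countably many values; where they are constant, measurability in [x]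
   for fixed arguments applies. *)
pose I := (int * {ffun 'I_N -> int})%type.
pose S (jv : I) : set T := (Om `&` u @^-1` [set s | Num.floor (n.+1%:R * s) = jv.1]) `&`
  \bigcap_(i in [set: 'I_N]) (Om `&` (fun x => V x ord0 i) @^-1` [set s | Num.floor (n.+1%:R * s) = jv.2 i]).
pose w (v : {ffun 'I_N -> int}) : 'rV[R]_N := \row_i ((v i)%:~R / n.+1%:R).
have -> : Om `&` (fun x => f x (rnd n (u x)) (rv n (V x))) @^-1` Y =
    \bigcup_jv ((S jv) `&` (Om `&` (fun x => f x (jv.1%:~R / n.+1%:R) (w jv.2)) @^-1` Y)).
  apply/seteqP; split=> [x [Ox Yx]|x [jv _ [[[_ /= e1] e2] [Ox Yx]]]].
    exists (Num.floor (n.+1%:R * u x), [ffun i => Num.floor (n.+1%:R * V x ord0 i)]) => //.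
    split; first by split=> // i _ /=; split=> //; rewrite ffunE.
    split=> //=; move: Yx; congr (Y (f x _ _)); apply/rowP => i; by rewrite !mxE ffunE.
  split=> //; move: Yx => /=; congr (Y (f x _ _)); first by rewrite /rnd e1.
  by apply/rowP => i; rewrite !mxE /rnd; have [_ /= ->] := e2 i Logic.I.
have mfl (z : int) : measurable [set s : R | Num.floor (n.+1%:R * s) = z].
  have -> : [set s : R | Num.floor (n.+1%:R * s) = z] =
      [set` `[(z%:~R / n.+1%:R : R), ((z + 1)%:~R / n.+1%:R)[ ].
    apply/seteqP; split=> s /=; rewrite in_itv/= ler_pdivrMr// ltr_pdivlMr// mulrC => h.
      by rewrite -h floor_itv.
    exact: floor_def.
  exact: measurable_itv.
apply: countable_bigcupT_measurable; first exact: countableP.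
move=> jv; apply: measurableI; last exact: (mf (jv.1%:~R / n.+1%:R) (w jv.2)).
apply: measurableI; first exact: mu'.
apply: fin_bigcap_measurable => // i _; exact: mV.
Qed.

End superposition.

(** * Caccioppoli inequality *)

Section test_pointwise.
Context (R : realType) (N : nat) (P Q al be dl et : R).
Hypotheses (P1 : 1 < P) (PQ : P <= Q) (QN : Q <= N%:R) (al0 : 0 <= al) (be0 : 0 <= be).
Hypotheses (dl1 : 1 <= dl) (et0 : 0 <= et).
Local Notation S := (Sv P Q al be dl et).
Local Notation s := (sv P Q al be dl et).

Lemma sv_le_S D : 0 <= D -> s D <= N.+1%:R * (S D + S 1).
Proof.
move=> D0; apply: le_trans (sv_le P1 PQ QN al0 be0 dl1 et0 D0) _.
have SD := Sv_ge0 P Q al0 be0 dl1 et0 D0.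
have S1 : 0 <= S 1 by apply: (Sv_ge0 P Q al0 be0 dl1 et0); exact: ler01.
have [h|h] := leP 1 D.
  apply: (@le_trans _ _ (D * s1v N P Q al be dl et D)).
    by rewrite ler_peMl//; exact: (s1v_ge0 N P Q al0 be0 dl1 et0 D0).
  by rewrite (s1vM N al be dl et P1 PQ D0) ler_wpM2l// lerDl.
apply: (@le_trans _ _ (s1v N P Q al be dl et 1)); first by apply: s1v_mono => //; exact: ltW.
by rewrite -[X in X <= _]mul1r (s1vM N al be dl et P1 PQ ler01) ler_wpM2l// lerDr.
Qed.

Lemma svM_le D : 0 <= D -> s D * D <= N.+1%:R * S D.
Proof.
move=> D0; rewrite mulrC -(s1vM N al be dl et P1 PQ)//; rewrite ler_wpM2l//; exact: sv_le.
Qed.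

Lemma Sv_add D E : 0 <= D -> 0 <= E -> S (D + E) <= 2 ^+ N.+1 * (S D + S E).
Proof.
move=> D0 E0; have sc x : 0 <= x -> S (2 * x) <= 2 ^+ N.+1 * S x.
  by move=> x0; apply: Sv_scale => //; rewrite ler1n.
have SD := Sv_ge0 P Q al0 be0 dl1 et0 D0; have SE := Sv_ge0 P Q al0 be0 dl1 et0 E0.
have m x : D + E <= 2 * x -> 0 <= x -> S (D + E) <= 2 ^+ N.+1 * S x.
  move=> h x0; apply: le_trans (sc x x0); apply: Sv_mono => //; exact: addr_ge0.
have [h|h] := leP D E.
  apply: (le_trans (m E _ E0)); first by lra.
  by rewrite ler_wpM2l ?exprn_ge0// lerDr.
apply: (le_trans (m D _ D0)); first by lra.
by rewrite ler_wpM2l ?exprn_ge0// lerDl.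
Qed.

(** The energy estimate at one point: [z] is the cutoff, [t] is [(u - k)_+], [G] and [D] are the
    lengths of the gradients of the cutoff and of [u], and [AD], [AG] are the products of the flux
    with these gradients. One quarter of the coercive term [2 * c2 * t * z ^ (N+1) * S D] pays for
    [AG] by Young's inequality, one quarter for [B] by the smallness of [t], and half of it is
    left. *)
Lemma test_lower (c1 c2 lam z t G D AD AG B : R) : (0 < N)%N -> 0 <= c1 -> 0 <= z <= 1 -> 0 <= t <= 1 ->
  0 <= G -> 0 <= D -> 1 <= lam -> c1 * N.+1%:R ^+ 2 / lam <= c2 / 2 -> c1 * t <= c2 / 2 ->
  c2 * S D - c1 <= AD -> `|AG| <= c1 * (s D + 1) * G -> `|B| <= c1 * (S D + 1) ->
  c2 * (t * (z ^+ N.+1 * S D)) - (3 * c1 + c1 * N.+1%:R + c1 * N.+1%:R ^+ 2 * lam ^+ N) *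
     (t * (1 + t * G + S (t * G)))
  <= z ^+ N.+1 * (2 * t) * AD + t ^+ 2 * (N.+1%:R * z ^+ N * AG) - B * (z ^+ N.+1 * t ^+ 2).
Proof.
move=> N0 c0 /[dup] z01 /andP[z0 z1] /andP[t0 t1] G0 D0 l1 hl ht hAD hAG hB.
have SD := Sv_ge0 P Q al0 be0 dl1 et0 D0.
have tG : 0 <= t * G by rewrite mulr_ge0.
have StG := Sv_ge0 P Q al0 be0 dl1 et0 tG.
have hy := sv_young P1 PQ QN al0 be0 dl1 et0 N0 z01 tG D0 l1.
have sD := sv_ge0 P1 PQ al0 be0 dl1 et0 D0.
have zN0 : 0 <= z ^+ N by rewrite exprn_ge0.
have zN1 : z ^+ N <= 1 by rewrite exprn_ile1.
have y0 : 0 <= z ^+ N.+1 by rewrite exprn_ge0.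
have y1 : z ^+ N.+1 <= 1 by rewrite exprn_ile1.
move: hy hl; set n : R := N.+1%:R; have n0 : 0 <= n by [].
move: SD StG sD hAD hAG hB; move: (S D) (S (t * G)) (s D) => SD StG sD SD0 StG0 sD0 hAD hAG hB.
move: zN0 zN1 y0 y1; move: (z ^+ N) (z ^+ N.+1) => zN y zN0 zN1 y0 y1.
have : 0 <= lam ^+ N by rewrite exprn_ge0// (le_trans _ l1).
move: (lam ^+ N) => X X0 hy hl.
have e1 : y * (2 * t) * (c2 * SD - c1) <= y * (2 * t) * AD by rewrite ler_wpM2l// !mulr_ge0.
have e2 : - (t ^+ 2 * (n * zN * (c1 * (sD + 1) * G))) <= t ^+ 2 * (n * zN * AG).
  rewrite -mulrN -mulrN ler_wpM2l ?exprn_ge0// ler_wpM2l ?mulr_ge0//.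
  by move: hAG; rewrite ler_norml => /andP[].
have e3 : B * (y * t ^+ 2) <= c1 * (SD + 1) * (y * t ^+ 2).
  by rewrite ler_wpM2r ?mulr_ge0 ?exprn_ge0//; apply: le_trans (ler_norm _) hB.
have e4 : t * (n * c1) * (zN * (t * G * sD)) <= t * (n * c1) * (n / lam * (y * SD) + n * X * StG).
  by rewrite ler_wpM2l// ?mulr_ge0.
have e5 : t * (c1 * n ^+ 2 / lam) * (y * SD) <= t * (c2 / 2) * (y * SD).
  by rewrite ler_wpM2r ?mulr_ge0// ler_wpM2l.
have e6 : c1 * t * (SD * y * t) <= c2 / 2 * (SD * y * t) by rewrite ler_wpM2r ?mulr_ge0.
have e7 : c1 * (y * t) <= c1 * t by rewrite ler_wpM2l// ler_piMl.
have e8 : c1 * (y * t ^+ 2) <= c1 * t.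
  have t2 : t ^+ 2 <= t by rewrite expr2 ler_piMl.
  by rewrite ler_wpM2l//; apply: le_trans t2; rewrite ler_piMl ?exprn_ge0.
have e9 : t ^+ 2 * (n * zN * (c1 * G)) <= t ^+ 2 * (n * (c1 * G)).
  by rewrite ler_wpM2l ?exprn_ge0// -mulrA ler_wpM2l// ler_piMl// mulr_ge0.
have f1 : 0 <= c1 * t by rewrite mulr_ge0.
have f2 : 0 <= c1 * t * (t * G) by rewrite !mulr_ge0.
have f3 : 0 <= c1 * t * StG by rewrite !mulr_ge0.
have f4 : 0 <= c1 * n * t by rewrite !mulr_ge0.
have f5 : 0 <= c1 * n * t * StG by rewrite !mulr_ge0.
have f6 : 0 <= c1 * n ^+ 2 * X * t by rewrite !mulr_ge0 ?exprn_ge0.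
have f7 : 0 <= c1 * n ^+ 2 * X * t * (t * G) by rewrite !mulr_ge0 ?exprn_ge0.
have g1 : y * (2 * t) * (c2 * SD - c1) = 2 * (c2 * (t * (y * SD))) - 2 * (c1 * (y * t)) by ring.
have g2 : t ^+ 2 * (n * zN * (c1 * (sD + 1) * G)) = t * (n * c1) * (zN * (t * G * sD)) +
   t ^+ 2 * (n * zN * (c1 * G)) by ring.
have g3 : c1 * (SD + 1) * (y * t ^+ 2) = c1 * t * (SD * y * t) + c1 * (y * t ^+ 2) by ring.
have g4 : t * (n * c1) * (n / lam * (y * SD) + n * X * StG) =
  t * (c1 * n ^+ 2 / lam) * (y * SD) + c1 * n ^+ 2 * X * t * StG by ring.
have g5 : t * (c2 / 2) * (y * SD) = c2 * (t * (y * SD)) / 2 by ring.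
have g6 : c2 / 2 * (SD * y * t) = c2 * (t * (y * SD)) / 2 by ring.
have g9 : t ^+ 2 * (n * (c1 * G)) = c1 * n * t * (t * G) by ring.
have g10 : (3 * c1 + c1 * n + c1 * n ^+ 2 * X) * (t * (1 + t * G + StG)) =
  3 * (c1 * t) + 3 * (c1 * t * (t * G)) + 3 * (c1 * t * StG) +
  c1 * n * t + c1 * n * t * (t * G) + c1 * n * t * StG +
  c1 * n ^+ 2 * X * t + c1 * n ^+ 2 * X * t * (t * G) + c1 * n ^+ 2 * X * t * StG by ring.
rewrite g10; rewrite g1 in e1; rewrite g2 in e2; rewrite g3 in e3; rewrite g4 in e4.
rewrite g5 in e5; rewrite g6 in e6; rewrite g9 in e9.
lra.
Qed.

End test_pointwise.

Section subset_ae.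
Context d (T : measurableType d) (R : realType) (mu : {measure set T -> \bar R}).

Lemma Rint_subset_ae (g : T -> R) (A B : set T) : measurable A -> measurable B ->
  mu.-integrable B (EFin \o g) -> A `<=` B -> {ae mu, forall x, B x -> 0 <= g x} ->
  \int[mu]_(x in A) g x <= \int[mu]_(x in B) g x.
Proof.
move=> mA mB ig AB g0.
have igA : mu.-integrable A (EFin \o g) by exact: integrableS ig.
have ign := integ_norm ig.
have -> : \int[mu]_(x in B) g x = \int[mu]_(x in B) `|g x|.
  apply: (Rint_ae_eq mB (integ_measurable ig) (integ_measurable ign)).
  by apply: filterS g0 => x h Bx; rewrite ger0_norm// h.
apply: le_trans (ler_norm _) _; apply: le_trans (Rint_norm mA igA) _.
rewrite /Rintegral; apply: fine_le.
- by apply: integrable_fin_num => //; exact: integrableS ign.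
- exact: integrable_fin_num.
- apply: (@ge0_subset_integral _ _ _ mu A B mA mB _ _ _ AB); last by move=> x _; rewrite lee_fin.
  exact: measurable_int ign.
Qed.

End subset_ae.

Section solution_data.
Context (R : realType) (N : nat).
Notation T := (leb_space R N).
Notation mu := (lebesgue_rV R N).
Notation HH := (hausdorff_rV R N N.-1).
Notation TH := (caratheodory_type (@hausdorff_outer R N N.-1)).
Context (Om : set 'rV[R]_N) (p q a b : 'rV[R]_N -> R) (dl et : R).
Local Notation S := (Slog p q a b dl et).
Implicit Types (u g f h zeta : 'rV[R]_N -> R) (V : 'rV[R]_N -> 'rV[R]_N).

Record integrand_data (Ma : R) : Prop := IntegrandData {
  id_mp : measurable_fun (Om : set T) p;
  id_mq : measurable_fun (Om : set T) q;
  id_ma : measurable_fun (Om : set T) a;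
  id_mb : measurable_fun (Om : set T) b;
  id_ae : ae_in Om (fun x => [/\ 1 < p x, p x <= q x, q x <= N%:R, 0 <= a x <= Ma & 0 <= b x <= Ma]);
  id_dl : 1 <= dl;
  id_et : 0 <= et }.

(* [Af] and [Bf] stand for [A(x, u, Du)] and [B(x, u, Du)]; in this form the
   hypotheses are invariant under [u |-> -u]. *)
Record sol_data u g (Du Af : 'rV[R]_N -> 'rV[R]_N) (Bf : 'rV[R]_N -> R) (c1 c2 : R) : Prop := SolData {
  sd_W11 : W11i Om u Du;
  sd_trace : forall eps : R, 0 < eps -> exists psi, [/\ C1 psi, (W11_dist Om u Du psi < eps%:E)%E &
      (\int[HH]_(x in boundary Om) `|psi x - g x|%:E < eps%:E)%E];
  sd_mg : measurable_fun (boundary Om : set TH) g;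
  sd_S : lintegrable Om (fun x => S x (enorm (Du x)));
  sd_mA : forall i, measurable_fun (Om : set T) (fun x : T => Af x ord0 i);
  sd_mB : measurable_fun (Om : set T) Bf;
  sd_A : ae_in Om (fun x => enorm (Af x) <= c1 * (slog p q a b dl et x (enorm (Du x)) + 1));
  sd_AD : ae_in Om (fun x => c2 * S x (enorm (Du x)) - c1 <= dotv (Af x) (Du x));
  sd_B : ae_in Om (fun x => `|Bf x| <= c1 * (S x (enorm (Du x)) + 1));
  sd_weak : forall phi Dphi, W1S S Om phi -> W011 Om phi -> weak_grad Om phi Dphi ->
    lintegrable Om (fun x => dotv (Af x) (Dphi x)) -> lintegrable Om (fun x => Bf x * phi x) ->
    \int[mu]_(x in Om) dotv (Af x) (Dphi x) = \int[mu]_(x in Om) (Bf x * phi x) }.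

Context (Ma : R) (hI : integrand_data Ma).
Context (N2 : (2 <= N)%N) (hO : bounded_domain Om) (lO : lipschitz_boundary Om).

Let mO : measurable (Om : set T). Proof. by apply: leb_open; case: hO. Qed.
Let fO : (mu Om < +oo)%E. Proof. by case: hO => _ _ _ /bounded_leb_fin. Qed.
Let dl1 := id_dl hI.
Let et0 := id_et hI.

Lemma Slog_measurable h : measurable_fun (Om : set T) h ->
  measurable_fun (Om : set T) (fun x : T => S x (h x)).
Proof.
move=> mh; apply: measurable_funD.
  by apply: measurable_funM; [exact: id_ma hI|exact: measurable_powRf (id_mp hI)].
apply: measurable_funM.
  by apply: measurable_funM; [exact: id_mb hI|exact: measurable_powRf (id_mq hI)].
apply: (measurableT_comp (@measurable_ln R)).
apply: measurable_funD; first exact: measurable_cst.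
by apply: measurable_funM => //; exact: measurable_cst.
Qed.

Lemma Slog_bounded t : 0 <= t -> exists2 M : R, 0 <= M & ae_in Om (fun x => 0 <= S x t <= M).
Proof.
move=> t0; pose m := Num.max 1 t; have m1 : 1 <= m by rewrite le_max lexx.
have tm : t <= m by rewrite le_max lexx orbT.
pose M1 : R := `|Ma| + `|Ma| * ln (dl + et * 1).
have l0 : 0 <= ln (dl + et * 1) by apply: (@lg_ge0 _ dl et dl1 et0 1).
have M10 : 0 <= M1 by rewrite addr_ge0 ?mulr_ge0.
exists (m ^+ N.+1 * M1); first by rewrite mulr_ge0 ?exprn_ge0// (le_trans ler01).
apply: ae_in_imp (id_ae hI) => x _ [h1 h2 h3 /andP[h4 h5] /andP[h6 h7]].
rewrite (Sv_ge0 (p x) (q x) h4 h6 dl1 et0 t0)/=.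
apply: le_trans (Sv_mono h1 h2 h4 h6 dl1 et0 t0 tm) _.
rewrite -[X in Sv _ _ _ _ _ _ X]mulr1.
apply: le_trans (Sv_scale h1 h2 h3 h4 h6 dl1 et0 m1 ler01) _.
rewrite ler_wpM2l ?exprn_ge0 ?(le_trans ler01 m1)// /Sv !powR1 !mulr1 /M1.
have l0' : 0 <= ln (dl + et) by rewrite -[et]mulr1.
have hM := ler_norm Ma; apply: lerD; first exact: le_trans hM.
by rewrite mulr1 ler_wpM2r//; exact: le_trans hM.
Qed.

Lemma LS_dom f h : measurable_fun (Om : set T) f ->
  ae_in Om (fun x => S x `|f x| <= h x) -> lintegrable Om h -> LS S Om f.
Proof.
move=> mf hf ih; split=> //; exists 1 => //.
have mS : measurable_fun (Om : set T) (fun x : T => S x `|f x|).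
  by apply: Slog_measurable; exact: (measurableT_comp (@normr_measurable R setT) mf).
have iS : lintegrable Om (fun x => S x `|f x|).
  apply: (integ_dom mO mS _ ih).
  apply: ae_in_imp2 (id_ae hI) hf => x _ [h1 h2 h3 /andP[h4 _] /andP[h6 _]] hx.
  by rewrite ger0_norm//; exact: (Sv_ge0 (p x) (q x) h4 h6 dl1 et0 (normr_ge0 _)).
under eq_integral do rewrite mul1r.
by rewrite (RintE mO iS) ltry.
Qed.

Lemma integ_cst (c : R) : lintegrable Om (fun=> c).
Proof. by apply: cb_int => //; exact: cb_cst. Qed.

(** Upper estimates for [- u] are lower estimates for [u]. *)
Lemma sol_dataN u g Du Af Bf c1 c2 : sol_data u g Du Af Bf c1 c2 ->
  sol_data (fun x => - u x) (fun x => - g x) (fun x => - Du x) (fun x => - Af x) (fun x => - Bf x) c1 c2.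
Proof.
have eN i (V : 'rV[R]_N -> 'rV[R]_N) : (fun x => (- V x) ord0 i) = (fun x => - V x ord0 i).
  by apply/funext => x; rewrite mxE.
have eNe V : (fun x => enorm (- V x)) = (fun x => enorm (V x)).
  by apply/funext => x; rewrite enormN.
move=> [iW ht mg iS mA mB hA hAD hB hw]; split.
- case: iW => iu iD; split=> [|i]; first exact: (integN mO iu).
  by rewrite eN; exact: (integN mO (iD i)).
- move=> eps /ht[psi [Cp h1 h2]].
  have Cm : C1 (fun x => -1 * psi x) by apply: C1M => //; exact: C1_cst.
  have pm i x : partial i (fun x => -1 * psi x) x = - partial i psi x.
    by rewrite (partialM i x (C1_cst N (-1)) Cp) partial_cst mulr0 addr0 mulN1r.
  exists (fun x => -1 * psi x); split; first exact: Cm.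
    move: h1; apply: le_lt_trans; rewrite le_eqVlt; apply/orP; left; apply/eqP.
    apply: eq_integral => x _.
    have -> : grad (fun x => -1 * psi x) x = - grad psi x by apply/rowP => i; rewrite !mxE pm.
    have -> : - u x - -1 * psi x = - (u x - psi x) by ring.
    by rewrite normrN -opprD enormN.
  move: h2; apply: le_lt_trans; rewrite le_eqVlt; apply/orP; left; apply/eqP.
  apply: eq_integral => x _.
  by congr EFin; rewrite mulN1r opprK -normrN opprD !opprK.
- exact: measurable_funN.
- by rewrite (_ : (fun x => S x (enorm (- Du x))) = fun x => S x (enorm (Du x)))//; apply/funext => x; rewrite enormN.
- by move=> i; rewrite eN; exact: measurable_funN.
- exact: measurable_funN.
- by apply: ae_in_imp hA => x _; rewrite !enormN.
- by apply: ae_in_imp hAD => x _; rewrite !enormN -[- Du x]scaleN1r -[- Af x]scaleN1r dotvZl dotvZr mulN1r mulN1r opprK.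
- by apply: ae_in_imp hB => x _; rewrite normrN enormN.
- move=> phi Dphi h1 h2 h3.
  have -> : (fun x => dotv (- Af x) (Dphi x)) = (fun x => - dotv (Af x) (Dphi x)).
    by apply/funext => x; rewrite -scaleN1r dotvZl mulN1r.
  have -> : (fun x => - Bf x * phi x) = (fun x => - (Bf x * phi x)).
    by apply/funext => x; rewrite mulNr.
  move=> /(integN mO) i1 /(integN mO) i2.
  have e f : (fun x : T => - - f x) = f by apply/funext => x; rewrite opprK.
  rewrite !e in i1 i2.
  under eq_Rintegral do rewrite -mulN1r; under [RHS]eq_Rintegral do rewrite -mulN1r.
  by rewrite (RintegralZl _ mO i1) (RintegralZl _ mO i2) (hw _ _ h1 h2 h3 i1 i2).
Qed.

Section caccioppoli.
Context (u g : 'rV[R]_N -> R) (Du Af : 'rV[R]_N -> 'rV[R]_N) (Bf : 'rV[R]_N -> R) (c1 c2 : R).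
Context (hs : sol_data u g Du Af Bf c1 c2).
Context (c10 : 0 < c1) (c20 : 0 < c2).

Let N0 : (0 < N)%N. Proof. exact: ltnW. Qed.

Lemma posp_trc (k w s : R) : 0 <= w -> s <= k + w -> trc k w s = posp (s - k) ^+ 2 /\ dtrc k w s = 2 * posp (s - k).
Proof.
move=> w0 sw; have [h|h] := leP k s.
  by rewrite trc_mid ?dtrc_mid ?h ?sw// posp_pos ?subr_ge0.
rewrite trc_below ?dtrc_below ?(ltW h)// posp_neg ?subr_le0 ?(ltW h)//.
by rewrite expr0n/= mulr0.
Qed.

Lemma C1_exp (zeta : 'rV[R]_N -> R) n : C1 zeta -> C1 (fun x => zeta x ^+ n.+1) /\
  forall x, grad (fun x => zeta x ^+ n.+1) x = (n.+1%:R * zeta x ^+ n) *: grad zeta x.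
Proof.
move=> Cz.
have dX s : is_derive s (1 : R) (fun s => s ^+ n.+1) (n.+1%:R * s ^+ n).
  have -> : (fun s : R => s ^+ n.+1) = (id : R -> R) ^+ n.+1 by apply/funext => y; rewrite exprfctE.
  by apply: is_derive_eq; rewrite /GRing.scale/= mulr1.
have cX : continuous (fun s : R => n.+1%:R * s ^+ n).
  by move=> s; apply: cvgM; [exact: cvg_cst|exact: exprn_continuous].
split; first exact: C1_comp Cz dX cX.
by move=> x; apply/rowP => i; rewrite !mxE (partial_comp i x Cz dX cX).
Qed.

(* The test function is [zeta^(N+1) trc k w (u)].  As [u <= k + w] on the support
   of [zeta] with [w] small, the term of natural growth is absorbed. *)
Section test_function.
Context (zeta : 'rV[R]_N -> R) (k w : R).
Context (Cz : C1 zeta) (cz : compact (closure [set x | zeta x != 0])) (z01 : forall x, 0 <= zeta x <= 1).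
Context (w0 : 0 <= w) (w1 : w <= 1).
Context (uk : ae_in Om (fun x => zeta x != 0 -> u x <= k + w)).
Context (hg : forall y, boundary Om y -> zeta y != 0 -> g y <= k).

Let phi x := zeta x ^+ N.+1 * trc k w (u x).
Let Dphi x := (zeta x ^+ N.+1 * dtrc k w (u x)) *: Du x + trc k w (u x) *: grad (fun x => zeta x ^+ N.+1) x.

Lemma test_zero_trace : zero_trace Om phi Dphi.
Proof.
have [CX gX] := C1_exp N Cz.
have e0 : [set x | zeta x ^+ N.+1 != 0] = [set x | zeta x != 0].
  by apply/seteqP; split=> x /=; rewrite expf_eq0.
have w20 : 0 <= 2 * w by rewrite mulr_ge0.
apply: (@zero_trace_comp R N Om u Du g (fun x => zeta x ^+ N.+1) (trc k w) (dtrc k w) (2 * w) 4 k).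
- exact: N2.
- exact: hO.
- exact: lO.
- exact: sd_W11 hs.
- exact: sd_trace hs.
- exact: sd_mg hs.
- exact: CX.
- by rewrite e0.
- exact: w20.
- by [].
- by move=> s; exact: is_derive_trc.
- by move=> s s'; exact: trc_lip.
- by move=> s; exact: dtrc_norm.
- by move=> s s'; exact: dtrc_lip.
- by move=> s; exact: trc_below.
- by move=> y By; rewrite expf_eq0/= => /(hg By).
Qed.

Let t x := posp (u x - k).
Let G x := enorm (grad zeta x).

Lemma test_val : ae_in Om (fun x => [/\ 0 <= phi x <= 1,
   phi x = zeta x ^+ N.+1 * t x ^+ 2,
   (zeta x != 0 -> t x <= w) &
   Dphi x = (zeta x ^+ N.+1 * (2 * t x)) *: Du x + (t x ^+ 2 * (N.+1%:R * zeta x ^+ N)) *: grad zeta x]).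
Proof.
have [_ gX] := C1_exp N Cz.
apply: ae_in_imp uk => x Ox hx; rewrite /phi /Dphi gX scalerA.
have [zx|zx] := eqVneq (zeta x) 0.
  have e0 : zeta x ^+ N = 0 by rewrite zx expr0n gtn_eqF.
  have e1 : zeta x ^+ N.+1 = 0 by rewrite zx expr0n.
  rewrite e0 e1 !(mul0r, mulr0) !scale0r; split; rewrite ?lexx ?ler01//.
have [-> ->] := posp_trc w0 (hx zx).
have tw : t x <= w.
  by rewrite /t; have [[_ ->]|[_ ->]] := posp_case (u x - k) => //; have := hx zx; lra.
have t0 : 0 <= t x by exact: posp_ge0.
have /andP[z0 z1] := z01 x.
split=> //; rewrite mulr_ge0 ?exprn_ge0//= mulr_ile1 ?exprn_ge0 ?exprn_ile1//.
exact: le_trans w1.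
Qed.

(** On the support of the cutoff [t <= w <= 1], so [phi] is bounded by [1] and its gradient by
    [2 * |Du| + Z]; the doubling property of the integrand then gives membership in the energy space
    and all integrability. *)
Lemma test_integrals : [/\ W1S S Om phi, lintegrable Om (fun x => dotv (Af x) (Dphi x)) &
  lintegrable Om (fun x => Bf x * phi x)].
Proof.
have hz := test_zero_trace; have [[iphi iD] _] := hz.
have mphi := integ_measurable iphi.
have mD i := integ_measurable (iD i).
have [_ iDu] := sd_W11 hs; have mDu i := integ_measurable (iDu i).
have [M M0 hM] := Slog_bounded (ler01 : 0 <= 1 :> R).
have [Z Z0 hZ] : exists2 Z : R, 0 <= Z & forall x, N.+1%:R * enorm (grad zeta x) <= Z.
  have cbv : cb (fun x => N.+1%:R * \sum_i `|partial i zeta x|).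
    apply: cbM; first exact: cb_cst.
    by apply: cb_sum => i; apply: cb_norm; exact: C1c_cb_partial.
  have [_ [Z hZ]] := cbv; exists `|Z|; first exact: normr_ge0.
  move=> x; apply: le_trans (le_trans (ler_norm _) (le_trans (hZ x) (ler_norm Z))).
  by rewrite ler_wpM2l//; apply: (le_trans (enorm_le_sum _)); under eq_bigr do rewrite mxE.
have [M' M'0 hM'] := Slog_bounded Z0.
have iS := sd_S hs.
pose D x := enorm (Du x).
have iDe : lintegrable Om D by apply: enorm_integrable.
have hDphi : ae_in Om (fun x => enorm (Dphi x) <= 2 * D x + Z).
  apply: ae_in_imp test_val => x Ox [_ _ ht ->].
  have t0 : 0 <= t x by exact: posp_ge0.
  have /andP[z0 z1] := z01 x.
  apply: le_trans (enormD _ _) _; rewrite !enormZ; apply: lerD.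
    rewrite ler_wpM2r ?enorm_ge0// ger0_norm ?mulr_ge0 ?exprn_ge0//.
    have [->|zx] := eqVneq (zeta x) 0; first by rewrite expr0n/= mul0r.
    have t1 : t x <= 1 by apply: le_trans (ht zx) w1.
    rewrite mulrCA ler_piMr// mulr_ile1 ?exprn_ge0 ?exprn_ile1//.
  apply: le_trans (hZ x); rewrite ler_wpM2r ?enorm_ge0// ger0_norm ?mulr_ge0 ?exprn_ge0//.
  have [->|zx] := eqVneq (zeta x) 0; first by rewrite expr0n gtn_eqF// !mulr0.
  have t1 : t x <= 1 by apply: le_trans (ht zx) w1.
  by rewrite mulrCA ler_piMr// mulr_ile1 ?exprn_ge0 ?exprn_ile1.
have LSphi : LS S Om phi.
  apply: (@LS_dom _ (fun=> M) mphi _ (integ_cst M)).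
  apply: ae_in_imp2 (ae_in_imp2 _ (id_ae hI) hM) test_val; last by move=> x _ h1 h2; exact: (conj h1 h2).
  move=> x _ [[h1 h2 h3 /andP[h4 h5] /andP[h6 h7]] /andP[_ hMx]] [/andP[p0 p1] _ _ _].
  apply: le_trans hMx; rewrite ger0_norm//.
  exact: (Sv_mono h1 h2 h4 h6 dl1 et0 p0 p1).
have LSD : LS S Om (fun x => enorm (Dphi x)).
  have ih : lintegrable Om (fun x => 2 ^+ N.+1 * (2 ^+ N.+1 * S x (D x) + M')).
    apply: (integZ mO); apply: (integD mO); last exact: integ_cst.
    exact: (integZ mO).
  apply: (LS_dom _ _ ih); first exact: enorm_measurable.
  apply: ae_in_imp2 (ae_in_imp2 _ (id_ae hI) hM') hDphi; last by move=> x _ h1 h2; exact: (conj h1 h2).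
  move=> x _ [[h1 h2 h3 /andP[h4 h5] /andP[h6 h7]] /andP[_ hMx]] hDx.
  have D0 : 0 <= D x by exact: enorm_ge0.
  have D20 : 0 <= 2 * D x by rewrite mulr_ge0.
  rewrite ger0_norm ?enorm_ge0//.
  apply: le_trans (Sv_mono h1 h2 h4 h6 dl1 et0 (enorm_ge0 _) hDx) _.
  apply: le_trans (Sv_add h1 h2 h3 h4 h6 dl1 et0 D20 Z0) _.
  rewrite ler_wpM2l ?exprn_ge0//; apply: lerD => //.
  apply: (Sv_scale h1 h2 h3 h4 h6 dl1 et0 _ D0); lra.
split.
- split=> //; exists Dphi => //; apply: zero_trace_weak_grad => //; by case: hO.
- have mAD : measurable_fun (Om : set T) (fun x : T => dotv (Af x) (Dphi x)).
    under eq_fun do rewrite dotvE.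
    by apply: measurable_sum => i; apply: measurable_funM; [exact: sd_mA hs i|exact: mD].
  have ih : lintegrable Om (fun x => c1 * ((N.+1%:R * 2 + Z * N.+1%:R) * S x (D x) + 2 * D x + Z * (N.+1%:R * M + 1))).
    apply: (integZ mO); apply: (integD mO); last exact: integ_cst.
    by apply: (integD mO); exact: (integZ mO).
  apply: (integ_dom mO mAD _ ih).
  apply: ae_in_imp2 (ae_in_imp2 _ (id_ae hI) hM) (ae_in_imp2 _ hDphi (sd_A hs));
    last 2 first; [by move=> x _ h1 h2; exact: (conj h1 h2)|by move=> x _ h1 h2; exact: (conj h1 h2)|].
  move=> x _ [[h1 h2 h3 /andP[h4 h5] /andP[h6 h7]] /andP[_ hMx]] [hDx hAx].
  have D0 : 0 <= D x by exact: enorm_ge0.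
  have s1 : slog p q a b dl et x (D x) <= N.+1%:R * (S x (D x) + S x 1) := sv_le_S h1 h2 h3 h4 h6 dl1 et0 D0.
  have s2 : slog p q a b dl et x (D x) * D x <= N.+1%:R * S x (D x) := svM_le h1 h2 h3 h4 h6 dl1 et0 D0.
  have s0 : 0 <= slog p q a b dl et x (D x) := sv_ge0 h1 h2 h4 h6 dl1 et0 D0.
  apply: (le_trans (cauchy_schwarz_norm _ _)).
  apply: (le_trans (ler_pM (enorm_ge0 _) (enorm_ge0 _) hAx hDx)).
  rewrite -mulrA ler_wpM2l ?(ltW c10)//.
  move: s1 s2 s0 hMx D0.
  rewrite -/(D x); move: (slog p q a b dl et x (D x)) (S x (D x)) (S x 1) => s SD S1.
  move: (D x) (N.+1%:R : R) (ler0n R N.+1) => d n n0 s1 s2 s0 hM1 d0.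
  have e1 : s * Z <= n * (SD + M) * Z.
    by apply: ler_wpM2r => //; apply: le_trans s1 _; rewrite ler_wpM2l// lerD2l.
  have e2 : (s + 1) * (2 * d + Z) = 2 * (s * d) + s * Z + 2 * d + Z by ring.
  have e3 : (n * 2 + Z * n) * SD + 2 * d + Z * (n * M + 1) = 2 * (n * SD) + n * (SD + M) * Z + 2 * d + Z by ring.
  by rewrite e2 e3; lra.
- have mB : measurable_fun (Om : set T) (fun x : T => Bf x * phi x).
    by apply: measurable_funM => //; exact: sd_mB hs.
  have ih : lintegrable Om (fun x => c1 * (S x (D x) + 1)).
    by apply: (integZ mO); apply: (integD mO) => //; exact: integ_cst.
  apply: (integ_dom mO mB _ ih).
  apply: ae_in_imp2 test_val (sd_B hs) => x _ [/andP[p0 p1] _ _ _] hB.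
  rewrite normrM; apply: le_trans hB; rewrite ler_piMr// ger0_norm//.
Qed.

(** The weak equation makes the integral of the flux term minus the right-hand side equal to zero,
    and [test_lower] bounds its integrand from below. [F] is any majorant of the error terms on the
    support of the cutoff. *)
Lemma test_energy (lam : R) (F : 'rV[R]_N -> R) : 1 <= lam -> c1 * N.+1%:R ^+ 2 / lam <= c2 / 2 ->
  c1 * w <= c2 / 2 -> lintegrable Om F -> (forall x, Om x -> 0 <= F x) ->
  ae_in Om (fun x => zeta x != 0 -> t x * (1 + t x * G x + S x (t x * G x)) <= F x) ->
  lintegrable Om (fun x => t x * (zeta x ^+ N.+1 * S x (enorm (Du x)))) /\
  c2 * \int[mu]_(x in Om) (t x * (zeta x ^+ N.+1 * S x (enorm (Du x)))) <=
  (3 * c1 + c1 * N.+1%:R + c1 * N.+1%:R ^+ 2 * lam ^+ N) * \int[mu]_(x in Om) F x.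
Proof.
move=> l1 hl hw iF F0 hF.
have [Wphi iA iB] := test_integrals.
have hz := test_zero_trace; have [iphi happ] := hz.
have wgz : weak_grad Om phi Dphi by apply: zero_trace_weak_grad => //; case: hO.
have W0 : W011 Om phi by exists Dphi => //; case: iphi.
have hweak := sd_weak hs Wphi W0 wgz iA iB.
have iS := sd_S hs.
have [iu _] := sd_W11 hs; have mu' := integ_measurable iu.
have mt : measurable_fun (Om : set T) (fun x : T => t x).
  apply: (measurableT_comp (f := @posp R)); first exact: continuous_measurable_fun (@posp_continuous R).
  by apply: measurable_funB => //; exact: measurable_cst.
have mz : measurable_fun (Om : set T) (fun x : T => zeta x ^+ N.+1).
  by apply: C1_measurable => //; case: (C1_exp N Cz).
have iL : lintegrable Om (fun x => t x * (zeta x ^+ N.+1 * S x (enorm (Du x)))).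
  apply: (integ_dom mO _ _ iS).
    exact: (measurable_funM mt (measurable_funM mz (integ_measurable iS))).
  apply: ae_in_imp2 (id_ae hI) test_val => x _ [h1 h2 h3 /andP[h4 _] /andP[h6 _]] [_ _ ht _].
  have S0 : 0 <= S x (enorm (Du x)) := Sv_ge0 (p x) (q x) h4 h6 dl1 et0 (enorm_ge0 _).
  have t0 : 0 <= t x by exact: posp_ge0.
  have /andP[z0 z1] := z01 x.
  rewrite mulrA normrM [X in _ * X]ger0_norm// ler_piMl//.
  have [->|zx] := eqVneq (zeta x) 0; first by rewrite expr0n/= mulr0 normr0.
  rewrite ger0_norm ?mulr_ge0 ?exprn_ge0//.
  by rewrite mulr_ile1 ?exprn_ge0 ?exprn_ile1// (le_trans (ht zx)).
split=> //.
have [C' C'0 C'E] : exists2 C', 0 <= C' & C' = 3 * c1 + c1 * N.+1%:R + c1 * N.+1%:R ^+ 2 * lam ^+ N.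
  by eexists; last reflexivity; rewrite !addr_ge0 ?mulr_ge0 ?exprn_ge0// ?(ltW c10)// (le_trans ler01).
rewrite -C'E.
have iLL := integZ mO c2 iL; have iFF := integZ mO C' iF.
have key : ae_in Om (fun x => c2 * (t x * (zeta x ^+ N.+1 * S x (enorm (Du x)))) - C' * F x <=
    dotv (Af x) (Dphi x) - Bf x * phi x).
  have h1 : ae_in Om (fun x => [/\ c2 * S x (enorm (Du x)) - c1 <= dotv (Af x) (Du x),
      enorm (Af x) <= c1 * (slog p q a b dl et x (enorm (Du x)) + 1) &
      `|Bf x| <= c1 * (S x (enorm (Du x)) + 1)]).
    apply: ae_in_imp2 (ae_in_imp2 _ (sd_A hs) (sd_AD hs)) (sd_B hs);
      last by move=> x _ k1 k2; exact: (conj k1 k2).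
    by move=> x _ [k1 k2] k3.
  have h2 : ae_in Om (fun x => (zeta x != 0 -> t x * (1 + t x * G x + S x (t x * G x)) <= F x) /\
    [/\ 1 < p x, p x <= q x, q x <= N%:R, 0 <= a x <= Ma & 0 <= b x <= Ma]).
    by apply: ae_in_imp2 hF (id_ae hI) => x _ k1 k2.
  apply: ae_in_imp2 (ae_in_imp2 _ h1 h2) test_val;
    last by move=> x _ k1 k2; exact: (conj k1 k2).
  move=> x Ox [[k1 k2 k3] [k4 [g1 g2 g3 /andP[g4 _] /andP[g6 _]]]] [_ -> ht ->].
  rewrite dotvDr !dotvZr.
  have [z0|zx] := eqVneq (zeta x) 0.
    have e0 : zeta x ^+ N = 0 by rewrite z0 expr0n gtn_eqF.
    have e1 : zeta x ^+ N.+1 = 0 by rewrite z0 expr0n.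
    rewrite e0 e1 !(mul0r, mulr0) addr0 subr0 sub0r oppr_le0.
    by rewrite mulr_ge0//; exact: F0.
  have t0 : 0 <= t x by exact: posp_ge0.
  have t1 : t x <= 1 by apply: le_trans (ht zx) w1.
  have ct : c1 * t x <= c2 / 2 by apply: le_trans hw; rewrite ler_wpM2l ?(ltW c10)//; exact: ht.
  have AGx : `|dotv (Af x) (grad zeta x)| <= c1 * (slog p q a b dl et x (enorm (Du x)) + 1) * G x.
    by apply: (le_trans (cauchy_schwarz_norm _ _)); rewrite ler_wpM2r ?enorm_ge0.
  have t01 : 0 <= t x <= 1 by rewrite t0 t1.
  have k6 : c2 * (t x * (zeta x ^+ N.+1 * S x (enorm (Du x)))) - C' * (t x * (1 + t x * G x + S x (t x * G x)))
    <= zeta x ^+ N.+1 * (2 * t x) * dotv (Af x) (Du x) + t x ^+ 2 * (N.+1%:R * zeta x ^+ N * dotv (Af x) (grad zeta x))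
       - Bf x * (zeta x ^+ N.+1 * t x ^+ 2).
    rewrite C'E; exact: (test_lower g1 g2 g3 g4 g6 dl1 et0 N0 (ltW c10) (z01 x) t01 (enorm_ge0 (grad zeta x))
      (enorm_ge0 (Du x)) l1 hl ct k1 AGx k3).
  have := ler_wpM2l C'0 (k4 zx); rewrite -[in X in _ -> _ <= X]mulrA => k5.
  apply: le_trans (le_trans _ k6) _; first by rewrite lerD2l lerN2.
  by rewrite -!mulrA.
have := Rint_ae_le mO (integB mO iLL iFF) (integB mO iA iB) key.
rewrite (RintegralB mO iLL iFF) (RintegralB mO iA iB) hweak subrr.
by rewrite (RintegralZl _ mO iL) (RintegralZl _ mO iF) subr_le0.
Qed.

End test_function.

(** The majorant in [test_energy] is a constant times the indicator of the superlevel set: on it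
    [(u - k)_+] is at most [w], elsewhere it vanishes. *)
Lemma cacc_cube : exists2 C : R, 0 < C & exists2 w0 : R, 0 < w0 <= 1 &
  forall (x0 : 'rV[R]_N) k w r rho M, 0 < r < rho -> 0 <= w <= w0 -> 0 <= M ->
  ae_in (Om `&` cube x0 rho) (fun x => u x <= k + w) ->
  (forall y, boundary Om y -> `|y - x0| < rho -> g y <= k) ->
  ae_in (Om `&` cube x0 rho) (fun x => S x (w / (rho - r)) <= M) ->
  lintegrable (Om `&` cube x0 r) (fun x => posp (u x - k) * S x (enorm (Du x))) /\
  \int[mu]_(x in Om `&` cube x0 r) (posp (u x - k) * S x (enorm (Du x))) <=
  C * w * (1 + w / (rho - r) + M) * fine (mu (Om `&` cube x0 rho `&` [set x | k < u x])).
Proof.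
(* The parameter in Young's inequality, so large that [c1 * N.+1 ^ 2 / lam <= c2 / 2]. *)
pose lam : R := 1 + 2 * c1 * N.+1%:R ^+ 2 / c2.
have l1 : 1 <= lam by rewrite lerDl divr_ge0 ?mulr_ge0 ?exprn_ge0// ltW.
have l0 : 0 < lam by apply: lt_le_trans l1.
have hl : c1 * N.+1%:R ^+ 2 / lam <= c2 / 2.
  have e : c2 / 2 * lam = c2 / 2 + c1 * N.+1%:R ^+ 2 by rewrite /lam; field; exact: lt0r_neq0.
  by rewrite ler_pdivrMr// e lerDr divr_ge0// ltW.
pose C' := 3 * c1 + c1 * N.+1%:R + c1 * N.+1%:R ^+ 2 * lam ^+ N.
have C'0 : 0 < C'.
  by rewrite /C' ltr_wpDr ?ltr_wpDr ?mulr_gt0// !mulr_ge0 ?exprn_ge0// ltW.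
(* The gradient of the cutoff has length at most [m / (rho - r)]; pulling [m] out of the integrand
   costs [m ^ (N+1)]. *)
pose m : R := 4 * N%:R.
have m1 : 1 <= m by rewrite /m -natrM ler1n muln_gt0.
have m0 : 0 <= m by exact: le_trans m1.
exists (C' / c2 * m ^+ N.+1); first by rewrite !mulr_gt0 ?invr_gt0 ?exprn_gt0// (lt_le_trans ltr01).
(* The bound [c1 * w <= c2 / 2] is what absorbs the term of natural growth. *)
exists (Num.min 1 (c2 / (2 * c1))).
  by rewrite lt_min ltr01 divr_gt0 ?mulr_gt0// ge_min lexx.
move=> x0 k w r rho M /andP[r0 rr] /andP[w0]; rewrite le_min => /andP[w1 w2] M0 uk hg hM.
have hw : c1 * w <= c2 / 2.
  by move: w2; rewrite ler_pdivlMr ?mulr_gt0// => h; lra.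
have [|zeta [Cz z01 z1 zs zp]] := @cutoff_exists R N x0 r rho; first by rewrite (ltW r0).
have cz : compact (closure [set x | zeta x != 0]).
  by apply: (@compact_supp_ball R N zeta x0 rho) => x /zs /ltW.
have zcube x : zeta x != 0 -> cube x0 rho x by move=> /zs; exact: cube_lt.
have uk' : ae_in Om (fun x => zeta x != 0 -> u x <= k + w).
  move: uk; apply: (@filterS _ (almost_everywhere mu)) => x h Ox zx; apply: h; split=> //.
  exact: zcube.
have hg' y : boundary Om y -> zeta y != 0 -> g y <= k by move=> By /zs; exact: hg.
have d0 : 0 < rho - r by rewrite subr_gt0.
have [iu _] := sd_W11 hs; have mu' := integ_measurable iu.
have [E Edef] : exists E : set T, E = Om `&` cube x0 rho `&` [set x | k < u x] by eexists.
have mE : measurable E.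
  rewrite Edef setIAC; apply: measurableI; last exact: measurable_cube.
  have -> : [set x | k < u x] = u @^-1` `]k, +oo[%classic by apply/seteqP; split=> x /=; rewrite in_itv/= andbT.
  exact: mu'.
have fE : (mu E < +oo)%E.
  by apply: le_lt_trans fO; apply: leb_le; rewrite Edef => x [[]].
have [c [c0 cE]] : exists c, 0 <= c /\ c = w * m ^+ N.+1 * (1 + w / (rho - r) + M).
  by eexists; split; last reflexivity; rewrite !mulr_ge0 ?exprn_ge0// !addr_ge0// divr_ge0// ltW.
have [iF hF] : lintegrable Om (fun x => c * \1_E x) /\ \int[mu]_(x in Om) (c * \1_E x) <= c * fine (mu E).
  by split; [exact: integ_indic|exact: Rint_indic_le].
have F0 x : Om x -> 0 <= c * \1_E x by move=> _; rewrite mulr_ge0.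
have Gle x : enorm (grad zeta x) <= m / (rho - r).
  apply: (le_trans (enorm_le_sum _)).
  apply: (@le_trans _ _ (\sum_(i < N) (4 / (rho - r)))).
    by apply: ler_sum => i _; rewrite mxE.
  by rewrite sumr_const card_ord -mulr_natl /m; lra.
have hEF : ae_in Om (fun x => zeta x != 0 -> posp (u x - k) * (1 + posp (u x - k) * enorm (grad zeta x) +
    S x (posp (u x - k) * enorm (grad zeta x))) <= c * \1_E x).
  have h1 : ae_in Om (fun x => zeta x != 0 -> S x (w / (rho - r)) <= M).
    move: hM; apply: (@filterS _ (almost_everywhere mu)) => x h Ox zx; apply: h; split=> //.
    exact: zcube.
  have h2 : ae_in Om (fun x => (zeta x != 0 -> S x (w / (rho - r)) <= M) /\ (zeta x != 0 -> u x <= k + w)).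
    by apply: ae_in_imp2 h1 uk' => x _.
  apply: ae_in_imp2 h2 (id_ae hI) => x Ox [k1 k2] [g1 g2 g3 /andP[g4 _] /andP[g6 _]] zx.
  have [[uk0 tE]|[uk0 ->]] := posp_case (u x - k); last by rewrite mul0r mulr_ge0.
  have [uk1|uk1] := leP (u x) k.
    have -> : posp (u x - k) = 0 by rewrite posp_neg// subr_le0.
    by rewrite mul0r mulr_ge0.
  have -> : \1_E x = 1 :> R.
    by rewrite indicE mem_set// Edef; split=> //; split=> //; exact: zcube.
  rewrite mulr1 cE -mulrA.
  have tw : posp (u x - k) <= w by rewrite tE; have := k2 zx; lra.
  apply: ler_pM => //; first exact: posp_ge0.
    have tG0 : 0 <= posp (u x - k) * enorm (grad zeta x) by rewrite mulr_ge0 ?posp_ge0 ?enorm_ge0.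
    apply: addr_ge0; first by rewrite addr_ge0.
    exact: (Sv_ge0 (p x) (q x) g4 g6 dl1 et0 tG0).
  have tG : posp (u x - k) * enorm (grad zeta x) <= m * (w / (rho - r)).
    rewrite mulrCA; apply: ler_pM => //; rewrite ?posp_ge0 ?enorm_ge0//.
  have q0 : 0 <= w / (rho - r) by rewrite divr_ge0// ltW.
  have mN1 : m <= m ^+ N.+1 by rewrite exprS ler_peMr// exprn_ege1.
  have tG0 : 0 <= posp (u x - k) * enorm (grad zeta x) by rewrite mulr_ge0 ?posp_ge0 ?enorm_ge0.
  rewrite !mulrDr mulr1; apply: lerD; first apply: lerD.
  - by rewrite exprn_ege1.
  - by apply: le_trans tG _; rewrite ler_wpM2r.
  - apply: le_trans (Sv_mono g1 g2 g4 g6 dl1 et0 tG0 tG) _.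
    apply: le_trans (Sv_scale g1 g2 g3 g4 g6 dl1 et0 m1 q0) _.
    by rewrite ler_wpM2l ?exprn_ge0//; exact: k1.
have [iL hE] := test_energy Cz cz z01 w0 w1 uk' hg' l1 hl hw iF F0 hEF.
have sub : Om `&` cube x0 r `<=` Om by exact: subIsetl.
have mK : measurable (Om `&` cube x0 r : set T) by apply: measurableI => //; exact: measurable_cube.
have eqz x : (Om `&` cube x0 r) x -> posp (u x - k) * (zeta x ^+ N.+1 * S x (enorm (Du x))) =
    posp (u x - k) * S x (enorm (Du x)).
  by move=> [_ /(cube_le (ltW r0)) xr]; rewrite z1// expr1n mul1r.
have iK : lintegrable (Om `&` cube x0 r) (fun x => posp (u x - k) * S x (enorm (Du x))).
  apply: (eq_integrable mK) (integrableS mO mK sub iL) => x /set_mem hx.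
  by rewrite /= eqz.
split=> //.
have eI : \int[mu]_(x in Om `&` cube x0 r) (posp (u x - k) * S x (enorm (Du x))) =
    \int[mu]_(x in Om `&` cube x0 r) (posp (u x - k) * (zeta x ^+ N.+1 * S x (enorm (Du x)))).
  by apply: eq_Rintegral => x /set_mem hx; rewrite eqz.
have pos : ae_in Om (fun x => 0 <= posp (u x - k) * (zeta x ^+ N.+1 * S x (enorm (Du x)))).
  apply: ae_in_imp (id_ae hI) => x _ [g1 g2 g3 /andP[g4 _] /andP[g6 _]].
  have /andP[z0 _] := z01 x.
  by rewrite !mulr_ge0 ?posp_ge0 ?exprn_ge0//; exact: (Sv_ge0 (p x) (q x) g4 g6 dl1 et0 (enorm_ge0 _)).
have hsub := Rint_subset_ae mK mO iL sub pos.
rewrite eI; apply: le_trans hsub _.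
have h4 := le_trans hE (ler_wpM2l (ltW C'0) hF).
rewrite -Edef; move: h4; rewrite mulrC -ler_pdivlMr// => h4; apply: le_trans h4 _.
rewrite cE le_eqVlt; apply/orP; left; apply/eqP; ring.
Qed.

End caccioppoli.

End solution_data.

(** * Comparability of the integrand on small cubes *)

Section comparability.
Context (R : realType) (N : nat).
Notation T := (leb_space R N).
Notation mu := (lebesgue_rV R N).

Lemma closure_bounded (Om : set 'rV[R]_N) : bounded_set Om -> compact (closure Om).
Proof.
move=> bO; apply: bounded_closed_compact; last exact: closed_closure.
have [M [Mr hM]] := bO.
exists (M + 1); split; first by rewrite realD// real1.
move=> K hK x clx.
have [y [Oy]] := clx _ (nbhsx_ballx x _ (ltr01 : 0 < 1 :> R)).
rewrite -ball_normE/= => xy.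
have My : `|y| <= K - 1 by apply: hM => //; rewrite ltrBrDr.
rewrite -(subrK y x); apply: (le_trans (ler_normD _ _)); lra.
Qed.

Lemma exponent_lower (Om : set 'rV[R]_N) (p : 'rV[R]_N -> R) : bounded_domain Om ->
  log_hoelder (closure Om) p -> (forall x, closure Om x -> 1 < p x) ->
  exists2 pm : R, 1 < pm & forall x, Om x -> pm <= p x.
Proof.
move=> [[z Oz] _ _ bO] hp p1.
have [|||c /set_mem cc hc] := @EVT_min_rV R N p (closure Om).
- by exists z; exact: subset_closure.
- exact: closure_bounded.
- exact: log_hoelder_cont.
by exists (p c) => [|x Ox]; [exact: p1|apply: hc; apply/mem_set; exact: subset_closure].
Qed.

(** The reference value is [S0v] frozen at an arbitrary point [z] of [Om] in the cube; it is at
    least [t] because [t >= 1] and the exponent exceeds [1]. The passage from [z] to [x] is made for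
    [S0v] by [S0v_compare], and the passage between [S0v] and the integrand is made at the fixed
    point [x]. *)
Lemma Slog_comparable (Om : set 'rV[R]_N) (p q a b : 'rV[R]_N -> R) (dl et Ma alpha d : R) :
  (0 < N)%N -> (forall x, closure Om x -> 1 < p x) -> log_hoelder (closure Om) p -> log_hoelder (closure Om) q ->
  integrand_data Om p q a b dl et Ma ->
  0 < alpha -> hoelder_on alpha (closure Om) b -> (forall x, closure Om x -> 0 <= b x) ->
  0 < d -> ae_in Om (fun x => d <= a x + b x) -> 1 < dl + et ->
  (ereal_sup [set (xt.2 `^ (q xt.1 - p xt.1 - alpha) * ln (dl + et * xt.2))%:E
     | xt in [set xt : 'rV[R]_N * R | Om xt.1 /\ (1 <= xt.2)%R]] < +oo)%E ->
  exists kap r0 C : R, [/\ 0 < kap, 0 < r0, 1 <= C &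
    forall x0 r t, 0 < r <= r0 -> 1 <= t -> t * r <= kap ->
    exists2 sg, t <= sg & ae_in (Om `&` cube x0 r) (fun x =>
      Slog p q a b dl et x t <= C * sg /\ sg <= C * Slog p q a b dl et x t)].
Proof.
move=> N0 p1 hp hq hI al0 [Cb hb] b0 d0 hab hde hsup.
have [dl1 et0] := (id_dl hI, id_et hI).
have [Ep Ep0 [rp rp0 hEp]] := log_hoelder_powR N0 hp.
have [Eq Eq0 [rq rq0 hEq]] := log_hoelder_powR N0 hq.
have [H H0 hH] : exists2 H : R, 0 <= H & forall x t, Om x -> 1 <= t ->
    t `^ (q x - p x - alpha) * lg dl et t <= H.
  pose s := ereal_sup [set (xt.2 `^ (q xt.1 - p xt.1 - alpha) * ln (dl + et * xt.2))%:E
     | xt in [set xt : 'rV[R]_N * R | Om xt.1 /\ (1 <= xt.2)%R]].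
  exists `|fine s|; first exact: normr_ge0.
  move=> x t Ox t1.
  have hs : ((t `^ (q x - p x - alpha) * lg dl et t)%:E <= s)%E.
    by apply: ereal_sup_ubound; exists (x, t).
  have sf : s \is a fin_num.
    rewrite fin_numE; apply/andP; split; last by rewrite lt_eqF.
    by apply/eqP => e; move: hs; rewrite e.
  move: hs; rewrite -(fineK sf) lee_fin => hs; exact: le_trans hs (ler_norm _).
pose E := Num.max Ep Eq; have E0 : 0 < E by rewrite lt_max Ep0.
(* For points of one cube of half-side [r] and [t * r <= 1], this bounds the oscillation of [b]
   times [t ^ alpha]. *)
pose G : R := `|Cb| * (2 * N%:R) `^ alpha.
have G0 : 0 <= G by rewrite mulr_ge0 ?powR_ge0.
pose C1 := E * (1 + G * H).
have C10 : 0 <= C1 by rewrite mulr_ge0 ?addr_ge0 ?mulr_ge0// ltW.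
have [l [l0 l1 lL]] : exists l : R, [/\ 0 < l, l <= 1 & l <= lg dl et 1].
  exists (Num.min 1 (lg dl et 1)); split; rewrite ?ge_min ?lexx ?orbT// lt_min ltr01/=.
  by rewrite /lg mulr1 ln_gt0.
pose m := Num.max 1 Ma; have m1 : 1 <= m by rewrite le_max lexx.
pose C2 := (1 + (l * d)^-1).
have C20 : 0 <= C2 by rewrite addr_ge0// invr_ge0 mulr_ge0 ?(ltW l0)// ltW.
pose C := 1 + m * C1 + C1 * C2.
exists (Num.min 1 (Num.min rp^-1 rq^-1)), (Num.min 1 (Num.min rp rq)), C; split.
- by rewrite !lt_min ltr01 !invr_gt0 rp0.
- by rewrite !lt_min ltr01 rp0.
- have mC : 0 <= m * C1 by rewrite mulr_ge0// (le_trans ler01).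
  by rewrite /C -addrA lerDl addr_ge0// mulr_ge0.
move=> x0 r t /andP[r0]; rewrite !le_min => /andP[_ /andP[rrp rrq]] t1 /andP[tr1 /andP[trp trq]].
have t0 : 0 < t by apply: lt_le_trans t1.
(* If the cube contains no point of [Om], the comparison is empty and [sg = t] will do. *)
have [[z [Oz Kz]]|hn] := pselect (exists z, Om z /\ cube x0 r z); last first.
  by exists t => //; apply: ae_in_all => x [Ox Kx]; case: hn; exists x.
have cl x : Om x -> closure Om x by move=> Ox; exact: subset_closure.
have bz := b0 _ (cl _ Oz).
exists (S0v dl et (p z) (q z) (b z) t).
  by apply: S0v_ge => //; exact: p1 (cl _ Oz).
have hcmp x y : Om x -> cube x0 r x -> Om y -> cube x0 r y ->
    S0v dl et (p y) (q y) (b y) t <= C1 * S0v dl et (p x) (q x) (b x) t.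
  move=> Ox Kx Oy Ky.
  have xy : `|x - y| <= 2 * r.
    rewrite (_ : x - y = (x - x0) - (y - x0)); last by rewrite opprB addrA subrK.
    have := cube_le (ltW r0) Kx; have := cube_le (ltW r0) Ky.
    have := ler_normB (x - x0) (y - x0); lra.
  have hbe : b y <= b x + `|Cb| * enorm (y - x) `^ alpha.
    have := hb _ _ (cl _ Oy) (cl _ Ox); have := ler_norm (b y - b x).
    have := ler_wpM2r (powR_ge0 (enorm (y - x)) alpha) (ler_norm Cb); lra.
  apply: (@S0v_compare R (p x) (q x) (b x) dl et (b0 _ (cl _ Ox)) dl1 et0 (p y) (q y) (b y) t E G H alpha
    (`|Cb| * enorm (y - x) `^ alpha)) => //.
  - by rewrite mulr_ge0 ?powR_ge0.
  - apply: (@le_trans _ _ Ep); last by rewrite le_max lexx.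
    by apply: (hEp _ _ r) => //; rewrite ?r0//; exact: cl.
  - apply: (@le_trans _ _ Eq); last by rewrite le_max lexx orbT.
    by apply: (hEq _ _ r) => //; rewrite ?r0//; exact: cl.
  - rewrite -mulrA ler_wpM2l// -powRM ?enorm_ge0 ?(ltW t0)//.
    apply: powR_mono; rewrite ?(ltW al0) ?mulr_ge0 ?enorm_ge0 ?(ltW t0)//.
    apply: (@le_trans _ _ (N%:R * (2 * r) * t)).
      rewrite ler_wpM2r ?(ltW t0)//; apply: (le_trans (enorm_le_sup _)).
      by rewrite ler_wpM2l// distrC.
    by rewrite (_ : N%:R * (2 * r) * t = 2 * N%:R * (t * r)); [rewrite ler_piMr// mulr_ge0|ring].
  - exact: hH.
have hae : ae_in (Om `&` cube x0 r) (fun x => d <= a x + b x /\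
   [/\ 1 < p x, p x <= q x, q x <= N%:R, 0 <= a x <= Ma & 0 <= b x <= Ma]).
  apply: (@ae_inS _ _ _ Om); first exact: subIsetl.
  by apply: ae_in_imp2 hab (id_ae hI) => x _.
apply: ae_in_imp hae => x [Ox Kx] [dab [h1 h2 h3 /andP[h4 h5] /andP[h6 h7]]].
have z1 := hcmp _ _ Oz Kz Ox Kx; have z2 := hcmp _ _ Ox Kx Oz Kz.
have s0 : 0 <= S0v dl et (p z) (q z) (b z) t.
  by rewrite addr_ge0 ?mulr_ge0 ?powR_ge0//; apply: lg_ge0 => //; exact: ltW.
have aM : a x <= m by rewrite le_max h5 orbT.
have u1 : Slog p q a b dl et x t <= m * S0v dl et (p x) (q x) (b x) t :=
  Sv_le_S0v (p x) (q x) h6 dl1 et0 (ltW t0) m1 aM.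
have l01 : 0 < l <= 1 by rewrite l0.
have u2 : S0v dl et (p x) (q x) (b x) t <= C2 * Slog p q a b dl et x t :=
  S0v_le_Sv h2 h4 h6 dl1 et0 t1 d0 l01 lL dab.
have s1 : 0 <= Slog p q a b dl et x t := Sv_ge0 (p x) (q x) h4 h6 dl1 et0 (ltW t0).
have v1 := ler_wpM2l (le_trans ler01 m1) z1; have v2 := ler_wpM2l C10 u2.
have m0 := le_trans ler01 m1.
split; rewrite /C !mulrDl mul1r.
  apply: le_trans u1 (le_trans v1 _); rewrite mulrA addrAC lerDr.
  exact: addr_ge0 s0 (mulr_ge0 (mulr_ge0 C10 C20) s0).
apply: le_trans z2 (le_trans v2 _); rewrite mulrA lerDr.
exact: addr_ge0 s1 (mulr_ge0 (mulr_ge0 m0 C10) s1).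
Qed.

End comparability.

Section de_giorgi_arith.
Context (R : realType).

(** If [tau] exceeds [Lam * t0], then [tau <= t0 * Lam ^ (1 - P') * (tau / t0) ^ P'], and growth
    bounds the last power by [C / sg * Ss]. The factor [tt / (th * w)], at least [1], brings in the
    weight of the Caccioppoli inequality. *)
Lemma dg_pointwise (P' t0 tau Lam sg Ss Sp th w tt C : R) : 1 < P' -> 0 < t0 -> 1 <= Lam -> 0 < sg ->
  0 < th * w -> th * w <= tt -> 0 <= tau -> 0 <= Ss -> 0 <= Sp -> sg <= C * Sp ->
  (t0 <= tau -> Sp * (tau / t0) `^ P' <= Ss) ->
  tau <= Lam * t0 + t0 * Lam `^ (- (P' - 1)) * (C / sg) * (th * w)^-1 * (tt * Ss).
Proof.
move=> P1 tp L1 s0 tw0 twt tau0 Ss0 Sp0 hC hS.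
have L0 : 0 < Lam by apply: lt_le_trans L1.
have C0 : 0 <= C.
  rewrite leNgt; apply/negP => Cn; have : C * Sp <= 0 by rewrite nmulr_rle0.
  by lra.
have ttp : 0 <= tt by apply: le_trans twt; exact: ltW.
have pos : 0 <= t0 * Lam `^ (- (P' - 1)) * (C / sg) * (th * w)^-1 * (tt * Ss).
  by rewrite !mulr_ge0 ?powR_ge0 ?invr_ge0// ltW.
have [h|h] := leP tau (Lam * t0); first by rewrite -[leLHS]addr0 lerD.
have t0tau : t0 <= tau by apply: le_trans (ltW h); rewrite ler_peMl// ltW.
have r1 : Lam <= tau / t0 by rewrite ler_pdivlMr// ltW.
have r0 : 0 < tau / t0 by apply: lt_le_trans r1.
have hS' := hS t0tau.
have e1 : (tau / t0) * Lam `^ (P' - 1) <= (tau / t0) `^ P'.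
  rewrite -(mulr_powRB1 (ltW r0) (lt_trans ltr01 P1)) ler_wpM2l ?(ltW r0)//.
  by apply: powR_mono; [rewrite subr_ge0 ltW|exact: ltW|exact: r1].
have Lp : 0 < Lam `^ (P' - 1) by exact: powR_gt0.
have e2 : tau <= t0 * Lam `^ (- (P' - 1)) * (tau / t0) `^ P'.
  apply: (@le_trans _ _ (t0 * Lam `^ (- (P' - 1)) * (tau / t0 * Lam `^ (P' - 1)))).
    by rewrite powRN le_eqVlt; apply/orP; left; apply/eqP; field; rewrite !gt_eqF.
  by rewrite ler_wpM2l ?mulr_ge0 ?powR_ge0 ?(ltW tp).
have e3 : sg * (tau / t0) `^ P' <= C * Ss.
  apply: (@le_trans _ _ (C * Sp * (tau / t0) `^ P')); first by rewrite ler_wpM2r ?powR_ge0.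
  by rewrite -mulrA ler_wpM2l.
have e4 : (tau / t0) `^ P' <= C / sg * Ss by rewrite mulrAC ler_pdivlMr// mulrC.
have e5 : Ss <= (th * w)^-1 * (tt * Ss) by rewrite mulrA ler_peMl// mulrC ler_pdivlMr// mul1r.
apply: (le_trans e2); rewrite -[leLHS]add0r; apply: lerD; first by rewrite mulr_ge0// ltW.
rewrite -!mulrA ler_wpM2l ?(ltW tp)// ler_wpM2l ?powR_ge0//; apply: (le_trans e4).
by rewrite -!mulrA ler_wpM2l// ler_wpM2l// invr_ge0 ltW.
Qed.

(** Each of [1], [Q * t0] and [Q * (C * sg)] is at most [C * (Q * sg)]; then [sg] and [w] cancel, so
    the bound is free of the reference value of the integrand. *)
Lemma dg_arith (C sg w t0 Lk th Q E C' : R) : 0 < sg -> 0 < w -> 0 <= t0 -> 0 <= Lk -> 0 < th -> 1 <= Q ->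
  0 <= E -> 0 <= C' -> 1 <= C -> t0 <= sg -> 1 <= t0 ->
  t0 * Lk * (C / sg) * (th * w)^-1 * (C' * w * (1 + Q * t0 + Q * (C * sg)) * E) <=
  t0 * (3 * C ^+ 2 * C' * Lk * th^-1 * Q * E).
Proof.
move=> s0 w0 tp L0 th0 Q1 E0 C'0 C1 ts t1.
have C0 : 0 < C by apply: lt_le_trans C1.
have Q0 : 0 < Q by apply: lt_le_trans Q1.
have h : 1 + Q * t0 + Q * (C * sg) <= 3 * (C * (Q * sg)).
  have a1 : Q * t0 <= C * (Q * sg).
    apply: (@le_trans _ _ (Q * sg)); first by rewrite ler_wpM2l// ltW.
    by rewrite ler_peMl// mulr_ge0// ltW.
  have a2 : 1 <= Q * t0 by rewrite -[1]mulr1 ler_pM.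
  have -> : Q * (C * sg) = C * (Q * sg) by ring.
  lra.
have -> : t0 * (3 * C ^+ 2 * C' * Lk * th^-1 * Q * E) =
   t0 * Lk * (C / sg) * (th * w)^-1 * (C' * w * (3 * (C * (Q * sg))) * E).
  by field; rewrite !gt_eqF.
rewrite ler_wpM2l//; first by rewrite !mulr_ge0 ?invr_ge0 ?mulr_ge0// ltW.
by rewrite ler_wpM2r// ler_wpM2l// mulr_ge0// ltW.
Qed.

Lemma cube_sub N (x : 'rV[R]_N) r r' : r <= r' -> cube x r `<=` cube x r'.
Proof.
by move=> rr y /cubeP h; apply/cubeP => i; have /andP[h1 h2] := h i; apply/andP; split; lra.
Qed.

End de_giorgi_arith.

(** * De Giorgi iteration *)

Section de_giorgi.
Context (R : realType) (N : nat).
Notation T := (leb_space R N).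
Notation mu := (lebesgue_rV R N).
Context (Om : set 'rV[R]_N) (p q a b : 'rV[R]_N -> R) (dl et Ma : R).
Local Notation S := (Slog p q a b dl et).
Context (hI : integrand_data Om p q a b dl et Ma).
Context (N2 : (2 <= N)%N) (hO : bounded_domain Om) (lO : lipschitz_boundary Om).
Context (u g : 'rV[R]_N -> R) (Du Af : 'rV[R]_N -> 'rV[R]_N) (Bf : 'rV[R]_N -> R) (c1 c2 : R).
Context (hs : sol_data Om p q a b dl et u g Du Af Bf c1 c2) (c10 : 0 < c1) (c20 : 0 < c2).
Context (pm : R) (pm1 : 1 < pm) (hpm : forall x, Om x -> pm <= p x).
Context (kap rs Cs : R) (kap0 : 0 < kap) (Cs1 : 1 <= Cs).
Context (hcmp : forall x0 r t, 0 < r <= rs -> 1 <= t -> t * r <= kap ->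
    exists2 sg, t <= sg & ae_in (Om `&` cube x0 r) (fun x => S x t <= Cs * sg /\ sg <= Cs * S x t)).

Let mO : measurable (Om : set T). Proof. by apply: leb_open; case: hO. Qed.
Let fO : (mu Om < +oo)%E. Proof. by case: hO => _ _ _ /bounded_leb_fin. Qed.
Let N0 : (0 < N)%N. Proof. exact: ltnW. Qed.
Let dl1 := id_dl hI.
Let et0 := id_et hI.
Let iu : lintegrable Om u. Proof. by case: (sd_W11 hs). Qed.
Let mu' : measurable_fun (Om : set T) u. Proof. exact: integ_measurable iu. Qed.
Let iD : lintegrable Om (fun x => enorm (Du x)).
Proof. by case: (sd_W11 hs) => _ h; apply: enorm_integrable. Qed.

Definition upper (x0 : 'rV[R]_N) (r k : R) : set T := Om `&` cube x0 r `&` [set x | k < u x].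

Lemma measurable_level (A : set R) : measurable A -> measurable (Om `&` u @^-1` A : set T).
Proof. exact: mu'. Qed.

Lemma measurable_upper x0 r k : measurable (upper x0 r k).
Proof.
rewrite /upper setIAC; apply: measurableI; last exact: measurable_cube.
have -> : [set x | k < u x] = u @^-1` `]k, +oo[%classic by apply/seteqP; split=> x /=; rewrite in_itv/= andbT.
exact: measurable_level.
Qed.

Lemma sub_Om_fin (A : set T) : A `<=` Om -> (mu A < +oo)%E.
Proof. by move=> AO; apply: le_lt_trans fO; exact: leb_le. Qed.

Lemma fine_leb_le (A B : set T) : A `<=` B -> (mu B < +oo)%E -> fine (mu A) <= fine (mu B).
Proof.
move=> AB fB; apply: fine_le; last exact: leb_le.
- by rewrite ge0_fin_numE//; apply: le_lt_trans fB; exact: leb_le.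
- by rewrite ge0_fin_numE.
Qed.

(* Where [|Du| > Lam w / r0] the growth of [S(x, .)] with exponent [pm > 1] bounds
   [|Du|] by [Lam^(1 - pm)] times [S(x, |Du|)], which [cacc_cube] controls. *)
Lemma dg_ineq : exists2 C : R, 0 < C & exists2 w0 : R, 0 < w0 <= 1 &
  forall (x0 : 'rV[R]_N) r0 k w r rho th Lam (D : set T),
  0 < r0 <= rs -> r0 <= w <= w0 -> 0 < r < rho -> rho <= r0 -> 0 < th -> 1 <= Lam ->
  ae_in (Om `&` cube x0 r0) (fun x => u x <= k + w) ->
  (forall y, boundary Om y -> `|y - x0| < r0 -> g y <= k) ->
  measurable D -> D `<=` Om `&` cube x0 r `&` [set x | k + th * w <= u x] ->
  \int[mu]_(x in D) enorm (Du x) <= w / r0 * (Lam * fine (mu D) +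
    C * Lam `^ (- (pm - 1)) * th^-1 * (r0 / (rho - r)) ^+ N.+1 * fine (mu (upper x0 rho k))).
Proof.
have [C' C'0 [w0 /andP[w00 w01] hC]] := cacc_cube hI N2 hO lO hs c10 c20.
exists (3 * Cs ^+ 2 * C'); first by rewrite !mulr_gt0 ?exprn_gt0// (lt_le_trans ltr01).
(* At the height [t = w / r0] the comparison [hcmp] is available: [1 <= t] because [r0 <= w], and
   [t * r0 = w <= kap]. *)
exists (Num.min w0 kap); first by rewrite lt_min w00 kap0 ge_min w01.
move=> x0 r0 k w r rho th Lam D /[dup] hr0 /andP[r00 r0s] /andP[rw]; rewrite le_min => /andP[ww0 wk].
move=> /[dup] hrr /andP[rp rr] rhor th0 L1 uk hg mD hD.
have wp : 0 < w by apply: lt_le_trans rw.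
have [t [t1 tE]] : exists t, 1 <= t /\ t = w / r0 by eexists; split; last reflexivity; rewrite ler_pdivlMr// mul1r.
have tp : 0 < t by apply: lt_le_trans t1.
have trk : t * r0 <= kap by rewrite tE divfK// gt_eqF.
have [sg tsg hsg] := hcmp x0 hr0 t1 trk.
have sp : 0 < sg by apply: lt_le_trans tsg.
have dr : 0 < rho - r by rewrite subr_gt0.
have [Q [Q1 QE]] : exists Q, 1 <= Q /\ Q = r0 / (rho - r).
  eexists; split; last reflexivity; rewrite ler_pdivlMr// mul1r; lra.
have Q0 : 0 <= Q by exact: le_trans Q1.
have wQ : w / (rho - r) = Q * t by rewrite QE tE; field; rewrite !gt_eqF.
have subK : Om `&` cube x0 rho `<=` Om `&` cube x0 r0.
  by move=> x [Ox Kx]; split=> //; exact: cube_sub rhor _ Kx.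
have M0 : 0 <= Q ^+ N.+1 * (Cs * sg) by rewrite !mulr_ge0 ?exprn_ge0 ?(ltW sp)// (le_trans ler01).
have ww : 0 <= w <= w0 by rewrite (ltW wp).
have hM : ae_in (Om `&` cube x0 rho) (fun x => S x (w / (rho - r)) <= Q ^+ N.+1 * (Cs * sg)).
  have i1 : ae_in (Om `&` cube x0 rho) (fun x => [/\ 1 < p x, p x <= q x, q x <= N%:R, 0 <= a x <= Ma & 0 <= b x <= Ma]).
    by apply: ae_inS (id_ae hI) => x [].
  apply: ae_in_imp2 i1 (ae_inS subK hsg) => x _ [g1 g2 g3 /andP[g4 _] /andP[g6 _]] [hx _].
  rewrite wQ; apply: le_trans (Sv_scale g1 g2 g3 g4 g6 dl1 et0 Q1 (ltW tp)) _.
  by rewrite ler_wpM2l ?exprn_ge0.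
have hg' y : boundary Om y -> `|y - x0| < rho -> g y <= k.
  by move=> By yx; apply: hg => //; exact: lt_le_trans rhor.
have [iK hE] := hC x0 k w r rho _ hrr ww M0 (ae_inS subK uk) hg' hM.
have DK : D `<=` Om `&` cube x0 r by move=> x /hD[].
have DO : D `<=` Om by move=> x /hD[[]].
have mK : measurable (Om `&` cube x0 r : set T) by apply: measurableI => //; exact: measurable_cube.
have fD := sub_Om_fin DO.
have iKD := integrableS mK mD DK iK.
have iDD := integrableS mO mD DO iD.
have [Y [Y0 YE]] : exists Y, 0 <= Y /\ Y = t * Lam `^ (- (pm - 1)) * (Cs / sg) * (th * w)^-1.
  eexists; split; last reflexivity.
  by rewrite !mulr_ge0 ?invr_ge0 ?mulr_ge0 ?powR_ge0 ?(ltW tp) ?(ltW sp) ?(ltW th0) ?(ltW wp)// (le_trans ler01).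
have ic : mu.-integrable D (EFin \o (fun=> Lam * t)) by apply: cb_int => //; exact: cb_cst.
have iY := integZ mD Y iKD.
have pw : ae_in D (fun x => enorm (Du x) <= Lam * t + Y * (posp (u x - k) * S x (enorm (Du x)))).
  have i1 : ae_in D (fun x => [/\ 1 < p x, p x <= q x, q x <= N%:R, 0 <= a x <= Ma & 0 <= b x <= Ma]).
    exact: ae_inS DO (id_ae hI).
  have i2 : ae_in D (fun x => S x t <= Cs * sg /\ sg <= Cs * S x t).
    by apply: ae_inS hsg => x /hD[[Ox Kx] _]; apply: subK; split=> //; exact: cube_sub (ltW rr) _ Kx.
  apply: ae_in_imp2 i1 i2 => x Dx [g1 g2 g3 /andP[g4 _] /andP[g6 _]] [_ hx].
  rewrite YE; apply: (@dg_pointwise R pm t (enorm (Du x)) Lam sg _ (S x t)) => //.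
  - by rewrite mulr_gt0.
  - by have [_ /= hu] := hD _ Dx; apply: le_trans (posp_ge _); rewrite lerBrDl.
  - exact: enorm_ge0.
  - exact: (Sv_ge0 (p x) (q x) g4 g6 dl1 et0 (enorm_ge0 _)).
  - exact: (Sv_ge0 (p x) (q x) g4 g6 dl1 et0 (ltW tp)).
  - by move=> h; apply: (Sv_lower g2 g4 g6 dl1 et0 tp h); apply: hpm; exact: DO.
have h1 := Rint_ae_le mD iDD (integD mD ic iY) pw.
rewrite (RintegralD mD ic iY) (RintegralZl _ mD iKD) Rintegral_cst// in h1.
have pos : ae_in (Om `&` cube x0 r) (fun x => 0 <= posp (u x - k) * S x (enorm (Du x))).
  have i1 : ae_in (Om `&` cube x0 r) (fun x => [/\ 1 < p x, p x <= q x, q x <= N%:R, 0 <= a x <= Ma & 0 <= b x <= Ma]).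
    by apply: ae_inS (id_ae hI) => x [].
  apply: ae_in_imp i1 => x _ [g1 g2 g3 /andP[g4 _] /andP[g6 _]].
  by rewrite mulr_ge0 ?posp_ge0//; exact: (Sv_ge0 (p x) (q x) g4 g6 dl1 et0 (enorm_ge0 _)).
have h2 := Rint_subset_ae mD mK iK DK pos.
have h3 := ler_wpM2l Y0 (le_trans h2 hE).
have E0 : 0 <= fine (mu (upper x0 rho k)) by exact: fine_ge0.
have hQ1 : 1 <= Q ^+ N.+1 by rewrite exprn_ege1.
have QQ : Q <= Q ^+ N.+1 by rewrite exprS ler_peMr// exprn_ege1.
have h4 : Y * (C' * w * (1 + w / (rho - r) + Q ^+ N.+1 * (Cs * sg)) * fine (mu (upper x0 rho k))) <=
    Y * (C' * w * (1 + Q ^+ N.+1 * t + Q ^+ N.+1 * (Cs * sg)) * fine (mu (upper x0 rho k))).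
  apply: ler_wpM2l => //; apply: ler_wpM2r => //; apply: ler_wpM2l; first by rewrite mulr_ge0// ltW.
  by rewrite lerD2r lerD2l wQ ler_wpM2r// ltW.
have h5 := @dg_arith R Cs sg w t (Lam `^ (- (pm - 1))) th (Q ^+ N.+1) (fine (mu (upper x0 rho k))) C'
  sp wp (ltW tp) (powR_ge0 _ _) th0 hQ1 E0 (ltW C'0) Cs1 tsg t1.
rewrite -YE in h5.
have := le_trans h3 (le_trans h4 h5); move: h1; rewrite -tE -QE.
rewrite [X in _ -> _ -> _ <= X]mulrDr.
have -> : t * (Lam * fine (mu D)) = Lam * t * fine (mu D) by ring.
move=> h6 h7; apply: le_trans h6 _; rewrite lerD2l; exact: h7.
Qed.

Lemma Rint_supp (K D : set T) f : D `<=` K -> (forall x, K x -> ~ D x -> f x = 0) ->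
  \int[mu]_(x in K) f x = \int[mu]_(x in D) f x.
Proof.
move=> DK h; rewrite /Rintegral; congr fine; rewrite integral_mkcond [RHS]integral_mkcond.
apply: eq_integral => x _; rewrite !patchE.
have [xD|xD] := boolP (x \in D); first by rewrite mem_set//; apply: DK; exact: set_mem.
have [xK|//] := boolP (x \in K); rewrite h//; first exact: set_mem.
by move=> Dx; move: xD; rewrite mem_set.
Qed.

(** The Poincare inequality for [zeta * stp l1 w (u)], which on [C] is [1] where [u >= l2], vanishes
    where [u <= l1] and has slope at most [2 / (l2 - l1)] in between. The set of zeros includes the
    part of [C] outside [Om]. *)
Lemma poincare_levels (x0 a0 : 'rV[R]_N) (rc r0 l1 l2 h th : R) : 0 < rc < r0 -> 0 < h -> 0 < th -> l1 < l2 ->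
  let C := hbox a0 (const_mx h) in
  C `<=` cube x0 rc -> (forall y, boundary Om y -> `|y - x0| < r0 -> g y <= l1) ->
  th * fine (mu C) <= fine (mu (C `\` (Om `&` [set x | l1 < u x]))) ->
  th * fine (mu (C `&` Om `&` [set x | l2 <= u x])) <=
  N%:R ^+ 2 * h * (th + 1) * (2 / (l2 - l1)) *
    \int[mu]_(x in C `&` Om `&` [set x | l1 < u x < l2]) enorm (Du x).
Proof.
move=> /andP[rc0 rcr] h0 th0 l12 C CK hg hZ.
pose w := (l2 - l1) / 2; have w0 : 0 < w by rewrite divr_gt0// subr_gt0.
have l2E : l2 = l1 + 2 * w by rewrite /w; field.
(* The plateau of the cutoff reaches beyond [rc], so that its gradient vanishes on [C]. *)
have [|zeta [Cz z01 z1 zs zp]] := @cutoff_exists R N x0 ((rc + r0) / 2) r0.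
  by apply/andP; split; lra.
have cz : compact (closure [set x | zeta x != 0]).
  by apply: (@compact_supp_ball R N zeta x0 r0) => x /zs /ltW.
have A0 : 0 <= 2 / w by rewrite divr_ge0// ltW.
have B0 : 0 <= 4 / w ^+ 2 by rewrite divr_ge0// exprn_ge0// ltW.
have iw : 0 <= (2 * w ^+ 2)^-1 by rewrite invr_ge0 mulr_ge0// exprn_ge0// ltW.
have hz : zero_trace Om (fun x => zeta x * stp l1 w (u x))
    (fun x => (zeta x * dstp l1 w (u x)) *: Du x + stp l1 w (u x) *: grad zeta x).
  apply: (@zero_trace_comp R N Om u Du g zeta (stp l1 w) (dstp l1 w) (2 / w) (4 / w ^+ 2) l1) => //.
  - exact: sd_W11 hs.
  - exact: sd_trace hs.
  - exact: sd_mg hs.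
  - by move=> s; exact: is_derive_stp.
  - move=> s s'; rewrite /stp -mulrBr normrM ger0_norm//.
    have -> : 2 / w * `|s - s'| = (2 * w ^+ 2)^-1 * (2 * w * `|s - s'| + 2 * w * `|s - s'|).
      by field; rewrite gt_eqF.
    rewrite ler_wpM2l//.
    have t1 := trc_lip l1 s s' (ltW w0); have t2 := trc_lip (l1 + w) s s' (ltW w0).
    have -> : trc l1 w s - trc (l1 + w) w s - (trc l1 w s' - trc (l1 + w) w s') =
      (trc l1 w s - trc l1 w s') - (trc (l1 + w) w s - trc (l1 + w) w s') by ring.
    apply: le_trans (ler_normB _ _) _; exact: lerD.
  - move=> s; have /andP[d0 d1] := dstp_bound l1 s w0; rewrite ger0_norm//; apply: le_trans d1 _.
    by rewrite ler_peMl ?invr_ge0 ?(ltW w0)// ler1n.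
  - move=> s s'; rewrite /dstp -mulrBr normrM ger0_norm//.
    have -> : 4 / w ^+ 2 * `|s - s'| = (2 * w ^+ 2)^-1 * (4 * `|s - s'| + 4 * `|s - s'|).
      by field; rewrite gt_eqF.
    rewrite ler_wpM2l//.
    have t1 := dtrc_lip l1 w s s'; have t2 := dtrc_lip (l1 + w) w s s'.
    have -> : dtrc l1 w s - dtrc (l1 + w) w s - (dtrc l1 w s' - dtrc (l1 + w) w s') =
      (dtrc l1 w s - dtrc l1 w s') - (dtrc (l1 + w) w s - dtrc (l1 + w) w s') by ring.
    apply: le_trans (ler_normB _ _) _; exact: lerD.
  - by move=> s; exact: stp_below (ltW w0).
  - by move=> y By /zs; exact: hg.
have mC : measurable (C : set T) by exact: measurable_hbox.
have mL (A : set R) : measurable A -> measurable (C `&` Om `&` u @^-1` A : set T).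
  by move=> mA; rewrite -setIA; apply: measurableI => //; exact: measurable_level.
have [_ oO _ _] := hO.
have mZ : measurable (C `\` (Om `&` [set x | l1 < u x]) : set T).
  apply: measurableD => //.
  have -> : [set x | l1 < u x] = u @^-1` `]l1, +oo[%classic by apply/seteqP; split=> x /=; rewrite in_itv/= andbT.
  exact: measurable_level.
have Zf (x : 'rV[R]_N) : (C `\` (Om `&` [set x | l1 < u x])) x -> Om x -> zeta x * stp l1 w (u x) = 0.
  move=> [Cx nx] Ox; rewrite stp_below ?mulr0 ?(ltW w0)// leNgt; apply/negP => ul; exact: nx.
have := zero_trace_poincare N0 oO hz h0 th0 mZ (@subDsetl _ _ _) Zf hZ.
have zC x : C x -> zeta x = 1 /\ grad zeta x = 0.
  move=> /CK /(cube_le (ltW rc0)) xr; split; first by apply: z1; lra.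
  apply/rowP => i; rewrite !mxE.
  have ne : \forall y \near x, zeta y = 1.
    have e0 : 0 < (r0 - rc) / 2 by rewrite divr_gt0// subr_gt0.
    apply: filterS (nbhsx_ballx x _ e0) => y; rewrite -ball_normE/= => xy; apply: z1.
    have -> : y - x0 = (x - x0) - (x - y) by rewrite opprB [RHS]addrC addrA subrK.
    by apply: le_trans (ler_normB _ _) _; lra.
  have := partial_cst (1 : R) i x; rewrite /partial => <-.
  exact: near_eq_derive ne.
rewrite -/C => hP.
have mCO : measurable (C `&` Om : set T) by exact: measurableI.
have sCO : C `&` Om `<=` Om by exact: subIsetr.
have [[iF iV] _] := hz.
have iFC := integ_norm (integrableS mO mCO sCO iF).
have iVO := enorm_integrable mO iV.
have [A AE] : exists A : set T, A = C `&` Om `&` [set x | l2 <= u x] by eexists.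
have mA : measurable A.
  have -> : A = C `&` Om `&` u @^-1` `[l2, +oo[%classic by rewrite AE; apply/seteqP; split=> x /=; rewrite in_itv/= andbT.
  exact: mL.
have [D DE] : exists D : set T, D = C `&` Om `&` [set x | l1 < u x < l2] by eexists.
have mD : measurable D.
  have -> : D = C `&` Om `&` u @^-1` `]l1, l2[%classic by rewrite DE; apply/seteqP; split=> x /=; rewrite in_itv.
  exact: mL.
have sA : A `<=` C `&` Om by rewrite AE => x [].
have sD : D `<=` C `&` Om by rewrite DE => x [].
have a1 : fine (mu A) <= \int[mu]_(x in C `&` Om) `|zeta x * stp l1 w (u x)|.
  have pos : ae_in (C `&` Om) (fun x => 0 <= `|zeta x * stp l1 w (u x)|) by apply: ae_in_all => x _.
  apply: le_trans (Rint_subset_ae mA mCO iFC sA pos).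
  rewrite (_ : \int[mu]_(x in A) _ = \int[mu]_(x in A) 1).
    by rewrite Rintegral_cst// mul1r.
  apply: eq_Rintegral => x /set_mem; rewrite AE => -[[Cx Ox]] /= ul.
  by have [-> _] := zC _ Cx; rewrite mul1r stp_above ?normr1// -l2E.
have a2 : \int[mu]_(x in C `&` Om) enorm ((zeta x * dstp l1 w (u x)) *: Du x + stp l1 w (u x) *: grad zeta x) <=
    2 / (l2 - l1) * \int[mu]_(x in D) enorm (Du x).
  rewrite (Rint_supp sD); last first.
    move=> x [Cx Ox] nD; have [-> ->] := zC _ Cx.
    have -> : dstp l1 w (u x) = 0.
      have [h1|h1] := leP (u x) l1.
        have w0' := ltW w0.
        by rewrite /dstp !dtrc_below ?subrr ?mulr0// (le_trans h1)// lerDl.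
      have [h2|h2] := leP l2 (u x).
        have w0' := ltW w0; have h3 : l1 + w <= u x by lra.
        have h4 : l1 + w + w <= u x by lra.
        by rewrite /dstp !dtrc_above ?subrr ?mulr0.
      by case: nD; rewrite DE; split=> //=; rewrite h1.
    by rewrite mulr0 scale0r scaler0 addr0 enorm0.
  have sDO := subset_trans sD sCO.
  have iDu' := integrableS mO mD sDO iD.
  rewrite -(RintegralZl _ mD iDu').
  apply: (Rint_ae_le mD (integrableS mO mD sDO iVO) (integZ mD _ iDu')).
  apply: aeW => x /sD [Cx Ox]; have [-> ->] := zC _ Cx.
  have /andP[d0 d1] := dstp_bound l1 (u x) w0.
  rewrite scaler0 addr0 mul1r enormZ ger0_norm// ler_wpM2r ?enorm_ge0//.
  by apply: le_trans d1 _; rewrite /w invf_div.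
rewrite -AE -DE; apply: (le_trans (ler_wpM2l (ltW th0) a1)); apply: (le_trans hP).
rewrite -[leRHS]mulrA ler_wpM2l// !mulr_ge0 ?exprn_ge0// ?(ltW h0)//.
by rewrite addr_ge0// ltW.
Qed.

Lemma cube_hbox (x0 : 'rV[R]_N) r : cube x0 (r / 2) = hbox (x0 - const_mx (r / 2)) (const_mx r).
Proof. by rewrite /cube (_ : 2 * (r / 2) = r)//; field. Qed.

(** [dg_ineq] with [th = 1 / 2] on the strip between [l + w / 2] and [l + 3 w / 4], inserted into
    [poincare_levels]. The strip stays [w / 2] above [l], where the weight [(u - l)_+] is bounded
    from below. The factors [w / r0] and [r0 / w] cancel. *)
Lemma shrink_step : exists2 C : R, 0 < C & exists2 w0 : R, 0 < w0 <= 1 &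
  forall (x0 : 'rV[R]_N) r0 l w Lam cs,
  0 < r0 <= rs -> r0 <= w <= w0 -> 1 <= Lam -> 0 < cs ->
  ae_in (Om `&` cube x0 r0) (fun x => u x <= l + w) ->
  (forall y, boundary Om y -> `|y - x0| < r0 -> g y <= l) ->
  cs * fine (mu (cube x0 (r0 / 2))) <=
    fine (mu (cube x0 (r0 / 2) `\` (Om `&` [set x | l + w / 2 < u x]))) ->
  cs * fine (mu (cube x0 (r0 / 2) `&` Om `&` [set x | l + 3 * w / 4 <= u x])) <=
  C * (cs + 1) * (Lam * (fine (mu (upper x0 (r0 / 2) (l + w / 2))) - fine (mu (upper x0 (r0 / 2) (l + 3 * w / 4))))
     + Lam `^ (- (pm - 1)) * r0 ^+ N).
Proof.
have [C C0 [w0 w01 hC]] := dg_ineq.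
(* The factor [2] is [th^-1], [2 ^ (N+1)] is the power of [r0 / (r0 - r0 / 2)], and [2 ^ N * r0 ^ N]
   is the measure of the large cube. *)
pose C4 : R := C * 2 * 2 ^+ N.+1 * 2 ^+ N.
have C40 : 0 < C4 by rewrite /C4 !mulr_gt0 ?exprn_gt0.
exists (N%:R ^+ 2 * 8 * (1 + C4)); first by rewrite !mulr_gt0 ?exprn_gt0 ?ltr0n// addr_gt0.
exists w0 => // x0 r0 l w Lam cs /[dup] hr0 /andP[r00 r0s] /[dup] hw /andP[rw ww] L1 cs0 uk hg hd.
have wp : 0 < w by apply: lt_le_trans rw.
have rc : 0 < r0 / 2 < r0 by apply/andP; split; lra.
have l12 : l + w / 2 < l + 3 * w / 4 by lra.
have hg1 y : boundary Om y -> `|y - x0| < r0 -> g y <= l + w / 2.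
  by move=> By yx; apply: le_trans (hg y By yx) _; rewrite lerDl divr_ge0// ltW.
have sK : hbox (x0 - const_mx (r0 / 2)) (const_mx r0) `<=` cube x0 (r0 / 2) by rewrite -cube_hbox.
have := @poincare_levels x0 (x0 - const_mx (r0 / 2)) (r0 / 2) r0 _ _ r0 cs rc r00 cs0 l12 sK hg1.
rewrite -cube_hbox => /(_ hd).
have [D DE] : exists D : set T, D = cube x0 (r0 / 2) `&` Om `&` [set x | l + w / 2 < u x < l + 3 * w / 4] by eexists.
have [U UE] : exists U : set T, U = cube x0 (r0 / 2) `&` Om `&` [set x | l + 3 * w / 4 <= u x] by eexists.
have mKO : measurable (cube x0 (r0 / 2) : set T) by exact: measurable_cube.
have mD : measurable D.
  rewrite DE -setIA; apply: measurableI => //.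
  have -> : [set x | l + w / 2 < u x < l + 3 * w / 4] = u @^-1` `]l + w / 2, l + 3 * w / 4[%classic.
    by apply/seteqP; split=> x /=; rewrite in_itv.
  exact: measurable_level.
have mU : measurable U.
  rewrite UE -setIA; apply: measurableI => //.
  have -> : [set x | l + 3 * w / 4 <= u x] = u @^-1` `[l + 3 * w / 4, +oo[%classic.
    by apply/seteqP; split=> x /=; rewrite in_itv/= andbT.
  exact: measurable_level.
rewrite -DE -UE => hiso.
have hD : D `<=` Om `&` cube x0 (r0 / 2) `&` [set x | l + 2^-1 * w <= u x].
  by rewrite DE => x [[Kx Ox] /andP[h1 h2]]; split=> //=; lra.
have rr : 0 < r0 / 2 < r0 by [].
have h2 : 0 < (2^-1 : R) by rewrite invr_gt0.
have := hC x0 r0 l w (r0 / 2) r0 2^-1 Lam D hr0 hw rr (lexx _) h2 L1 uk hg mD hD.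
have -> : r0 / (r0 - r0 / 2) = 2.
  by have -> : r0 - r0 / 2 = r0 / 2 by [field]; rewrite invf_div mulrCA divff ?mulr1 ?gt_eqF.
rewrite invrK => hdg.
have hup : fine (mu (upper x0 r0 l)) <= 2 ^+ N * r0 ^+ N.
  have -> : 2 ^+ N * r0 ^+ N = fine (mu (cube x0 r0)) by rewrite leb_cube ?(ltW r00)// exprMn.
  by apply: fine_leb_le; [move=> x [[]]|exact: leb_cube_fin].
have hDU : fine (mu D) <= fine (mu (upper x0 (r0 / 2) (l + w / 2))) - fine (mu (upper x0 (r0 / 2) (l + 3 * w / 4))).
  have fu l' : mu (upper x0 (r0 / 2) l') \is a fin_num.
    by rewrite ge0_fin_numE//; apply: sub_Om_fin => x [[]].
  have fDD : mu D \is a fin_num by rewrite ge0_fin_numE//; apply: sub_Om_fin => x /hD[[]].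
  rewrite lerBrDr -fineD// -measureU//.
  - apply: fine_leb_le; last by rewrite -ge0_fin_numE.
    by rewrite DE => x [[[Kx Ox] /andP[h3 h4]]|[[Ox Kx] /= h3]]; split=> //=; lra.
  - exact: measurable_upper.
  - by rewrite DE; apply/seteqP; split=> // x [[_ /andP[_ h3]] [_ /= h4]]; lra.
have d0 : 0 <= fine (mu D) by exact: fine_ge0.
have Lp : 0 <= Lam `^ (- (pm - 1)) by exact: powR_ge0.
apply: (le_trans hiso).
have e1 : l + 3 * w / 4 - (l + w / 2) = w / 4 by field.
rewrite e1.
have step := ler_wpM2l (_ : 0 <= N%:R ^+ 2 * r0 * (cs + 1) * (2 / (w / 4))) hdg.
apply: (le_trans (step _)).
  by rewrite !mulr_ge0 ?exprn_ge0 ?(ltW r00) ?addr_ge0 ?(ltW cs0) ?invr_ge0 ?divr_ge0 ?(ltW wp).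
have e2 X : N%:R ^+ 2 * r0 * (cs + 1) * (2 / (w / 4)) * (w / r0 * X) = N%:R ^+ 2 * 8 * (cs + 1) * X.
  by field; rewrite !gt_eqF.
rewrite e2 -[leRHS]mulrA.
have -> : N%:R ^+ 2 * 8 * (1 + C4) * ((cs + 1) * (Lam * (fine (mu (upper x0 (r0 / 2) (l + w / 2))) -
   fine (mu (upper x0 (r0 / 2) (l + 3 * w / 4)))) + Lam `^ (- (pm - 1)) * r0 ^+ N)) =
   N%:R ^+ 2 * 8 * (cs + 1) * ((1 + C4) * (Lam * (fine (mu (upper x0 (r0 / 2) (l + w / 2))) -
   fine (mu (upper x0 (r0 / 2) (l + 3 * w / 4)))) + Lam `^ (- (pm - 1)) * r0 ^+ N)) by ring.
rewrite ler_wpM2l ?mulr_ge0 ?exprn_ge0 ?addr_ge0 ?(ltW cs0)//.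
move: hDU; move: (_ - _) => dd hDU.
have dd0 := le_trans d0 hDU.
have r0N : 0 <= r0 ^+ N by rewrite exprn_ge0// ltW.
have f1 : Lam * fine (mu D) <= Lam * dd by rewrite ler_wpM2l// (le_trans ler01).
have f2 : C * Lam `^ (- (pm - 1)) * 2 * 2 ^+ N.+1 * fine (mu (upper x0 r0 l)) <=
    C * Lam `^ (- (pm - 1)) * 2 * 2 ^+ N.+1 * (2 ^+ N * r0 ^+ N).
  by rewrite ler_wpM2l// !mulr_ge0 ?exprn_ge0// ltW.
have f3 : C * Lam `^ (- (pm - 1)) * 2 * 2 ^+ N.+1 * (2 ^+ N * r0 ^+ N) = C4 * (Lam `^ (- (pm - 1)) * r0 ^+ N).
  by rewrite /C4; ring.
have f4 : 0 <= C4 * (Lam * dd) := mulr_ge0 (ltW C40) (mulr_ge0 (le_trans ler01 L1) dd0).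
have f5 : 0 <= Lam `^ (- (pm - 1)) * r0 ^+ N by rewrite mulr_ge0.
rewrite f3 in f2; rewrite mulrDl mul1r mulrDr; lra.
Qed.

(** The levels [k + w - w / 2 ^ i] define disjoint strips, so after summation over [n] levels the
    strips contribute on average at most a multiple of [Lam * r0 ^ N / n], while the other term
    carries the factor [Lam ^ (1 - pm)]. The latter is made small by the choice of [Lam], the former
    by that of [n]. *)
Lemma shrink cs nu : 0 < cs -> 0 < nu -> exists J : nat, exists2 w0 : R, 0 < w0 <= 1 &
  forall (x0 : 'rV[R]_N) r0 k w,
  0 < r0 <= rs -> w <= w0 -> r0 <= w / 2 ^+ J ->
  ae_in (Om `&` cube x0 r0) (fun x => u x <= k + w) ->
  (forall y, boundary Om y -> `|y - x0| < r0 -> g y <= k) ->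
  cs * fine (mu (cube x0 (r0 / 2))) <=
    fine (mu (cube x0 (r0 / 2) `\` (Om `&` [set x | k < u x]))) ->
  fine (mu (upper x0 (r0 / 2) (k + w - w / 2 ^+ J))) <= nu * r0 ^+ N.
Proof.
move=> cs0 nu0; have [C C0 [w0 w01 hC]] := shrink_step.
pose K := C * (cs + 1) / cs; have K0 : 0 < K by rewrite !mulr_gt0 ?invr_gt0 ?addr_gt0.
pose e := Num.min 1 (nu / (2 * K)).
have e0 : 0 < e by rewrite lt_min ltr01 divr_gt0// mulr_gt0.
have k0 : 0 < pm - 1 by rewrite subr_gt0.
have [e1 e2] : e <= 1 /\ e <= nu / (2 * K) by rewrite /e !ge_min !lexx orbT.
have [Lam L1 LE] : exists2 Lam : R, 1 <= Lam & Lam `^ (- (pm - 1)) = e.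
  have ie : 1 <= e^-1 by rewrite invf_ge1.
  exists (e^-1 `^ (pm - 1)^-1).
    apply: (@le_trans _ _ (1 `^ (pm - 1)^-1)); first by rewrite powR1.
    by apply: powR_mono => //; rewrite invr_ge0 ltW.
  by rewrite -powRrM mulrN mulVf ?gt_eqF// powRN powRr1 ?invrK// invr_ge0 ltW.
have L0 : 0 < Lam by apply: lt_le_trans L1.
pose n := Num.bound (Lam / e).
have nL : Lam / e < n%:R by apply: archi_boundP; rewrite divr_ge0 ?ltW.
have n0 : 0 < n%:R :> R by apply: le_lt_trans nL; rewrite divr_ge0 ?ltW.
(* The step of index [i < n] ends at the level of index [i + 2], so [n + 1] is the last level;
   [r0 <= w / 2 ^ (n+1)] keeps all steps in the range of [shrink_step]. *)
exists n.+1, w0 => // x0 r0 k w /[dup] hr0 /andP[r00 r0s] ww rw uk hg hd.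
have p2 i : 0 < 2 ^+ i :> R by rewrite exprn_gt0.
have wp : 0 < w by rewrite -(pmulr_lgt0 _ (_ : 0 < (2 ^+ n.+1)^-1)) ?invr_gt0//; exact: lt_le_trans rw.
have w_anti i j : (i <= j)%N -> w / 2 ^+ j <= w / 2 ^+ i.
  by move=> ij; rewrite ler_pM2l// lef_pV2 ?posrE// ler_eXn2l// ltr1n.
have [ki kiE] : exists ki : nat -> R, ki = (fun i => k + w - w / 2 ^+ i) by eexists.
have ki_mono i j : (i <= j)%N -> ki i <= ki j by move=> ij; rewrite kiE lerD2l lerN2; exact: w_anti.
have -> : k + w - w / 2 ^+ n.+1 = ki n.+1 by rewrite kiE.
have kk i : k <= ki i by apply: (@le_trans _ _ (ki 0)); rewrite ?ki_mono// kiE expr0 divr1; lra.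
have [m mE] : exists m : R -> R, m = (fun l => fine (mu (upper x0 (r0 / 2) l))) by eexists.
have r0N : 0 <= r0 ^+ N by rewrite exprn_ge0// ltW.
have CC : 0 <= C * (cs + 1) by rewrite mulr_ge0 ?addr_ge0// ltW.
have step i : (i < n)%N -> cs * m (ki n.+1) <= C * (cs + 1) * (Lam * (m (ki i.+1) - m (ki i.+2)) + e * r0 ^+ N).
  move=> lin; have h1 : ki i + w / 2 ^+ i = k + w by rewrite kiE subrK.
  have h2 : ki i + w / 2 ^+ i / 2 = ki i.+1 by rewrite kiE exprSr; field; rewrite gt_eqF.
  have h3 : ki i + 3 * (w / 2 ^+ i) / 4 = ki i.+2 by rewrite kiE !exprSr; field; rewrite gt_eqF.
  have a1 : r0 <= w / 2 ^+ i <= w0.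
    rewrite (le_trans rw) ?w_anti//=; last by apply: leq_trans (leqnSn _); exact: ltnW.
    by apply: le_trans ww; rewrite -[leRHS]divr1 -(expr0 2); exact: w_anti.
  have a2 : ae_in (Om `&` cube x0 r0) (fun x => u x <= ki i + w / 2 ^+ i) by rewrite h1.
  have a3 y : boundary Om y -> `|y - x0| < r0 -> g y <= ki i by move=> By yx; apply: le_trans (kk i); exact: hg.
  have := hC x0 r0 (ki i) (w / 2 ^+ i) Lam cs hr0 a1 L1 cs0 a2 a3; rewrite h2 h3 LE mE => H.
  apply: le_trans (H _); last first.
    apply: le_trans hd _; apply: fine_leb_le; last first.
      by apply: le_lt_trans (leb_cube_fin x0 (r0 / 2)); exact: leb_le (@subDsetl _ _ _).
    by move=> x [Kx nx]; split=> // -[Ox /= h4]; apply: nx; split=> //=; apply: le_lt_trans h4.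
  rewrite ler_wpM2l ?(ltW cs0)//; apply: fine_leb_le.
    by move=> x [[Ox Kx] /= h4]; split=> //=; apply: le_trans (ltW h4); exact: ki_mono.
  by apply: sub_Om_fin => x [[]].
have sum i : (i <= n)%N -> i%:R * (cs * m (ki n.+1)) <= C * (cs + 1) * (Lam * (m (ki 1) - m (ki i.+1)) + i%:R * (e * r0 ^+ N)).
  elim: i => [_|i IH hi]; first by rewrite mul0r subrr mulr0 mul0r addr0 mulr0.
  have h1 := IH (ltnW hi); have h2 := step i hi.
  rewrite -natr1 mulrDl mul1r.
  have -> : C * (cs + 1) * (Lam * (m (ki 1) - m (ki i.+2)) + (i%:R + 1) * (e * r0 ^+ N)) =
    C * (cs + 1) * (Lam * (m (ki 1) - m (ki i.+1)) + i%:R * (e * r0 ^+ N)) +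
    C * (cs + 1) * (Lam * (m (ki i.+1) - m (ki i.+2)) + e * r0 ^+ N) by ring.
  exact: lerD.
have m0 l : 0 <= m l by rewrite mE fine_ge0.
have m1 : m (ki 1) <= r0 ^+ N.
  have -> : r0 ^+ N = fine (mu (cube x0 (r0 / 2))).
    by rewrite leb_cube ?divr_ge0 ?(ltW r00)//= mulrC divfK.
  by rewrite mE; apply: fine_leb_le; [move=> x [[]]|exact: leb_cube_fin].
have := sum n (leqnn n).
have -> : fine (mu (upper x0 (r0 / 2) (ki n.+1))) = m (ki n.+1) by rewrite mE.
move=> hsum.
have e3 : Lam <= n%:R * e by move: nL; rewrite ltr_pdivrMr// => /ltW.
have h4 : n%:R * (cs * m (ki n.+1)) <= C * (cs + 1) * (n%:R * (2 * e * r0 ^+ N)).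
  apply: le_trans hsum _; rewrite ler_wpM2l//.
  have q1 : Lam * (m (ki 1) - m (ki n.+1)) <= n%:R * e * r0 ^+ N.
    apply: (@le_trans _ _ (Lam * r0 ^+ N)); last by rewrite ler_wpM2r.
    by rewrite ler_wpM2l ?(ltW L0)//; have := m0 (ki n.+1); lra.
  lra.
have h5 : m (ki n.+1) <= K * (2 * e * r0 ^+ N).
  rewrite -(ler_pM2l cs0) -(ler_pM2l n0); apply: le_trans h4 _.
  rewrite le_eqVlt; apply/orP; left; apply/eqP; rewrite /K; field; exact: lt0r_neq0.
apply: le_trans h5 _; rewrite mulrA ler_wpM2r//.
have K2 : 0 < 2 * K := mulr_gt0 (ltr0Sn R 1) K0.
by move: e2; rewrite (ler_pdivlMr _ _ K2) => e2; lra.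
Qed.

End de_giorgi.

(** * Partitions of a cube into the cells of a grid *)

Section finite_partition.
Context d (T : measurableType d) (R : realType) (m : {measure set T -> \bar R}).
Context (I : finType) (C : I -> set T).
Hypotheses (mC : forall i, measurable (C i)) (dC : forall i j x, C i x -> C j x -> i = j).

Lemma Rint_partition (B : set T) (f : T -> R) : measurable B -> m.-integrable B (EFin \o f) ->
  (forall x, B x -> exists i, C i x) ->
  \sum_i \int[m]_(x in C i `&` B) f x = \int[m]_(x in B) f x.
Proof.
move=> mB iB hB; apply: EFin_inj; rewrite -sumEFin -RintE//.
have mCB i : measurable (C i `&` B) by exact: measurableI.
have e : B = \big[setU/set0]_(i <- index_enum I) (C i `&` B).
  rewrite -bigcup_seq; apply/seteqP; split=> [x Bx|x [i _ []//]].
  by have [i Ci] := hB x Bx; exists i => //=; exact: mem_index_enum.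
rewrite {2}e integral_bigsetU_EFin => //; last 3 first.
- exact: index_enum_uniq.
- by move=> i j _ _ [x [[Ci _] [Cj _]]]; exact: dC Ci Cj.
- by rewrite -e; exact: measurable_int iB.
apply: eq_bigr => i _; rewrite RintE//.
by apply: integrableS iB => //; exact: subIsetr.
Qed.

Lemma partition_sum_le (A D : set T) (f : T -> R) (th K : R) : measurable A -> measurable D ->
  (m A < +oo)%E -> m.-integrable D (EFin \o f) ->
  (forall x, A x \/ D x -> exists i, C i x) ->
  (forall i, th * fine (m (C i `&` A)) <= K * \int[m]_(x in C i `&` D) f x) ->
  th * fine (m A) <= K * \int[m]_(x in D) f x.
Proof.
move=> mA mD fA iD hAD h.
have i1 : m.-integrable A (EFin \o (fun=> 1 : R)).
  apply/integrableP; split; first by apply/measurable_EFinP; exact: measurable_cst.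
  rewrite (eq_integral (cst 1%E)); last by move=> x _; rewrite /= normr1.
  by rewrite integral_cst// mul1e.
rewrite -(Rint_partition mD iD); last by move=> x Dx; apply: hAD; right.
have -> : fine (m A) = \int[m]_(x in A) 1 by rewrite Rintegral_cst// mul1r.
rewrite -(Rint_partition mA i1); last by move=> x Ax; apply: hAD; left.
rewrite !mulr_sumr; apply: ler_sum => i _; apply: le_trans (h i).
by rewrite Rintegral_cst ?mul1r//; exact: measurableI.
Qed.

End finite_partition.

Section grid.
Context (R : realType) (N : nat).
Notation T := (leb_space R N).
Notation mu := (lebesgue_rV R N).

Definition grid_cell (x0 : 'rV[R]_N) (r : R) (n : nat) (v : {ffun 'I_N -> 'I_n}) : set 'rV[R]_N :=
  hbox (\row_i (x0 ord0 i - r + (v i)%:R * (2 * r / n%:R))) (const_mx (2 * r / n%:R)).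

Lemma grid_cellP x0 r n (v : {ffun 'I_N -> 'I_n}) y : grid_cell x0 r v y <-> forall i,
  x0 ord0 i - r + (v i)%:R * (2 * r / n%:R) <= y ord0 i < x0 ord0 i - r + (v i).+1%:R * (2 * r / n%:R).
Proof.
split=> h i; have := h i; rewrite !mxE -natr1 => /andP[h1 h2]; apply/andP; split=> //; lra.
Qed.

Lemma grid_cell_sub x0 r n (v : {ffun 'I_N -> 'I_n}) : 0 < r -> (0 < n)%N -> grid_cell x0 r v `<=` cube x0 r.
Proof.
move=> r0 n0 y /grid_cellP h; apply/cubeP => i; have /andP[h1 h2] := h i.
have n0' : 0 < n%:R :> R by rewrite ltr0n.
have hh : 0 < 2 * r / n%:R by rewrite divr_gt0 ?mulr_gt0.
apply/andP; split; first by apply: le_trans h1; rewrite lerDl mulr_ge0// ltW.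
apply: (lt_le_trans h2).
have : (v i).+1%:R * (2 * r / n%:R) <= n%:R * (2 * r / n%:R) by rewrite ler_wpM2r ?(ltW hh)// ler_nat.
rewrite [X in _ <= X]mulrC divfK ?gt_eqF//; lra.
Qed.

Lemma grid_cell_disj x0 r n (v w : {ffun 'I_N -> 'I_n}) y : 0 < r -> (0 < n)%N -> grid_cell x0 r v y -> grid_cell x0 r w y -> v = w.
Proof.
move=> r0 n0 /grid_cellP h /grid_cellP h'; apply/ffunP => i; apply/val_inj/eqP => /=.
have hh : 0 < 2 * r / n%:R by rewrite divr_gt0 ?mulr_gt0 ?ltr0n.
have /andP[h1 h2] := h i; have /andP[h3 h4] := h' i.
have a1 : (v i)%:R * (2 * r / n%:R) < (w i).+1%:R * (2 * r / n%:R) by lra.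
have a2 : (w i)%:R * (2 * r / n%:R) < (v i).+1%:R * (2 * r / n%:R) by lra.
rewrite ltr_pM2r// ltr_nat ltnS in a1; rewrite ltr_pM2r// ltr_nat ltnS in a2.
by rewrite eqn_leq a1.
Qed.

Lemma grid_cell_cover x0 r n y : 0 < r -> (0 < n)%N -> cube x0 r y -> exists v : {ffun 'I_N -> 'I_n}, grid_cell x0 r v y.
Proof.
move=> r0 n0 /cubeP h.
have n0' : 0 < n%:R :> R by rewrite ltr0n.
have hh : 0 < 2 * r / n%:R by rewrite divr_gt0 ?mulr_gt0.
have key i : exists j : 'I_n, x0 ord0 i - r + j%:R * (2 * r / n%:R) <= y ord0 i <
    x0 ord0 i - r + j.+1%:R * (2 * r / n%:R).
  have /andP[h1 h2] := h i.
  pose s := (y ord0 i - (x0 ord0 i - r)) / (2 * r / n%:R).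
  have s0 : 0 <= s by rewrite divr_ge0 ?(ltW hh)//; lra.
  have /andP[t1 t2] := truncn_itv s0.
  have sE : s * (2 * r / n%:R) = y ord0 i - (x0 ord0 i - r) by rewrite /s divfK// gt_eqF.
  have sn : s < n%:R.
    by rewrite /s ltr_pdivrMr// mulrCA divff ?gt_eqF// mulr1; lra.
  have tn : (Num.truncn s < n)%N by rewrite -(ltr_nat R); exact: le_lt_trans sn.
  exists (Ordinal tn) => /=; apply/andP; split.
    have := ler_wpM2r (ltW hh) t1; rewrite sE; lra.
  have : s * (2 * r / n%:R) < (Num.truncn s).+1%:R * (2 * r / n%:R) by rewrite ltr_pM2r.
  rewrite sE; lra.
have [v hv] := choice key; exists [ffun i => v i].
by apply/grid_cellP => i; rewrite ffunE.
Qed.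

Lemma leb_grid_cell x0 r n (v : {ffun 'I_N -> 'I_n}) : 0 < r -> fine (mu (grid_cell x0 r v)) = (2 * r / n%:R) ^+ N.
Proof.
move=> r0; rewrite leb_hbox; last by move=> i; rewrite mxE divr_ge0 ?mulr_ge0// ltW.
by under eq_bigr do rewrite mxE; rewrite prodr_const card_ord.
Qed.

End grid.

(** * From small superlevel sets to bounds *)

Section measure_to_sup.
Context (R : realType) (N : nat).
Notation T := (leb_space R N).
Notation mu := (lebesgue_rV R N).
Context (Om : set 'rV[R]_N) (p q a b : 'rV[R]_N -> R) (dl et Ma : R).
Local Notation S := (Slog p q a b dl et).
Context (hI : integrand_data Om p q a b dl et Ma).
Context (N2 : (2 <= N)%N) (hO : bounded_domain Om) (lO : lipschitz_boundary Om).
Context (u g : 'rV[R]_N -> R) (Du Af : 'rV[R]_N -> 'rV[R]_N) (Bf : 'rV[R]_N -> R) (c1 c2 : R).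
Context (hs : sol_data Om p q a b dl et u g Du Af Bf c1 c2) (c10 : 0 < c1) (c20 : 0 < c2).
Context (pm : R) (pm1 : 1 < pm) (hpm : forall x, Om x -> pm <= p x).
Context (kap rs Cs : R) (kap0 : 0 < kap) (Cs1 : 1 <= Cs).
Context (hcmp : forall x0 r t, 0 < r <= rs -> 1 <= t -> t * r <= kap ->
    exists2 sg, t <= sg & ae_in (Om `&` cube x0 r) (fun x => S x t <= Cs * sg /\ sg <= Cs * S x t)).
Local Notation upper := (upper Om u).

Let mO : measurable (Om : set T). Proof. by apply: leb_open; case: hO. Qed.
Let fO : (mu Om < +oo)%E. Proof. by case: hO => _ _ _ /bounded_leb_fin. Qed.
Let N0 : (0 < N)%N. Proof. exact: ltnW. Qed.
Let mu' : measurable_fun (Om : set T) u. Proof. by case: (sd_W11 hs) => /integ_measurable. Qed.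
Let iD : lintegrable Om (fun x => enorm (Du x)).
Proof. by case: (sd_W11 hs) => _ h; apply: enorm_integrable. Qed.
Let mup x0 r k : measurable (upper x0 r k).
Proof. exact: (measurable_upper hO hs). Qed.

Lemma cell_density (C : set T) (l l1 : R) x0 rho : measurable C -> (mu C < +oo)%E -> C `<=` cube x0 rho ->
  l <= l1 -> fine (mu (upper x0 rho l)) <= 2^-1 * fine (mu C) ->
  2^-1 * fine (mu C) <= fine (mu (C `\` (Om `&` [set x | l1 < u x]))).
Proof.
move=> mC fC CK ll h.
have mL : measurable (Om `&` [set x | l1 < u x] : set T).
  have -> : [set x | l1 < u x] = u @^-1` `]l1, +oo[%classic by apply/seteqP; split=> x /=; rewrite in_itv/= andbT.
  exact: mu'.
have mZ : measurable (C `\` (Om `&` [set x | l1 < u x])) by exact: measurableD.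
have mI : measurable (C `&` (Om `&` [set x | l1 < u x])) by exact: measurableI.
have fin (A : set T) : A `<=` C -> mu A \is a fin_num.
  by move=> AC; rewrite ge0_fin_numE//; apply: le_lt_trans fC; exact: leb_le.
have e : fine (mu C) = fine (mu (C `&` (Om `&` [set x | l1 < u x]))) +
    fine (mu (C `\` (Om `&` [set x | l1 < u x]))).
  rewrite -fineD ?fin//.
  rewrite -measureU ?setUIDK//.
  by apply/seteqP; split=> // x [[_ h1] [_ h2]].
have : fine (mu (C `&` (Om `&` [set x | l1 < u x]))) <= fine (mu (upper x0 rho l)).
  apply: fine_leb_le.
    by move=> x [Cx [Ox /= ul]]; split; [split=> //; exact: CK|apply: le_lt_trans ul].
  by apply: (sub_Om_fin hO) => x [[]].
lra.
Qed.

Lemma level_arith (n2 h r0 n s w1 C Q E A I mD : R) : 0 <= n2 -> 0 < r0 -> 0 < n -> 0 < s <= 1 -> 0 < w1 -> 0 < C ->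
  1 <= Q -> 0 <= E -> 0 <= h -> h <= r0 / n -> mD <= E ->
  2^-1 * A <= n2 * h * (2^-1 + 1) * (2 / (s * w1 / 2)) * I ->
  I <= w1 / r0 * (mD + C * (s / 2)^-1 * Q * E) ->
  A <= 12 * n2 * (1 + 2 * C) * n^-1 * (s^-1 ^+ 2) * Q * E.
Proof.
move=> n20 r00 n0 /andP[s0 s1] w10 C0 Q1 E0 h0 hr hmD hA hI'.
have Q0 : 0 <= Q by exact: le_trans Q1.
have is1 : 1 <= s^-1 by rewrite invf_ge1.
have b1 : mD + C * (s / 2)^-1 * Q * E <= (1 + 2 * C) * s^-1 * Q * E.
  have -> : (1 + 2 * C) * s^-1 * Q * E = s^-1 * (Q * E) + C * (s / 2)^-1 * Q * E by field; rewrite gt_eqF.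
  rewrite lerD2r; apply: le_trans hmD _; apply: (@le_trans _ _ (Q * E)); first by rewrite ler_peMl.
  by rewrite ler_peMl// mulr_ge0.
have wr : 0 <= w1 / r0 by rewrite divr_ge0// ltW.
have b2 := le_trans hI' (ler_wpM2l wr b1).
have b3 : n2 * h * (2^-1 + 1) * (2 / (s * w1 / 2)) <= n2 * (r0 / n) * (2^-1 + 1) * (2 / (s * w1 / 2)).
  have p1 : 0 <= 2 / (s * w1 / 2) by rewrite divr_ge0// divr_ge0// mulr_ge0// ltW.
  have p2 : (0 : R) <= 2^-1 + 1 by lra.
  by rewrite ler_wpM2r// ler_wpM2r// ler_wpM2l.
have k0 : 0 <= n2 * (r0 / n) * (2^-1 + 1) * (2 / (s * w1 / 2)).
  by rewrite !mulr_ge0 ?invr_ge0 ?divr_ge0 ?mulr_ge0 ?addr_ge0 ?invr_ge0// ltW.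
have k1 : 0 <= w1 / r0 * ((1 + 2 * C) * s^-1 * Q * E).
  by rewrite !mulr_ge0 ?invr_ge0 ?addr_ge0 ?mulr_ge0// ltW.
have b4 : 2^-1 * A <= n2 * (r0 / n) * (2^-1 + 1) * (2 / (s * w1 / 2)) * (w1 / r0 * ((1 + 2 * C) * s^-1 * Q * E)).
  apply: le_trans hA _; apply: (@le_trans _ _ (n2 * h * (2^-1 + 1) * (2 / (s * w1 / 2)) * (w1 / r0 * ((1 + 2 * C) * s^-1 * Q * E)))).
    rewrite ler_wpM2l// !mulr_ge0 ?invr_ge0 ?divr_ge0 ?mulr_ge0 ?addr_ge0 ?invr_ge0// ltW//.
  by rewrite ler_wpM2r.
have e : n2 * (r0 / n) * (2^-1 + 1) * (2 / (s * w1 / 2)) * (w1 / r0 * ((1 + 2 * C) * s^-1 * Q * E)) =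
  2^-1 * (12 * n2 * (1 + 2 * C) * n^-1 * (s^-1 ^+ 2) * Q * E).
  by field; rewrite !gt_eqF.
by move: b4; rewrite e ler_pM2l// invr_gt0.
Qed.

(** [poincare_levels] on each cell, at the levels [l + s * w1 / 2] and [l + s * w1], summed over the
    cells. The superlevel set is assumed smaller than half of a single cell, so every cell has
    density [1 / 2] however the set is distributed. [dg_ineq] is used with [Lam = 1]; the estimate
    is linear in the measure, and its gain is the factor [1 / n]. *)
Lemma level_step : exists2 C : R, 0 < C & exists2 w0 : R, 0 < w0 <= 1 &
  forall (x0 : 'rV[R]_N) r0 l w1 r rho s (n : nat),
  0 < r0 <= rs -> r0 <= w1 <= w0 -> 0 < r < rho -> rho <= r0 / 2 -> 0 < s <= 1 -> (0 < n)%N ->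
  ae_in (Om `&` cube x0 r0) (fun x => u x <= l + w1) ->
  (forall y, boundary Om y -> `|y - x0| < r0 -> g y <= l) ->
  fine (mu (upper x0 rho l)) <= 2^-1 * (2 * r / n%:R) ^+ N ->
  fine (mu (upper x0 r (l + s * w1))) <=
    C * n%:R^-1 * s^-1 ^+ 2 * (r0 / (rho - r)) ^+ N.+1 * fine (mu (upper x0 rho l)).
Proof.
have [C C0 [w0 w01 hC]] := dg_ineq hI N2 hO lO hs c10 c20 pm1 hpm kap0 Cs1 hcmp.
exists (12 * N%:R ^+ 2 * (1 + 2 * C)); first by rewrite !mulr_gt0 ?exprn_gt0 ?ltr0n ?addr_gt0 ?mulr_gt0.
exists w0 => // x0 r0 l w1 r rho s n /[dup] hr0 /andP[r00 r0s] /[dup] hw /andP[rw ww] /[dup] hrr /andP[rp rr] rhor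
  /[dup] hss /andP[s0 s1] n0 uk hg hE.
have wp : 0 < w1 by apply: lt_le_trans rw.
have sw : 0 < s * w1 by rewrite mulr_gt0.
have n0' : 0 < n%:R :> R by rewrite ltr0n.
have [h [hp hdef]] : exists h, 0 < h /\ h = 2 * r / n%:R by eexists; split; last reflexivity; rewrite divr_gt0 ?mulr_gt0.
have rc : 0 < r < r0 by apply/andP; split; lra.
have l12 : l + s * w1 / 2 < l + s * w1 by lra.
have hg1 y : boundary Om y -> `|y - x0| < r0 -> g y <= l + s * w1 / 2.
  by move=> By yx; apply: le_trans (hg y By yx) _; rewrite lerDl divr_ge0// ltW.
have h20 : 0 < (2^-1 : R) by rewrite invr_gt0.
have [D DE] : exists D : set T, D = Om `&` cube x0 r `&` [set x | l + s * w1 / 2 < u x < l + s * w1] by eexists.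
have mD : measurable D.
  rewrite DE setIAC; apply: measurableI; last exact: measurable_cube.
  have -> : [set x | l + s * w1 / 2 < u x < l + s * w1] = u @^-1` `]l + s * w1 / 2, l + s * w1[%classic.
    by apply/seteqP; split=> x /=; rewrite in_itv.
  exact: mu'.
have DO : D `<=` Om by rewrite DE => x [[]].
have iDD := integrableS mO mD DO iD.
have hiso (v : {ffun 'I_N -> 'I_n}) : 2^-1 * fine (mu (grid_cell x0 r v `&` upper x0 r (l + s * w1))) <=
   N%:R ^+ 2 * h * (2^-1 + 1) * (2 / (s * w1 / 2)) * \int[mu]_(x in grid_cell x0 r v `&` D) enorm (Du x).
  have sub := grid_cell_sub (v := v) (x0 := x0) rp n0.
  have mC : measurable (grid_cell x0 r v : set T) by exact: measurable_hbox.
  have fC : (mu (grid_cell x0 r v : set T) < +oo)%E by exact: leb_hbox_fin.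
  have hZ : 2^-1 * fine (mu (grid_cell x0 r v)) <= fine (mu (grid_cell x0 r v `\` (Om `&` [set x | l + s * w1 / 2 < u x]))).
    apply: (@cell_density _ l _ x0 rho mC fC).
    - by apply: subset_trans sub _; exact: cube_sub (ltW rr).
    - by rewrite lerDl divr_ge0// ltW.
    - by rewrite leb_grid_cell.
  move: sub hZ; rewrite /grid_cell -hdef => sub hZ.
  have := @poincare_levels R N Om p q a b dl et N2 hO lO u g Du Af Bf c1 c2 hs x0
    (\row_i (x0 ord0 i - r + (v i)%:R * h)) r r0 (l + s * w1 / 2) (l + s * w1) h 2^-1 rc hp h20 l12 sub hg1 hZ.
  have -> : l + s * w1 - (l + s * w1 / 2) = s * w1 / 2 by field.
  have -> : hbox (\row_i (x0 ord0 i - r + (v i)%:R * h)) (const_mx h) `&` Om `&` [set x | l + s * w1 / 2 < u x < l + s * w1] =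
     hbox (\row_i (x0 ord0 i - r + (v i)%:R * h)) (const_mx h) `&` D.
    rewrite DE; apply/seteqP; split=> x; first by move=> [[Cx Ox] hx]; split=> //; split=> //; split=> //; exact: sub.
    by move=> [Cx [[Ox _] hx]].
  apply: le_trans; rewrite ler_wpM2l ?(ltW h20)//; apply: fine_leb_le.
    by move=> x [Cx [[Ox _] /= hx]]; split=> //=; exact: ltW.
  by apply: (sub_Om_fin hO) => x [[]].
have hsum := @partition_sum_le _ T R mu _ (fun v : {ffun 'I_N -> 'I_n} => grid_cell x0 r v)
  (fun v => measurable_hbox _ _) (fun v w y => grid_cell_disj rp n0) (upper x0 r (l + s * w1)) D (fun x => enorm (Du x))
  2^-1 (N%:R ^+ 2 * h * (2^-1 + 1) * (2 / (s * w1 / 2))) (mup _ _ _) mD (sub_Om_fin hO _) iDD _ hiso.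
have cov x : upper x0 r (l + s * w1) x \/ D x -> exists v : {ffun 'I_N -> 'I_n}, grid_cell x0 r v x.
  move=> hx; apply: (grid_cell_cover rp n0); move: hx; rewrite DE; by move=> [[[]]|[[]]].
have supO : upper x0 r (l + s * w1) `<=` Om by move=> x [[]].
have hD : D `<=` Om `&` cube x0 r `&` [set x | l + s / 2 * w1 <= u x].
  by rewrite DE => x [Kx /andP[h1 h2]]; split=> //=; lra.
have s20 : 0 < s / 2 by rewrite divr_gt0.
have rhor' : rho <= r0 by lra.
have := hC x0 r0 l w1 r rho (s / 2) 1 D hr0 hw hrr rhor' s20 (lexx _) uk hg mD hD.
rewrite powR1 mul1r mulr1 => hdg.
have dr : 0 < rho - r by rewrite subr_gt0.
have Q1 : 1 <= (r0 / (rho - r)) ^+ N.+1.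
  by rewrite exprn_ege1// ler_pdivlMr// mul1r; lra.
have hh : h <= r0 / n%:R by rewrite hdef ler_pM2r ?invr_gt0//; lra.
have mDE : fine (mu D) <= fine (mu (upper x0 rho l)).
  apply: fine_leb_le; last by apply: (sub_Om_fin hO) => x [[]].
  move=> x /hD[[Ox Kx] /= hx]; split; first by split=> //; exact: cube_sub (ltW rr) _ Kx.
  by apply: lt_le_trans hx; rewrite /= ltrDl mulr_gt0.
have E0 : 0 <= fine (mu (upper x0 rho l)) by exact: fine_ge0.
have n20 : 0 <= N%:R ^+ 2 :> R by rewrite exprn_ge0.
exact: (level_arith n20 r00 n0' hss wp C0 Q1 E0 (ltW hp) hh mDE (hsum supO cov) hdg).
Qed.

Lemma upper_ae x0 r l : fine (mu (upper x0 r l)) = 0 -> ae_in (Om `&` cube x0 r) (fun x => u x <= l).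
Proof.
move=> h; exists (upper x0 r l); split; first exact: mup.
  have f : mu (upper x0 r l) \is a fin_num.
    by rewrite ge0_fin_numE//; apply: (sub_Om_fin hO) => x [[]].
  by rewrite -(fineK f) h.
move=> x /= nx; have [[Ox Kx]|no] := pselect ((Om `&` cube x0 r) x); last by case: nx => /no.
by split=> //=; rewrite ltNge; apply/negP => ul; apply: nx.
Qed.

(* In a grid of [n^N] cells, smallness in the whole cube still gives density in
   each cell, and the Poincare inequality on the cells gains a factor [1/n];
   letting [n] grow geometrically with the level absorbs the geometric loss of
   [level_step]. *)
Lemma half_sup : exists2 nu : R, 0 < nu & exists2 w0 : R, 0 < w0 <= 1 &
  forall (x0 : 'rV[R]_N) r0 k w, 0 < r0 <= rs -> 2 * r0 <= w -> w <= w0 ->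
  ae_in (Om `&` cube x0 r0) (fun x => u x <= k + w) ->
  (forall y, boundary Om y -> `|y - x0| < r0 -> g y <= k) ->
  fine (mu (upper x0 (r0 / 2) k)) <= nu * r0 ^+ N ->
  ae_in (Om `&` cube x0 (r0 / 4)) (fun x => u x <= k + w / 2).
Proof.
have [C C0 [w0 w01 hC]] := level_step.
(* The ratio of successive grid sizes: [lam ^ j] equals [(2 ^ j) ^ 2] times [(2 ^ j) ^ (N+1)], which
   cancels the losses from [s^-1 ^ 2] and from the ratio of [r0] to the gap between the radii. *)
have [lam [lam2 lam_def]] : exists lam : nat, (2 <= lam)%N /\ lam = (2 ^ (N + 3))%N.
  by eexists; split; last reflexivity; rewrite -{1}(expn1 2) leq_exp2l// addn3.
have lam0 : (0 < lam)%N by apply: leq_trans lam2.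
have lamj j : (lam ^ j)%:R = (2 ^+ j) ^+ 2 * (2 ^+ j) ^+ N.+1 :> R.
  rewrite lam_def -expnM natrX -!exprM -exprD; congr (_ ^+ _).
  by rewrite -mulnDr mulnC addn3 add2n.
pose C5 : R := C * 16 * 8 ^+ N.+1.
have C50 : 0 < C5 by rewrite !mulr_gt0 ?exprn_gt0.
(* Makes the factor of each step at most [lam ^ -N], the ratio of successive thresholds in [key]. *)
pose n0 := (Num.bound (C5 * lam%:R ^+ N)).+1.
have hn0 : C5 * lam%:R ^+ N <= n0%:R.
  have : C5 * lam%:R ^+ N < (Num.bound (C5 * lam%:R ^+ N))%:R.
    by apply: archi_boundP; rewrite mulr_ge0 ?exprn_ge0// ltW.
  by move=> /ltW h; apply: le_trans h _; rewrite ler_nat.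
pose nn j := (n0 * lam ^ j)%N.
have nn0 j : (0 < nn j)%N by rewrite muln_gt0 expn_gt0 lam0.
have nnR j : 0 < (nn j)%:R :> R by rewrite ltr0n.
exists (2^-1 * (2 * n0%:R)^-1 ^+ N); first by rewrite mulr_gt0 ?invr_gt0 ?exprn_gt0 ?invr_gt0 ?mulr_gt0 ?ltr0n.
exists w0 => // x0 r0 k w /[dup] hr0 /andP[r00 r0s] rw ww uk hg hY.
have wp : 0 < w by apply: lt_le_trans rw; rewrite mulr_gt0.
have p2 j : 0 < 2 ^+ j :> R by rewrite exprn_gt0.
have ip2 j : 0 < (2 ^+ j)^-1 :> R by rewrite invr_gt0.
have ip21 j : (2 ^+ j)^-1 <= 1 :> R by rewrite invf_le1// exprn_ege1// ler1n.
(* The half-sides decrease from [r0 / 2] to [r0 / 4], and the levels [lj] increase from [k] to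
   [k + w / 2]. *)
have [rj rjE] : exists rj : nat -> R, rj = (fun j => r0 / 4 * (1 + (2 ^+ j)^-1)) by eexists.
have [lj ljE] : exists lj : nat -> R, lj = (fun j => k + w / 2 * (1 - (2 ^+ j)^-1)) by eexists.
have ipS j : (2 ^+ j.+1)^-1 = (2 ^+ j)^-1 / 2 :> R by rewrite exprSr invfM.
have key j : fine (mu (upper x0 (rj j) (lj j))) <= 2^-1 * (r0 / (2 * (nn j)%:R)) ^+ N.
  elim: j => [|j IH].
    have -> : lj 0%N = k by rewrite ljE expr0 invr1; ring.
    have -> : rj 0%N = r0 / 2 by rewrite rjE expr0 invr1; field.
    apply: le_trans hY _; rewrite /nn expn0 muln1 exprMn mulrA mulrAC lexx//.
  have [t tE] : exists t : R, t = (2 ^+ j)^-1 by eexists.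
  have [t0 t1] : 0 < t /\ t <= 1 by rewrite tE.
  (* [w1] is the distance from the current level to the upper bound [k + w], and [s] is the fraction
     of it by which the level rises. *)
  have [w1 w1E] : exists w1 : R, w1 = w / 2 * (1 + t) by eexists.
  have w1p : 0 < w1 by rewrite w1E mulr_gt0 ?divr_gt0// addr_gt0.
  have hw : r0 <= w1 <= w0.
    have e1 : w1 = w / 2 + w / 2 * t by rewrite w1E mulrDr mulr1.
    have e2 : w / 2 * t <= w / 2 by rewrite ler_piMr// divr_ge0// ltW.
    have e3 : 0 <= w / 2 * t by rewrite mulr_ge0 ?divr_ge0// ltW.
    by apply/andP; split; lra.
  have h1 : lj j + w1 = k + w by rewrite ljE w1E -tE; field.
  have [s sE] : exists s : R, s = w / 4 * t / w1 by eexists.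
  have s0 : 0 < s by rewrite sE divr_gt0// mulr_gt0// divr_gt0.
  have hs1 : s <= 1.
    rewrite sE ler_pdivrMr// mul1r w1E.
    have e3 : 0 <= w / 2 * t by rewrite mulr_ge0 ?divr_ge0// ltW.
    have -> : w / 4 * t = w / 2 * t / 2 by field.
    have -> : w / 2 * (1 + t) = w / 2 + w / 2 * t by ring.
    lra.
  have h2 : lj j + s * w1 = lj j.+1.
    by rewrite sE divfK ?gt_eqF// ljE ipS -tE; field.
  have hrr : 0 < rj j.+1 < rj j.
    rewrite rjE ipS -tE; apply/andP; split; first by rewrite mulr_gt0 ?divr_gt0// addr_gt0// divr_gt0.
    rewrite ltr_pM2l ?divr_gt0//; lra.
  have hrho : rj j <= r0 / 2.
    rewrite rjE -tE; have -> : r0 / 2 = r0 / 4 * (1 + 1) by field.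
    by rewrite ler_pM2l ?divr_gt0// lerD2l.
  have uk' : ae_in (Om `&` cube x0 r0) (fun x => u x <= lj j + w1) by rewrite h1.
  have hg' y : boundary Om y -> `|y - x0| < r0 -> g y <= lj j.
    move=> By yx; apply: le_trans (hg y By yx) _; rewrite ljE lerDl mulr_ge0 ?divr_ge0 ?(ltW wp)// subr_ge0//.
  have hE : fine (mu (upper x0 (rj j) (lj j))) <= 2^-1 * (2 * rj j.+1 / (nn j)%:R) ^+ N.
    apply: le_trans IH _; rewrite ler_wpM2l ?invr_ge0//.
    have e4 : r0 / (2 * (nn j)%:R) <= 2 * rj j.+1 / (nn j)%:R.
      have -> : r0 / (2 * (nn j)%:R) = r0 / 2 / (nn j)%:R by field; rewrite gt_eqF.
      rewrite ler_pM2r ?invr_gt0// rjE.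
      have e5 := ltW (ip2 j.+1).
      have -> : 2 * (r0 / 4 * (1 + (2 ^+ j.+1)^-1)) = r0 / 2 + r0 / 2 * (2 ^+ j.+1)^-1 by field; rewrite gt_eqF.
      by rewrite lerDl mulr_ge0// divr_ge0// ltW.
    have e6 : 0 <= r0 / (2 * (nn j)%:R) by rewrite divr_ge0 ?mulr_ge0// ltW.
    by rewrite ler_pXn2r// nnegrE//; exact: le_trans e4.
  have s01 : 0 < s <= 1 by rewrite s0.
  have := hC x0 r0 (lj j) w1 (rj j.+1) (rj j) s (nn j) hr0 hw hrr hrho s01 (nn0 j) uk' hg' hE.
  rewrite h2 => hstep; apply: le_trans hstep _.
  have hQ : r0 / (rj j - rj j.+1) = 8 * 2 ^+ j.
    rewrite rjE ipS -tE.
    have -> : r0 / 4 * (1 + t) - r0 / 4 * (1 + t / 2) = r0 / 8 * t by field.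
    have -> : 2 ^+ j = t^-1 by rewrite tE invrK.
    by field; rewrite !gt_eqF.
  have hsi : s^-1 <= 4 * 2 ^+ j.
    rewrite sE invf_div ler_pdivrMr ?mulr_gt0 ?divr_gt0//.
    have -> : 4 * 2 ^+ j * (w / 4 * t) = w by rewrite tE; field; rewrite gt_eqF.
    rewrite w1E; have e2 : w / 2 * t <= w / 2 by rewrite ler_piMr// divr_ge0// ltW.
    have -> : w / 2 * (1 + t) = w / 2 + w / 2 * t by ring.
    lra.
  have fac : C * (nn j)%:R^-1 * s^-1 ^+ 2 * (r0 / (rj j - rj j.+1)) ^+ N.+1 <= lam%:R^-1 ^+ N.
    rewrite hQ.
    have e7 : s^-1 ^+ 2 <= (4 * 2 ^+ j) ^+ 2.
      by rewrite ler_pXn2r// nnegrE ?invr_ge0 ?mulr_ge0// ltW.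
    apply: (@le_trans _ _ (C * (nn j)%:R^-1 * (4 * 2 ^+ j) ^+ 2 * (8 * 2 ^+ j) ^+ N.+1)).
      rewrite ler_wpM2r ?exprn_ge0 ?mulr_ge0 ?(ltW (p2 j))// ler_wpM2l// mulr_ge0 ?invr_ge0 ?(ltW C0)//.
    have n00 : 0 < n0%:R :> R by rewrite ltr0n.
    have l0R : 0 < lam%:R :> R by rewrite ltr0n.
    have -> : C * (nn j)%:R^-1 * (4 * 2 ^+ j) ^+ 2 * (8 * 2 ^+ j) ^+ N.+1 = C5 / n0%:R.
      rewrite /nn natrM lamj !exprMn /C5; have := p2 j; move: (2 ^+ j) => z z0.
      have z1 : 0 < z ^+ N.+1 by rewrite exprn_gt0.
      by field; rewrite !gt_eqF.
    by rewrite ler_pdivrMr// exprVn mulrC ler_pdivlMr// exprn_gt0.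
  have M0 : 0 <= fine (mu (upper x0 (rj j) (lj j))) by exact: fine_ge0.
  apply: le_trans (ler_wpM2r M0 fac) _.
  apply: le_trans (ler_wpM2l _ IH) _; first by rewrite exprn_ge0// invr_ge0.
  have l0R : 0 < lam%:R :> R by rewrite ltr0n.
  rewrite mulrCA ler_wpM2l ?invr_ge0// -exprMn le_eqVlt; apply/orP; left; apply/eqP; congr (_ ^+ _).
  rewrite /nn expnSr !natrM; have zz : 0 < (lam ^ j)%:R :> R by rewrite ltr0n expn_gt0 lam0.
  have n00 : 0 < n0%:R :> R by rewrite ltr0n.
  by field; rewrite !gt_eqF.
apply: upper_ae; apply/eqP; rewrite eq_le fine_ge0// andbT leNgt; apply/negP.
set Y := fine _ => Y0.
(* The limiting superlevel set lies in all those of the iteration, whose measures decay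
   geometrically. *)
have hY' j : Y <= r0 ^+ N / 2 ^+ j.
  apply: (@le_trans _ _ (fine (mu (upper x0 (rj j) (lj j))))).
    apply: fine_leb_le; last by apply: (sub_Om_fin hO) => x [[]].
    move=> x [[Ox Kx] /= hx]; split; first split=> //.
      by apply: cube_sub Kx; rewrite rjE mulrDr mulr1 lerDl mulr_ge0 ?divr_ge0 ?(ltW r00)// ltW.
    have e8 : 1 - (2 ^+ j)^-1 <= 1 :> R by have := ltW (ip2 j); lra.
    by apply: le_lt_trans hx; rewrite ljE /= lerD2l ler_piMr// divr_ge0// ltW.
  apply: le_trans (key j) _; apply: (@le_trans _ _ ((r0 / (2 * (nn j)%:R)) ^+ N)).
    by rewrite ler_piMl ?exprn_ge0 ?divr_ge0 ?mulr_ge0 ?(ltW r00)// invf_le1// ler1n.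
  rewrite exprMn ler_wpM2l ?exprn_ge0 ?(ltW r00)//.
  rewrite exprVn lef_pV2 ?posrE ?exprn_gt0 ?mulr_gt0//.
  have a1 : 2 ^+ j <= (nn j)%:R :> R.
    rewrite -natrX ler_nat /nn; apply: (@leq_trans (lam ^ j)); first by case: (j) => // i; rewrite leq_exp2r.
    by rewrite leq_pmull.
  have a2 : 1 <= 2 * (nn j)%:R :> R.
    by rewrite -natrM ler1n muln_gt0 nn0.
  apply: (@le_trans _ _ (2 * (nn j)%:R)); first by apply: le_trans a1 _; rewrite ler_peMl// ler1n.
  by rewrite ler_eXnr.
have hb : r0 ^+ N / Y < 2 ^+ (Num.bound (r0 ^+ N / Y)).
  by apply: upper_nthrootP.
have := hY' (Num.bound (r0 ^+ N / Y)).
rewrite ler_pdivlMr//; move: hb; rewrite ltr_pdivrMr// mulrC => hb hc.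
by have := lt_le_trans hb hc; rewrite ltxx.
Qed.

(* [shrink] makes the superlevel set at [H - 2^-J (H - k)] small and [half_sup]
   turns smallness into a bound.  If [H - k] is small compared with [r0] there is
   nothing to prove; if it is too large, [k] is raised first. *)
Lemma one_sided cs W : 0 < cs -> 0 < W -> exists2 th : R, 0 < th <= 2^-1 &
  forall (x0 : 'rV[R]_N) r0 k H, 0 < r0 <= rs -> H - k <= W ->
  ae_in (Om `&` cube x0 r0) (fun x => u x <= H) ->
  (forall y, boundary Om y -> `|y - x0| < r0 -> g y <= k) ->
  cs * fine (mu (cube x0 (r0 / 2))) <=
    fine (mu (cube x0 (r0 / 2) `\` (Om `&` [set x | k < u x]))) ->
  ae_in (Om `&` cube x0 (r0 / 4)) (fun x => u x <= H - th * (H - k) + r0).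
Proof.
move=> cs0 W0; have [nu nu0 [w1 /andP[w10 w11] hA]] := half_sup.
have [J [w2 /andP[w20 w21] hB]] :=
  shrink hI N2 hO lO hs c10 c20 pm1 hpm kap0 Cs1 hcmp cs0 nu0.
have [w0 [w00 [w01 [w02 w03]]]] : exists w0 : R, 0 < w0 /\ w0 <= w1 /\ w0 <= w2 /\ w0 <= W.
  exists (Num.min w1 (Num.min w2 W)).
  by rewrite !lt_min w10 w20 W0 !ge_min !lexx !orbT.
have [e [e0 e1 eE]] : exists e : R, [/\ 0 < e, e <= 1 & e = (2 ^+ J)^-1].
  by eexists; split; last reflexivity; [rewrite invr_gt0 exprn_gt0|rewrite invf_le1 ?exprn_gt0// exprn_ege1// ler1n].
have small (x0 : 'rV[R]_N) r0 k H : 0 < r0 <= rs -> 0 < H - k <= w0 ->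
  ae_in (Om `&` cube x0 r0) (fun x => u x <= H) ->
  (forall y, boundary Om y -> `|y - x0| < r0 -> g y <= k) ->
  cs * fine (mu (cube x0 (r0 / 2))) <=
    fine (mu (cube x0 (r0 / 2) `\` (Om `&` [set x | k < u x]))) ->
  ae_in (Om `&` cube x0 (r0 / 4)) (fun x => u x <= H - e / 2 * (H - k) + r0).
  move=> /[dup] hr0 /andP[r00 r0s] /andP[wp ww] uk hg hd.
  have sub : Om `&` cube x0 (r0 / 4) `<=` Om `&` cube x0 r0.
    by move=> x [Ox Kx]; split=> //; apply: cube_sub Kx; lra.
  have [hsm|hbig] := leP (2 * r0) ((H - k) * e); last first.
    apply: ae_in_imp (ae_inS sub uk) => x _ h; apply: le_trans h _; lra.
  have uk' : ae_in (Om `&` cube x0 r0) (fun x => u x <= k + (H - k)).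
    by apply: ae_in_imp uk => x _ h; rewrite subrKC.
  have q1 : H - k <= w2 by lra.
  have q2 : r0 <= (H - k) / 2 ^+ J by rewrite -eE; lra.
  have := hB x0 r0 k (H - k) hr0 q1 q2 uk' hg hd; rewrite -eE subrKC => hY.
  have uk2 : ae_in (Om `&` cube x0 r0) (fun x => u x <= H - (H - k) * e + (H - k) * e).
    by apply: ae_in_imp uk => x _ h; rewrite subrK.
  have q0 : (H - k) * e <= H - k by rewrite ler_piMr// ltW.
  have q3 : (H - k) * e <= w1 by lra.
  have hg2 y : boundary Om y -> `|y - x0| < r0 -> g y <= H - (H - k) * e.
    by move=> By yx; have := hg y By yx; lra.
  have := hA x0 r0 _ _ hr0 hsm q3 uk2 hg2 hY.
  apply: ae_in_imp => x _ h; apply: le_trans h _; lra.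
have th1 : 0 < w0 / W <= 1 by rewrite divr_gt0//= ler_pdivrMr// mul1r.
have /andP[th1a th1b] := th1.
(* Raising [k] to [H - w0] when [H - k] exceeds [w0] replaces [H - k] by [w0], which is at least
   [w0 / W] times [H - k]. *)
exists (e / 2 * (w0 / W)).
  rewrite mulr_gt0 ?divr_gt0//=.
  have a1 : e / 2 * (w0 / W) <= e / 2 by rewrite ler_piMr// divr_ge0// ltW.
  by apply: le_trans a1 _; lra.
move=> x0 r0 k H /[dup] hr0 /andP[r00 r0s] HW uk hg hd.
have sub : Om `&` cube x0 (r0 / 4) `<=` Om `&` cube x0 r0.
  by move=> x [Ox Kx]; split=> //; apply: cube_sub Kx; lra.
have [hw|hw] := leP (H - k) 0.
  apply: ae_in_imp (ae_inS sub uk) => x _ h; apply: le_trans h _.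
  have a1 : e / 2 * (w0 / W) * (H - k) <= 0.
    by rewrite mulr_ge0_le0// mulr_ge0 ?divr_ge0// ltW.
  lra.
have [hw2|hw2] := leP (H - k) w0.
  have hkw : 0 < H - k <= w0 by rewrite hw.
  apply: ae_in_imp (small x0 r0 k H hr0 hkw uk hg hd) => x _ h; apply: le_trans h _.
  by rewrite lerD2r lerD2l lerN2 ler_wpM2r ?(ltW hw)// ler_piMr// divr_ge0// ltW.
have hkw : 0 < H - (H - w0) <= w0 by apply/andP; split; lra.
have hg2 y : boundary Om y -> `|y - x0| < r0 -> g y <= H - w0.
  by move=> By yx; have := hg y By yx; lra.
have hd2 : cs * fine (mu (cube x0 (r0 / 2))) <=
    fine (mu (cube x0 (r0 / 2) `\` (Om `&` [set x | H - w0 < u x]))).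
  apply: le_trans hd _; apply: fine_leb_le; last first.
    by apply: le_lt_trans (leb_cube_fin x0 (r0 / 2)); exact: leb_le (@subDsetl _ _ _).
  by move=> x [Kx nx]; split=> // -[Ox /= h]; apply: nx; split=> //=; lra.
apply: ae_in_imp (small x0 r0 (H - w0) H hr0 hkw uk hg2 hd2) => x _ h; apply: le_trans h _.
rewrite lerD2r lerD2l lerN2.
have -> : H - (H - w0) = w0 by ring.
rewrite -mulrA ler_wpM2l ?divr_ge0 ?(ltW e0)// mulrAC ler_pdivrMr// ler_wpM2l// ltW//.
Qed.

End measure_to_sup.

(** * The continuous representative *)

Section hoelder_representative.
Context (R : realType) (N : nat).
Notation T := (leb_space R N).
Notation mu := (lebesgue_rV R N).
Context (Om : set 'rV[R]_N) (u : 'rV[R]_N -> R) (B R1 M0 be : R).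
Hypotheses (oO : open Om) (B0 : 0 <= B) (R10 : 0 < R1) (be0 : 0 < be).
Hypothesis uM : ae_in Om (fun x => `|u x| <= M0).
Local Notation lam := (4^-1 `^ be : R).
Hypothesis hosc : forall x0 n, exists m M : R, M - m <= B * lam ^+ n /\
  ae_in (Om `&` cube x0 (R1 / 4 ^+ n)) (fun x => m <= u x <= M).

(** A cube about a point of the closure, boundary points included, meets [Om] in a set containing a
    ball, so that almost everywhere statements on it are not vacuous. *)
Lemma closure_nonnull y eps : closure Om y -> 0 < eps -> ae_in (Om `&` cube y eps) (fun=> False) -> False.
Proof.
move=> cy e0 [Z [mZ Z0 hZ]].
have [z [Oz yz]] := cy _ (nbhsx_ballx y _ e0).
have : nbhs z (Om `&` ball y eps).
  by apply: open_nbhs_nbhs; split=> //; apply: openI => //; exact: ball_open.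
move=> /nbhs_ballP[d /= d0 hd].
have sub : (ball z d : set T) `<=` Z.
  move=> x /hd[Ox yx]; apply: hZ => /= h; apply: h; split=> //; apply: cube_lt.
  by move: yx; rewrite -ball_normE/= distrC.
have := lt_le_trans (leb_ball_pos z d0) (leb_le sub).
by rewrite [mu Z]Z0 ltxx.
Qed.

(* The essential limit superior of [u] at [x]. *)
Definition vrep (x : 'rV[R]_N) : R :=
  inf [set t | exists n : nat, ae_in (Om `&` cube x (R1 / 4 ^+ n)) (fun z => u z <= t)].

Let rad_gt0 n : 0 < R1 / 4 ^+ n.
Proof. by rewrite divr_gt0// exprn_gt0. Qed.

Lemma rad_small eps : 0 < eps -> exists n, R1 / 4 ^+ n <= eps.
Proof.
move=> e0; exists (Num.bound (R1 / eps)); rewrite ler_pdivrMr ?exprn_gt0// mulrC -ler_pdivrMr//.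
apply: ltW; apply: (@lt_le_trans _ _ (2 ^+ Num.bound (R1 / eps))); first exact: upper_nthrootP.
by rewrite lerXn2r ?nnegrE// ler_nat.
Qed.

(** Two almost everywhere bounds on cubes about [y] can be compared because they hold at a common
    point, by [closure_nonnull]; this also covers boundary points. *)
Lemma vrep_itv y eps m M : closure Om y -> 0 < eps ->
  ae_in (Om `&` cube y eps) (fun x => m <= u x <= M) -> m <= vrep y <= M.
Proof.
move=> cy e0 h.
have lb m' eps' t : 0 < eps' -> ae_in (Om `&` cube y eps') (fun x => m' <= u x) ->
    (exists n : nat, ae_in (Om `&` cube y (R1 / 4 ^+ n)) (fun z => u z <= t)) -> m' <= t.
  move=> e'0 h1 [n h2]; rewrite leNgt; apply/negP => tm.
  have d0 : 0 < Num.min eps' (R1 / 4 ^+ n) by rewrite lt_min e'0 rad_gt0.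
  apply: (closure_nonnull cy d0).
  have s1 : Om `&` cube y (Num.min eps' (R1 / 4 ^+ n)) `<=` Om `&` cube y eps'.
    by move=> x [Ox Kx]; split=> //; apply: cube_sub Kx; rewrite ge_min lexx.
  have s2 : Om `&` cube y (Num.min eps' (R1 / 4 ^+ n)) `<=` Om `&` cube y (R1 / 4 ^+ n).
    by move=> x [Ox Kx]; split=> //; apply: cube_sub Kx; rewrite ge_min lexx orbT.
  apply: ae_in_imp2 (ae_inS s1 h1) (ae_inS s2 h2) => x _ h3 h4.
  by have := lt_le_trans tm (le_trans h3 h4); rewrite ltxx.
have [n0 hn0] := rad_small e0.
have sM : exists n : nat, ae_in (Om `&` cube y (R1 / 4 ^+ n)) (fun z => u z <= M).
  exists n0; have s : Om `&` cube y (R1 / 4 ^+ n0) `<=` Om `&` cube y eps.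
    by move=> x [Ox Kx]; split=> //; apply: cube_sub Kx.
  by apply: ae_in_imp (ae_inS s h) => x _ /andP[].
have hm : ae_in (Om `&` cube y eps) (fun x => m <= u x) by apply: ae_in_imp h => x _ /andP[].
apply/andP; split.
  by apply: lb_le_inf; [exists M|move=> t ht; exact: (lb m eps t e0 hm ht)].
by apply: ge_inf => //; exists m => t ht; exact: (lb m eps t e0 hm ht).
Qed.

Lemma vrep_bound y : closure Om y -> `|vrep y| <= M0.
Proof.
move=> cy; have s : Om `&` cube y 1 `<=` Om by exact: subIsetl.
have h : ae_in (Om `&` cube y 1) (fun x => - M0 <= u x <= M0).
  by apply: ae_in_imp (ae_inS s uM) => x _; rewrite ler_norml.
by rewrite ler_norml; exact: vrep_itv cy ltr01 h.
Qed.

Let lam0 : 0 < lam. Proof. by rewrite powR_gt0// invr_gt0. Qed.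

Lemma lam_exp n : lam ^+ n = ((4 ^+ n)^-1) `^ be.
Proof.
rewrite -[lam ^+ n]powR_mulrn ?powR_ge0// -powRrM mulrC powRrM powR_mulrn ?invr_ge0//.
by rewrite exprVn.
Qed.

Lemma cube_shift (x y : 'rV[R]_N) r : `|x - y| < r -> cube y (r - `|x - y|) `<=` cube x r.
Proof.
move=> h z /cubeP hz; apply/cubeP => i; have /andP[h1 h2] := hz i.
have := sup_norm_coord (x - y) i; rewrite !mxE ler_norml => /andP[h3 h4].
by apply/andP; split; lra.
Qed.

(** Let [n + 1] be the first index with [R1 / 4 ^ (n+1) <= |x - y|]. The cube of half-side
    [R1 / 4 ^ n] about [x] contains a cube about [y], so its oscillation bound governs both values.
    Distances of at least [R1] are covered by the bound [M0]. *)
Lemma vrep_hoelder : hoelder_on be (closure Om) vrep.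
Proof.
have M00 x : closure Om x -> 0 <= M0 by move=> /vrep_bound; exact: le_trans (normr_ge0 _).
exists (2 * `|M0| * R1^-1 `^ be + B * lam^-1 * R1^-1 `^ be) => x y cx cy.
have e0 : 0 <= enorm (x - y) by exact: enorm_ge0.
have M0' := M00 x cx.
have iR : 0 <= R1^-1 by rewrite invr_ge0 ltW.
have P1 : 0 <= 2 * `|M0| * R1^-1 `^ be by rewrite !mulr_ge0 ?powR_ge0.
have P2 : 0 <= B * lam^-1 * R1^-1 `^ be by rewrite !mulr_ge0 ?powR_ge0 ?invr_ge0// ltW.
have E0 : 0 <= enorm (x - y) `^ be by exact: powR_ge0.
have [xy|hd] := eqVneq x y.
  have -> : vrep x - vrep y = 0 by rewrite xy subrr.
  rewrite normr0; exact: mulr_ge0 (addr_ge0 P1 P2) E0.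
have d0 : 0 < `|x - y| by rewrite normr_gt0 subr_eq0.
have dE : `|x - y| <= enorm (x - y) by exact: sup_le_enorm.
have mon c : 0 <= c -> c <= R1^-1 * enorm (x - y) -> c `^ be <= R1^-1 `^ be * enorm (x - y) `^ be.
  by move=> c0 hc; rewrite -powRM//; apply: powR_mono => //; exact: ltW.
have [hR|hR] := leP R1 `|x - y|.
  rewrite mulrDl; apply: (@le_trans _ _ (2 * `|M0| * R1^-1 `^ be * enorm (x - y) `^ be)); last first.
    by rewrite lerDl mulr_ge0.
  apply: (@le_trans _ _ (2 * `|M0|)).
    apply: le_trans (ler_normB _ _) _; have := vrep_bound cx; have := vrep_bound cy.
    by have := ler_norm M0; lra.
  rewrite -mulrA ler_peMr ?mulr_ge0//.
  have := mon 1 ler01; rewrite powR1; apply.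
  by rewrite mulrC ler_pdivlMr// mul1r (le_trans hR).
have [n0 hn0] := rad_small d0.
have ex : exists n, R1 / 4 ^+ n <= `|x - y| by exists n0.
have [n hn nmin] := find_ex_minn ex.
case: n hn nmin => [|n] hn nmin.
  by move: hn; rewrite expr0 divr1 => /(lt_le_trans hR); rewrite ltxx.
have hlt : `|x - y| < R1 / 4 ^+ n.
  by rewrite ltNge; apply/negP => /nmin; rewrite ltnn.
have [m [M [hmM hu]]] := hosc x n.
have vx := vrep_itv cx (rad_gt0 n) hu.
have ep : 0 < R1 / 4 ^+ n - `|x - y| by rewrite subr_gt0.
have sub : Om `&` cube y (R1 / 4 ^+ n - `|x - y|) `<=` Om `&` cube x (R1 / 4 ^+ n).
  by move=> z [Oz Kz]; split=> //; exact: cube_shift hlt _ Kz.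
have vy := vrep_itv cy ep (ae_inS sub hu).
have d1 : `|vrep x - vrep y| <= B * lam ^+ n.
  apply: le_trans hmM; move: vx vy => /andP[v1 v2] /andP[v3 v4].
  by rewrite ler_norml; apply/andP; split; lra.
apply: le_trans d1 _; rewrite mulrDl.
apply: (@le_trans _ _ (B * lam^-1 * R1^-1 `^ be * enorm (x - y) `^ be)); last by rewrite lerDr mulr_ge0.
have -> : B * lam ^+ n = B * lam^-1 * lam ^+ n.+1.
  by rewrite exprS -mulrA mulKf// gt_eqF.
rewrite -!mulrA ler_wpM2l// ler_wpM2l ?invr_ge0 ?(ltW lam0)// lam_exp.
apply: mon; first by rewrite invr_ge0 exprn_ge0.
rewrite mulrC ler_pdivlMr// mulrC; exact: le_trans dE.
Qed.

(** For each [n] the values of [u] and [vrep] differ by at most [B * lam ^ n] almost everywhere, as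
    both lie between the same bounds on a cube; the countably many exceptional sets are then
    united. *)
Lemma vrep_ae : lam < 1 -> ae_in Om (fun x => u x = vrep x).
Proof.
move=> l1.
have h n : ae_in Om (fun x => `|u x - vrep x| <= B * lam ^+ n).
  apply: ae_local => x Ox.
  have : nbhs x Om by exact: open_nbhs_nbhs.
  move=> /nbhs_ballP[e /= e0 he].
  have [m [M [hmM hu]]] := hosc x n.
  have r0 : 0 < Num.min e (R1 / 4 ^+ n) by rewrite lt_min e0 rad_gt0.
  exists (Num.min e (R1 / 4 ^+ n)) => //.
  have hb z : ball x (Num.min e (R1 / 4 ^+ n)) z -> Om z /\ `|x - z| < R1 / 4 ^+ n.
    rewrite -ball_normE/= lt_min => /andP[h1 h2]; split=> //; apply: he.
    by rewrite -ball_normE.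
  have sub : ball x (Num.min e (R1 / 4 ^+ n)) `<=` Om `&` cube x (R1 / 4 ^+ n).
    by move=> z /hb[Oz xz]; split=> //; apply: cube_lt; rewrite distrC.
  apply: ae_in_imp (ae_inS sub hu) => z /hb[Oz xz] /andP[u1 u2].
  have ep : 0 < R1 / 4 ^+ n - `|x - z| by rewrite subr_gt0.
  have sub2 : Om `&` cube z (R1 / 4 ^+ n - `|x - z|) `<=` Om `&` cube x (R1 / 4 ^+ n).
    by move=> z' [Oz' Kz']; split=> //; exact: cube_shift xz _ Kz'.
  have cz : closure Om z by exact: subset_closure.
  have /andP[v1 v2] := vrep_itv cz ep (ae_inS sub2 hu).
  apply: le_trans hmM; by rewrite ler_norml; apply/andP; split; lra.
have := ae_foralln h.
apply: (@filterS _ (almost_everywhere mu)) => x hx Ox.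
apply/eqP; rewrite -subr_eq0 -normr_eq0 eq_le normr_ge0 andbT.
apply/ler_addgt0Pl => eps eps0; rewrite addr0.
have cl : B * lam ^+ n @[n --> \oo] --> (0 : R).
  rewrite -[X in _ --> X](mulr0 B); apply: cvgMr; apply: cvg_expr.
  by rewrite gtr0_norm.
have [n _ hn] : \forall n \near \oo, B * lam ^+ n <= eps.
  move: cl => /cvgrPdist_le /(_ _ eps0); apply: filterS => n; rewrite sub0r normrN.
  exact: le_trans (ler_norm _).
apply: le_trans (hx n Ox) _; exact: hn n (leqnn n).
Qed.

End hoelder_representative.

(** * Decay of the oscillation *)

Section oscillation_decay.
Context (R : realType) (N : nat).
Notation T := (leb_space R N).
Notation mu := (lebesgue_rV R N).

(** The conclusion of [one_sided] as a property, so that it can be assumed for [u] and for [- u]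
    with common constants. *)
Definition decays (Om : set 'rV[R]_N) (v gv : 'rV[R]_N -> R) (rs cs W th : R) :=
  forall (x0 : 'rV[R]_N) r0 k H, 0 < r0 <= rs -> 0 <= H - k <= W ->
  ae_in (Om `&` cube x0 r0) (fun x => v x <= H) ->
  (forall y, boundary Om y -> `|y - x0| < r0 -> gv y <= k) ->
  cs * fine (mu (cube x0 (r0 / 2))) <=
    fine (mu (cube x0 (r0 / 2) `\` (Om `&` [set x | k < v x]))) ->
  ae_in (Om `&` cube x0 (r0 / 4)) (fun x => v x <= H - th * (H - k) + r0).

Lemma decays_le Om v gv rs rs' cs W th th' : rs' <= rs -> th' <= th -> decays Om v gv rs cs W th ->
  decays Om v gv rs' cs W th'.
Proof.
move=> rr tt h x0 r0 k H /andP[r00 r1] /[dup] hw /andP[H0 HW] uk hg hd.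
have r0s : 0 < r0 <= rs by rewrite r00 (le_trans r1).
apply: ae_in_imp (h x0 r0 k H r0s hw uk hg hd) => x _ hx; apply: le_trans hx _.
by rewrite lerD2r lerD2l lerN2 ler_wpM2r.
Qed.

Context (Om : set 'rV[R]_N) (u g : 'rV[R]_N -> R) (rs cs th M0 Mg Cg be0 : R).
Hypotheses (mO : measurable (Om : set T)) (mu' : measurable_fun (Om : set T) u).
Hypotheses (rs0 : 0 < rs) (rs1 : rs <= 1) (cs1 : cs <= 2^-1).
Hypotheses (th0 : 0 < th) (th1 : th <= 2^-1) (M00 : 0 <= M0) (Mg0 : 0 <= Mg) (Cg0 : 0 <= Cg).
Hypotheses (be00 : 0 < be0) (be01 : be0 <= 1).
Hypothesis uM : ae_in Om (fun x => `|u x| <= M0).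
Hypothesis gM : forall y, boundary Om y -> `|g y| <= Mg.
Hypothesis hg : forall x y, boundary Om x -> boundary Om y -> `|g x - g y| <= Cg * enorm (x - y) `^ be0.
Hypothesis hcs : forall y r, boundary Om y -> 0 < r <= rs ->
  cs * fine (mu (cube y (r / 2))) <= fine (mu (cube y (r / 2) `\` Om)).
Let W := 2 * M0 + Mg.
Hypothesis hu : decays Om u g rs cs W th.
Hypothesis hun : decays Om (fun x => - u x) (fun x => - g x) rs cs W th.

Lemma exterior_density y r (A : set T) : boundary Om y -> 0 < r <= rs ->
  cs * fine (mu (cube y (r / 2))) <= fine (mu (cube y (r / 2) `\` (Om `&` A))).
Proof.
move=> By hr; apply: le_trans (hcs By hr) _; apply: fine_leb_le.
  by move=> x [Kx nx]; split=> // -[].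
by apply: le_lt_trans (leb_cube_fin y (r / 2)); exact: leb_le (@subDsetl _ _ _).
Qed.

(** The decay is applied to [u] and [- u] with [H] at distance [A] and [k] at distance [G] from the
    boundary value, where [G] bounds the oscillation of [g] on the cube. The density hypothesis
    comes from the complement of [Om]. *)
Lemma boundary_step y r A : boundary Om y -> 0 < r <= rs -> 0 <= A <= M0 + Mg ->
  ae_in (Om `&` cube y r) (fun x => `|u x - g y| <= A) ->
  ae_in (Om `&` cube y (r / 4)) (fun x => `|u x - g y| <= (1 - th) * A + Cg * (N%:R * r) `^ be0 + r).
Proof.
have [M00' Mg0' th0' th1'] : [/\ 0 <= M0, 0 <= Mg, 0 < th & th <= 2^-1] by split.
move=> By /[dup] hr /andP[r0 r1] /andP[A0 AM] hA.
have [G [G0 GE]] : exists G, 0 <= G /\ G = Cg * (N%:R * r) `^ be0.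
  by eexists; split; last reflexivity; rewrite mulr_ge0 ?powR_ge0.
have sub : Om `&` cube y (r / 4) `<=` Om `&` cube y r.
  by move=> x [Ox Kx]; split=> //; apply: cube_sub Kx; lra.
rewrite -GE; have tA : th * A <= A by rewrite ler_piMl// (le_trans th1)// invf_le1// ler1n.
(* If [A <= G], the level [k] is not below [H], but then the asserted bound exceeds [A]. *)
have [AG|GA] := leP A G.
  apply: ae_in_imp (ae_inS sub hA) => x _ h; apply: le_trans h _.
  have : th * A <= G by apply: le_trans AG.
  have -> : (1 - th) * A = A - th * A by ring.
  lra.
have tG : th * G <= G by rewrite ler_piMl// (le_trans th1)// invf_le1// ler1n.
have gG z : boundary Om z -> `|z - y| < r -> `|g z - g y| <= G.
  move=> Bz zy; apply: le_trans (hg Bz By) _; rewrite GE ler_wpM2l//.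
  apply: powR_mono; rewrite ?(ltW be00) ?enorm_ge0//.
  by apply: (le_trans (enorm_le_sup _)); rewrite ler_wpM2l// ltW.
have MW : A - G <= W by rewrite /W; lra.
have h1 : ae_in (Om `&` cube y r) (fun x => u x <= g y + A).
  by apply: ae_in_imp hA => x _; rewrite ler_norml => /andP[]; lra.
have h2 : ae_in (Om `&` cube y r) (fun x => - u x <= - g y + A).
  by apply: ae_in_imp hA => x _; rewrite ler_norml => /andP[]; lra.
have w1 : 0 <= (g y + A) - (g y + G) <= W by apply/andP; split; lra.
have w2 : 0 <= (- g y + A) - (- g y + G) <= W by apply/andP; split; lra.
have g1 z : boundary Om z -> `|z - y| < r -> g z <= g y + G.
  by move=> Bz zy; have := gG z Bz zy; rewrite ler_norml => /andP[]; lra.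
have g2 z : boundary Om z -> `|z - y| < r -> - g z <= - g y + G.
  by move=> Bz zy; have := gG z Bz zy; rewrite ler_norml => /andP[]; lra.
have k1 := hu hr w1 h1 g1 (exterior_density _ By hr).
have k2 := hun hr w2 h2 g2 (exterior_density _ By hr).
apply: ae_in_imp2 k1 k2 => x _.
have -> : g y + A - (g y + G) = A - G by ring.
have -> : - g y + A - (- g y + G) = A - G by ring.
have -> : th * (A - G) = th * A - th * G by ring.
have -> : (1 - th) * A = A - th * A by ring.
move=> l1 l2; rewrite ler_norml; apply/andP; split; lra.
Qed.

(** With [k] the midpoint of [m] and [M], either [u <= k] or [u > k] occupies the fraction
    [cs <= 1 / 2] of the smaller cube, and the decay applies to [u] or to [- u]. Since [H - k] is
    half of [M - m], the gain is [th / 2]. The new bounds are clipped to keep them ordered and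
    within [M0]. *)
Lemma interior_step x0 r m M : 0 < r <= rs -> - M0 <= m -> m <= M -> M <= M0 ->
  (forall y, boundary Om y -> ~ `|y - x0| < r) ->
  ae_in (Om `&` cube x0 r) (fun x => m <= u x <= M) ->
  exists m' M', [/\ - M0 <= m', m' <= M', M' <= M0, M' - m' <= (1 - th / 2) * (M - m) + r &
    ae_in (Om `&` cube x0 (r / 4)) (fun x => m' <= u x <= M')].
Proof.
have [M00' Mg0' th0' th1'] : [/\ 0 <= M0, 0 <= Mg, 0 < th & th <= 2^-1] by split.
move=> /[dup] hr /andP[r0 r1] Mm mM MM hB hmM.
have sub : Om `&` cube x0 (r / 4) `<=` Om `&` cube x0 r.
  by move=> x [Ox Kx]; split=> //; apply: cube_sub Kx; lra.
have [k kE] : exists k : R, k = (m + M) / 2 by eexists.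
have tm : th * (M - m) <= M - m by rewrite ler_piMl ?subr_ge0// (le_trans th1)// invf_le1// ler1n.
have tm0 : 0 <= th * (M - m) by rewrite mulr_ge0 ?subr_ge0// ltW.
have [K KE] : exists K : set T, K = cube x0 (r / 2) by eexists.
have mK : measurable K by rewrite KE; exact: measurable_cube.
have fK : (mu K < +oo)%E by rewrite KE; exact: leb_cube_fin.
have csK : cs * fine (mu K) <= 2^-1 * fine (mu K) by rewrite ler_wpM2r// fine_ge0.
have [U UE] : exists U : set T, U = K `&` (Om `&` [set x | k < u x]) by eexists.
have mU : measurable U.
  rewrite UE; apply: measurableI => //.
  have -> : [set x | k < u x] = u @^-1` `]k, +oo[%classic by apply/seteqP; split=> x /=; rewrite in_itv/= andbT.
  exact: mu'.
have UK : U `<=` K by rewrite UE; exact: subIsetl.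
have DU : K `\` (Om `&` [set x | k < u x]) = K `\` U.
  apply/seteqP; split=> x [Kx nx]; split=> //; first by rewrite UE => -[].
  by move=> h; apply: nx; rewrite UE.
have fin (A : set T) : A `<=` K -> mu A \is a fin_num.
  by move=> AC; rewrite ge0_fin_numE//; apply: le_lt_trans fK; exact: leb_le.
have eK : fine (mu K) = fine (mu U) + fine (mu (K `\` U)).
  rewrite -fineD ?fin//.
  rewrite -measureU//; [|exact: measurableD|by apply/seteqP; split=> // x [h1 [_ h2]]].
  by congr (fine (mu _)); apply/seteqP; split=> x; [move=> Kx; have [h|h] := pselect (U x); [left|right]|move=> [/UK|[]]].
have uM1 : ae_in (Om `&` cube x0 r) (fun x => u x <= M) by apply: ae_in_imp hmM => x _ /andP[].
have um1 : ae_in (Om `&` cube x0 r) (fun x => - u x <= - m) by apply: ae_in_imp hmM => x _ /andP[]; lra.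
have [hd|hd] := leP (cs * fine (mu K)) (fine (mu (K `\` U))).
- have w1 : 0 <= M - k <= W by rewrite kE /W; apply/andP; split; lra.
  have g1 z : boundary Om z -> `|z - x0| < r -> g z <= k by move=> Bz /(hB z Bz).
  have h1 := hu hr w1 uM1 g1; rewrite -KE DU in h1; have {}h1 := h1 hd.
  exists m, (Num.min M (M - th * (M - m) / 2 + r)); split=> //.
  + by rewrite le_min mM/=; lra.
  + by rewrite ge_min MM.
  + rewrite lerBlDr ge_min; apply/orP; right; lra.
  + apply: ae_in_imp2 h1 (ae_inS sub hmM) => x _ h2 /andP[h3 h4]; rewrite h3 le_min h4/=.
    by move: h2; rewrite kE; lra.
- have w1 : 0 <= - m - - k <= W by rewrite kE /W; apply/andP; split; lra.
  have g1 z : boundary Om z -> `|z - x0| < r -> - g z <= - k by move=> Bz /(hB z Bz).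
  have h1 := hun hr w1 um1 g1; rewrite -KE in h1.
  have hd2 : cs * fine (mu K) <= fine (mu (K `\` (Om `&` [set x | - k < - u x]))).
    apply: (@le_trans _ _ (fine (mu U))); first by lra.
    apply: fine_leb_le; last by apply: le_lt_trans fK; exact: leb_le (@subDsetl _ _ _).
    by rewrite UE => x [Kx [Ox /= h]]; split=> // -[_ /=]; lra.
  have {}h1 := h1 hd2.
  exists (Num.max m (m + th * (M - m) / 2 - r)), M; split=> //.
  + by rewrite le_max Mm.
  + by rewrite ge_max mM/=; lra.
  + rewrite lerBlDr -lerBlDl le_max; apply/orP; right; lra.
  + apply: ae_in_imp2 h1 (ae_inS sub hmM) => x _ h2 /andP[h3 h4]; rewrite h4 ge_max h3/= andbT.
    by move: h2; rewrite kE; lra.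
Qed.

(** The larger of [1 - th / 4] and [4 ^ (- be0)], written as a power of [1 / 4]. The steps contract
    by [1 - th / 2] or better, so [th / 4] remains to absorb the additive radius. *)
Lemma decay_rate : exists be : R, [/\ 0 < be, be <= be0, 1 - th / 4 <= 4^-1 `^ be, 4^-1 `^ be0 <= (4^-1 `^ be : R) & (4^-1 `^ be : R) < 1].
Proof.
have [M00' Mg0' th0' th1'] : [/\ 0 <= M0, 0 <= Mg, 0 < th & th <= 2^-1] by split.
have i4 : 0 < (4^-1 : R) by rewrite invr_gt0.
have l4 : ln (4^-1 : R) < 0 by rewrite ln_lt0// i4 invf_lt1// ltr1n.
pose l := Num.max (1 - th / 4) (4^-1 `^ be0).
have r1 : (4^-1 `^ be0 : R) < 1.
  by rewrite /powR gt_eqF// -[ltRHS]expR0 ltr_expR pmulr_rlt0.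
have l1 : l < 1 by rewrite gt_max r1 andbT; lra.
have l0 : 0 < l by rewrite lt_max powR_gt0// orbT.
have lE : 4^-1 `^ (ln l / ln 4^-1) = l.
  by rewrite /powR gt_eqF// divfK ?lt_eqF// lnK.
exists (ln l / ln 4^-1); rewrite lE; split=> //.
- by rewrite nmulr_rgt0 ?invr_lt0// ln_lt0// l0.
- rewrite ler_ndivrMr// -ler_expR (lnK (_ : l \is Num.pos)) ?posrE//.
  have -> : expR (be0 * ln 4^-1) = 4^-1 `^ be0 by rewrite /powR gt_eqF.
  by rewrite le_max lexx orbT.
- by rewrite le_max lexx.
- by rewrite le_max lexx orbT.
Qed.

Lemma osc_decay : exists be B : R, [/\ 0 < be, be <= be0, 0 <= B, (4^-1 `^ be : R) < 1 &
  forall x0 n, exists m M : R, M - m <= B * (4^-1 `^ be) ^+ n /\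
    ae_in (Om `&` cube x0 (rs / 4 ^+ n)) (fun x => m <= u x <= M)].
Proof.
have [M00' Mg0' th0' th1'] : [/\ 0 <= M0, 0 <= Mg, 0 < th & th <= 2^-1] by split.
have [be [b0 b1 l1 l2 l3]] := decay_rate.
have [lam lamE] : exists lam : R, lam = 4^-1 `^ be by eexists.
rewrite -lamE in l1 l2 l3.
have lam0 : 0 < lam by rewrite lamE powR_gt0// invr_gt0.
have rp n : 0 < rs / 4 ^+ n <= rs.
  by rewrite divr_gt0 ?exprn_gt0//= ler_pdivrMr ?exprn_gt0// ler_peMr ?(ltW rs0)// exprn_ege1// ler1n.
have rS n : rs / 4 ^+ n.+1 = rs / 4 ^+ n / 4 by rewrite exprSr invfM mulrA.
have rN n : (rs / 4 ^+ n) `^ be0 <= lam ^+ n.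
  apply: (@le_trans _ _ ((4^-1 `^ be0) ^+ n)); last by rewrite lerXn2r ?nnegrE ?powR_ge0// ltW.
  rewrite lam_exp; apply: powR_mono; rewrite ?(ltW be00) ?divr_ge0 ?exprn_ge0 ?(ltW rs0)//.
  by rewrite ler_piMl ?invr_ge0 ?exprn_ge0.
have rN1 n : rs / 4 ^+ n <= lam ^+ n.
  apply: le_trans (rN n); have /andP[q1 q2] := rp n.
  by apply: ger1_powR => //; rewrite q1 (le_trans q2).
have [C6 [C60 C6E]] : exists C6 : R, 1 <= C6 /\ C6 = Cg * N%:R `^ be0 + 1.
  by eexists; split; last reflexivity; rewrite lerDr mulr_ge0 ?powR_ge0.
(* [B1] covers the start of the induction, and its margin [B1 * (th / 4)] absorbs the radius and the
   oscillation of [g], which together are at most [C6 * lam ^+ n]. *)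
have [B1 [B10 B1a B1b]] : exists B1 : R, [/\ 0 <= B1, M0 + Mg <= B1 & C6 <= B1 * (th / 4)].
  exists (M0 + Mg + C6 / (th / 4)).
  have q : 0 < th / 4 by rewrite divr_gt0.
  have c : 0 <= C6 / (th / 4) by rewrite divr_ge0 ?(ltW q)// (le_trans ler01).
  split; [by rewrite !addr_ge0|by rewrite lerDl|].
  by rewrite mulrDl divfK ?gt_eqF// lerDr mulr_ge0 ?addr_ge0// ltW.
have lp n : 0 < lam ^+ n by rewrite exprn_gt0.
have ln1 n : lam ^+ n <= 1 by rewrite exprn_ile1 ?ltW.
have hbd y n : boundary Om y -> ae_in (Om `&` cube y (rs / 4 ^+ n)) (fun x => `|u x - g y| <= B1 * lam ^+ n).
  move=> By; have h0 r : ae_in (Om `&` cube y r) (fun x => `|u x - g y| <= M0 + Mg).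
    have s : Om `&` cube y r `<=` Om by exact: subIsetl.
    apply: ae_in_imp (ae_inS s uM) => x _ h; apply: le_trans (ler_normB _ _) _.
    by apply: lerD => //; exact: gM.
  elim: n => [|n IH].
    by apply: ae_in_imp (h0 _) => x _ h; rewrite expr0 mulr1; exact: le_trans B1a.
  (* The minimum keeps [A] in the range of [boundary_step], where [H - k] must not exceed [W]. *)
  have [A AE] : exists A, A = Num.min (B1 * lam ^+ n) (M0 + Mg) by eexists.
  have A0 : 0 <= A <= M0 + Mg.
    rewrite AE le_min ge_min lexx orbT andbT; apply/andP; split; last exact: addr_ge0.
    by rewrite mulr_ge0// ltW.
  have AB : A <= B1 * lam ^+ n by rewrite AE ge_min lexx.
  have hA : ae_in (Om `&` cube y (rs / 4 ^+ n)) (fun x => `|u x - g y| <= A).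
    by apply: ae_in_imp2 IH (h0 _) => x _ h h'; rewrite AE le_min h.
  rewrite rS; apply: ae_in_imp (boundary_step By (rp n) A0 hA) => x _ h; apply: le_trans h _.
  have e1 : Cg * (N%:R * (rs / 4 ^+ n)) `^ be0 + rs / 4 ^+ n <= C6 * lam ^+ n.
    rewrite C6E mulrDl mul1r; apply: lerD => //.
    have /andP[q1 _] := rp n.
    by rewrite powRM ?(ltW q1)// mulrA ler_wpM2l ?mulr_ge0 ?powR_ge0.
  have e2 : (1 - th) * A <= (1 - th) * (B1 * lam ^+ n) by rewrite ler_wpM2l//; lra.
  have e3 : C6 * lam ^+ n <= B1 * (th / 4) * lam ^+ n by rewrite ler_wpM2r// ltW.
  have e4 : B1 * lam ^+ n * (1 - th / 4) <= B1 * lam ^+ n * lam by rewrite ler_wpM2l// mulr_ge0// ltW.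
  have e5 : 0 <= th * (B1 * lam ^+ n) by rewrite !mulr_ge0// ltW.
  rewrite exprSr mulrA; lra.
(* The conditions come, in this order, from the first two scales, from the radius in
   [interior_step], and from the boundary case, where the estimate at scale [n] is used at scale
   [n + 2]. *)
have [B2 [B20 B2a B2b B2c]] : exists B2 : R, [/\ 0 <= B2, 2 * M0 <= B2 * lam, 1 <= B2 * (th / 4) & 2 * B1 <= B2 * lam ^+ 2].
  have q : 0 < th / 4 by rewrite divr_gt0.
  have k1 : 0 <= 2 * M0 / lam by rewrite divr_ge0 ?mulr_ge0// ltW.
  have k2 : 0 <= (th / 4)^-1 by rewrite invr_ge0 ltW.
  have k3 : 0 <= 2 * B1 / lam ^+ 2 by rewrite divr_ge0 ?mulr_ge0// ltW.
  exists (2 * M0 / lam + (th / 4)^-1 + 2 * B1 / lam ^+ 2); split; first by rewrite !addr_ge0.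
  - rewrite -ler_pdivrMr//; lra.
  - rewrite -ler_pdivrMr// mul1r; lra.
  - rewrite -ler_pdivrMr//; lra.
exists be, B2; split=> //; first by rewrite -lamE.
rewrite -lamE => x0 n.
suff : exists m M, [/\ - M0 <= m, m <= M, M <= M0, M - m <= B2 * lam ^+ n &
    ae_in (Om `&` cube x0 (rs / 4 ^+ n)) (fun x => m <= u x <= M)].
  by move=> [m [M [_ _ _ h h']]]; exists m, M.
have triv r : ae_in (Om `&` cube x0 r) (fun x => - M0 <= u x <= M0).
  have s : Om `&` cube x0 r `<=` Om by exact: subIsetl.
  by apply: ae_in_imp (ae_inS s uM) => x _; rewrite ler_norml.
have nM : - M0 <= M0 by lra.
case: n => [|n].
  exists (- M0), M0; split=> //.
  have : B2 * lam <= B2 by rewrite ler_piMr// ltW.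
  by rewrite expr0 mulr1; lra.
elim: n => [|n IH].
  by exists (- M0), M0; split=> //; rewrite expr1; lra.
(* If a boundary point [y] is near, the cube of scale [n + 2] about [x0] lies in the one of scale
   [n] about [y], because [1/4 + 1/16 < 1]; otherwise the previous cube is free of boundary
   points. *)
have [[y [By yx]]|no] := pselect (exists y, boundary Om y /\ `|y - x0| < rs / 4 ^+ n.+1).
  have sub : Om `&` cube x0 (rs / 4 ^+ n.+2) `<=` Om `&` cube y (rs / 4 ^+ n).
    move=> x [Ox Kx]; split=> //; apply: cube_lt.
    have /andP[q _] := rp n; have /andP[q' _] := rp n.+2.
    have := cube_le (ltW q') Kx; move: yx; rewrite !rS => yx Kx'.
    have -> : x - y = (x - x0) - (y - x0) by rewrite opprB addrA subrK.
    by apply: le_lt_trans (ler_normB _ _) _; lra.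
  have hb := ae_inS sub (hbd y n By).
  have [m mE] : exists m : R, m = Num.max (- M0) (g y - B1 * lam ^+ n) by eexists.
  have [M ME] : exists M : R, M = Num.min M0 (g y + B1 * lam ^+ n) by eexists.
  have hmM : ae_in (Om `&` cube x0 (rs / 4 ^+ n.+2)) (fun x => m <= u x <= M).
    apply: ae_in_imp2 hb (triv _) => x _; rewrite ler_norml => /andP[h1 h2] /andP[h3 h4].
    by rewrite mE ME ge_max le_min h3 h4/=; apply/andP; split; lra.
  have B2n : 2 * (B1 * lam ^+ n) <= B2 * lam ^+ n.+2.
    have -> : B2 * lam ^+ n.+2 = B2 * lam ^+ 2 * lam ^+ n by rewrite -addn2 exprD; ring.
    by rewrite mulrA ler_wpM2r// ltW.
  have m1 : g y - B1 * lam ^+ n <= m by rewrite mE le_max lexx orbT.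
  have M1 : M <= g y + B1 * lam ^+ n by rewrite ME ge_min lexx orbT.
  have [mM|Mm] := leP m M.
    exists m, M; split=> //; first by rewrite mE le_max lexx.
      by rewrite ME ge_min lexx.
    lra.
  (* The bounds are contradictory, so the cube meets [Om] in a null set and any values will do. *)
  exists 0, 0; split=> //; rewrite ?oppr_le0//.
    by rewrite subrr mulr_ge0// ltW.
  apply: ae_in_imp hmM => x _ /andP[h1 h2].
  by have := lt_le_trans Mm (le_trans h1 h2); rewrite ltxx.
have [m [M [h1 h2 h3 h4 h5]]] := IH.
have hB y : boundary Om y -> ~ `|y - x0| < rs / 4 ^+ n.+1 by move=> By yx; apply: no; exists y.
have [m' [M' [k1 k2 k3 k4 k5]]] := interior_step (rp n.+1) h1 h2 h3 hB h5.
exists m', M'; split=> //; last by rewrite rS.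
apply: le_trans k4 _.
have e1 : (1 - th / 2) * (M - m) <= (1 - th / 2) * (B2 * lam ^+ n.+1) by rewrite ler_wpM2l//; lra.
have e2 : B2 * lam ^+ n.+1 * (1 - th / 4) <= B2 * lam ^+ n.+1 * lam by rewrite ler_wpM2l// mulr_ge0// ltW.
have e3 : lam ^+ n.+1 <= B2 * (th / 4) * lam ^+ n.+1 by rewrite ler_peMl// ltW.
have e4 := rN1 n.+1.
rewrite [in X in _ <= X]exprSr mulrA; lra.
Qed.

End oscillation_decay.

(** * From weak solutions to the iteration *)

Section regularity.
Context (R : realType) (N : nat).
Notation T := (leb_space R N).
Notation mu := (lebesgue_rV R N).
Notation TH := (caratheodory_type (@hausdorff_outer R N N.-1)).

Lemma hoelder_cont (D : set 'rV[R]_N) f (be : R) : 0 < be -> hoelder_on be D f -> {within D, continuous f}.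
Proof.
move=> be0 [C hC]; apply/subspace_continuousP => x Dx.
apply/cvgrPdist_le => eps eps0.
have [C1 [C10 CC1]] : exists C1 : R, 0 < C1 /\ C <= C1.
  by exists (`|C| + 1); split; [rewrite ltr_wpDl|apply: le_trans (ler_norm _) _; rewrite lerDl].
have N1 : 0 < N.+1%:R :> R by [].
pose r : R := (eps / C1) `^ be^-1 / N.+1%:R.
have r0 : 0 < r by rewrite divr_gt0// powR_gt0// divr_gt0.
rewrite /within/=; apply: filterS (nbhsx_ballx x r r0) => y; rewrite -ball_normE/= => xy Dy.
have e0 := enorm_ge0 (x - y).
apply: le_trans (hC _ _ Dx Dy) _; apply: (@le_trans _ _ (C1 * enorm (x - y) `^ be)).
  by rewrite ler_wpM2r ?powR_ge0.
rewrite mulrC -ler_pdivlMr//.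
have h : enorm (x - y) <= (eps / C1) `^ be^-1.
  apply: (le_trans (enorm_le_sup _)); apply: (@le_trans _ _ (N.+1%:R * r)).
    by rewrite ler_pM ?ler_nat// ltW.
  by rewrite /r mulrC divfK ?gt_eqF.
apply: le_trans (powR_mono (ltW be0) e0 h) _.
by rewrite -powRrM mulVf ?gt_eqF// powRr1// divr_ge0// ltW.
Qed.

Lemma within_bounded (K : set 'rV[R]_N) (f : 'rV[R]_N -> R) : compact K -> {within K, continuous f} ->
  exists2 M : R, 0 <= M & forall x, K x -> `|f x| <= M.
Proof.
move=> cK cf; have [[z Kz]|nK] := pselect (exists z, K z); last first.
  by exists 0 => // x Kx; case: nK; exists x.
have K0 : K !=set0 by exists z.
have [c _ hc] := EVT_max_rV K0 cK cf; have [c' _ hc'] := EVT_min_rV K0 cK cf.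
exists (`|f c| + `|f c'|); first by rewrite addr_ge0.
move=> x Kx; have := hc x (mem_set Kx); have := hc' x (mem_set Kx).
have := ler_norm (f c); have := ler_norm (- f c'); rewrite normrN.
have := normr_ge0 (f c); have := normr_ge0 (f c').
by move=> ? ? ? ? ? ?; rewrite ler_norml; apply/andP; split; lra.
Qed.

(** Finiteness for some [lam] gives it for [lam = 1], by the polynomial growth of [Sv_scale]. *)
Lemma LS_integrable (Om : set 'rV[R]_N) p q a b dl et Ma f : bounded_domain Om -> 
  integrand_data Om p q a b dl et Ma -> LS (Slog p q a b dl et) Om f ->
  lintegrable Om (fun x => Slog p q a b dl et x `|f x|).
Proof.
move=> hO hI [mf [lam l0 hfin]].
have mO : measurable (Om : set T) by apply: leb_open; case: hO.
have mnf : measurable_fun (Om : set T) (fun x : T => `|f x|) := measurableT_comp (@normr_measurable R setT) mf.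
have mlf : measurable_fun (Om : set T) (fun x : T => lam * `|f x|).
  by apply: measurable_funM => //; exact: measurable_cst.
have mS := Slog_measurable hI hO mlf.
have iS : lintegrable Om (fun x => Slog p q a b dl et x (lam * `|f x|)).
  apply/integrableP; split; first exact/measurable_EFinP.
  apply: le_lt_trans hfin; rewrite le_eqVlt; apply/orP; left; apply/eqP; apply: ae_eq_integral.
  - exact: mO.
  - apply/measurable_EFinP; exact: (measurableT_comp (@normr_measurable R setT) mS).
  - exact/measurable_EFinP.
  - have h := id_ae hI; move: h; apply: (@filterS _ (almost_everywhere mu)) => x h Ox /=.
    have [h1 h2 h3 /andP[h4 _] /andP[h6 _]] := h Ox.
    rewrite ger0_norm//; apply: (Sv_ge0 (p x) (q x) h4 h6 (id_dl hI) (id_et hI)).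
    by rewrite mulr_ge0// ltW.
pose c := Num.max 1 lam^-1; have c1 : 1 <= c by rewrite le_max lexx.
have c0 : 0 <= c by exact: le_trans c1.
apply: (integ_dom mO (Slog_measurable hI hO mnf) _ (integZ mO (c ^+ N.+1) iS)).
apply: ae_in_imp (id_ae hI) => x _ [h1 h2 h3 /andP[h4 _] /andP[h6 _]].
have f0 : 0 <= `|f x| by [].
have lf0 : 0 <= lam * `|f x| by rewrite mulr_ge0// ltW.
rewrite ger0_norm; last exact: (Sv_ge0 (p x) (q x) h4 h6 (id_dl hI) (id_et hI) f0).
apply: le_trans (Sv_scale h1 h2 h3 h4 h6 (id_dl hI) (id_et hI) c1 lf0).
apply: (Sv_mono h1 h2 h4 h6 (id_dl hI) (id_et hI) f0).
by rewrite mulrA ler_peMl// -ler_pdivrMr// mul1r le_max lexx orbT.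
Qed.

Context (Om : set 'rV[R]_N) (p q a b : 'rV[R]_N -> R) (dl et : R).
Local Notation S := (Slog p q a b dl et).

Lemma integrand_dataP alpha : bounded_domain Om -> log_hoelder (closure Om) p -> log_hoelder (closure Om) q ->
  (forall x, closure Om x -> [/\ 1 < p x, p x <= q x & q x < N%:R]) ->
  Linfty Om a -> ae_in Om (fun x => 0 <= a x) -> 0 < alpha -> hoelder_on alpha (closure Om) b ->
  (forall x, closure Om x -> 0 <= b x) -> 1 <= dl -> 0 <= et -> exists Ma, integrand_data Om p q a b dl et Ma.
Proof.
move=> hO hp hq hpq [ma [A hA]] a0 al0 hb b0 dl1 et0.
have [_ oO _ bO] := hO.
have mO : measurable (Om : set T) by exact: leb_open.
have mcl : measurable (closure Om : set T) by apply: leb_closed; exact: closed_closure.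
have sub : (Om : set T) `<=` closure Om by exact: subset_closure.
have cb' := hoelder_cont al0 hb.
have [Mb Mb0 hMb] := within_bounded (closure_bounded bO) cb'.
have mS (f : 'rV[R]_N -> R) : {within closure Om, continuous f} -> measurable_fun (Om : set T) f.
  by move=> cf; apply: (measurable_funS mcl sub); exact: leb_continuous_in.
exists (`|A| + Mb); split=> //.
- by apply: mS; exact: log_hoelder_cont.
- by apply: mS; exact: log_hoelder_cont.
- exact: mS.
apply: ae_in_imp2 hA a0 => x Ox h1 h2; have cx := sub x Ox.
have [h3 h4 h5] := hpq x cx; have h6 := b0 x cx; have h7 := hMb x cx.
split=> //; first exact: ltW.
- rewrite h2; have := ler_norm (a x); have := ler_norm A; lra.
- rewrite h6; have := ler_norm (b x); have := normr_ge0 A; lra.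
Qed.

(** The weak gradient provided by the trace agrees almost everywhere with the one of finite energy,
    by uniqueness. Monotonicity turns the coefficients [a1], [a2], [b1] into their values at the
    bound [M0], so that the structure conditions hold with the constants [c1] and [c2]. *)
Lemma solution_data Ma (A : 'rV[R]_N -> R -> 'rV[R]_N -> 'rV[R]_N) (B : 'rV[R]_N -> R -> 'rV[R]_N -> R)
    (u g : 'rV[R]_N -> R) (a1 a2 b1 : R -> R) (a3 b2 M0 : R) : (0 < N)%N -> bounded_domain Om -> integrand_data Om p q a b dl et Ma ->
  (forall i : 'I_N, caratheodory_fun Om (fun x t xi => A x t xi ord0 i)) -> caratheodory_fun Om B ->
  0 < a3 -> 0 < b2 ->
  (forall t, 0 <= t -> 0 < a1 t) -> (forall t, 0 <= t -> 0 < a2 t) -> (forall t, 0 <= t -> 0 < b1 t) ->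
  (forall s t, 0 <= s -> s <= t -> a1 s <= a1 t) -> (forall s t, 0 <= s -> s <= t -> a2 t <= a2 s) ->
  (forall s t, 0 <= s -> s <= t -> b1 s <= b1 t) ->
  ae_in Om (fun x => forall t xi, enorm (A x t xi) <= a1 `|t| * (slog p q a b dl et x (enorm xi) + 1)) ->
  ae_in Om (fun x => forall t xi, a2 `|t| * S x (enorm xi) - a3 <= dotv (A x t xi) xi) ->
  ae_in Om (fun x => forall t xi, `|B x t xi| <= b1 `|t| * (S x (enorm xi) + b2)) ->
  weak_solution S Om A B u -> 0 <= M0 -> ae_in Om (fun x => `|u x| <= M0) ->
  measurable_fun (boundary Om : set TH) g -> has_trace Om u g ->
  exists (Du Af : 'rV[R]_N -> 'rV[R]_N) (Bf : 'rV[R]_N -> R) (c1 c2 : R),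
    [/\ 0 < c1, 0 < c2 & sol_data Om p q a b dl et u g Du Af Bf c1 c2].
Proof.
move=> N0 hO hI cA cB a30 b20 a10 a20 b10 a1m a2m b1m h1 h2 h3 [[_ [Du0 wD0 LSD]] hw] M00 uM mg [Du [wD iu iD] happ].
have [_ oO _ _] := hO.
have mO : measurable (Om : set T) by exact: leb_open.
have mu' := integ_measurable iu; have mD i := integ_measurable (iD i).
have eqD := weak_grad_unique N0 oO wD wD0.
have mnD : measurable_fun (Om : set T) (fun x : T => enorm (Du x)) by exact: enorm_measurable.
have iS : lintegrable Om (fun x => S x (enorm (Du x))).
  apply: (integ_dom mO (Slog_measurable hI hO mnD) _ (LS_integrable hO hI LSD)).
  apply: ae_in_imp2 eqD (id_ae hI) => x _ -> [k1 k2 k3 /andP[k4 _] /andP[k6 _]].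
  rewrite (ger0_norm (enorm_ge0 _)) ger0_norm//.
  exact: (Sv_ge0 (p x) (q x) k4 k6 (id_dl hI) (id_et hI) (enorm_ge0 _)).
have pos : ae_in Om (fun x => 0 <= S x (enorm (Du x)) /\ 0 <= slog p q a b dl et x (enorm (Du x))).
  apply: ae_in_imp (id_ae hI) => x _ [k1 k2 k3 /andP[k4 _] /andP[k6 _]]; split.
    exact: (Sv_ge0 (p x) (q x) k4 k6 (id_dl hI) (id_et hI) (enorm_ge0 _)).
  exact: (sv_ge0 k1 k2 k4 k6 (id_dl hI) (id_et hI) (enorm_ge0 _)).
have good : ae_in Om (fun x => `|u x| <= M0 /\ (0 <= S x (enorm (Du x)) /\ 0 <= slog p q a b dl et x (enorm (Du x)))).
  by apply: ae_in_imp2 uM pos => x _.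
have p1 := a10 _ M00; have p2 := a20 _ M00; have p3 := b10 _ M00.
have [c1 [c1a c1b c1c c1d]] : exists c1 : R, [/\ 0 < c1, a1 M0 <= c1, a3 <= c1 & b1 M0 * (1 + b2) <= c1].
  exists (a1 M0 + a3 + b1 M0 * (1 + b2)).
  have : 0 < b1 M0 * (1 + b2) by rewrite mulr_gt0 ?addr_gt0.
  by move=> q1; split; lra.
exists Du, (fun x => A x (u x) (Du x)), (fun x => B x (u x) (Du x)), c1, (a2 M0); split; [exact: c1a|exact: p2|split].
- by split.
- exact: happ.
- exact: mg.
- exact: iS.
- by move=> i; apply: (superposition_measurable mO (cA i) mu' mD).
- exact: (superposition_measurable mO cB mu' mD).
- apply: ae_in_imp2 h1 good => x _ /(_ (u x) (Du x)) k1 [k2 [_ k3]]; apply: le_trans k1 _.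
  apply: ler_wpM2r; first by rewrite addr_ge0.
  exact: le_trans (a1m _ _ (normr_ge0 _) k2) c1b.
- apply: ae_in_imp2 h2 good => x _ /(_ (u x) (Du x)) k1 [k2 [k3 _]]; apply: le_trans k1.
  by apply: lerB => //; rewrite ler_wpM2r//; exact: a2m.
- apply: ae_in_imp2 h3 good => x _ /(_ (u x) (Du x)) k1 [k2 [k3 _]]; apply: le_trans k1 _.
  have k4 : b1 `|u x| <= b1 M0 by exact: b1m.
  have k5 : b1 `|u x| * (S x (enorm (Du x)) + b2) <= b1 M0 * ((1 + b2) * (S x (enorm (Du x)) + 1)).
    apply: ler_pM => //; first by apply: ltW; exact: b10.
      by rewrite addr_ge0// ltW.
    have : 0 <= b2 * S x (enorm (Du x)) by rewrite mulr_ge0// ltW.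
    move: (S x (enorm (Du x))) => s bs.
    have -> : (1 + b2) * (s + 1) = s + b2 + (1 + b2 * s) by ring.
    by rewrite lerDl addr_ge0.
  by apply: le_trans k5 _; rewrite mulrA ler_wpM2r// addr_ge0.
- move=> phi Dphi W1 W2 W3 i1 i2; have := hw Du phi Dphi wD W1 W2 W3.
  by rewrite (RintE mO i1) (RintE mO i2) => -[].
Qed.

End regularity.

Theorem theorem1p3 (R : realType) (N : nat) (hN : (2 <= N)%N)
  (Om : set 'rV[R]_N) (hOm : bounded_domain Om) (hLip : lipschitz_boundary Om)
  (p q : 'rV[R]_N -> R)
  (hp : log_hoelder (closure Om) p) (hq : log_hoelder (closure Om) q)
  (hpq : forall x, closure Om x -> [/\ 1 < p x, p x <= q x & q x < N%:R])
  (a b : 'rV[R]_N -> R)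
  (ha : Linfty Om a) (ha0 : ae_in Om (fun x => 0 <= a x))
  (alpha : R) (halpha : 0 < alpha <= 1)
  (hb : hoelder_on alpha (closure Om) b)
  (hb0 : forall x, closure Om x -> 0 <= b x)
  (d : R) (hd : 0 < d) (hab : ae_in Om (fun x => d <= a x + b x))
  (dl et : R) (hdl : 1 <= dl <= expR 1) (het : 0 <= et) (hdlet : 1 < dl + et)
  (hsup : (ereal_sup [set (xt.2 `^ (q xt.1 - p xt.1 - alpha)
                            * ln (dl + et * xt.2))%:E
                     | xt in [set xt : 'rV[R]_N * R | Om xt.1 /\ (1 <= xt.2)%R]]
           < +oo)%E)
  (A : 'rV[R]_N -> R -> 'rV[R]_N -> 'rV[R]_N)
  (B : 'rV[R]_N -> R -> 'rV[R]_N -> R)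
  (hA : forall i : 'I_N, caratheodory_fun Om (fun x t xi => A x t xi ord0 i))
  (hB : caratheodory_fun Om B)
  (a1 a2 b1 : R -> R) (a3 b2 : R) (ha3 : 0 < a3) (hb2 : 0 < b2)
  (ha1_pos : forall t, 0 <= t -> 0 < a1 t)
  (ha2_pos : forall t, 0 <= t -> 0 < a2 t)
  (hb1_pos : forall t, 0 <= t -> 0 < b1 t)
  (ha1_cont : {within [set t : R | 0 <= t], continuous a1})
  (ha2_cont : {within [set t : R | 0 <= t], continuous a2})
  (hb1_cont : {within [set t : R | 0 <= t], continuous b1})
  (ha1_mono : forall s t, 0 <= s -> s <= t -> a1 s <= a1 t)
  (ha2_mono : forall s t, 0 <= s -> s <= t -> a2 t <= a2 s)
  (hb1_mono : forall s t, 0 <= s -> s <= t -> b1 s <= b1 t)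
  (h1 : ae_in Om (fun x => forall t xi,
          enorm (A x t xi) <= a1 `|t| * (slog p q a b dl et x (enorm xi) + 1)))
  (h2 : ae_in Om (fun x => forall t xi,
          a2 `|t| * Slog p q a b dl et x (enorm xi) - a3
            <= dotv (A x t xi) xi))
  (h3 : ae_in Om (fun x => forall t xi,
          `|B x t xi| <= b1 `|t| * (Slog p q a b dl et x (enorm xi) + b2)))
  (u : 'rV[R]_N -> R)
  (hu : weak_solution (Slog p q a b dl et) Om A B u)
  (hubd : Linfty Om u)
  (beta0 : R) (hbeta0 : 0 < beta0 <= 1)
  (htr : exists2 g, hoelder_on beta0 (boundary Om) g & has_trace Om u g) :
  exists beta : R, 0 < beta <= beta0 /\
    exists2 v : 'rV[R]_N -> R,
      hoelder_on beta (closure Om) v & ae_in Om (fun x => u x = v x).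
Proof.
have N0 : (0 < N)%N by exact: ltnW.
have [_ oO _ bO] := hOm.
have mO : measurable (Om : set (leb_space R N)) by exact: leb_open.
have /andP[dl1 _] := hdl; have /andP[al0 _] := halpha; have /andP[be0 be1] := hbeta0.
have p1 x : closure Om x -> 1 < p x by move=> /hpq[].
have [Ma hI] := integrand_dataP hOm hp hq hpq ha ha0 al0 hb hb0 dl1 het.
have [mu' [M uM']] := hubd.
have [M0 M00 uM] : exists2 M0 : R, 0 <= M0 & ae_in Om (fun x => `|u x| <= M0).
  exists `|M|; first exact: normr_ge0.
  by apply: ae_in_imp uM' => x _ h; apply: le_trans h (ler_norm M).
have [g hg tg] := htr.
have cg := hoelder_cont be0 hg.
have mg : measurable_fun (boundary Om : set (caratheodory_type (@hausdorff_outer R N N.-1))) g.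
  apply: cara_continuous_in => //; first exact: hausdorff_outer_half.
  by apply: cara_closed; [exact: hausdorff_outer_half|exact: closed_boundary].
have [Mg Mg0 gM] := within_bounded (compact_boundary bO) cg.
have [Du [Af [Bf [c1 [c2 [c10 c20 hs]]]]]] := solution_data N0 hOm hI hA hB ha3 hb2 ha1_pos ha2_pos
  hb1_pos ha1_mono ha2_mono hb1_mono h1 h2 h3 hu M00 uM mg tg.
have hsn := sol_dataN hOm hs.
have [pm pm1 hpm] := exponent_lower hOm hp p1.
have [kap [r1 [Cs [kap0 r10 Cs1 hcmp]]]] :=
  Slog_comparable N0 p1 hp hq hI al0 hb hb0 hd hab hdlet hsup.
have [c c0 hc] := boundary_regular hN hOm hLip.
(* The exterior density [c * (r / 2) ^ N] is compared with the volume [r ^ N] of the cube of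
   half-side [r / 2]; the bound [2^-1] is for the interior alternative. *)
have [cs [cs0 cs1 csc]] : exists cs : R, [/\ 0 < cs, cs <= 2^-1 & cs <= c / 2 ^+ N].
  exists (Num.min 2^-1 (c / 2 ^+ N)).
  by rewrite lt_min invr_gt0 ltr0n divr_gt0 ?exprn_gt0// !ge_min !lexx orbT.
(* The summand [1] keeps the admissible height positive when [u] and [g] vanish. *)
have W0 : 0 < 2 * M0 + Mg + 1 by rewrite ltr_wpDl ?addr_ge0 ?mulr_ge0.
have [t1 /andP[t10 t11] hOS] := one_sided hI hN hOm hLip hs c10 c20 pm1 hpm kap0 Cs1 hcmp cs0 W0.
have [t2 /andP[t20 t21] hOSn] := one_sided hI hN hOm hLip hsn c10 c20 pm1 hpm kap0 Cs1 hcmp cs0 W0.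
(* [rs <= 2 * c] because the boundary density is used at radius [r / 2], and [rs <= 1] lets powers
   of the radius be compared. *)
have [rs [rs0 rs1 rsr rsc]] : exists rs : R, [/\ 0 < rs, rs <= 1, rs <= r1 & rs <= 2 * c].
  exists (Num.min 1 (Num.min r1 (2 * c))).
  by rewrite !lt_min ltr01 r10 mulr_gt0// !ge_min !lexx !orbT.
have [th [th0 th1 tht1 tht2]] : exists th : R, [/\ 0 < th, th <= 2^-1, th <= t1 & th <= t2].
  exists (Num.min t1 t2); rewrite lt_min t10 t20 !ge_min !lexx orbT; split=> //.
  by rewrite t11.
have dec v gv t : th <= t ->
    (forall (x0 : 'rV[R]_N) r0 k H, 0 < r0 <= r1 -> H - k <= 2 * M0 + Mg + 1 ->
      ae_in (Om `&` cube x0 r0) (fun x => v x <= H) ->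
      (forall y, boundary Om y -> `|y - x0| < r0 -> gv y <= k) ->
      cs * fine (lebesgue_rV R N (cube x0 (r0 / 2))) <=
        fine (lebesgue_rV R N (cube x0 (r0 / 2) `\` (Om `&` [set x | k < v x]))) ->
      ae_in (Om `&` cube x0 (r0 / 4)) (fun x => v x <= H - t * (H - k) + r0)) ->
    decays Om v gv rs cs (2 * M0 + Mg) th.
  move=> tht h; apply: (decays_le rsr tht) => x0 r0 k H hr /andP[_ HW] uk hgv hd0.
  by apply: h => //; apply: le_trans HW _; rewrite lerDl.
have [Cg Cg0 hgC] : exists2 Cg : R, 0 <= Cg & forall x y, boundary Om x -> boundary Om y ->
    `|g x - g y| <= Cg * enorm (x - y) `^ beta0.
  have [C hC] := hg; exists `|C|; first exact: normr_ge0.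
  move=> x y Bx By; apply: le_trans (hC x y Bx By) _.
  by rewrite ler_wpM2r ?powR_ge0// ler_norm.
have hcs y r : boundary Om y -> 0 < r <= rs ->
    cs * fine (lebesgue_rV R N (cube y (r / 2))) <= fine (lebesgue_rV R N (cube y (r / 2) `\` Om)).
  move=> By /andP[r0 rr].
  have r2 : 0 < r / 2 <= c by rewrite divr_gt0//= ler_pdivrMr// mulrC (le_trans rr).
  have [_ hext _] := hc y (r / 2) By r2.
  rewrite leb_cube ?divr_ge0 ?(ltW r0)//= mulrC [2 * (r / 2)]mulrC divfK//.
  have fc : (lebesgue_rV R N (cube y (r / 2) `\` Om) < +oo)%E.
    by apply: le_lt_trans (leb_cube_fin y (r / 2)); exact: leb_le (@subDsetl _ _ _).
  have hb' : ((c * (r / 2) ^+ N)%:E <= lebesgue_rV R N (cube y (r / 2) `\` Om))%E.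
    apply: le_trans hext _; apply: leb_le => x [yx nx]; split=> //; apply: cube_lt.
    by move: yx; rewrite -ball_normE/= distrC.
  have fn : lebesgue_rV R N (cube y (r / 2) `\` Om) \is a fin_num by rewrite ge0_fin_numE.
  move: hb'; rewrite -[X in (_ <= X)%E]fineK// lee_fin => hb'; apply: le_trans hb'.
  by rewrite expr_div_n mulrCA ler_wpM2l// exprn_ge0// ltW.
have [be [B0 [b0 bb B00 l1 hosc]]] := osc_decay mO mu' rs0 rs1 cs1 th0 th1 M00 Mg0 Cg0 be0 be1
  uM gM hgC hcs (dec _ _ _ tht1 hOS) (dec _ _ _ tht2 hOSn).
exists be; split; first by rewrite b0.
exists (vrep Om u rs); first exact: (vrep_hoelder oO B00 rs0 b0 uM hosc).
exact: (vrep_ae oO rs0 hosc l1).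
Qed.
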